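(* Let $(W_1,S_1)$, $(W_2,S_2)$ be Coxeter systems of finite rank with sets of reflections $T_1,T_2$, let $S_1=\{s_1,\dots,s_k\}$, $S_2=\{s_{k+1},\dots,s_n\}$, $h_1=s_1\cdots s_k$, $h_2=s_{k+1}\cdots s_n$. Let $(W,S)$ be the Coxeter system with $W=W_1*W_2$, $S=S_1\sqcup S_2$, set of reflections $T$, and $h=h_1h_2$. Assume that $(W_1,(s_1,\dots,s_k))$ and $(W_2,(s_{k+1},\dots,s_n))$ are well-stabilized and that $(W_1,T_1,h_1)$ and $(W_2,T_2,h_2)$ are pan-transitive. Then $(W,(s_1,\dots,s_n))$ is well-stabilized and $(W,T,h)$ is pan-transitive. In particular, $\mathrm{Art}(W,S)$ is isomorphic to $\mathrm{Art}^*(W,T,h)$.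
   Context: A Coxeter system $(W,S)$: $W=\langle S\mid (ss')^{m(s,s')}=1\text{ whenever } m(s,s')\neq\infty\rangle$ with $m$ symmetric, $m(s,s)=1$, $m(s,s')\in\{2,3,\dots,\infty\}$ for $s\neq s'$; reflections are conjugates of elements of $S$; $W_1*W_2$ with $S_1\sqcup S_2$ is the Coxeter system with $m(s,s')=\infty$ for $s\in S_1,s'\in S_2$. For a group $G$ with generating set $X$ and $a\in G$: $\ell_X(a)$ is the minimal $k$ with $a=x_1\cdots x_k$, $x_i\in X\cup X^{-1}$; $\mathrm{Red}_X(a)$ the set of such tuples of length $\ell_X(a)$; $a\le_X b$ iff $\ell_X(a)+\ell_X(a^{-1}b)=\ell_X(b)$; $[1,b]_X=\{a:a\le_Xb\}$. The braid group $B_m$ acts on $G^m$ by the Hurwitz action $\sigma_i\cdot(g_1,\dots,g_m)=(g_1,\dots,g_{i-1},g_ig_{i+1}g_i^{-1},g_i,g_{i+2},\dots,g_m)$. For a Coxeter system $(V,R)$ with ordering $(r_1,\dots,r_m)$ of $R$: $\mathrm{Art}(V,R)$ is generated by $\bar r_1,\dots,\bar r_m$ subject to $\bar r_i\bar r_j\bar r_i\cdots=\bar r_j\bar r_i\bar r_j\cdots$ (each side with $m(r_i,r_j)$ factors) whenever $m(r_i,r_j)\neq\infty$; $(V,(r_1,\dots,r_m))$ is well-stabilized if the stabilizer in $B_m$ of $(r_1,\dots,r_m)\in V^m$ equals the stabilizer of $(\bar r_1,\dots,\bar r_m)\in\mathrm{Art}(V,R)^m$ under the Hurwitz action. With reflections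 $T_V$ and Coxeter element $c$, the dual Artin group $\mathrm{Art}^*(V,T_V,c)$ is generated by symbols $\{t\}$, $t\in T_V\cap[1,c]_{T_V}$, subject to $\{t_1\}\cdots\{t_k\}=\{t'_1\}\cdots\{t'_k\}$ whenever both tuples lie in $\mathrm{Red}_{T_V}(a)$ for some $a\in[1,c]_{T_V}$; $(V,T_V,c)$ is pan-transitive if for each $a\in[1,c]_{T_V}$ the Hurwitz action of $B_{\ell_{T_V}(a)}$ on $\mathrm{Red}_{T_V}(a)$ is transitive. *)

(* Defs.v *)
(* Groups given by presentations are modelled as
   words in generators and their inverses, modulo the congruence generated by
   the defining relations and free cancellation. *)
From mathcomp Require Import all_boot.
Set Implicit Arguments. Unset Strict Implicit. Unset Printing Implicit Defensive.

(* A letter (a, false) is the generator a, (a, true) its inverse. *)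
Definition letter (A : Type) := (A * bool)%type.
Definition word (A : Type) := seq (letter A).
Definition linv {A : Type} (x : letter A) : letter A := (x.1, ~~ x.2).
Definition winv {A : Type} (w : word A) : word A := rev (map linv w).
Definition gen {A : Type} (a : A) : word A := [:: (a, false)].

(* The congruence on words defined by the relations R (u = v for R u v):
   equality in the group < A | R >. *)
Inductive peq {A : Type} (R : word A -> word A -> Prop) : word A -> word A -> Prop :=
| peq_rel p u v q : R u v -> peq R (p ++ u ++ q) (p ++ v ++ q)
| peq_free p x q : peq R (p ++ [:: x; linv x] ++ q) (p ++ q)
| peq_refl u : peq R u u
| peq_sym u v : peq R u v -> peq R v u
| peq_trans u v w : peq R u v -> peq R v w -> peq R u w.

Definition pres_iso {A B : Type} (E1 : word A -> word A -> Prop)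
    (E2 : word B -> word B -> Prop) : Prop :=
  exists (f : word A -> word B) (g : word B -> word A),
    (forall u v, E1 u v -> E2 (f u) (f v)) /\
    (forall u v, E2 u v -> E1 (g u) (g v)) /\
    (forall u v, E2 (f (u ++ v)) (f u ++ f v)) /\
    (forall u, E1 (g (f u)) u) /\
    (forall v, E2 (f (g v)) v).

(* Convention: m i j = 0 encodes m(s_i,s_j) = infinity. *)
Definition coxeter_matrix (n : nat) (m : 'I_n -> 'I_n -> nat) : Prop :=
  (forall i j, m i j = m j i) /\ (forall i, m i i = 1) /\
  (forall i j, i != j -> m i j != 1).

Definition alt {A : Type} (a b : A) (N : nat) : word A :=
  [seq ((if odd i then b else a), false) | i <- iota 0 N].

Definition cox_rel (n : nat) (m : 'I_n -> 'I_n -> nat) (u v : word 'I_n) : Prop :=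
  exists i j, m i j != 0 /\ u = alt i j (2 * m i j) /\ v = [::].
Definition art_rel (n : nat) (m : 'I_n -> 'I_n -> nat) (u v : word 'I_n) : Prop :=
  exists i j, m i j != 0 /\ u = alt i j (m i j) /\ v = alt j i (m i j).

Definition coxeq (n : nat) (m : 'I_n -> 'I_n -> nat) := peq (cox_rel m).
Definition arteq (n : nat) (m : 'I_n -> 'I_n -> nat) := peq (art_rel m).

Definition gens (n : nat) : seq (word 'I_n) := [seq gen i | i <- enum 'I_n].
Definition cox_elt (n : nat) : word 'I_n := [seq (i, false) | i <- enum 'I_n].

(* braid letter (i, false) = sigma_{i+1}, (i, true) = its inverse; it acts on
   positions i, i+1 (0-based) of a tuple. *)
Definition hstep {A : Type} (x : nat * bool) (t : seq (word A)) : seq (word A) :=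
  let i := x.1 in
  let g := nth [::] t i in
  let g' := nth [::] t i.+1 in
  if i.+1 < size t then
    if ~~ x.2 then set_nth [::] (set_nth [::] t i (g ++ g' ++ winv g)) i.+1 g
    else set_nth [::] (set_nth [::] t i g') i.+1 (winv g' ++ g ++ g')
  else t.
Definition hurwitz {A : Type} (b : seq (nat * bool)) (t : seq (word A)) :=
  foldr hstep t b.
Definition braid_word (k : nat) (b : seq (nat * bool)) : bool :=
  all (fun x => x.1.+1 < k) b.
Definition teq {A : Type} (E : word A -> word A -> Prop) (t t' : seq (word A)) : Prop :=
  size t = size t' /\ forall i, i < size t -> E (nth [::] t i) (nth [::] t' i).

(* (W, (s_1,...,s_n)) is well-stabilized: Stab_{B_n}(s_1..s_n) = Stab_{B_n}(sbar_1..sbar_n).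
   (Stabilizers are compared through braid words representing elements of B_n.) *)
Definition well_stabilized (n : nat) (m : 'I_n -> 'I_n -> nat) : Prop :=
  forall b, braid_word n b ->
    (teq (coxeq m) (hurwitz b (gens n)) (gens n) <->
     teq (arteq m) (hurwitz b (gens n)) (gens n)).

Definition is_refl (n : nat) (m : 'I_n -> 'I_n -> nat) (w : word 'I_n) : Prop :=
  exists (u : word 'I_n) (i : 'I_n), coxeq m w (u ++ gen i ++ winv u).
Definition tfact (n : nat) (m : 'I_n -> 'I_n -> nat) (a : word 'I_n)
    (s : seq (word 'I_n)) : Prop :=
  (forall i, i < size s -> is_refl m (nth [::] s i) \/ is_refl m (winv (nth [::] s i)))
  /\ coxeq m a (flatten s).
Definition tlen (n : nat) (m : 'I_n -> 'I_n -> nat) (a : word 'I_n) (k : nat) : Prop :=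
  (exists s, size s = k /\ tfact m a s) /\ (forall s, tfact m a s -> k <= size s).
Definition tle (n : nat) (m : 'I_n -> 'I_n -> nat) (a c : word 'I_n) : Prop :=
  exists ka kb kc, tlen m a ka /\ tlen m (winv a ++ c) kb /\ tlen m c kc /\ ka + kb = kc.
Definition tred (n : nat) (m : 'I_n -> 'I_n -> nat) (a : word 'I_n)
    (s : seq (word 'I_n)) : Prop :=
  tfact m a s /\ tlen m a (size s).

Definition pan_transitive (n : nat) (m : 'I_n -> 'I_n -> nat) (c : word 'I_n) : Prop :=
  forall a, tle m a c -> forall s s', tred m a s -> tred m a s' ->
    exists b, braid_word (size s) b /\ teq (coxeq m) (hurwitz b s) s'.

(* symbols {t}, t in T n [1,c]_T (represented by words; equal elements give
   equal symbols through the length-one relations) *)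
Definition dgen (n : nat) (m : 'I_n -> 'I_n -> nat) (c : word 'I_n) :=
  {w : word 'I_n | is_refl m w /\ tle m w c}.
Definition dual_rel (n : nat) (m : 'I_n -> 'I_n -> nat) (c : word 'I_n)
    (u v : word (dgen m c)) : Prop :=
  exists a, tle m a c /\
    all (fun x => ~~ x.2) u /\ all (fun x => ~~ x.2) v /\
    tred m a [seq sval x.1 | x <- u] /\ tred m a [seq sval x.1 | x <- v].
Definition dualeq (n : nat) (m : 'I_n -> 'I_n -> nat) (c : word 'I_n) :=
  peq (@dual_rel n m c).

Definition fpmat (k l : nat) (m1 : 'I_k -> 'I_k -> nat) (m2 : 'I_l -> 'I_l -> nat)
    (i j : 'I_(k + l)) : nat :=
  match split i, split j with
  | inl a, inl b => m1 a b
  | inr a, inr b => m2 a b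
  | _, _ => 0
  end.
Arguments dualeq {n} m c.
Arguments dual_rel {n} m c.

(* Main.v *)
(* The braid group acts on the free group F of rank n by Artin automorphisms,
   and a Hurwitz translate of the tuple of generators is the image of this
   tuple under a braid.  The images of the initial products x_0 ... x_(c-1)
   are the classes of the simple loops in the n-punctured disc; they are
   recognized by a condition of non-crossing with respect to the circular
   order on the ends of the universal cover.  For a free product W, the
   syllables of a simple loop are again simple loops in the two factors, and an
   induction on the number of syllables shows that two simple loops with the
   same image in W differ by a braid that fixes every generator in W.  This
   gives the transitivity on factorizations, once any n reflections with
   product h are known to form a Hurwitz translate of the generators, which
   follows from normal forms.  A braid that fixes every generator in W fixes
   the loop x_0 ... x_(k-1), because its image has one syllable; hence it is a
   product of braids of the two factors, and the stabilizers agree.  Finally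
   the simple loops around single punctures lift the symbols of the dual
   Artin group to the Artin group, and this lift is the inverse of the
   canonical map.  That h has reflection length n is seen in a reflection
   representation with linearly independent roots and coroots. *)
From HB Require Import structures.
From Stdlib Require ClassicalEpsilon FunctionalExtensionality PropExtensionality.
From mathcomp Require Import all_boot all_algebra all_field zify ring.
Require Import Defs.
Set Implicit Arguments. Unset Strict Implicit. Unset Printing Implicit Defensive.

(** Pan-transitivity of the factors speaks about single syllables, whereas a loop has many, and one
    braid must serve them all. It is therefore used on the first syllable only. Once that syllable
    is straight, equal to [dl a c], planarity forbids every later passage between [[a, c)] and
    [[c, m)]. Two such loops with the same image in W then have the same image already in the free
    product split at [c] instead of [m], and there their complements in [dl a b] have fewer
    syllables. Both the splitting and the congruence change during the induction, which is why the
    statements quantify over [a], [m], [b] and a congruence [E] with a short list of properties.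
    Simplicity of a loop is stated without braids; this allows a syllable, or a loop that lies in a
    smaller interval, to be recognized as simple there. The discrete circular order replaces the
    topology of the disc. It has to be preserved by the free group and by the braids, and it
    includes the punctures as points because the arcs to them cut the disc open. *)

Lemma linvK (A : Type) : involutive (@linv A).
Proof. by case=> a b; rewrite /linv /= negbK. Qed.

Lemma linv_inj (A : Type) : injective (@linv A).
Proof. exact: inv_inj (@linvK A). Qed.

Lemma linv_neq (A : eqType) (x : letter A) : (linv x == x) = false.
Proof. by apply/negbTE/eqP; case: x => a [] []. Qed.

Lemma winv_cat (A : Type) (u v : word A) : winv (u ++ v) = winv v ++ winv u.
Proof. by rewrite /winv map_cat rev_cat. Qed.

Lemma winv_cons (A : Type) (x : letter A) (u : word A) :
  winv (x :: u) = winv u ++ [:: linv x].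
Proof. by rewrite /winv /= rev_cons cats1. Qed.

Lemma winvK (A : Type) : involutive (@winv A).
Proof.
by elim=> // x u IH; rewrite winv_cons winv_cat IH /= linvK.
Qed.

(** * Free reduction of words *)

Definition push (x : letter nat) (w : word nat) : word nat :=
  if w is y :: w' then if y == linv x then w' else x :: w else [:: x].
Definition red (w : word nat) : word nat := foldr push [::] w.
Fixpoint reduced (w : word nat) : bool :=
  if w is x :: w' then
    (if w' is y :: _ then y != linv x else true) && reduced w'
  else true.

Lemma reduced_behead x w : reduced (x :: w) -> reduced w.
Proof. by case/andP. Qed.

Lemma reduced_push x w : reduced w -> reduced (push x w).
Proof.
case: w => [|y w] //= /andP[Hy Hw]; case: eqP => //= /eqP-> /=.
by rewrite Hy Hw.
Qed.

Lemma reduced_foldr s u : reduced s -> reduced (foldr push s u).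
Proof. by move=> Hs; elim: u => //= x u; apply: reduced_push. Qed.

Lemma push_pushV x w : reduced w -> push x (push (linv x) w) = w.
Proof.
case: w => [|y w] /=; first by rewrite eqxx.
rewrite linvK; case: eqP => [->|/eqP Hy] /=; last by rewrite eqxx.
by case: w => [|z w] //= /andP[/negbTE-> _].
Qed.

Lemma red_id w : reduced w -> red w = w.
Proof.
elim: w => // x w IH; move=> H; have Hw := reduced_behead H.
rewrite /= -/(red w) IH //; case: w H Hw {IH} => //= y w /andP[/negbTE-> //].
Qed.

Lemma foldr_push1 s x w : reduced s ->
  foldr push s (push x w) = push x (foldr push s w).
Proof.
move=> Hs; case: w => [|y w] //=; case: eqP => [->|_] //=.
by rewrite push_pushV // reduced_foldr.
Qed.

Lemma foldr_push_red s u : reduced s -> foldr push s (red u) = foldr push s u.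
Proof. by move=> Hs; elim: u => //= x u IH; rewrite foldr_push1 // IH. Qed.

Lemma red_cat u v : red (u ++ v) = foldr push (red v) u.
Proof. by rewrite /red foldr_cat. Qed.

Lemma reduced_red u : reduced (red u).
Proof. exact: reduced_foldr. Qed.

Lemma red_catl u v : red (red u ++ v) = red (u ++ v).
Proof. by rewrite !red_cat foldr_push_red // reduced_red. Qed.

Lemma red_catr u v : red (u ++ red v) = red (u ++ v).
Proof. by rewrite !red_cat (red_id (reduced_red v)). Qed.

Lemma red_winvl u : red (winv u ++ u) = [::].
Proof.
elim: u => // x u IH; rewrite winv_cons -catA red_cat /= -/(red u).
rewrite -{2}[x]linvK push_pushV ?reduced_red //.
by rewrite -red_cat.
Qed.

Lemma reduced_cat1 u x v : reduced (u ++ x :: v) =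
  reduced (rcons u x) && reduced (x :: v).
Proof.
elim: u => [|y u IH] //=; case: u IH => [|z u] /= IH; rewrite ?IH /= ?andbA //.
by rewrite andbT.
Qed.

Lemma reduced_winv u : reduced u -> reduced (winv u).
Proof.
elim: u => // x [|y u] IH H //.
have /andP[Hxy Hu] := H.
rewrite winv_cons winv_cons -catA /= reduced_cat1 -cats1 -winv_cons IH //=.
by rewrite andbT linvK; apply: contra Hxy => /eqP->.
Qed.

(** * The free group on the natural numbers *)

Record fg := Fg { fw : word nat; fgP : reduced fw }.
HB.instance Definition _ := [isSub for fw].
HB.instance Definition _ := [Choice of fg by <:].

Lemma fg_inj (g h : fg) : fw g = fw h -> g = h.
Proof. exact: val_inj. Qed.

Definition mkF (w : word nat) : fg := Fg (reduced_red w).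
(* Locked so that unification does not read [mkF w] as a product. *)
HB.lock Definition fmul (g h : fg) : fg := mkF (fw g ++ fw h).
Lemma fw_fmul g h : fw (fmul g h) = red (fw g ++ fw h).
Proof. by rewrite fmul.unlock. Qed.
Definition fone : fg := mkF [::].
Definition finv (g : fg) : fg := mkF (winv (fw g)).

Lemma fmulA : associative fmul.
Proof. by move=> x y z; apply: fg_inj; rewrite !fw_fmul red_catl red_catr catA. Qed.
Lemma fmul1 : left_id fone fmul.
Proof. by move=> x; apply: fg_inj; rewrite fw_fmul /= red_id // fgP. Qed.
Lemma fmulr1 : right_id fone fmul.
Proof. by move=> x; apply: fg_inj; rewrite fw_fmul /= cats0 red_id // fgP. Qed.
Lemma fmulV : left_inverse fone finv fmul.
Proof. by move=> x; apply: fg_inj; rewrite fw_fmul /= red_catl red_winvl. Qed.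
Lemma fmulrV : right_inverse fone finv fmul.
Proof.
move=> x; apply: fg_inj; rewrite fw_fmul /= red_catr.
by rewrite -{1}(winvK (fw x)) red_winvl.
Qed.
HB.instance Definition _ := isGroup.Build fg fmulA fmul1 fmulr1 fmulV fmulrV.

Local Open Scope group_scope.

Lemma fwM (g h : fg) : fw (g * h) = red (fw g ++ fw h). Proof. exact: fw_fmul. Qed.
Lemma fwV (g : fg) : fw g^-1 = winv (fw g).
Proof. by rewrite [LHS]/= red_id // reduced_winv // fgP. Qed.
Lemma fw_eq1 (g : fg) : (fw g == [::]) = (g == 1).
Proof. by []. Qed.

Definition X (i : nat) : fg := mkF (gen i).
Definition L (x : letter nat) : fg := mkF [:: x].

Lemma XL i : X i = L (i, false). Proof. by []. Qed.
Lemma LV x : (L x)^-1 = L (linv x).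
Proof. by apply: fg_inj; rewrite fwV. Qed.
Lemma LX i b : L (i, b) = if b then (X i)^-1 else X i.
Proof. by case: b; rewrite // XL LV. Qed.

Lemma mkF_cat u v : mkF (u ++ v) = mkF u * mkF v.
Proof. by apply: fg_inj; rewrite fwM /= red_catl red_catr. Qed.
Lemma mkF_cons x v : mkF (x :: v) = L x * mkF v.
Proof. by rewrite -mkF_cat. Qed.
Lemma mkF_fw (g : fg) : mkF (fw g) = g.
Proof. by apply: fg_inj; rewrite /= red_id // fgP. Qed.
Lemma mkF_winv u : mkF (winv u) = (mkF u)^-1.
Proof.
elim: u => [|x u IH]; first by rewrite invg1.
by rewrite winv_cons mkF_cat IH -/(L _) [mkF (x :: u)]mkF_cons invgM LV.
Qed.

Lemma fg_ind' (P : fg -> Prop) :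
  P 1 -> (forall x g, P g -> P (L x * g)) -> forall g, P g.
Proof.
move=> P1 PL g; rewrite -(mkF_fw g); elim: (fw g) => // x w IH.
by rewrite mkF_cons; apply: PL.
Qed.

(** * Homomorphisms out of the free group *)

Definition evl (G : groupType) (f : nat -> G) (x : letter nat) : G :=
  if x.2 then (f x.1)^-1 else f x.1.
Definition ev (G : groupType) (f : nat -> G) (w : word nat) : G :=
  foldr (fun x g => evl f x * g) 1 w.
HB.lock Definition hom (G : groupType) (f : nat -> G) (g : fg) : G := ev f (fw g).

Section Ev.
Variables (G : groupType) (f : nat -> G).

Lemma evlV x : evl f (linv x) = (evl f x)^-1.
Proof. by case: x => i []; rewrite /evl //= invgK. Qed.

Lemma ev_cat u v : ev f (u ++ v) = ev f u * ev f v.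
Proof. by elim: u => [|x u IH] /=; rewrite ?mul1g // IH mulgA. Qed.

Lemma ev_push x w : ev f (push x w) = evl f x * ev f w.
Proof.
case: w => //= y w; case: eqP => [->|] //=.
by rewrite evlV mulVKg.
Qed.

Lemma ev_red u : ev f (red u) = ev f u.
Proof. by elim: u => //= x u IH; rewrite ev_push IH. Qed.

Lemma homM g h : hom f (g * h) = hom f g * hom f h.
Proof. by rewrite hom.unlock fwM ev_red ev_cat. Qed.
Lemma hom1 : hom f 1 = 1. Proof. by rewrite hom.unlock. Qed.

Lemma homV g : hom f g^-1 = (hom f g)^-1.
Proof. by apply: (mulgI (hom f g)); rewrite -homM !mulgV hom1. Qed.
Lemma homL x : hom f (L x) = evl f x.
Proof. by rewrite hom.unlock /= mulg1. Qed.
Lemma homX i : hom f (X i) = f i.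
Proof. by rewrite XL homL. Qed.

End Ev.

Lemma hom_ext (G : groupType) (f f' : nat -> G) g :
  (forall x, x \in fw g -> f x.1 = f' x.1) -> hom f g = hom f' g.
Proof.
rewrite hom.unlock; elim: (fw g) => //= x w IH H.
rewrite IH; last by move=> y Hy; apply: H; rewrite inE Hy orbT.
by rewrite /evl H // mem_head.
Qed.

Lemma hom_id g : hom X g = g.
Proof.
elim/fg_ind': g => [|x g IH]; first by rewrite hom1.
by rewrite homM IH homL /evl; case: x => i b; rewrite LX.
Qed.

(** * Supports *)

(** A block of generators is an interval of indices in one free group of countable rank, so that
    passing to a factor changes only the bounds. *)
Definition inF (a b : nat) (g : fg) := all (fun x : letter nat => (a <= x.1 < b)%N) (fw g).

Lemma all_push (p : pred (letter nat)) x w : p x -> all p w -> all p (push x w).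
Proof.
case: w => [|y w] /= px; first by rewrite px.
by case/andP=> py pw; case: eqP => //= _; rewrite px py pw.
Qed.

Lemma all_red (p : pred (letter nat)) w : all p w -> all p (red w).
Proof. by elim: w => //= x w IH /andP[px pw]; apply: all_push => //; apply: IH. Qed.

Lemma inF1 a b : inF a b 1. Proof. by []. Qed.
Lemma inFM a b g h : inF a b g -> inF a b h -> inF a b (g * h).
Proof. by move=> Hg Hh; rewrite /inF fwM all_red // all_cat; apply/andP; split. Qed.
Lemma inFV a b g : inF a b g -> inF a b g^-1.
Proof. by rewrite /inF fwV /winv all_rev all_map. Qed.
Lemma inFVE a b g : inF a b g^-1 = inF a b g.
Proof. by apply/idP/idP => /inFV; rewrite ?invgK. Qed.
Lemma inFMl a b g h : inF a b g -> inF a b (g * h) = inF a b h.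
Proof.
move=> Hg; apply/idP/idP => [H|]; last exact: inFM.
by rewrite -(mulKg g h); apply: inFM => //; apply: inFV.
Qed.
Lemma inFMr a b g h : inF a b h -> inF a b (g * h) = inF a b g.
Proof.
move=> Hg; apply/idP/idP => [H|H]; last exact: inFM.
by rewrite -(mulgK h g); apply: inFM => //; apply: inFV.
Qed.
Lemma inFL a b x : inF a b (L x) = (a <= x.1 < b)%N.
Proof. by rewrite /inF /= andbT. Qed.
Lemma inFX a b i : inF a b (X i) = (a <= i < b)%N.
Proof. by rewrite XL inFL. Qed.
Lemma inFS a b a' b' g : (a' <= a)%N -> (b <= b')%N -> inF a b g -> inF a' b' g.
Proof. by move=> Ha Hb; apply: sub_all => x /=; lia. Qed.

Lemma inF_ind a b (P : fg -> Prop) :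
  P 1 -> (forall x g, (a <= x.1 < b)%N -> inF a b g -> P g -> P (L x * g)) ->
  forall g, inF a b g -> P g.
Proof.
move=> P1 PL g; rewrite /inF -{2}(mkF_fw g).
elim: (fw g) => // x w IH /= /andP[Hx Hw].
rewrite mkF_cons; apply: PL => //; last exact: IH.
by rewrite /inF /= all_red.
Qed.

(** * Braids as automorphisms *)

Definition pr (G : groupType) (s : seq G) : G := foldr (fun x y => x * y) 1 s.
Lemma pr_cat (G : groupType) (s t : seq G) : pr (s ++ t) = pr s * pr t.
Proof. by elim: s => [|x s IH] /=; rewrite ?mul1g // IH mulgA. Qed.

Definition xs (a b : nat) : seq fg := [seq X i | i <- iota a (b - a)].
(** The Coxeter element of a block, lifted to the free group; geometrically, the loop around the
    punctures of the block. *)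
Definition dl (a b : nat) : fg := pr (xs a b).

Lemma xs_cat a m b : (a <= m <= b)%N -> xs a b = xs a m ++ xs m b.
Proof.
move=> H; rewrite /xs -map_cat; congr map.
have ->: (b - a = (m - a) + (b - m))%N by lia.
by rewrite iotaD; congr (_ ++ iota _ _); lia.
Qed.
Lemma dl_cat a m b : (a <= m <= b)%N -> dl a b = dl a m * dl m b.
Proof. by move=> H; rewrite /dl (xs_cat H) pr_cat. Qed.
Lemma dl_nil a b : (b <= a)%N -> dl a b = 1.
Proof. by move=> H; rewrite /dl /xs (_ : b - a = 0)%N //; lia. Qed.
Lemma dl1 a : dl a a.+1 = X a.
Proof. by rewrite /dl /xs subSnn /= mulg1. Qed.
Lemma dlS a b : (a < b)%N -> dl a b = X a * dl a.+1 b.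
Proof. by move=> H; rewrite (@dl_cat a a.+1 b) ?dl1 //; lia. Qed.
Lemma dlSr a b : (a <= b)%N -> dl a b.+1 = dl a b * X b.
Proof. by move=> H; rewrite (@dl_cat a b b.+1) ?dl1 //; lia. Qed.
Lemma inF_dl a b a' b' : (a' <= a)%N -> (b <= b')%N -> inF a' b' (dl a b).
Proof.
move=> Ha Hb; elim: (b - a)%N {-2}a Ha (erefl (b - a)%N) => [|d IH] c Hc Hd.
  by rewrite dl_nil //; lia.
by rewrite dlS ?inFM ?IH ?inFX //; lia.
Qed.

Definition sgf (x : nat * bool) (j : nat) : fg :=
  let i := x.1 in
  if ~~ x.2 then
    if j == i then X i * X i.+1 * (X i)^-1 else if j == i.+1 then X i else X j
  else
    if j == i then X i.+1 else if j == i.+1 then (X i.+1)^-1 * X i * X i.+1 else X j.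
Definition sg (x : nat * bool) : fg -> fg := hom (sgf x).
(* With this order of composition the tuple (aut b (X i))_i is the Hurwitz
   transform by b of the tuple of the generators. *)
Fixpoint aut (b : seq (nat * bool)) (g : fg) : fg :=
  if b is x :: b' then aut b' (sg x g) else g.
Definition brw (a b : nat) (w : seq (nat * bool)) : bool :=
  all (fun x => (a <= x.1) && (x.1.+1 < b))%N w.
Definition binv (w : seq (nat * bool)) : seq (nat * bool) :=
  rev [seq (x.1, ~~ x.2) | x <- w].

Lemma sg1 x : sg x 1 = 1. Proof. exact: hom1. Qed.
Lemma sgM x g h : sg x (g * h) = sg x g * sg x h. Proof. exact: homM. Qed.
Lemma sgV x g : sg x g^-1 = (sg x g)^-1. Proof. exact: homV. Qed.
Lemma sgX x j : sg x (X j) = sgf x j. Proof. exact: homX. Qed.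
Lemma sgL x j c : sg x (L (j, c)) = if c then (sgf x j)^-1 else sgf x j.
Proof. by rewrite LX; case: c; rewrite ?sgV sgX. Qed.

Lemma sgK x g : sg (x.1, ~~ x.2) (sg x g) = g.
Proof.
elim/fg_ind': g => [|[j c] g IH]; first by rewrite !sg1.
rewrite !sgM IH; congr (_ * _).
suff E: sg (x.1, ~~ x.2) (sgf x j) = X j.
  by rewrite sgL; case: c; rewrite ?sgV E LX.
have D k : (k.+1 == k) = false by lia.
clear IH; case: x => i [] /=; rewrite /sgf /=; case: (j =P i) => [->|/eqP/negbTE Hj].
- by rewrite sgX /sgf /= D eqxx.
- case: (j =P i.+1) => [->|/eqP/negbTE Hj']; last by rewrite sgX /sgf /= Hj Hj'.
  by rewrite !sgM sgV !sgX /sgf /= eqxx D eqxx !mulgA mulVg mul1g mulgVK.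
- by rewrite !sgM sgV !sgX /sgf /= eqxx D eqxx !mulgA mulgK mulgV mul1g.
case: (j =P i.+1) => [->|/eqP/negbTE Hj']; first by rewrite sgX /sgf /= eqxx.
by rewrite sgX /sgf /= Hj Hj'.
Qed.

Lemma autM w g h : aut w (g * h) = aut w g * aut w h.
Proof. by elim: w g h => //= x w IH g h; rewrite sgM IH. Qed.
Lemma aut1 w : aut w 1 = 1.
Proof. by elim: w => //= x w IH; rewrite sg1. Qed.
Lemma autV w g : aut w g^-1 = (aut w g)^-1.
Proof. by elim: w g => //= x w IH g; rewrite sgV IH. Qed.
Lemma aut_pr w s : aut w (pr s) = pr [seq aut w x | x <- s].
Proof. by elim: s => [|x s IH] /=; rewrite ?aut1 // autM IH. Qed.
Lemma aut_cat w w' g : aut (w ++ w') g = aut w' (aut w g).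
Proof. by elim: w g => //= x w IH g. Qed.
Lemma aut_hom w g : aut w g = hom (fun i => aut w (X i)) g.
Proof.
elim/fg_ind': g => [|[i c] g IH]; first by rewrite aut1 hom1.
by rewrite autM homM IH homL LX /evl; case: c; rewrite //= autV.
Qed.

Lemma binv_cat w w' : binv (w ++ w') = binv w' ++ binv w.
Proof. by rewrite /binv map_cat rev_cat. Qed.
Lemma binvK : involutive binv.
Proof.
move=> w; rewrite /binv map_rev revK -map_comp -[RHS]map_id.
by apply: eq_map => -[i b] /=; rewrite negbK.
Qed.
Lemma autK w g : aut (binv w) (aut w g) = g.
Proof.
elim: w g => //= x w IH g.
by rewrite (binv_cat [:: x] w) aut_cat IH /= sgK.
Qed.
Lemma autVK w g : aut w (aut (binv w) g) = g.
Proof. by rewrite -{1}(binvK w) autK. Qed.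
Lemma aut_inj w : injective (aut w).
Proof. exact: can_inj (autK w). Qed.

Lemma brw_cat a b w w' : brw a b (w ++ w') = brw a b w && brw a b w'.
Proof. exact: all_cat. Qed.
Lemma brw_binv a b w : brw a b (binv w) = brw a b w.
Proof. by rewrite /brw /binv all_rev all_map. Qed.
Lemma brwS a b a' b' w : (a' <= a)%N -> (b <= b')%N -> brw a b w -> brw a' b' w.
Proof. by move=> Ha Hb; apply: sub_all => x /=; lia. Qed.

Lemma inF_hom a b a' b' f g : (forall i, (a <= i < b)%N -> inF a' b' (f i)) ->
  inF a b g -> inF a' b' (hom f g).
Proof.
move=> H; elim/inF_ind: g / => [|x g Hx Hg IH]; first by rewrite hom1.
rewrite homM inFM // homL /evl; case: x.2; last exact: H.
by rewrite inFVE; apply: H.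
Qed.

Lemma sgf_id x j : j != x.1 -> j != x.1.+1 -> sgf x j = X j.
Proof. by rewrite /sgf => /negbTE-> /negbTE->; rewrite if_same. Qed.

Lemma inF_sg a b x g : (a <= x.1)%N -> (x.1.+1 < b)%N -> inF a b g -> inF a b (sg x g).
Proof.
move=> Ha Hb; apply: inF_hom => i Hi; rewrite /sgf.
by case: x Ha Hb => k [] /= Ha Hb; repeat (case: eqP => _);
  rewrite ?inFM ?inFVE ?inFX //; lia.
Qed.
Lemma inF_aut a b w g : brw a b w -> inF a b (aut w g) = inF a b g.
Proof.
have H: forall w g, brw a b w -> inF a b g -> inF a b (aut w g).
  elim=> //= x v IH h /andP[/andP[Hx Hx'] Hv] Hh.
  by apply: IH => //; apply: inF_sg.
move=> Hw; apply/idP/idP; last exact: H.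
by move/(H (binv w)); rewrite brw_binv autK; apply.
Qed.

Lemma sg_id a b x g : inF a b g -> (x.1.+1 < a)%N || (b <= x.1)%N -> sg x g = g.
Proof.
move=> Hg Hx; elim/inF_ind: g / Hg => [|[i c] g Hi Hg IH]; first by rewrite sg1.
have Hj: (i != x.1) /\ (i != x.1.+1) by move: Hi Hx => /=; split; lia.
by rewrite sgM IH sgL sgf_id ?LX //; case: Hj.
Qed.
Lemma aut_id a b a' b' w g : inF a b g -> brw a' b' w -> (b' <= a)%N || (b <= a')%N ->
  aut w g = g.
Proof.
move=> Hg Hw Hab; elim: w Hw => //= x w IH /andP[/andP[Hx Hx'] Hw].
by rewrite (sg_id Hg) ?IH //; lia.
Qed.

Lemma sg_dl a b x : (a <= x.1)%N -> (x.1.+1 < b)%N -> sg x (dl a b) = dl a b.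
Proof.
case: x => i c /= Ha Hb.
rewrite (@dl_cat a i b) ?(@dl_cat i i.+2 b) ?(dlS (ltnSn _)) //; try lia.
rewrite (@dlS i i.+2) ?dl1; try lia.
rewrite !sgM (@sg_id a i) ?(@sg_id i.+2 b _ (dl i.+2 b)) ?inF_dl //=; try lia.
rewrite !sgX /sgf /= eqxx (_ : (i.+1 == i) = false) ?eqxx; last lia.
by case: c => /=; rewrite !mulgA ?mulgK ?mulgVK.
Qed.
Lemma aut_dl a b w : brw a b w -> aut w (dl a b) = dl a b.
Proof. by elim: w => //= x w IH /andP[/andP[Hx Hx'] Hw]; rewrite sg_dl ?IH. Qed.

(** * The circular order of the planar tree *)

(* A point is a reduced word followed by [None] (the base point at the vertex
   reached) or [Some i] (the puncture i).  Around every vertex the directions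
   are ordered cyclically as base, X 0, puncture 0, (X 0)^-1, X 1, ...  *)
Definition pt := (word nat * option nat)%type.
Definition lc (x : letter nat) : nat := if x.2 then (3 * x.1 + 4)%N else (3 * x.1 + 2)%N.
Definition tc (t : option nat) : nat := if t is Some i then (3 * i + 3)%N else 1%N.
(** Read cyclically from [b], the code [x] comes strictly before [y]. *)
Definition cw (b x y : nat) : bool :=
  [|| (b < x) && (x < y), (x < y) && (y < b) | (y < b) && (b < x)]%N.
(** Here [b] is the direction through which the current vertex was entered. It is 0 at the root,
    where all codes are positive and the cyclic order becomes linear. After a common letter [x], the
    next vertex is entered through the direction of the inverse of [x]. *)
Fixpoint ltp (b : nat) (u : word nat) s (v : word nat) t : bool :=
  match u, v with
  | x :: u', y :: v' => if x == y then ltp (lc (linv x)) u' s v' t else cw b (lc x) (lc y)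
  | x :: _, [::] => cw b (lc x) (tc t)
  | [::], y :: _ => cw b (tc s) (lc y)
  | [::], [::] => cw b (tc s) (tc t)
  end.
Definition Lt (p q : pt) : bool := ltp 0 p.1 p.2 q.1 q.2.
Definition C (p q r : pt) : bool :=
  [|| Lt p q && Lt q r, Lt q r && Lt r p | Lt r p && Lt p q].

(** [X i] fixes the puncture i; a word ending in a letter of index i and followed by this puncture
    would name a point a second time. *)
Fixpoint okw (u : word nat) (t : option nat) : bool :=
  if u is x :: u' then
    (if u' is y :: _ then y != linv x else t != Some x.1) && okw u' t
  else true.
Definition okp (p : pt) := okw p.1 p.2.
Definition hdw (u : word nat) (t : option nat) := if u is x :: _ then lc x else tc t.

Lemma lc_inj : injective lc.
Proof. by case=> [i []] [j []]; rewrite /lc /= => H; congr pair; lia. Qed.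
Lemma tc_inj : injective tc.
Proof. by case=> [i|] [j|] //= H; first (congr Some); lia. Qed.
Lemma lc_tc x t : lc x != tc t.
Proof. by case: x t => [i []] [j|]; rewrite /lc /=; lia. Qed.
Lemma lc_eq x y : (lc x == lc y) = (x == y).
Proof. exact: (inj_eq lc_inj). Qed.
Lemma lc_gt0 x : (1 < lc x)%N.
Proof. by case: x => i []; rewrite /lc /=; lia. Qed.
Lemma tc_gt0 t : (0 < tc t)%N. Proof. by case: t => //= i; lia. Qed.
Lemma hdw_gt0 u t : (0 < hdw u t)%N.
Proof. by case: u => [|x u] /=; [exact: tc_gt0 | rewrite ltnW // lc_gt0]. Qed.

Lemma ok_hdw x u t : okw (x :: u) t -> hdw u t != lc (linv x).
Proof.
case: u => [_|y u /= /andP[H _]] /=; last by rewrite lc_eq.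
by rewrite eq_sym lc_tc.
Qed.
Lemma okw_behead x u t : okw (x :: u) t -> okw u t.
Proof. by case/andP. Qed.
Lemma okw_reduced u t : okw u t -> reduced u.
Proof. by elim: u => //= x [|y u] IH //= /andP[-> /IH]. Qed.
Lemma okw_None u : okw u None = reduced u.
Proof. by elim: u => //= x u ->; case: u. Qed.

Lemma ltpE b x u s y v t : ltp b (x :: u) s (y :: v) t =
  if x == y then ltp (lc (linv x)) u s v t else cw b (lc x) (lc y).
Proof. by []. Qed.
Lemma ltp_ne b u s v t : hdw u s != hdw v t -> ltp b u s v t = cw b (hdw u s) (hdw v t).
Proof. by case: u v => [|x u] [|y v] //=; rewrite lc_eq => /negbTE->. Qed.

Lemma cw_anti b x y : b != x -> b != y -> x != y -> cw b y x = ~~ cw b x y.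
Proof. rewrite /cw; lia. Qed.

Lemma ltp_anti b u s v t : okw u s -> okw v t -> b != hdw u s -> b != hdw v t ->
  (u, s) != (v, t) -> ltp b v t u s = ~~ ltp b u s v t.
Proof.
elim: u v b => [|x u IH] [|y v] b Hu Hv Hbu Hbv Hne.
- by rewrite /= cw_anti //; apply: contra Hne => /eqP/tc_inj->.
- by rewrite /= cw_anti //= eq_sym lc_tc.
- by rewrite /= cw_anti //= lc_tc.
rewrite !ltpE eq_sym; case: eqP => [E|/eqP E]; last by rewrite cw_anti // lc_eq.
subst y; apply: IH; rewrite ?(okw_behead Hu) ?(okw_behead Hv) // 1?eq_sym ?ok_hdw //.
by apply: contra Hne => /eqP[-> ->].
Qed.

Lemma ltp_irr b u s : ltp b u s u s = false.
Proof. by elim: u b => [|x u IH] b /=; rewrite ?eqxx ?IH // /cw; lia. Qed.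

Lemma ltp_trans b u s v t w r : ltp b u s v t -> ltp b v t w r -> ltp b u s w r.
Proof.
have T c x y z : cw c x y -> cw c y z -> cw c x z by rewrite /cw; lia.
have N c x y : cw c x y -> cw c y x -> False by rewrite /cw; lia.
elim: u v w b => [|x u IH] [|y v] [|z w] b; rewrite ?ltpE //=; try exact: T.
- by case: (y =P z) => [->|_] //; exact: T.
- case: (x =P z) => [E|_]; last exact: T.
  by subst => H1 H2; case: (N _ _ _ H1 H2).
- by case: (x =P y) => [->|_] //; exact: T.
case: (x =P y) => [->|Hxy]; first by case: (y =P z) => [_|//]; apply: IH.
case: (y =P z) => [<-|Hyz]; first by case: (x =P y).
case: (x =P z) => [->|_] H1 H2; last exact: T H1 H2.
by case: (N _ _ _ H1 H2).
Qed.

Lemma Lt_anti p q : okp p -> okp q -> p != q -> Lt q p = ~~ Lt p q.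
Proof.
move=> Hp Hq H; apply: ltp_anti => //.
- by have := hdw_gt0 p.1 p.2; lia.
- by have := hdw_gt0 q.1 q.2; lia.
Qed.
Lemma Lt_irr p : Lt p p = false. Proof. exact: ltp_irr. Qed.
Lemma Lt_trans p q r : Lt p q -> Lt q r -> Lt p r. Proof. exact: ltp_trans. Qed.

Lemma C_rot p q r : C p q r = C q r p.
Proof. by rewrite /C; case: (Lt p q); case: (Lt q r); case: (Lt r p). Qed.

(** * The action of the free group *)

Definition act1 (x : letter nat) (p : pt) : pt :=
  if p.1 is y :: u then (if y == linv x then (u, p.2) else (x :: p.1, p.2))
  else if p.2 == Some x.1 then p else ([:: x], p.2).
Definition actw (w : word nat) (p : pt) : pt := foldr act1 p w.
Definition act (g : fg) (p : pt) : pt := actw (fw g) p.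
Definition base : pt := ([::], None).
Definition punc (i : nat) : pt := ([::], Some i).

Lemma ok_act1 x p : okp p -> okp (act1 x p).
Proof.
case: p => [[|y u] t]; rewrite /okp /act1 /=; first by case: ifP => //= ->.
by case: ifP => [_|H] /andP[H1 H2] //=; rewrite H H1 H2.
Qed.
Lemma ok_actw w p : okp p -> okp (actw w p).
Proof. by move=> Hp; elim: w => //= x w; apply: ok_act1. Qed.
Lemma ok_act g p : okp p -> okp (act g p).
Proof. exact: ok_actw. Qed.
Lemma ok_base : okp base. Proof. by []. Qed.
Lemma ok_punc i : okp (punc i). Proof. by []. Qed.

Lemma act1K x p : okp p -> act1 (linv x) (act1 x p) = p.
Proof.
case: p => [[|y u] t]; rewrite /okp /act1 /=.
  by case: ifP => H _ /=; rewrite ?H // linvK eqxx.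
case: (y =P linv x) => [->|/eqP H] /=; last by rewrite linvK eqxx.
case: u => [|z u] /=; first by rewrite andbT => /negbTE->.
by rewrite linvK => /andP[/negbTE-> _].
Qed.

Lemma actw_push x w p : okp p -> actw (push x w) p = act1 x (actw w p).
Proof.
case: w => //= y w Hp; case: (y =P linv x) => [->|_] //=.
by have := act1K (linv x) (ok_actw w Hp); rewrite linvK.
Qed.
Lemma actw_red w p : okp p -> actw (red w) p = actw w p.
Proof. by move=> Hp; elim: w => //= x w IH; rewrite actw_push // IH. Qed.
Lemma actM g h p : okp p -> act (g * h) p = act g (act h p).
Proof. by move=> Hp; rewrite /act fwM actw_red // /actw foldr_cat. Qed.
Lemma act1g p : act 1 p = p. Proof. by []. Qed.
Lemma actL x p : act (L x) p = act1 x p. Proof. by []. Qed.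
Lemma actVK g p : okp p -> act g (act g^-1 p) = p.
Proof. by move=> Hp; rewrite -actM // mulgV. Qed.
Lemma actK g p : okp p -> act g^-1 (act g p) = p.
Proof. by move=> Hp; rewrite -actM // mulVg. Qed.
Lemma act_inj g p q : okp p -> okp q -> act g p = act g q -> p = q.
Proof. by move=> Hp Hq E; rewrite -(actK g Hp) E actK. Qed.
Lemma act_eq g p q : okp p -> okp q -> (act g p == act g q) = (p == q).
Proof. by move=> Hp Hq; apply/eqP/eqP => [/act_inj|->//]; apply. Qed.

Lemma act_base g : act g base = (fw g, None).
Proof.
have H w : actw w base = (red w, None).
  elim: w => //= x w ->; rewrite -/(red w).
  by case: (red w) => [|y v] //=; rewrite /act1 /=; case: ifP.
by rewrite /act H red_id // fgP.
Qed.
Lemma act_base_inj g h : act g base = act h base -> g = h.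
Proof. by rewrite !act_base => -[]; apply: fg_inj. Qed.

Lemma act_reduced w u t : okw (w ++ u) t -> actw w (u, t) = (w ++ u, t).
Proof.
elim: w => //= x w IH H; rewrite IH ?(andP H).2 //.
case: (w ++ u) H => [|y v] /= /andP[H _]; rewrite /act1 /=.
  by rewrite (negbTE H).
by rewrite (negbTE H).
Qed.

(* [act] without the cancellation that fixes the puncture of the letter x;
   comparisons are unchanged. *)
Definition actr (x : letter nat) (p : pt) : pt :=
  if p.1 is y :: u then (if y == linv x then (u, p.2) else (x :: p.1, p.2))
  else ([:: x], p.2).

(** The code of the puncture i lies directly between the codes of the two letters of index i, so
    lengthening the path to the puncture by such a letter moves it past no other point. *)
Lemma ltp0_norm x v t : okw v t -> (v, t) != punc x.1 ->
  (ltp 0 [:: x] (Some x.1) v t = ltp 0 [::] (Some x.1) v t) /\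
  (ltp 0 v t [:: x] (Some x.1) = ltp 0 v t [::] (Some x.1)).
Proof.
case: v => [|y v] Hv Hne; split; rewrite ?ltpE.
- have: tc t != tc (Some x.1) by apply: contra Hne => /eqP/tc_inj->.
  by have := lc_tc x t; rewrite /= /cw /lc /=; case: x.2; lia.
- have: tc t != tc (Some x.1) by apply: contra Hne => /eqP/tc_inj->.
  by have := lc_tc x t; rewrite /= /cw /lc /=; case: x.2; lia.
- case: eqP => [E|/eqP]; last first.
    rewrite -lc_eq; have := lc_tc y (Some x.1).
    by rewrite /= /cw /lc /=; case: x.2; case: y.2; lia.
  subst y; have N1 := ok_hdw Hv; have N2 : hdw v t != tc (Some x.1).
    case: v Hv {N1 Hne} => [/= /andP[H _]|z v _]; last exact: (lc_tc z (Some x.1)).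
    by apply: contra H => /eqP H'; rewrite (@tc_inj t (Some x.1) H').
  rewrite ltp_ne 1?eq_sym //=.
  by move: N1 N2; rewrite /cw /lc /linv /=; case: x.2 => /=; lia.
- case: eqP => [E|/eqP]; last first.
    rewrite -lc_eq; have := lc_tc y (Some x.1).
    by rewrite /= /cw /lc /=; case: x.2; case: y.2; lia.
  subst y; have N1 := ok_hdw Hv; have N2 : hdw v t != tc (Some x.1).
    case: v Hv {N1 Hne} => [/= /andP[H _]|z v _]; last exact: (lc_tc z (Some x.1)).
    by apply: contra H => /eqP H'; rewrite (@tc_inj t (Some x.1) H').
  rewrite ltp_ne //=.
  by move: N1 N2; rewrite /cw /lc /linv /=; case: x.2 => /=; lia.
Qed.

(** * Translations preserve the circular order *)

Definition hd (p : pt) := hdw p.1 p.2.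
Definition dp (p q : pt) : bool :=
  match p.1, q.1 with
  | x :: u, _ :: v => ltp (lc (linv x)) u p.2 v q.2
  | _, _ => false
  end.

Lemma ltpdE b (p q : pt) : p != q -> ltp b p.1 p.2 q.1 q.2 =
  if hd p == hd q then dp p q else cw b (hd p) (hd q).
Proof.
case: p q => [[|x u] s] [[|y v] t] H //; rewrite /hd /dp /=.
- by case: eqP => // /tc_inj E; rewrite E eqxx in H.
- by rewrite eq_sym (negbTE (lc_tc _ _)).
- by rewrite (negbTE (lc_tc _ _)).
by rewrite lc_eq; case: eqP => [->|].
Qed.

Lemma hd_gt0 p : (0 < hd p)%N. Proof. exact: hdw_gt0. Qed.

Lemma LtE p q : p != q -> Lt p q = if hd p == hd q then dp p q else (hd p < hd q)%N.
Proof.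
move=> H; rewrite /Lt ltpdE //; case: eqP => // /eqP Hh.
by move: Hh (hd_gt0 p) (hd_gt0 q); rewrite /cw; lia.
Qed.

(** The points whose path from the root is shortened by [x]. *)
Definition inA (x : letter nat) (p : pt) := if p.1 is y :: _ then y == linv x else false.

Lemma inA_hd x p : inA x p = (hd p == lc (linv x)).
Proof.
by case: p => [[|y u] t]; rewrite /inA /hd /= ?lc_eq // eq_sym (negbTE (lc_tc _ _)).
Qed.

Lemma Lt_actrN x p q : p != q -> inA x p = false -> inA x q = false ->
  Lt (actr x p) (actr x q) =
  if hd p == hd q then dp p q else cw (lc (linv x)) (hd p) (hd q).
Proof.
move=> Hne Hp Hq; rewrite -ltpdE //.
have K r : inA x r = false -> actr x r = (x :: r.1, r.2).
  by case: r => [[|y u] t]; rewrite /inA /actr //= => ->.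
by rewrite !K // /Lt /= eqxx.
Qed.

Lemma Lt_actrAN x p q : okp p -> inA x p -> inA x q = false ->
  (hd (actr x p) != lc x) * (hd (actr x q) = lc x) *
  (Lt (actr x p) (actr x q) = (hd (actr x p) < lc x)%N) *
  (Lt (actr x q) (actr x p) = (lc x < hd (actr x p))%N).
Proof.
case: p => [[//|y u] s] Hp; rewrite /inA /= => /eqP E; subst y.
have K : inA x q = false -> actr x q = (x :: q.1, q.2).
  by case: q => [[|y v] t]; rewrite /inA /actr //= => ->.
move=> /K ->.
have Ea : actr x (linv x :: u, s) = (u, s) by rewrite /actr /= eqxx.
have E : hd (x :: q.1, q.2) = lc x by [].
have N: hd (u, s) != lc x by have := ok_hdw Hp; rewrite linvK.
have N': (u, s) != (x :: q.1, q.2) by apply: contra N => /eqP->.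
by rewrite Ea (LtE N') LtE 1?eq_sym // E [lc x == _]eq_sym (negbTE N).
Qed.

Lemma Lt_actrA x p q : p != q -> inA x p -> inA x q ->
  (hd p = hd q) * (actr x p != actr x q) *
  (dp p q = if hd (actr x p) == hd (actr x q) then dp (actr x p) (actr x q)
            else cw (lc x) (hd (actr x p)) (hd (actr x q))).
Proof.
case: p q => [[//|y u] s] [[//|z v] t] Hne; rewrite /inA /= => /eqP E /eqP E'.
subst y z; rewrite /actr /= eqxx -ltpdE; last by apply: contra Hne => /eqP[-> ->].
rewrite /dp /= linvK; do 2!split=> //.
by apply: contra Hne => /eqP[-> ->].
Qed.

Lemma cw_anti' m a b : m != a -> m != b -> a != b -> cw m b a = ~~ cw m a b.
Proof. exact: cw_anti. Qed.

Lemma cw_rot m a b : cw m a b = cw a b m.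
Proof. by rewrite /cw; case: (m < a)%N; case: (a < b)%N; case: (b < m)%N. Qed.

Lemma cw_cut m a b c : m != a -> m != b -> m != c -> a != b -> b != c -> c != a ->
  [|| cw m a b && cw m b c, cw m b c && cw m c a | cw m c a && cw m a b] = cw a b c.
Proof.
rewrite /cw; case: (ltngtP m a) => // H1; case: (ltngtP m b) => // H2;
  case: (ltngtP m c) => // H3 _ _ _; case: (ltngtP a b) => // H4;
  case: (ltngtP b c) => // H5; case: (ltngtP c a) => // H6 _ _ _ //=; exfalso; lia.
Qed.

Definition cyc3 (a b c : bool) := [|| a && b, b && c | c && a].

Lemma cyc3_same a x : cyc3 a x (~~ x) = a.
Proof. by case: a; case: x. Qed.

(** Cutting a cyclic order at [m] or at [m'] gives linear orders that close up to the same cyclic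
    order, however ties are broken. *)
Lemma cyc_cut m m' a b c d1 d2 d3 : m != a -> m != b -> m != c ->
  m' != a -> m' != b -> m' != c ->
  cyc3 (if a == b then d1 else cw m a b) (if b == c then d2 else cw m b c)
       (if c == a then d3 else cw m c a) =
  cyc3 (if a == b then d1 else cw m' a b) (if b == c then d2 else cw m' b c)
       (if c == a then d3 else cw m' c a).
Proof.
move=> M1 M2 M3 M4 M5 M6; case: (a =P b) => [<-|/eqP N1].
  rewrite [c == a]eq_sym; case: (a =P c) => [//|/eqP N2].
  by rewrite (cw_anti' M1 M3) // (cw_anti' M4 M6) // !cyc3_same.
case: (b =P c) => [<-|/eqP N2].
  rewrite [b == a]eq_sym (negbTE N1) (cw_anti' M1 M2) // (cw_anti' M4 M5) //.
  by move: (cw m a b) (cw m' a b) => [] []; case: d2.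
case: (c =P a) => [->|/eqP N3]; last by rewrite /cyc3 !cw_cut.
rewrite (cw_anti' M1 M2) // (cw_anti' M4 M5) //.
by move: (cw m a b) (cw m' a b) => [] []; case: d3.
Qed.

Lemma LtE0 p q : p != q -> Lt p q = if hd p == hd q then dp p q else cw 0 (hd p) (hd q).
Proof. exact: ltpdE. Qed.
Lemma CE p q r : C p q r = cyc3 (Lt p q) (Lt q r) (Lt r p).
Proof. by []. Qed.
Lemma hd_neq0 p : 0%N != hd p.
Proof. by have := hd_gt0 p; lia. Qed.
Lemma cw0_lt a b : (0 < a)%N -> (0 < b)%N -> cw 0 a b = (a < b)%N.
Proof. by rewrite /cw; lia. Qed.

(** The letter [x] changes only the direction from which a vertex is seen, that is, the place where
    the cyclic order there is cut. The cases [H0] to [H3] count how many of the three points have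
    their path shortened. *)
Lemma C_actr x p q r : okp p -> okp q -> okp r -> p != q -> q != r -> r != p ->
  C (actr x p) (actr x q) (actr x r) = C p q r.
Proof.
set m := lc x; set n := lc (linv x).
have H0 : forall p q r, okp p -> okp q -> okp r -> p != q -> q != r -> r != p ->
    inA x p = false -> inA x q = false -> inA x r = false ->
    C (actr x p) (actr x q) (actr x r) = C p q r.
  move=> {}p {}q {}r Hp Hq Hr N1 N2 N3 A1 A2 A3.
  rewrite !CE !Lt_actrN // !LtE0 //; apply: cyc_cut; rewrite ?hd_neq0 //.
  - by rewrite eq_sym -inA_hd A1.
  - by rewrite eq_sym -inA_hd A2.
  - by rewrite eq_sym -inA_hd A3.
have H1 : forall p q r, okp p -> okp q -> okp r -> p != q -> q != r -> r != p ->
    inA x p -> inA x q = false -> inA x r = false ->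
    C (actr x p) (actr x q) (actr x r) = C p q r.
  move=> {}p {}q {}r Hp Hq Hr N1 N2 N3 A1 A2 A3.
  have [[[K1 _] K2] K3] := Lt_actrAN Hp A1 A2.
  have [[[_ _] K5] K6] := Lt_actrAN Hp A1 A3.
  have E1 : hd p = n by apply/eqP; rewrite -inA_hd.
  have E2 : n != hd q by rewrite eq_sym -inA_hd A2.
  have E3 : n != hd r by rewrite eq_sym -inA_hd A3.
  rewrite !CE K2 K6 Lt_actrN // !LtE0 // E1 (negbTE E2) [hd r == n]eq_sym (negbTE E3).
  rewrite -/m -/n; have -> : (hd (actr x p) < m)%N = ~~ (m < hd (actr x p))%N.
    by move: K1; rewrite -/m; case: ltngtP.
  case: eqP => [E|/eqP E].
    rewrite -E (@cw_anti' 0 n (hd q)) ?hd_neq0 -?E1 ?hd_neq0 ?E1 //.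
    by move: (cw 0 n (hd q)) (m < hd (actr x p))%N => [] []; case: (dp q r).
  rewrite [RHS]/cyc3 cw_cut ?hd_neq0 // -?E1 ?hd_neq0 ?E1 // 1?eq_sym //.
  by move: (cw n _ _) (m < _)%N => [] [].
have H2 : forall p q r, okp p -> okp q -> okp r -> p != q -> q != r -> r != p ->
    inA x p -> inA x q -> inA x r = false ->
    C (actr x p) (actr x q) (actr x r) = C p q r.
  move=> {}p {}q {}r Hp Hq Hr N1 N2 N3 A1 A2 A3.
  have [[[K1 _] K2] K3] := Lt_actrAN Hp A1 A3.
  have [[[K4 _] K5] K6] := Lt_actrAN Hq A2 A3.
  have [[E1 N4] K7] := Lt_actrA N1 A1 A2.
  have E2 : hd q = n by apply/eqP; rewrite -inA_hd.
  have E3 : n != hd r by rewrite eq_sym -inA_hd A3.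
  rewrite !CE K3 K5 !LtE0 // E1 eqxx K7 E2 (negbTE E3) [hd r == n]eq_sym (negbTE E3).
  rewrite (cw_anti' _ (hd_neq0 r)) ?cyc3_same // -?E2 ?hd_neq0 //.
  have G : (0 < m)%N by rewrite ltnW // lc_gt0.
  have M : 0%N != m by rewrite eq_sym -lt0n.
  have K1' : hd (actr x p) != m by []. have K4' : hd (actr x q) != m by [].
  rewrite -/m -(@cw0_lt (hd (actr x q)) m) ?hd_gt0 // -(@cw0_lt m (hd (actr x p))) ?hd_gt0 //.
  case: eqP => [->|/eqP F].
    by rewrite (@cw_anti' 0 (hd (actr x q)) m) ?hd_neq0 // cyc3_same.
  by rewrite /cyc3 cw_cut ?hd_neq0 // 1?eq_sym // -cw_rot.
have H3 : inA x p -> inA x q -> inA x r -> okp p -> okp q -> okp r ->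
    p != q -> q != r -> r != p -> C (actr x p) (actr x q) (actr x r) = C p q r.
  move=> A1 A2 A3 Hp Hq Hr N1 N2 N3.
  have [[E1 N4] K7] := Lt_actrA N1 A1 A2.
  have [[E2 N5] K8] := Lt_actrA N2 A2 A3.
  have [[E3 N6] K9] := Lt_actrA N3 A3 A1.
  have Nx s : okp s -> inA x s -> m != hd (actr x s).
    case: s => [[//|y u] s] Hs; rewrite /inA /= => /eqP E; subst y.
    by rewrite /actr /= eqxx eq_sym; have := ok_hdw Hs; rewrite linvK.
  rewrite !CE !LtE0 // E1 E2 E3 E1 E2 !eqxx K7 K8 K9.
  by apply: cyc_cut; rewrite ?hd_neq0 ?Nx.
move=> Hp Hq Hr N1 N2 N3.
case A1: (inA x p); case A2: (inA x q); case A3: (inA x r).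
- exact: H3.
- exact: H2.
- by rewrite [LHS]C_rot [LHS]C_rot [RHS]C_rot [RHS]C_rot; apply: H2.
- exact: H1.
- by rewrite [LHS]C_rot [RHS]C_rot; apply: H2.
- by rewrite [LHS]C_rot [RHS]C_rot; apply: H1.
- by rewrite [LHS]C_rot [LHS]C_rot [RHS]C_rot [RHS]C_rot; apply: H1.
- exact: H0.
Qed.

Lemma Lt_act1 x p q : okp p -> okp q -> p != q ->
  Lt (act1 x p) (act1 x q) = Lt (actr x p) (actr x q).
Proof.
have E r : okp r -> r != punc x.1 -> act1 x r = actr x r.
  by case: r => [[|y u] t] // _ H; rewrite /act1 /actr /=; case: eqP => // E; case/eqP: H; rewrite E.
have E' : act1 x (punc x.1) = punc x.1 by rewrite /act1 /= eqxx.
have oka s : okp s -> s != punc x.1 -> okp (actr x s) by move=> Hs Ns; rewrite -E // ok_act1.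
have na s : okp s -> s != punc x.1 -> actr x s != punc x.1.
  move=> Hs Ns; apply/negP => /eqP H; case/negP: (Ns); apply/eqP.
  by rewrite -(act1K x Hs) (E s Hs Ns) H /act1 /= eqxx.
move=> Hp Hq N; have [Ep|Np] := eqVneq p (punc x.1).
  have Nq: q != punc x.1 by rewrite -Ep eq_sym.
  rewrite Ep E' E //; have [K _] := ltp0_norm (oka _ Hq Nq) (na _ Hq Nq).
  by rewrite /Lt [punc _]lock /= -lock -K.
have [Eq|Nq] := eqVneq q (punc x.1); last by rewrite !E.
rewrite Eq E' E //; have [_ K] := ltp0_norm (oka _ Hp Np) (na _ Hp Np).
by rewrite /Lt /= K.
Qed.

Lemma C_act1 x p q r : okp p -> okp q -> okp r -> p != q -> q != r -> r != p ->
  C (act1 x p) (act1 x q) (act1 x r) = C p q r.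
Proof. by move=> *; rewrite -[RHS](@C_actr x) // !CE !Lt_act1. Qed.

Lemma C_act g p q r : okp p -> okp q -> okp r -> p != q -> q != r -> r != p ->
  C (act g p) (act g q) (act g r) = C p q r.
Proof.
move=> Hp Hq Hr N1 N2 N3; elim/fg_ind': g => // x g IH.
by rewrite !actM // !actL C_act1 ?IH ?ok_act ?act_eq.
Qed.

(** * The action of braids on points *)

Definition sgt (x : nat * bool) (t : option nat) : pt :=
  if t is Some j then
    if ~~ x.2 then
      if j == x.1 then ([:: (x.1, false)], Some x.1.+1)
      else if j == x.1.+1 then punc x.1 else punc j
    else
      if j == x.1 then punc x.1.+1
      else if j == x.1.+1 then ([:: (x.1.+1, true)], Some x.1) else punc j
  else base.
(** Forced by equivariance: a point is the translate, by its word, of the base point or of a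
    puncture. *)
Definition sgp (x : nat * bool) (p : pt) : pt := act (sg x (mkF p.1)) (sgt x p.2).

Lemma ok_sgt x t : okp (sgt x t).
Proof.
case: t x => [j|] [i b] //; rewrite /sgt /=.
by case: b => /=; repeat (case: ifP => _); rewrite ?ok_punc // /okp /= andbT;
  apply/eqP => -[]; lia.
Qed.
Lemma ok_sgp x p : okp (sgp x p).
Proof. by rewrite ok_act // ok_sgt. Qed.

Lemma act_fixV g p : okp p -> act g p = p -> act g^-1 p = p.
Proof. by move=> Hp E; rewrite -{1}E actK. Qed.

Lemma actX_punc j c : act1 (j, c) (punc j) = punc j.
Proof. by rewrite /act1 /= eqxx. Qed.

(** The puncture j is fixed by [X j], so its image has to be fixed by the image of [X j]; this
    consistency makes [sgp] equivariant. *)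
Lemma sgt_fix x j : act (sgf x j) (sgt x (Some j)) = sgt x (Some j).
Proof.
have D k : (k.+1 == k) = false by lia.
have D' k : (k == k.+1) = false by lia.
have O k d m : m != k -> okp ([:: (k, d)], Some m).
  by rewrite /okp /= andbT => H; apply: contra H => /eqP [->].
have K l p : okp p -> act1 l (act1 (linv l) p) = p.
  by move=> Hp; rewrite -{1}(linvK l) act1K.
case: x => i []; case: (j =P i) => [->|/eqP/negbTE Hj];
  rewrite /sgf /sgt /= ?eqxx ?Hj /=.
- by rewrite XL actL actX_punc.
- case: (j =P i.+1) => [Ej|_]; last by rewrite XL actL actX_punc.
  rewrite !XL !LV !actM ?ok_act ?O ?D' // !actL.
  have -> : ([:: (i.+1, true)], Some i) = act1 (i.+1, true) (punc i).
    by rewrite /act1 /=; case: eqP => // -[]; lia.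
  by rewrite (K (i.+1, false)) ?ok_punc // actX_punc.
- rewrite !XL !LV !actM ?ok_act ?O ?D // !actL.
  have -> : ([:: (i, false)], Some i.+1) = act1 (i, false) (punc i.+1).
    by rewrite /act1 /=; case: eqP => // -[]; lia.
  by rewrite (K (i, true)) ?ok_punc // actX_punc.
by case: (j =P i.+1) => [_|_]; rewrite XL actL actX_punc.
Qed.

Lemma pt_act p : okp p -> p = act (mkF p.1) ([::], p.2).
Proof.
case: p => u t Hp; have /= Hu := okw_reduced Hp.
by rewrite /act /= red_id // act_reduced cats0.
Qed.

Lemma sgp_act1 x l p : okp p -> sgp x (act1 l p) = act (sg x (L l)) (sgp x p).
Proof.
case: p => [[|y u] t] Hp; rewrite /sgp /act1 [_.1]/= [(_, t).2]/=.
  case: (t =P Some l.1) => [->|_]; last by rewrite [mkF ([::], _).1]/(1 : fg) sg1 act1g.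
  rewrite [mkF _]/(1 : fg) sg1 act1g; case: l {Hp} => j c; rewrite LX; case: c; last by rewrite sgX sgt_fix.
  by rewrite sgV sgX act_fixV ?ok_sgt ?sgt_fix.
case: ifP => [/eqP->|_]; rewrite ![_.1]/= ![_.2]/=.
  rewrite mkF_cons -actM ?ok_sgt // -sgM.
  by rewrite -LV mulVKg.
by rewrite mkF_cons sgM -actM ?ok_sgt.
Qed.

Lemma sgp_act x g p : okp p -> sgp x (act g p) = act (sg x g) (sgp x p).
Proof.
move=> Hp; elim/fg_ind': g => [|l g IH]; first by rewrite sg1.
rewrite actM // actL sgp_act1 ?ok_act // IH sgM actM //; exact: ok_sgp.
Qed.

Lemma sgp_base x : sgp x base = base.
Proof. by rewrite /sgp /= sg1. Qed.

Lemma sgpK x p : okp p -> sgp (x.1, ~~ x.2) (sgp x p) = p.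
Proof.
move=> Hp; have D k : (k.+1 == k) = false by lia.
rewrite [sgp x p]/sgp sgp_act ?ok_sgt // sgK [RHS]pt_act //; congr act.
case: p {Hp} => [u [j|]] /=; last by rewrite sgp_base.
have E k c t : sgp (x.1, ~~ x.2) ([:: (k, c)], t) =
    act (sg (x.1, ~~ x.2) (L (k, c))) (sgt (x.1, ~~ x.2) t) by [].
have E' k : sgp (x.1, ~~ x.2) (punc k) = sgt (x.1, ~~ x.2) (Some k).
  by rewrite /sgp /= sg1.
rewrite /sgt; case: x E E' => i b /=; case: b => /= E E'.
- case: (j =P i) => [->|/eqP/negbTE H]; first by rewrite E' /= D eqxx.
  case: (j =P i.+1) => [->|/eqP/negbTE H'].
    rewrite E sgL /sgf /= D eqxx /= eqxx XL LV actL.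
    by rewrite /act1 /= eqxx.
  by rewrite E' /= H H'.
case: (j =P i) => [->|/eqP/negbTE H].
  rewrite E sgL /sgf /= eqxx /= D eqxx XL actL.
  by rewrite /act1 /= eqxx.
case: (j =P i.+1) => [->|/eqP/negbTE H']; first by rewrite E' /= eqxx.
by rewrite E' /= H H'.
Qed.

Lemma sgp_inj x p q : okp p -> okp q -> sgp x p = sgp x q -> p = q.
Proof. by move=> Hp Hq E; rewrite -(sgpK x Hp) E sgpK. Qed.

(** * Braids preserve the circular order *)

Lemma hd_punc p j : hd p = (3 * j + 3)%N -> p = punc j.
Proof.
case: p => [[|[k []] u] [m|]]; rewrite /hd /hdw /tc /lc /= => H; try lia.
by congr (_, Some _); lia.
Qed.

Lemma hd_act1 l p : hd p != lc (linv l) -> p != punc l.1 -> hd (act1 l p) = lc l.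
Proof.
case: p => [[|y u] t]; rewrite /act1 /hd /=.
  by move=> _; case: (t =P Some l.1) => // ->; rewrite eqxx.
by rewrite lc_eq => /negbTE ->.
Qed.

(** Bounds for the image [s] of a point with first direction [c]. Only the six codes from [a] to
    [a + 5], of the letters and punctures of index i and i+1, are affected. When the image starts
    with [X i], of code [a], the bound concerns the direction [h] taken after this letter. *)
Definition shp (i c : nat) (s : pt) : Prop :=
  let a := (3 * i + 2)%N in let h := hd (act1 (i, true) s) in
  [/\ ((c < a) || (a + 5 < c))%N -> hd s = c,
      (a <= c <= a + 2)%N -> hd s = a /\ h = (c + 3)%N,
      c = (a + 3)%N -> hd s = a /\ ((h < a + 2) || (a + 5 < h))%N,
      c = (a + 4)%N -> hd s = a.+1 &
      c = (a + 5)%N -> (a + 2 <= hd s <= a + 5)%N].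

(** Induction on the word: the bounds for its tail, together with the exclusion of a cancelling
    letter, control how the image of the next letter cancels against the image of the tail. *)
Lemma shp_sgp i p : okp p -> shp i (hd p) (sgp (i, false) p).
Proof.
have D k : (k.+1 == k) = false by lia.
case: p => u t; elim: u => [_|l v IH Hp].
  case: t => [j|]; last by rewrite sgp_base; split; rewrite /hd /=; lia.
  rewrite /sgp /= sg1 act1g /sgt /=; case: (j =P i) => [->|Hj].
    by split; rewrite /hd /act1 /= ?eqxx /= /lc /=; try lia; split; lia.
  by case: (j =P i.+1) => [->|Hj']; split; rewrite /hd /act1 /=; lia.
have Hq := okw_behead Hp; have {IH}[S1 S2 S3 S4 S5] := IH Hq.
have N1 : hd (v, t) != lc (linv l) by exact: ok_hdw.
have N2 : (v, t) != punc l.1.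
  by apply/eqP => -[E1 E2]; move: Hp; rewrite E1 E2 /okp /= eqxx.
have N2' : hd (v, t) != (3 * l.1 + 3)%N by apply: contra N2 => /eqP/hd_punc ->.
have Es : sgp (i, false) (l :: v, t) = act (sg (i, false) (L l)) (sgp (i, false) (v, t)).
  by rewrite /sgp /= mkF_cons sgM actM ?ok_sgt.
have Hs := ok_sgp (i, false) (v, t).
move: (sgp _ (v, t)) Es Hs S1 S2 S3 S4 S5 => s -> Hs S1 S2 S3 S4 S5.
move: (hd (v, t)) S1 S2 S3 S4 S5 N1 N2' => c S1 S2 S3 S4 S5 N1 N2'.
have Eh : hd (l :: v, t) = lc l by []. rewrite {}Eh.
have P j : s = punc j -> hd s = (3 * j + 3)%N by move=> ->.
case: l Hp Hq N1 N2 N2' => j b Hp _ N1 N2 N2'.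
case: (j =P i) => [Ej|Hj]; last case: (j =P i.+1) => [Ej|Hj'].
- subst j.
  have Hr : hd (act1 (i, true) s) != (3 * i.+1 + 3)%N /\
            hd (act1 (i, true) s) != lc (linv (i.+1, b)).
    have [Ea|Na] := eqVneq (hd s) (3 * i + 2)%N.
      rewrite /lc /linv /= in N1 *; destruct b; cbn in *; split; lia.
    have [E|/eqP Np] := eqVneq s (punc i).
      by rewrite E actX_punc /hd /lc /linv /=; destruct b; cbn; split; lia.
    rewrite hd_act1; [|by rewrite /lc /linv /=|exact/eqP].
    by rewrite /lc /linv /=; destruct b; cbn; split; lia.
  have E : act (sg (i, false) (L (i, b))) s =
      act1 (i, false) (act1 (i.+1, b) (act1 (i, true) s)).
    rewrite sgL /sgf /= eqxx; destruct b.
      by rewrite !invgM invgK !mulgA XL !LV !actM ?ok_act // XL ?LV.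
    by rewrite XL !LV !actM ?ok_act // XL ?LV.
  set r := act1 (i, true) s in Hr E.
  have Hr1 : hd (act1 (i.+1, b) r) = lc (i.+1, b).
    by apply: hd_act1; [case: Hr|case: Hr => H _; apply: contra H => /eqP ->].
  have okr : okp (act1 (i.+1, b) r) by rewrite !ok_act1.
  rewrite E /shp; have -> : act1 (i, true) (act1 (i, false) (act1 (i.+1, b) r)) = act1 (i.+1, b) r.
    exact: (@act1K (i, false)).
  have Hr2 : hd (act1 (i, false) (act1 (i.+1, b) r)) = (3 * i + 2)%N.
    apply: hd_act1; first by rewrite Hr1 lc_eq; apply/eqP => -[]; lia.
    by apply/eqP => H; move: Hr1; rewrite H /hd /lc /=; destruct b; lia.
  by rewrite Hr1 Hr2 /lc /=; destruct b; cbn; split; lia.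
- subst j; destruct b; rewrite sgL /sgf /= D eqxx XL ?LV actL.
    have [Ea|Na] := eqVneq (hd s) (3 * i + 2)%N.
      rewrite /lc /linv /= in N1 N2' *; split; lia.
    have Np : s != punc i.
      apply/eqP => H; have := P _ H.
      rewrite /lc /linv /= in N1 N2' *; lia.
    rewrite /shp /linv /= hd_act1 //; rewrite /lc /=; split; lia.
  have N3 : hd s != (3 * i + 4)%N by rewrite /lc /linv /= in N1 N2'; lia.
  have Np : s != punc i.
    by apply/eqP => H; have := P _ H; rewrite /lc /linv /= in N1 N2'; lia.
  rewrite /shp; have -> : act1 (i, true) (act1 (i, false) s) = s by exact: (@act1K (i, false)).
  rewrite hd_act1 //; rewrite /lc /linv /= in N1 N2' *; split; lia.
have -> : sg (i, false) (L (j, b)) = L (j, b).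
  by rewrite sgL sgf_id ?LX //; apply/eqP.
rewrite /shp actL hd_act1.
- clear -Hj Hj'; move: (hd (act1 (i, true) _)) => h; split; rewrite /lc /=; case: (b); try lia; split; lia.
- move: N1; clear -Hj Hj' S1 S2 S3 S4 S5; move: (hd s) (hd _) S1 S2 S3 S4 S5 => d h.
  by rewrite /lc /linv /=; case: b => /=; lia.
apply/eqP => /P; move: N2'; clear -Hj Hj' S1 S2 S3 S4 S5; move: (hd s) (hd _) S1 S2 S3 S4 S5 => d h.
by rewrite /=; lia.
Qed.

Lemma hd_lc p x : hd p = lc x -> exists u, p = (x :: u, p.2).
Proof.
case: p => [[|y u] t]; rewrite /hd /=.
  by move=> E; have := lc_tc x t; rewrite E eqxx.
by move/lc_inj => ->; exists u.
Qed.

Lemma hd_share p q : p != q -> hd p = hd q -> exists x, hd p = lc x.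
Proof.
case: p q => [[|x u] s] [[|y v] t] H; rewrite /hd /=.
- by move/tc_inj=> E; rewrite E eqxx in H.
- by exists y.
- by exists x.
by exists x.
Qed.

Lemma dp_head x s t : hd s = lc x -> hd t = lc x ->
  hd (act1 (linv x) s) != hd (act1 (linv x) t) ->
  dp s t = cw (lc (linv x)) (hd (act1 (linv x) s)) (hd (act1 (linv x) t)).
Proof.
move=> /hd_lc[u ->] /hd_lc[v ->]; rewrite /act1 /= linvK eqxx /dp /=.
exact: ltp_ne.
Qed.

(** The bounds of [shp] are monotone in [c], with the second direction deciding when both images
    start with [X i]. *)
Lemma Lt_sgp_hd i p q : okp p -> okp q -> (hd p < hd q)%N ->
  Lt (sgp (i, false) p) (sgp (i, false) q).
Proof.
move=> Hp Hq Hlt.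
have Hne : sgp (i, false) p != sgp (i, false) q.
  by apply/eqP => /sgp_inj E; move: Hlt; rewrite E // ltnn.
have [P1 P2 P3 P4 P5] := shp_sgp i Hp; have [Q1 Q2 Q3 Q4 Q5] := shp_sgp i Hq.
rewrite LtE //; move: (sgp _ p) (sgp _ q) (hd p) (hd q) Hlt Hne P1 P2 P3 P4 P5 Q1 Q2 Q3 Q4 Q5.
move=> s t c d Hlt Hne P1 P2 P3 P4 P5 Q1 Q2 Q3 Q4 Q5.
case: eqP => [E|]; last first.
  move: (hd (act1 _ s)) (hd (act1 _ t)) P1 P2 P3 P4 P5 Q1 Q2 Q3 Q4 Q5 => h h'.
  by move: (hd s) (hd t) => x y *; lia.
have [Hc Hd Hs] : [/\ (c <= 3 * i + 4)%N, (3 * i + 2 <= c)%N & (d <= 3 * i + 5)%N].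
  move: (hd (act1 _ s)) (hd (act1 _ t)) P1 P2 P3 P4 P5 Q1 Q2 Q3 Q4 Q5 => h h'.
  by move: (hd s) (hd t) E => x y *; split; lia.
have [Es Eh] : hd s = (3 * i + 2)%N /\ hd (act1 (i, true) s) = (c + 3)%N by apply: P2; lia.
have Et : hd t = (3 * i + 2)%N by rewrite -E.
have Hk : (d <= 3 * i + 4)%N /\ hd (act1 (i, true) t) = (d + 3)%N \/
  d = (3 * i + 5)%N /\ ((hd (act1 (i, true) t) < 3 * i + 4) || (3 * i + 2 + 5 < hd (act1 (i, true) t)))%N.
  have [H|H] := leqP d (3 * i + 4); [left|right].
    by split=> //; apply: (Q2 _).2; lia.
  have Ed : d = (3 * i + 2 + 3)%N by lia.
  by have := Q3 Ed; lia.
have := @dp_head (i, false) s t Es Et; rewrite /linv /= Eh => ->.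
  rewrite /lc /cw /=; move: (hd (act1 _ t)) Hk => h; clear -Hc Hd Hlt.
  by case=> -[H1 H2]; lia.
by move: (hd (act1 _ t)) Hk => h; clear -Hc Hd Hlt; case=> -[H1 H2]; lia.
Qed.

Lemma Lt_sgp i p q : okp p -> okp q -> hd p != hd q ->
  Lt (sgp (i, false) p) (sgp (i, false) q) = Lt p q.
Proof.
move=> Hp Hq Hne; have N : p != q by apply: contra Hne => /eqP->.
have [H|H|H] := ltngtP (hd p) (hd q); last by rewrite H eqxx in Hne.
  by rewrite Lt_sgp_hd // LtE // (negbTE Hne) H.
rewrite Lt_anti ?ok_sgp ?Lt_sgp_hd //; last first.
  by apply/eqP => /sgp_inj E; move/eqP: N => []; rewrite E.
by rewrite LtE // (negbTE Hne) ltnNge ltnW.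
Qed.

Lemma size_act1 x p : (size (act1 x p).1 <= (size p.1).+1)%N.
Proof.
by case: p => [[|y u] t]; rewrite /act1 //=; [case: ifP|case: ifP => //= _; lia].
Qed.

(** The root is moved to the vertex where the three paths branch. Each step along a shared first
    letter shortens two words by one and lengthens the third by at most one. [D] keeps the
    translation inside a block. *)
Lemma hd_separate (D : pred (letter nat)) p q r : (forall x, D (linv x) = D x) ->
  all D p.1 -> all D q.1 -> all D r.1 ->
  okp p -> okp q -> okp r -> p != q -> q != r -> r != p ->
  exists2 g, all D (fw g) & [/\ hd (act g p) != hd (act g q), hd (act g q) != hd (act g r)
              & hd (act g r) != hd (act g p)].
Proof.
move=> HD; have [n] := ubnP (size p.1 + size q.1 + size r.1)%N.
have Da x p' : D x -> all D p'.1 -> all D (act1 (linv x) p').1.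
  case: p' => [[|y u] t] Dx; rewrite /act1 /=; first by case: ifP; rewrite //= HD Dx.
  by case: ifP => _ /=; [case/andP|rewrite HD Dx].
elim: n p q r => // n IH p q r Hn Dp Dq Dr Hp Hq Hr N1 N2 N3.
suff S p' q' r' : all D p'.1 -> all D q'.1 -> all D r'.1 -> okp p' -> okp q' -> okp r' -> p' != q' -> q' != r' -> r' != p' ->
   (size p'.1 + size q'.1 + size r'.1 < n.+1)%N -> hd p' = hd q' ->
   exists2 g, all D (fw g) & [/\ hd (act g p') != hd (act g q'), hd (act g q') != hd (act g r')
              & hd (act g r') != hd (act g p')].
  have [E1|M1] := eqVneq (hd p) (hd q); first exact: S.
  have [E2|M2] := eqVneq (hd q) (hd r).
    have [|g Hg [? ? ?]] := S q r p Dq Dr Dp Hq Hr Hp N2 N3 N1 _ E2; first by clear -Hn; lia.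
    by exists g.
  have [E3|M3] := eqVneq (hd r) (hd p).
    have [|g Hg [? ? ?]] := S r p q Dr Dp Dq Hr Hp Hq N3 N1 N2 _ E3; first by clear -Hn; lia.
    by exists g.
  by exists 1.
move=> {}Dp {}Dq {}Dr {}Hp {}Hq {}Hr {}N1 {}N2 {}N3 {}Hn E; have [x Ex] := hd_share N1 E.
have Dx : D x by have [u Eu] := hd_lc Ex; move: Dp; rewrite Eu => /andP[].
have [] := IH (act1 (linv x) p') (act1 (linv x) q') (act1 (linv x) r'); rewrite ?ok_act1 ?Da //.
- have := size_act1 (linv x) r'; set k := size (act1 _ r').1; move: k Hn => k Hn; move: Hn; rewrite E in Ex.
  have [u ->] := hd_lc Ex; rewrite -E in Ex; have [v ->] := hd_lc Ex.
  rewrite /act1 linvK /= !eqxx /=; clear; move: (size v) (size u) (size r'.1) => *; lia.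
- by rewrite -!actL act_eq.
- by rewrite -!actL act_eq.
- by rewrite -!actL act_eq.
move=> g Hg [H1 H2 H3]; exists (g * L (linv x)); last by rewrite !actM ?actL.
by rewrite fwM all_red // all_cat Hg /= HD Dx.
Qed.

(** By equivariance the points may be translated until their first directions differ, where [Lt_sgp]
    applies. The inverse generator is handled by applying this to the images. *)
Lemma C_sgp x p q r : okp p -> okp q -> okp r -> p != q -> q != r -> r != p ->
  C (sgp x p) (sgp x q) (sgp x r) = C p q r.
Proof.
have E y a b : okp a -> okp b -> (sgp y a == sgp y b) = (a == b).
  by move=> Ha Hb; apply/eqP/eqP => [/sgp_inj->|->].
have K i a b c : okp a -> okp b -> okp c -> a != b -> b != c -> c != a ->
    C (sgp (i, false) a) (sgp (i, false) b) (sgp (i, false) c) = C a b c.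
  move=> Ha Hb Hc N1 N2 N3; have [g _ [H1 H2 H3]] := @hd_separate predT a b c (fun=> erefl) (all_predT _) (all_predT _) (all_predT _) Ha Hb Hc N1 N2 N3.
  rewrite -(C_act g Ha Hb Hc) // -(C_act (sg (i, false) g)) ?ok_sgp ?E //.
  by rewrite -!sgp_act // !CE !Lt_sgp ?ok_act.
case: x => i [] Hp Hq Hr N1 N2 N3; last exact: K.
have Q s : okp s -> sgp (i, false) (sgp (i, true) s) = s by apply: (@sgpK (i, true)).
by rewrite -[LHS](K i) ?ok_sgp ?E // !Q.
Qed.

Fixpoint autp (b : seq (nat * bool)) (p : pt) : pt :=
  if b is x :: b' then autp b' (sgp x p) else p.

Lemma ok_autp b p : okp p -> okp (autp b p).
Proof. by elim: b p => //= x b IH p Hp; rewrite IH ?ok_sgp. Qed.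
Lemma autp_act b g p : okp p -> autp b (act g p) = act (aut b g) (autp b p).
Proof. by elim: b g p => //= x b IH g p Hp; rewrite sgp_act // IH ?ok_sgp. Qed.
Lemma autp_base b : autp b base = base.
Proof. by elim: b => //= x b; rewrite sgp_base. Qed.
Lemma autp_cat b b' p : autp (b ++ b') p = autp b' (autp b p).
Proof. by elim: b p => //= x b IH p. Qed.
Lemma autpK b p : okp p -> autp (binv b) (autp b p) = p.
Proof.
elim: b p => //= x b IH p Hp.
by rewrite (binv_cat [:: x] b) autp_cat IH ?ok_sgp //= sgpK.
Qed.
Lemma autpVK b p : okp p -> autp b (autp (binv b) p) = p.
Proof. by move=> Hp; rewrite -{1}(binvK b) autpK. Qed.
Lemma autp_inj b p q : okp p -> okp q -> autp b p = autp b q -> p = q.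
Proof. by move=> Hp Hq E; rewrite -(autpK b Hp) E autpK. Qed.
Lemma autp_eq b p q : okp p -> okp q -> (autp b p == autp b q) = (p == q).
Proof. by move=> Hp Hq; apply/eqP/eqP => [/autp_inj->|->]. Qed.
Lemma C_autp b p q r : okp p -> okp q -> okp r -> p != q -> q != r -> r != p ->
  C (autp b p) (autp b q) (autp b r) = C p q r.
Proof.
elim: b p q r => //= x b IH p q r Hp Hq Hr N1 N2 N3.
have E a c : okp a -> okp c -> (sgp x a == sgp x c) = (a == c).
  by move=> Ha Hc; apply/eqP/eqP => [/sgp_inj->|->].
by rewrite IH ?ok_sgp ?E // C_sgp.
Qed.

(** * Simple arcs *)

Definition cycn (a b c : nat) := [|| (a < b) && (b < c), (b < c) && (c < a) | (c < a) && (a < b)]%N.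

Lemma count_lt (T : eqType) (a b : pred T) x s :
  subpred a b -> x \in s -> ~~ a x -> b x -> (count a s < count b s)%N.
Proof.
move=> Hab Hx Ha Hb; elim: s Hx => //= y s IH; rewrite inE => /orP[/eqP<-|/IH].
  by rewrite (negbTE Ha) Hb ltnS sub_count.
by have := Hab y; rewrite /=; case: (a y) => [/(_ isT) ->|_] H; [rewrite ltn_add2l|apply: ltn_addl].
Qed.

Lemma Lt_rank (s : seq pt) : all okp s -> exists f : pt -> nat,
  [/\ forall p q : pt, p \in s -> q \in s -> Lt p q = (f p < f q)%N,
      forall p q : pt, p \in s -> q \in s -> f p = f q -> p = q & forall p : pt, f p <= size s]%N.
Proof.
move=> /allP Hs; pose f p := count (Lt^~ p) s.
have mono p q : Lt p q -> p \in s -> (f p < f q)%N.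
  move=> H Hp; apply: (count_lt _ Hp) => //; last by rewrite /= Lt_irr.
  by move=> r Hr; apply: Lt_trans Hr H.
exists f; have tot p q : p \in s -> q \in s -> p <> q -> Lt p q || Lt q p.
  by move=> Hp Hq /eqP N; rewrite (@Lt_anti p q) ?Hs // orbN.
split=> [p q Hp Hq|p q Hp Hq E|p]; last exact: count_size.
  apply/idP/idP => [H|H]; first exact: mono.
  case: (p =P q) => [E|N]; first by rewrite E ltnn in H.
  by case/orP: (tot p q Hp Hq N) => // /mono/(_ Hq); lia.
case: (p =P q) => // N; case/orP: (tot p q Hp Hq N) => /mono.
  by move/(_ Hp); lia.
by move/(_ Hq); lia.
Qed.

(** Replaces finitely many points by natural numbers, with a chosen point at 0, so that arguments
    about crossings become linear arithmetic. *)
Lemma C_rank o (s : seq pt) : okp o -> all okp s -> exists f : pt -> nat,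
  [/\ f o = 0%N, forall p q : pt, p \in o :: s -> q \in o :: s -> f p = f q -> p = q
   & forall p q r : pt, p \in o :: s -> q \in o :: s -> r \in o :: s ->
     C p q r = cycn (f p) (f q) (f r)].
Proof.
move=> Ho Hs; have /Lt_rank [f [f1 f2 f3]] : all okp (o :: s) by rewrite /= Ho.
pose N := (size (o :: s)).+1.
exists (fun p => if (f o <= f p)%N then (f p - f o)%N else (f p + (N - f o))%N).
have Hb p : (f p < N)%N by rewrite ltnS f3.
split=> [|p q Hp Hq|p q r Hp Hq Hr].
- by rewrite leqnn subnn.
- move=> E; apply: f2 => //; move: E (Hb p) (Hb q) (Hb o); clearbody N.
  by case: (leqP (f o) (f p)) => ?; case: (leqP (f o) (f q)) => ? *; lia.
rewrite /C !f1 // /cycn; have := Hb p; have := Hb q; have := Hb r; have := Hb o.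
clearbody N; clear Hb f1 f2 f3; move: N (f o) (f p) (f q) (f r) => N x a b c H1 H2 H3 H4.
by case: (leqP x a); case: (leqP x b); case: (leqP x c) => ? ? ?; lia.
Qed.

(** The chords [p q] and [r s] do not cross; chords with a common end count as uncrossed. *)
Definition unl (p q r s : pt) : bool := uniq [:: p; q; r; s] ==> (C p q r == C p q s).

Lemma unl_inj (h : pt -> pt) p q r s : okp p -> okp q -> okp r -> okp s ->
  (forall x y, okp x -> okp y -> (h x == h y) = (x == y)) ->
  (forall x y z, okp x -> okp y -> okp z -> x != y -> y != z -> z != x ->
    C (h x) (h y) (h z) = C x y z) ->
  unl (h p) (h q) (h r) (h s) = unl p q r s.
Proof.
move=> Hp Hq Hr Hs He HC; rewrite /unl /= !inE !He //.
case: (p =P q) => //= /eqP N1; case: (p =P r) => //= /eqP N2; case: (p =P s) => //= /eqP N3.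
case: (q =P r) => //= /eqP N4; case: (q =P s) => //= /eqP N5; case: (r =P s) => //= /eqP N6.
by rewrite !HC // eq_sym.
Qed.

Lemma unl_act g p q r s : okp p -> okp q -> okp r -> okp s ->
  unl (act g p) (act g q) (act g r) (act g s) = unl p q r s.
Proof.
move=> Hp Hq Hr Hs; apply: unl_inj => //; first by move=> *; rewrite act_eq.
by move=> *; apply: C_act.
Qed.

Lemma unl_autp b p q r s : okp p -> okp q -> okp r -> okp s ->
  unl (autp b p) (autp b q) (autp b r) (autp b s) = unl p q r s.
Proof.
move=> Hp Hq Hr Hs; apply: unl_inj => //; first by move=> *; rewrite autp_eq.
by move=> *; apply: C_autp.
Qed.

Lemma unl_swapr p q r s : unl p q r s = unl p q s r.
Proof.
rewrite /unl /= !inE [s == r]eq_sym [C p q s == _]eq_sym.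
by case: (p == q); case: (p == r); case: (p == s); case: (q == r); case: (q == s).
Qed.

Lemma cycn_sym a b c d : a != b -> a != c -> a != d -> b != c -> b != d -> c != d ->
  (cycn a b c == cycn a b d) = (cycn c d a == cycn c d b).
Proof.
rewrite /cycn; case: (ltngtP a b) => ? //; case: (ltngtP a c) => ? //;
case: (ltngtP a d) => ? //; case: (ltngtP b c) => ? //; case: (ltngtP b d) => ? //;
case: (ltngtP c d) => ? // *; exfalso; lia.
Qed.

Lemma unl_sym p q r s : okp p -> okp q -> okp r -> okp s -> unl p q r s = unl r s p q.
Proof.
move=> Hp Hq Hr Hs.
have [|f [_ f1 f2]] := @C_rank p [:: q; r; s] Hp; first by rewrite /= Hq Hr Hs.
have U : uniq [:: p; q; r; s] = uniq [:: r; s; p; q] by rewrite -(rot_uniq 2 [:: r; s; p; q]).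
rewrite /unl -U; case Hu: (uniq _) => //=.
rewrite !f2 ?inE ?eqxx ?orbT //.
have J x y : x != y -> x \in [:: p; q; r; s] -> y \in [:: p; q; r; s] -> f x != f y.
  by move=> N Hx Hy; apply: contra N => /eqP E; apply/eqP; apply: f1.
move: Hu; rewrite /= !inE !negb_or => /and4P[/and3P[N1 N2 N3] /andP[N4 N5] N6 _].
by apply: cycn_sym; apply: J => //; rewrite !inE eqxx ?orbT.
Qed.
Lemma unl_swapl p q r s : okp p -> okp q -> okp r -> okp s -> unl p q r s = unl q p r s.
Proof. by move=> *; rewrite unl_sym // unl_swapr unl_sym. Qed.

(** The arc from [base] to [z] crosses none of its translates. Its image in the punctured disc is
    then a simple arc, or a simple loop when [z] is a translate of [base]. *)
Definition Sim a b z := forall g, inF a b g -> unl base z (act g base) (act g z).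

Definition inP a b (p : pt) : bool := all (fun x : letter nat => (a <= x.1 < b)%N) p.1 &&
  (if p.2 is Some i then (a <= i < b)%N else true).

Lemma inP_act1 a b x p : (a <= x.1 < b)%N -> inP a b p -> inP a b (act1 x p).
Proof.
move=> Hx; case: p => [[|y u] t]; rewrite /inP /act1 /=; first by case: ifP => //= _; rewrite Hx.
by case: ifP => _ //=; [case/andP=> /andP[_ ->]|rewrite Hx].
Qed.
Lemma inP_act a b g p : inF a b g -> inP a b p -> inP a b (act g p).
Proof.
rewrite /inF /act => Hg Hp; elim: (fw g) Hg => //= x w IH /andP[Hx Hw].
by apply: inP_act1 => //; apply: IH.
Qed.
Lemma inF_mkF a b w : all (fun x : letter nat => (a <= x.1 < b)%N) w -> inF a b (mkF w).
Proof. exact: all_red. Qed.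
Lemma inP_sgp a b x p : (a <= x.1)%N -> (x.1.+1 < b)%N -> inP a b p -> inP a b (sgp x p).
Proof.
move=> Hx1 Hx2 /andP[H1 H2]; apply: inP_act; first by rewrite inF_sg ?inF_mkF.
case: p.2 H2 => [j|] //= Hj; case: x Hx1 Hx2 => i [] /= Hx1 Hx2;
  do 2?[case: ifP => _]; rewrite /inP /=; lia.
Qed.
Lemma inP_autp a b w p : brw a b w -> inP a b p -> inP a b (autp w p).
Proof. by elim: w p => //= x w IH p /andP[/andP[? ?] Hw] Hp; rewrite IH ?inP_sgp. Qed.

Lemma Sim_autp a b w z : brw a b w -> okp z -> Sim a b z -> Sim a b (autp w z).
Proof.
move=> Hw Hz H g Hg; have := H (aut (binv w) g).
rewrite -(unl_autp w) ?ok_act // !autp_act // autVK autp_base; apply.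
by rewrite inF_aut ?brw_binv.
Qed.

Lemma reduced_catl u v : reduced (u ++ v) -> reduced u.
Proof. by elim: u => // x [|y u] IH //= /andP[-> /IH]. Qed.
Lemma okw_catr u v t : okw (u ++ v) t -> okw v t.
Proof. by elim: u => //= x u IH /andP[_ /IH]. Qed.

Lemma hd_cat u v t : u != [::] -> hd (u ++ v, t) = hd (u, None).
Proof. by case: u. Qed.

Lemma actw_punc u i : reduced u -> exists u1 u2, [/\ u = u1 ++ u2,
  all (fun x : letter nat => x.1 == i) u2 & actw u (punc i) = (u1, Some i)].
Proof.
elim: u => [|x u IH] Hu; first by exists [::], [::].
have [u1 [u2 [E Hu2 Ea]]] := IH (reduced_behead Hu).
rewrite [actw _ _]/= -/(actw u (punc i)) Ea.
case: u1 E Ea => [|y u1] E Ea; rewrite /act1 /=.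
  case: (Some i =P Some x.1) => [[Ei]|_].
    by exists [::], (x :: u); rewrite E /= -Ei eqxx.
  by exists [:: x], u2; rewrite E.
move: Hu; rewrite E /= => /andP[/negbTE-> _].
by exists (x :: y :: u1), u2.
Qed.

Lemma act_punc g i : act g (punc i) = punc i /\ all (fun x : letter nat => x.1 == i) (fw g) \/
  g != 1 /\ hd (act g (punc i)) = hd (act g base).
Proof.
have [u1 [u2 [E Hu2 Ea]]] := actw_punc i (fgP g); rewrite act_base /act Ea.
case: u1 E {Ea} => [|y u1] E; [left|right]; first by rewrite E.
by split; [rewrite -fw_eq1 E|rewrite E].
Qed.

Lemma okw_cat v x y : reduced (rcons v x) -> okp y -> hd y != lc (linv x) -> y != punc x.1 ->
  okw (rcons v x ++ y.1) y.2.
Proof.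
move=> Hv Hy H1 H2; elim: v Hv => [|z v IH].
  case: y Hy H1 H2 => [[|z u] t] /=; first by move=> _ _ H _; rewrite andbT; apply: contra H => /eqP->.
  by rewrite /okp /hd /= lc_eq => -> ->.
by case: v IH => [|z' v] IH /= /andP[H3 H4]; move: (IH H4) => /= ->; rewrite H3.
Qed.

(** The word of [g] survives in front of [y] unless [y] starts with the inverse of its last letter,
    which is the third case; in the second, a puncture absorbs all letters. *)
Lemma hd_act g y : okp y -> g != 1 -> [\/ hd (act g y) = hd (act g base),
  exists i, [/\ y = punc i, act g y = y & all (fun x : letter nat => x.1 == i) (fw g)]
  | hd y = hd (act g^-1 base)].
Proof.
move=> Hy; rewrite -fw_eq1 !act_base fwV /act.
have := fgP g; move Ev: (fw g) => w; case/lastP: w Ev => // v x Ev Hv _.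
have [->|N1] := eqVneq (hd y) (lc (linv x)).
  by constructor 3; rewrite -cats1 winv_cat.
have [Ey|N2] := eqVneq y (punc x.1).
  have := act_punc g x.1; rewrite act_base /act -Ey Ev => -[[E1 E2]|[_ E]].
    by constructor 2; exists x.1.
  by constructor 1.
constructor 1; rewrite {1}[y]surjective_pairing act_reduced ?okw_cat // hd_cat //.
by case: (v).
Qed.

(** The points on the far side of the edge from the root to [X j]. *)
Definition br (j : nat) (p : pt) : bool := hd p == (3 * j + 2)%N.
Lemma brE j p : br j p = (hd p == lc (j, false)). Proof. by []. Qed.
Lemma br_base j : br j base = false. Proof. by rewrite /br /hd /=; lia. Qed.
Lemma br_punc j i : br j (punc i) = false. Proof. by rewrite /br /hd /=; lia. Qed.

Lemma hd_step g x :
  [\/ hd (act (g * L x) base) = hd (act g base), g = 1 | g * L x = 1].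
Proof.
rewrite -[g]mkF_fw; case: (lastP (fw g)) (fgP g) => [|v y] Hv; first by constructor 2.
have Ev : fw (mkF (rcons v y)) = rcons v y by rewrite /= red_id.
have E : mkF (rcons v y) = mkF v * L y by rewrite -cats1 mkF_cat.
have [Exy|N] := eqVneq x (linv y).
  have rv : reduced v by move: Hv; rewrite -cats1 => /reduced_catl.
  have -> : mkF (rcons v y) * L x = mkF v by rewrite E Exy -LV mulgK.
  case: v {Hv E} Ev rv => [|z v] Ev rv; first by constructor 3.
  have E2 : fw (mkF (z :: v)) = z :: v := red_id rv.
  by constructor 1; rewrite !act_base Ev E2.
have rx : reduced (rcons (rcons v y) x).
  by rewrite -cats1 cat_rcons reduced_cat1 Hv /= andbT.
have -> : mkF (rcons v y) * L x = mkF (rcons (rcons v y) x) by rewrite -[in RHS]cats1 mkF_cat.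
constructor 1; rewrite !act_base Ev [fw (mkF _)]/= red_id // -[rcons (rcons v y) x]cats1.
by rewrite hd_cat //; case: (v).
Qed.

Lemma br_step j g x : br j (act g base) != br j (act (g * L x) base) ->
  g = 1 /\ x = (j, false) \/ g = X j /\ x = (j, true).
Proof.
have [E|->|E] := hd_step g x; first by rewrite !brE E eqxx.
  by rewrite mul1g act1g br_base actL brE /act1 /hd /= lc_eq; case: (x =P _) => // ->; left.
have -> : g = L (linv x) by rewrite -LV; apply/(mulIg (L x)); rewrite E mulVg.
rewrite -[L x]invgK LV mulgV act1g br_base actL brE /act1 /hd /= lc_eq.
by case: (_ =P (j, false)) => // Ex _; right; split; [rewrite XL -Ex|apply: linv_inj; rewrite Ex].
Qed.

(* The translation that moves the n-th letter of u to the edge from 1 to X j. *)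
Definition tn (u : word nat) (n : nat) : fg :=
  (mkF (if (nth (0, false) u n).2 then take n.+1 u else take n u))^-1.

(** Along the letters of [u] the side of the edge changes only where the translated path traverses
    this edge, hence at a letter of index j. *)
Lemma edge_pass j g u t : okw u t -> act g (u, t) != punc j ->
  br j (act g base) != br j (act g (u, t)) ->
  exists n, [/\ (n < size u)%N, (nth (0, false) u n).1 = j & g = tn u n].
Proof.
elim: u g => [|x u IH] g Hu N1 N2.
  case: t Hu N1 N2 => [i|] _ N1; last by rewrite eqxx.
  have [[E Ha]|[_ E]] := act_punc g i; last by rewrite !brE E eqxx.
  rewrite -/(punc i) E br_punc act_base; move: N1; rewrite E.
  case: (fw g) Ha => [|y v]; first by rewrite br_base.
  rewrite /= => /andP[/eqP Ei _] N; rewrite brE /hd /= lc_eq.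
  case: (y =P _) => // Ey; case/eqP: N; rewrite -Ei Ey //.
have Hu' := okw_behead Hu.
have E0 : (x :: u, t) = act (L x) (u, t).
  by have := @act_reduced [:: x] u t Hu; rewrite /act /= => ->.
have E1 : act g (x :: u, t) = act (g * L x) (u, t) by rewrite E0 actM.
have [E|N] := eqVneq (br j (act g base)) (br j (act (g * L x) base)); last first.
  exists 0; have [[-> ->]|[-> ->]] := br_step N; split=> //.
  by rewrite /tn /= take0 -[mkF _]/(L _) LV.
have := IH (g * L x) Hu'; rewrite -E1 -E => /(_ N1 N2) [n [H1 H2 H3]].
exists n.+1; split=> //; apply: (mulIg (L x)); rewrite H3 /tn [nth _ (x :: u) _]/=.
by case: ifP => _; rewrite [take _ (x :: u)]/= mkF_cons invgM mulgVK.
Qed.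

(** * The strands of an arc through an edge *)

Section Strands.
Variables (j : nat) (u : word nat) (t : option nat).
Hypothesis Hu : okw u t.
Let z : pt := (u, t).
Let eps n := (nth (0, false) u n).2.

Lemma tn_z n : act (tn u n) z = (drop (if eps n then n.+1 else n) u, t).
Proof.
rewrite /tn -/(eps n); set m := if eps n then n.+1 else n.
have -> : (if eps n then take n.+1 u else take n u) = take m u by rewrite /m; case: ifP.
have Hr : reduced (take m u).
  by have := okw_reduced Hu; rewrite -{1}(cat_take_drop m u) => /reduced_catl.
have Hd : okw (drop m u) t by move: Hu; rewrite -{1}(cat_take_drop m u) => /okw_catr.
have -> : z = act (mkF (take m u)) (drop m u, t).
  by rewrite /act /= red_id // act_reduced cat_take_drop.
exact: (@actK _ (_, _) Hd).
Qed.

Lemma split_nth n : (n < size u)%N -> (nth (0, false) u n).1 = j ->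
  u = take n u ++ (j, eps n) :: drop n.+1 u.
Proof.
by move=> Hn Hj; rewrite -{1}(cat_take_drop n u) (drop_nth (0, false)) // -Hj -surjective_pairing.
Qed.

Lemma tn_br n : (n < size u)%N -> (nth (0, false) u n).1 = j ->
  [/\ br j (act (tn u n) base) = eps n, br j (act (tn u n) z) = ~~ eps n
    & act (tn u n) z != punc j].
Proof.
move=> Hn Hj; have E := split_nth Hn Hj; rewrite tn_z act_base /tn -/(eps n).
have Hd : okw ((j, eps n) :: drop n.+1 u) t.
  by move: Hu; rewrite {1}E => /okw_catr.
have Hr : reduced (rcons (take n u) (j, eps n)).
  by have := okw_reduced Hu; rewrite {1}E reduced_cat1 => /andP[].
have Hd' := ok_hdw Hd.
have Es : take n.+1 u = rcons (take n u) (j, eps n).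
  by rewrite (take_nth (0, false)) // -Hj -surjective_pairing.
have Ed : drop n u = (j, eps n) :: drop n.+1 u.
  by rewrite (drop_nth (0, false)) // -Hj -surjective_pairing.
rewrite !brE Es; case Ee: (eps n) Ed Hd Hr Hd' => Ed Hd Hr Hd'; rewrite ?Ed fwV.
  rewrite [fw _]/= red_id // -cats1 winv_cat /= eqxx; split=> //.
    by apply/negbTE.
  by apply: contraL Hd => /eqP[-> ->]; rewrite /= eqxx.
have := reduced_winv Hr; rewrite -cats1 winv_cat /= => Hw.
have Hr' : reduced (take n u).
  by move: Hr; rewrite -cats1 => /reduced_catl.
rewrite [red _]red_id //; split=> //; last by rewrite /hd /= eqxx.
apply/negbTE; apply: (@ok_hdw (linv (j, false)) _ None).
by rewrite okw_None.
Qed.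

End Strands.

(** The code of [X j] immediately precedes that of the puncture j, so the points behind the edge
    come last when read from the puncture. *)
Lemma br_C j p q : p != punc j -> q != punc j -> ~~ br j p -> br j q -> C (punc j) p q.
Proof.
rewrite /br => N1 N2 Hp /eqP Hq; have Np : hd p != (3 * j + 3)%N.
  by apply: contra N1 => /eqP/hd_punc->.
have ho : hd (punc j) = (3 * j + 3)%N by [].
have Npq : p != q by apply: contra Hp => /eqP->; rewrite Hq.
rewrite CE !LtE // 1?eq_sym // ho Hq; move: (hd p) Np Hp => c Np Hp; rewrite /cyc3.
have -> : (c == 3 * j + 3)%N = false by lia.
have -> : (c == 3 * j + 2)%N = false by lia.
have -> : (3 * j + 2 == 3 * j + 3)%N = false by lia.
lia.
Qed.

Lemma unl_nat p q r s : (p < q)%N -> uniq [:: p; q; r; s] ==> (cycn p q r == cycn p q s) ->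
  (p < r < q -> p <= s <= q)%N /\ ((r < p) || (q < r) -> (s <= p) || (q <= s))%N.
Proof.
move=> Hpq; rewrite /= !inE !negb_or /cycn.
case: (ltngtP p r) => H1; case: (ltngtP p s) => H2; case: (ltngtP q r) => H3;
case: (ltngtP q s) => H4; case: (ltngtP r s) => H5; rewrite ?Hpq ?(ltn_eqF Hpq) //= => _; split; lia.
Qed.

Lemma lnk_nat p q r s : (p < q)%N -> ~~ (uniq [:: p; q; r; s] ==> (cycn p q r == cycn p q s)) ->
  (p < r < q)%N /\ ((s < p) || (q < s))%N \/ (p < s < q)%N /\ ((r < p) || (q < r))%N.
Proof.
move=> Hpq; rewrite /= !inE !negb_or /cycn.
case: (ltngtP p r) => H1; case: (ltngtP p s) => H2; case: (ltngtP q r) => H3;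
case: (ltngtP q s) => H4; case: (ltngtP r s) => H5; rewrite ?Hpq ?(ltn_eqF Hpq) //= => _;
  by [left|right|lia].
Qed.

Lemma unl_rank o (l : seq pt) : okp o -> all okp l -> exists f : pt -> nat,
  [/\ f o = 0%N, {in o :: l &, forall p q, f p = f q -> p = q},
      {in o :: l & &, forall p q r, C p q r = cycn (f p) (f q) (f r)},
      {in o :: l &, forall p q, {in o :: l &, forall r s, (f p < f q)%N -> unl p q r s ->
        (f p < f r < f q -> f p <= f s <= f q)%N /\
        ((f r < f p) || (f q < f r) -> (f s <= f p) || (f q <= f s))%N}}
    & {in o :: l &, forall p q, {in o :: l &, forall r s, (f p < f q)%N -> ~~ unl p q r s ->
        (f p < f r < f q)%N /\ ((f s < f p) || (f q < f s))%N \/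
        (f p < f s < f q)%N /\ ((f r < f p) || (f q < f r))%N}}].
Proof.
move=> Ho Hl; have [f [f0 f1 f2]] := C_rank Ho Hl; exists f.
have E p q r s : p \in o :: l -> q \in o :: l -> r \in o :: l -> s \in o :: l ->
    unl p q r s = uniq [:: f p; f q; f r; f s] ==> (cycn (f p) (f q) (f r) == cycn (f p) (f q) (f s)).
  move=> Hp Hq Hr Hs; rewrite /unl !f2 //; congr (_ ==> _).
  rewrite -[RHS]/(uniq (map f [:: p; q; r; s])) map_inj_in_uniq // => x y.
  rewrite !inE => Hx Hy; apply: f1.
    by case/or4P: Hx => /eqP->.
  by case/or4P: Hy => /eqP->.
split=> //.
  by move=> p q Hp Hq r s Hr Hs H; rewrite E //; apply: unl_nat.
by move=> p q Hp Hq r s Hr Hs H; rewrite E //; apply: lnk_nat.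
Qed.

Lemma C_lt o (f : pt -> nat) p q : f o = 0%N -> f p <> 0%N ->
  C o p q = cycn (f o) (f p) (f q) -> C o p q = (f p < f q)%N.
Proof. by move=> -> N ->; rewrite /cycn; lia. Qed.

Ltac nlia := repeat match goal with
  | H : is_true ?b |- _ =>
    lazymatch b with
    | leq _ _ => fail
    | andb (leq _ _) _ => fail
    | _ => clear H
    end
  | H : (forall _ _, _) |- _ => clear H
  | H : @eq ?T _ _ |- _ => lazymatch T with nat => fail | _ => clear H end
  end; lia.

(** * The innermost strand and the shorter arc obtained from it *)

Section Reduct.
Variables (a b : nat) (z : pt).
Hypotheses (okz : okp z) (inz : inP a b z) (simz : Sim a b z).
Let u := z.1.
Let O (j n : nat) := (n < size u)%N && ((nth (0, false) u n).1 == j).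
Let eps n := (nth (0, false) u n).2.
(** [P n] and [Q n] are the ends of the n-th strand on the near and on the far side of the edge; the
    sign of the letter decides which end of the arc lies where. *)
Let P n := if eps n then act (tn u n) z else act (tn u n) base.
Let Q n := if eps n then act (tn u n) base else act (tn u n) z.

Let zE : z = (u, z.2). Proof. exact: surjective_pairing. Qed.
Let okt n : okp (act (tn u n) z). Proof. exact: ok_act. Qed.

Lemma strand_PQ j n : O j n -> [/\ ~~ br j (P n), br j (Q n), P n != punc j, Q n != punc j & C (punc j) (P n) (Q n)].
Proof.
case/andP=> Hn /eqP Hj; have [|B1 B2 B3] := @tn_br j u z.2 _ n Hn Hj; first by rewrite -[okw _ _]/(okp z).
rewrite -zE in B2 B3.
have N : act (tn u n) base != punc j by rewrite act_base; apply/eqP => -[].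
suff [H1 H2 H3 H4] : [/\ ~~ br j (P n), br j (Q n), P n != punc j & Q n != punc j].
  by split=> //; apply: br_C.
by rewrite /P /Q; move: B1 B2; rewrite -/(eps n); case: (eps n) => E1 E2; rewrite E1 E2; split.
Qed.

Lemma inF_tn n : inF a b (tn u n).
Proof.
have /andP[Hu _] := inz; apply/inFV/inF_mkF.
by case: ifP => _; apply/allP => x /mem_take Hx; apply: (allP Hu).
Qed.

Lemma extremal j n0 : O j n0 -> exists2 n, O j n & forall m, O j m ->
  (P m = P n \/ C (punc j) (P m) (P n)) -> (Q m = Q n \/ C (punc j) (Q n) (Q m)) ->
  P m = P n /\ Q m = Q n.
Proof.
move=> Hn0; have Hs : (n0 < size u)%N by case/andP: Hn0.
have [|f [f0 f1 f2 _ _]] := @unl_rank (punc j) ([seq P n | n <- iota 0 (size u)] ++ [seq Q n | n <- iota 0 (size u)]) (ok_punc j).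
  by rewrite all_cat !all_map; apply/andP; split; apply/allP => n _; rewrite /P /Q /=; case: ifP; rewrite ok_act.
have MP m : O j m -> P m \in punc j :: [seq P n | n <- iota 0 (size u)] ++ [seq Q n | n <- iota 0 (size u)].
  by case/andP=> Hm _; rewrite inE mem_cat map_f ?orbT // mem_iota.
have MQ m : O j m -> Q m \in punc j :: [seq P n | n <- iota 0 (size u)] ++ [seq Q n | n <- iota 0 (size u)].
  by case/andP=> Hm _; rewrite inE mem_cat (map_f Q) ?orbT // mem_iota.
have Mo : punc j \in punc j :: [seq P n | n <- iota 0 (size u)] ++ [seq Q n | n <- iota 0 (size u)] by rewrite inE eqxx.
move: (_ ++ _) f0 f1 f2 MP MQ Mo => l f0 f1 f2 MP MQ Mo.
(* In the order cut at the puncture, a strand closer to the puncture spans a longer interval, so an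
   innermost strand is found by maximizing this difference. *)
pose F n := (f (Q n) - f (P n))%N.
have [n On Hmax] : exists2 n, O j n & forall m, O j m -> (F m <= F n)%N.
  case: (@arg_maxnP _ (Ordinal Hs) (fun i : 'I_(size u) => O j i) (fun i => F i) Hn0) => n On Hm.
  by exists n => // m Om; have Hms : (m < size u)%N by [case/andP: Om]; apply: (Hm (Ordinal Hms)).
exists n => // m Om HP HQ; have := Hmax m Om; rewrite /F.
have nz p : p \in punc j :: l -> p != punc j -> f p <> 0%N.
  by move=> Hp /eqP N E; apply: N; apply: f1; rewrite ?f0.
have [_ _ P1 Q1 C1] := strand_PQ Om; have [_ _ P2 Q2 C2] := strand_PQ On.
have lt p q : p \in punc j :: l -> q \in punc j :: l -> p != punc j -> C (punc j) p q -> (f p < f q)%N.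
  by move=> Hp Hq N; rewrite (@C_lt _ f) ?f2 //; apply: nz.
have {C1} C1 := lt _ _ (MP _ Om) (MQ _ Om) P1 C1; have {C2} C2 := lt _ _ (MP _ On) (MQ _ On) P2 C2.
have L1 : (f (P m) <= f (P n))%N.
  by case: HP => [->//|H]; apply/ltnW/lt => //; [apply: MP|apply: MP].
have L2 : (f (Q n) <= f (Q m))%N.
  by case: HQ => [->//|H]; apply/ltnW/lt => //; [apply: MQ|apply: MQ].
by move=> H; split; apply: f1; [exact: MP|exact: MP| |exact: MQ|exact: MQ|]; move: H C1 C2 L1 L2; clear; lia.
Qed.

Let okP n : okp (P n). Proof. by rewrite /P; case: ifP; rewrite ok_act. Qed.
Let okQ n : okp (Q n). Proof. by rewrite /Q; case: ifP; rewrite ok_act. Qed.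

Let unlPQ n r s : okp r -> okp s ->
  unl (act (tn u n) base) (act (tn u n) z) r s = unl (P n) (Q n) r s.
Proof. by move=> Hr Hs; rewrite /P /Q; case: ifP => // _; rewrite unl_swapl ?ok_act. Qed.

Let unlPQ' g n r s : okp r -> okp s ->
  unl r s (act (g * tn u n) base) (act (g * tn u n) z) = unl r s (act g (P n)) (act g (Q n)).
Proof.
move=> Hr Hs; rewrite /P /Q !actM //; case: ifP => // _; exact: unl_swapr.
Qed.

Let below o (f : pt -> nat) (j n : nat) x : O j n -> o = punc j -> f o = 0%N -> f x <> 0%N ->
  C o (P n) x = cycn (f o) (f (P n)) (f x) -> (0 < f (P n))%N -> (f x <= f (P n))%N -> ~~ br j x.
Proof.
move=> On Eo f0 fx fC fP Hle; have [B1 _ N1 _ _] := strand_PQ On.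
apply/negP => Hx; have Nx : x != punc j by apply/eqP => E; apply: fx; rewrite E -Eo.
have := br_C N1 Nx B1 Hx; rewrite -Eo (@C_lt o f) //; nlia.
Qed.

Let above o (f : pt -> nat) (j n : nat) x : O j n -> o = punc j -> f o = 0%N -> f x <> 0%N ->
  C o x (Q n) = cycn (f o) (f x) (f (Q n)) -> (f (Q n) <= f x)%N -> br j x.
Proof.
move=> On Eo f0 fx fC Hle; have [_ B2 _ N2 _] := strand_PQ On.
apply/negPn/negP => Hx; have Nx : x != punc j by apply/eqP => E; apply: fx; rewrite E -Eo.
have := br_C Nx N2 Hx B2; rewrite -Eo (@C_lt o f) //; nlia.
Qed.

Let extr (j n : nat) := forall m, O j m ->
  (P m = P n \/ C (punc j) (P m) (P n)) -> (Q m = Q n \/ C (punc j) (Q n) (Q m)) ->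
  P m = P n /\ Q m = Q n.

(** A translate of the arc does not cross the strand [P n], [Q n], since [z] is simple. If it
    crossed the chord from the puncture to an end of the strand, it would pass between the strand
    and the puncture. It would then traverse the edge, hence be a strand itself, and one closer to
    the puncture. *)
Lemma unl_extremal (j n : nat) g e : O j n -> extr j n -> inF a b g -> e = P n \/ e = Q n ->
  unl (punc j) e (act g base) (act g z).
Proof.
move=> On Hx Hg He; apply/negPn/negP => Hl.
have oke : okp e by case: He => ->.
set U := act g base in Hl; set V := act g z in Hl.
have okU : okp U by rewrite ok_act. have okV : okp V by rewrite ok_act.
have [B1 B2 N1 N2 CPQ] := strand_PQ On.
have [|f [f0 f1 f2 f4 f5]] := @unl_rank (punc j) [:: P n; Q n; U; V] (ok_punc j).
  by rewrite /= okP okQ okU okV.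
have [Mo MP MQ MU MV] : [/\ punc j \in punc j :: [:: P n; Q n; U; V], P n \in punc j :: [:: P n; Q n; U; V],
  Q n \in punc j :: [:: P n; Q n; U; V], U \in punc j :: [:: P n; Q n; U; V] & V \in punc j :: [:: P n; Q n; U; V]].
  by rewrite !inE !eqxx ?orbT.
have Me : e \in punc j :: [:: P n; Q n; U; V] by case: He => ->.
have SPQ : unl (P n) (Q n) U V.
  rewrite -unlPQ // -(unl_act (tn u n)^-1) ?ok_act // !actK ?ok_act // -!actM //.
  by apply/simz/inFM => //; apply/inFV/inF_tn.
move: (_ :: _) f1 f2 f4 f5 Mo MP MQ MU MV Me => l f1 f2 f4 f5 Mo MP MQ MU MV Me.
have nz p : p \in l -> p != punc j -> (0 < f p)%N.
  by move=> Hp N; rewrite lt0n; apply: contra N => /eqP E; apply/eqP/f1; rewrite ?f0.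
have P0 := nz _ MP N1; have Q0 := nz _ MQ N2.
have clt p q : p \in l -> q \in l -> (0 < f p)%N -> C (punc j) p q = (f p < f q)%N.
  by move=> Hp Hq N; apply: C_lt => //; [apply/eqP; rewrite -lt0n|apply: f2].
have {CPQ} PQ : (f (P n) < f (Q n))%N by rewrite -clt.
have e0 : (0 < f e)%N by case: He => ->.
have Ee : f e = f (P n) \/ f e = f (Q n) by case: He => ->; [left|right].
have L := f5 _ _ Mo Me _ _ MU MV; rewrite f0 in L; have {}L := L e0 Hl.
have [T1 T2] := f4 _ _ MP MQ _ _ MU MV PQ SPQ.
have [T3 T4] := f4 _ _ MP MQ _ _ MV MU PQ (etrans (unl_swapr _ _ _ _) SPQ).
have [U0 [V0 D]] : (0 < f U /\ 0 < f V /\ ((f U <= f (P n) /\ f (Q n) <= f V /\ f U < f e < f V) \/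
   (f V <= f (P n) /\ f (Q n) <= f U /\ f V < f e < f U)))%N.
  clear -T1 T2 T3 T4 L Ee PQ P0; move: (f U) (f V) (f (P n)) (f (Q n)) (f e) T1 T2 T3 T4 L Ee PQ P0.
  by move=> x y p q e'; lia.
have okD : br j U != br j V.
  case: D => -[D1 [D2 _]].
    rewrite (negbTE (@below (punc j) f j n U On erefl f0 _ _ P0 D1)) ?f2 //; last nlia.
    by rewrite (@above (punc j) f j n V On erefl f0) ?f2 //; nlia.
  rewrite (negbTE (@below (punc j) f j n V On erefl f0 _ _ P0 D1)) ?f2 //; last nlia.
  by rewrite (@above (punc j) f j n U On erefl f0) ?f2 //; nlia.
have NV : V != punc j by apply/eqP => E; rewrite E f0 in V0.
have [m [Hm Ej Eg]] : exists m, [/\ (m < size u)%N, (nth (0, false) u m).1 = j & g = tn u m].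
  by apply: (@edge_pass j g u z.2); rewrite -?zE.
have Om : O j m by rewrite /O Hm Ej eqxx.
have [B3 B4 _ _ _] := strand_PQ Om.
have [D1 D2 D3] : [/\ (f (P m) <= f (P n))%N, (f (Q n) <= f (Q m))%N & (f (P m) < f e < f (Q m))%N].
  move: B3 B4; rewrite /P /Q -Eg -/U -/V -/(P n) -/(Q n); case: (eps m) => B3 B4; case: D => -[D1 [D2 D3]] //.
    by move: B3; rewrite (@above (punc j) f j n V On erefl f0) ?f2 //; nlia.
  by move: B3; rewrite (@above (punc j) f j n U On erefl f0) ?f2 //; nlia.
have MPm : P m \in l by rewrite /P -Eg; case: ifP.
have MQm : Q m \in l by rewrite /Q -Eg; case: ifP.
have [||E1 E2] := Hx m Om.
- have [E|E] := eqVneq (f (P m)) (f (P n)); first by left; apply: f1.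
  right; have [_ _ N3 _ _] := strand_PQ Om; rewrite clt //; last exact: nz.
  by rewrite ltn_neqAle E.
- have [E|E] := eqVneq (f (Q m)) (f (Q n)); first by left; apply: f1.
  by right; rewrite clt // ltn_neqAle eq_sym E.
by move: D3; rewrite E1 E2; nlia.
Qed.

Lemma hd_escape j g y : okp y -> y != punc j -> act g (punc j) != punc j ->
  act g y = punc j \/ br j (act g y) != br j (act g base) -> hd y = hd (act g^-1 base).
Proof.
move=> Hy Ny Nj H; have Ng : g != 1 by apply: contra Nj => /eqP->; rewrite act1g.
have [E|[i [Ey E Ha]]|//] := hd_act Hy Ng.
  case: H => [H|]; last by rewrite !brE E eqxx.
  move: E; rewrite H act_base; move: Ng; rewrite -fw_eq1; case: (fw g) => // x w _.
  by rewrite /hd /= => E; have := lc_tc x (Some j); rewrite -E eqxx.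
case: H => [H|]; first by case/eqP: Ny; rewrite -E.
rewrite E Ey br_punc act_base; move: Ng Ha; rewrite -fw_eq1.
case: (fw g) => // x w _ /= /andP[/eqP Ei _]; rewrite brE /hd /= lc_eq.
by case: (x =P _) => // Ex; case/eqP: Ny; rewrite Ey -Ei Ex.
Qed.

Lemma side_nat p q x gp gq e ge : (0 < p < q)%N -> e = p /\ ge = gp \/ e = q /\ ge = gq ->
  (0 < x < e /\ (ge < 0 \/ e < ge) \/ 0 < ge < e /\ (x < 0 \/ e < x))%N ->
  (forall f, f = p \/ f = q -> ((0 < gp < f -> gq <= f) /\ (f < gp -> gq = 0 \/ f <= gq) /\
     (0 < gq < f -> gp <= f) /\ (f < gq -> gp = 0 \/ f <= gp)))%N ->
  (p < x < q -> p <= ge <= q)%N -> (x < p \/ q < x -> ge <= p \/ q <= ge)%N ->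
  cycn x gp gq ->
  (q <= x /\ gp <= p /\ gq <= p \/ 0 < x <= p /\ (gp = 0 \/ q <= gp) /\ (gq = 0 \/ q <= gq))%N.
Proof.
move=> Hpq He HT Hf H1 H2; have [F1 [F2 [F3 F4]]] := Hf p (or_introl erefl).
have [G1 [G2 [G3 G4]]] := Hf q (or_intror erefl); clear Hf.
by case: He => -[? ?]; subst; rewrite /cycn; lia.
Qed.

(** If the chord from the puncture to [e] crossed its translate by [g], then [unl_extremal], used
    for [g] and for [g^-1], and [side_nat] would separate the translated puncture from the
    translated strand by the edge. Both ends of the strand would then have the first direction of
    [g^-1], although they lie on different sides of the edge. *)
Lemma Sim_extremal (j n : nat) : O j n -> extr j n -> Sim a b (act (tn u n)^-1 (punc j)).
Proof.
move=> On Hx g0 Hg0; have [B1 B2 N1 N2 CPQ] := strand_PQ On.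
set h := tn u n; have Fh : inF a b h by exact: inF_tn.
rewrite -(unl_act h) ?ok_act // -!actM ?ok_act // mulgV act1g.
have -> : act (h * g0) base = act (h * g0 * h^-1) (act h base) by rewrite -actM // mulgVK.
set g := h * g0 * h^-1; have Fg : inF a b g by do 2?apply: inFM => //; apply: inFV.
clearbody g; clear g0 Hg0.
have He : act h base = P n \/ act h base = Q n by rewrite /P /Q; case: ifP; [right|left].
move: (act h base) He => e He; have oke : okp e by case: He => ->.
rewrite unl_swapl ?ok_act // unl_swapr; apply/negPn/negP => Hl.
have [|f [f0 f1 f2 f4 f5]] := @unl_rank (punc j)
   [:: P n; Q n; act g (P n); act g (Q n); act g (punc j)] (ok_punc j).
  by rewrite /= okP okQ !ok_act.
set l := _ :: _ in f1 f2 f4 f5.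
have [Mo MP MQ] : [/\ punc j \in l, P n \in l & Q n \in l] by rewrite !inE !eqxx ?orbT.
have [MGo MGP MGQ] : [/\ act g (punc j) \in l, act g (P n) \in l & act g (Q n) \in l] by rewrite !inE !eqxx ?orbT.
have Me : e \in l by case: He => ->.
have MGe : act g e \in l by case: He => ->.
clearbody l.
have nz p : p \in l -> p != punc j -> (0 < f p)%N.
  by move=> Hp N; rewrite lt0n; apply: contra N => /eqP E; apply/eqP/f1; rewrite ?f0.
have clt p q : p \in l -> q \in l -> (0 < f p)%N -> C (punc j) p q = (f p < f q)%N.
  by move=> Hp Hq N; apply: C_lt => //; [apply/eqP; rewrite -lt0n|apply: f2].
have P0 := nz _ MP N1; have PQ : (f (P n) < f (Q n))%N by rewrite -clt.
have e0 : (0 < f e)%N by case: He => ->; rewrite ?nz.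
have L := f5 _ _ Mo Me _ _ MGo MGe; rewrite f0 in L; have {}L := L e0 Hl.
have Bu x : x = P n \/ x = Q n -> unl (punc j) x (act g (P n)) (act g (Q n)).
  move=> Hxx; rewrite -unlPQ' ?ok_punc //; last by case: Hxx => ->.
  by apply: unl_extremal On Hx _ Hxx; apply: inFM.
have Bg : unl (P n) (Q n) (act g (punc j)) (act g e).
  rewrite unl_sym ?ok_act // -[P n](actVK g) // -[Q n](actVK g) // unl_act ?ok_act //.
  rewrite -unlPQ' ?ok_punc //; apply: unl_extremal On Hx _ He.
  by apply: inFM => //; apply: inFV.
have NPQ : P n != Q n by apply: contra B1 => /eqP->.
have Cg : cycn (f (act g (punc j))) (f (act g (P n))) (f (act g (Q n))).
  by rewrite -f2 // C_act // 1?eq_sym.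
have D := @side_nat (f (P n)) (f (Q n)) (f (act g (punc j))) (f (act g (P n))) (f (act g (Q n))) (f e) (f (act g e)).
have [T1 T2] := f4 _ _ MP MQ _ _ MGo MGe PQ Bg.
have {}D : (f (Q n) <= f (act g (punc j)) /\ f (act g (P n)) <= f (P n) /\ f (act g (Q n)) <= f (P n) \/
   0 < f (act g (punc j)) <= f (P n) /\ (f (act g (P n)) = 0 \/ f (Q n) <= f (act g (P n))) /\
   (f (act g (Q n)) = 0 \/ f (Q n) <= f (act g (Q n))))%N.
  apply: D => //.
  - by rewrite P0.
  - by case: He => ->; [left|right].
  - by move: L; clear; lia.
  - move=> k Hk; have [x [Hxx Mx Ek]] : exists x, [/\ x = P n \/ x = Q n, x \in l & k = f x].
      by case: Hk => ->; [exists (P n); split; [left| |]|exists (Q n); split; [right| |]].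
    have k0 : (0 < f x)%N by case: Hxx => ->; rewrite ?nz.
    have A1 := f4 _ _ Mo Mx _ _ MGP MGQ; have A2 := f4 _ _ Mo Mx _ _ MGQ MGP.
    rewrite f0 in A1 A2; have {}A1 := A1 k0 (Bu x Hxx).
    have {}A2 := A2 k0 (etrans (unl_swapr _ _ _ _) (Bu x Hxx)).
    by rewrite Ek; move: A1 A2 k0; clear; lia.
  - by move: T2; clear; lia.
have Nz x : f x <> 0%N -> x != punc j by move=> H; apply/eqP => E; apply: H; rewrite E.
have Ngo : act g (punc j) != punc j by apply: Nz; move: D PQ; clear; lia.
have Ego : br j (act g base) = br j (act g (punc j)).
  by have [[/eqP]|[_ E]] := act_punc g j; rewrite ?(negbTE Ngo) // !brE E.
have lo x : x \in l -> (f x <= f (P n))%N -> f x <> 0%N -> ~~ br j x.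
  by move=> Mx H1 H2; apply: (@below (punc j) f j n x On erefl f0 H2 _ P0 H1); rewrite f2.
have hi x : x \in l -> (f (Q n) <= f x)%N -> br j x.
  move=> Mx H1; apply: (@above (punc j) f j n x On erefl f0 _ _ H1); rewrite ?f2 //.
  by move: H1 PQ; clear; lia.
have zo x : x \in l -> f x = 0%N -> x = punc j by move=> Mx E; apply: f1; rewrite ?f0.
suff E x : x = P n \/ x = Q n -> hd x = hd (act g^-1 base).
  by move: B2; rewrite brE E ?(E (Q n)); [|right]; rewrite // -(E (P n)) -?brE ?(negbTE B1) //; left.
move=> Hxx; have Nx : x != punc j by case: Hxx => ->.
have okx : okp x by case: Hxx => ->.
have MGx : act g x \in l by case: Hxx => ->.
apply: (hd_escape okx Nx Ngo).
have [E0|/eqP NE0] := eqVneq (f (act g x)) 0%N; [left; exact: zo|right].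
rewrite Ego; case: D => [[D1 [D2 D3]]|[/andP[D0 D1] [D2 D3]]].
  rewrite (hi _ MGo D1) (negbTE (lo _ MGx _ NE0)) //.
  by case: Hxx => ->.
rewrite (negbTE (lo _ MGo D1 _)) ?(hi _ MGx) //; first by case: Hxx NE0 => -> NE0; [case: D2|case: D3].
by move: D0; clear; lia.
Qed.

End Reduct.

Lemma size_act w p : (size (actw w p).1 <= size w + size p.1)%N.
Proof. by elim: w => //= x w IH; have := size_act1 x (actw w p); lia. Qed.

(* The innermost strand of the arc of [z] through an edge labelled x.1 leads
   straight to the puncture x.1. *)
Lemma Sim_reduct a b z x : okp z -> inP a b z -> Sim a b z -> x \in z.1 ->
  exists t, [/\ okp t, inP a b t, (size t.1 < size z.1)%N, t.2 = Some x.1 & Sim a b t] /\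
    forall g, inF a b g -> unl base t (act g base) (act g z).
Proof.
move=> Hz Hin HS Hx; have Hi : (index x z.1 < size z.1)%N by rewrite index_mem.
have [|n On Ex] := @extremal z Hz x.1 (index x z.1); first by rewrite Hi nth_index //=.
exists (act (tn z.1 n)^-1 (punc x.1)).
have /andP[Hn /eqP Hj] := On.
have /andP[Hu _] := Hin.
have Ft := inF_tn Hin n.
have Ein : (a <= x.1 < b)%N by have := allP Hu _ Hx.
split; last first.
  move=> g Hg; rewrite -(unl_act (tn z.1 n)) ?ok_act // actVK // -!actM //.
  rewrite unl_swapl ?ok_act //; apply: (unl_extremal Hz Hin HS On Ex); first exact: inFM.
  by case: ifP => _; [right|left].
have Et : act (tn z.1 n)^-1 (punc x.1) = actw (take n z.1) (punc x.1).
  rewrite /tn invgK; set w := if _ then _ else _; rewrite /act /= actw_red // /w.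
  case: ifP => // Hb; rewrite (take_nth (0, false)) // -cats1 /actw foldr_cat /=.
  by rewrite -Hj /act1 /= eqxx.
split.
- exact: ok_act.
- by apply: inP_act; [rewrite inFVE|rewrite /inP /=].
- rewrite Et; apply: leq_ltn_trans (size_act _ _) _.
  by rewrite addn0 size_takel // ltnW.
- by rewrite Et; elim: (take n z.1) => //= y w IH; rewrite -IH /act1; case: (actw w _) => [[|? ?] ?] /=; case: ifP.
exact: Sim_extremal.
Qed.

(** * Braids that shift the indices of an interval *)

Definition upb (a n : nat) : seq (nat * bool) := rev [seq (i, true) | i <- iota a n].
Definition dnb (a n : nat) : seq (nat * bool) := rev [seq (i, false) | i <- iota a n].

Lemma upbS a n : upb a n.+1 = (a + n, true)%N :: upb a n.
Proof. by rewrite /upb -addn1 iotaD map_cat rev_cat. Qed.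
Lemma dnbS a n : dnb a n.+1 = (a + n, false)%N :: dnb a n.
Proof. by rewrite /dnb -addn1 iotaD map_cat rev_cat. Qed.
Lemma brw_upb a n a' b : (a' <= a)%N -> (a + n < b)%N -> brw a' b (upb a n).
Proof. by move=> H1 H2; rewrite /brw all_rev all_map; apply/allP => i; rewrite mem_iota /=; lia. Qed.
Lemma brw_dnb a n a' b : (a' <= a)%N -> (a + n < b)%N -> brw a' b (dnb a n).
Proof. by move=> H1 H2; rewrite /brw all_rev all_map; apply/allP => i; rewrite mem_iota /=; lia. Qed.

Lemma sgp_punc x j : sgp x (punc j) = sgt x (Some j).
Proof. by rewrite /sgp [mkF _](_ : _ = 1) // sg1. Qed.
Lemma autp_punc_id a b w j : brw a b w -> ~~ (a <= j < b)%N -> autp w (punc j) = punc j.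
Proof.
elim: w => //= x w IH /andP[/andP[H1 H2] Hw] Hj; rewrite sgp_punc /sgt.
have /negbTE-> : j != x.1 by lia.
have /negbTE-> : j != x.1.+1 by lia.
by rewrite if_same IH.
Qed.
Lemma autX_id a b w j : brw a b w -> ~~ (a <= j < b)%N -> aut w (X j) = X j.
Proof.
elim: w => //= x w IH /andP[/andP[H1 H2] Hw] Hj.
have N1 : j != x.1 by lia.
have N2 : j != x.1.+1 by lia.
by rewrite sgX sgf_id ?IH.
Qed.

Lemma aut_upb a n j : (a <= j < a + n)%N -> aut (upb a n) (X j) = X j.+1.
Proof.
elim: n => [|n IH] Hj; first lia.
rewrite upbS /= sgX; have [Ej|Nj] := eqVneq j (a + n)%N.
  by rewrite Ej /sgf /= eqxx (@autX_id a (a + n).+1) ?brw_upb //; lia.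
by rewrite sgf_id ?IH //=; try apply/eqP; lia.
Qed.

Lemma aut_dnb_last a n : aut (dnb a n) (X (a + n)) = X a.
Proof.
elim: n => [|n IH]; first by rewrite addn0.
by rewrite dnbS /= sgX addnS /sgf /= eqxx (_ : ((a + n).+1 == a + n) = false)%N ?IH //; lia.
Qed.
Lemma aut_dnb a n j : (a <= j < a + n)%N -> aut (dnb a n) (X j) = X a * X j.+1 * (X a)^-1.
Proof.
elim: n => [|n IH] Hj; first lia.
rewrite dnbS /= sgX; have [Ej|Nj] := eqVneq j (a + n)%N.
  rewrite Ej /sgf /= eqxx !autM autV aut_dnb_last.
  by rewrite (@autX_id a (a + n).+1) ?brw_dnb //; lia.
by rewrite sgf_id ?IH //=; try apply/eqP; lia.
Qed.
Lemma autp_dnb a n j : (a <= j < a + n)%N -> autp (dnb a n) (punc j) = act (X a) (punc j.+1).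
Proof.
elim: n => [|n IH] Hj; first lia.
rewrite dnbS /= sgp_punc /sgt /=; have [Ej|Nj] := eqVneq j (a + n)%N.
  rewrite (_ : (_, _) = act (X (a + n)) (punc (a + n).+1)); last first.
    by rewrite XL actL /act1 /=; case: eqP => // -[]; lia.
  rewrite autp_act // aut_dnb_last Ej.
  by rewrite (@autp_punc_id a (a + n).+1) ?brw_dnb //; lia.
by rewrite (_ : (j == (a + n).+1) = false) ?IH //; lia.
Qed.

Definition hom_pred (g : fg) : fg := hom (fun i => X i.-1) g.
(** A word above a, conjugated by [X a], is a braid image of the same word with its indices lowered.
    An induction on the size of the block may then lower [b] where it cannot raise [a]. *)
Lemma aut_dnb_pred a b g : inF a.+1 b g -> (0 < b)%N ->
  inF a b.-1 (hom_pred g) /\ aut (dnb a (b.-1 - a)) (hom_pred g) = X a * g * (X a)^-1.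
Proof.
move=> Hg Hb; split; first by apply: inF_hom Hg => i Hi; rewrite inFX; lia.
elim/inF_ind: g / Hg => [|[i c] g /= Hi Hg IH].
  by rewrite /hom_pred hom1 aut1 mulg1 mulgV.
have E : aut (dnb a (b.-1 - a)) (X i.-1) = X a * X i * (X a)^-1.
  by rewrite aut_dnb ?prednK //; lia.
rewrite /hom_pred homM autM -/(hom_pred g) IH homL /evl LX /=.
by case: c => /=; rewrite ?autV E ?invgM ?invgK !mulgA mulgVK.
Qed.

(** * Braid images of initial products are the positively oriented simple loops *)

Definition Ii a b g := exists w c, [/\ brw a b w, (a <= c <= b)%N & g = aut w (dl a c)].
(** Around its base point, the direction in which the loop leaves precedes the one by which it
    returns; this tells a loop from its inverse. *)
Definition Ori g := Lt (act g base) (act g^-1 base).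

Lemma Ii_aut a b w g : brw a b w -> Ii a b g -> Ii a b (aut w g).
Proof.
move=> Hw [w' [c [Hw' Hc ->]]]; exists (w' ++ w), c; split=> //.
  by rewrite brw_cat Hw' Hw.
by rewrite aut_cat.
Qed.

Lemma Ii_shift a b g : Ii a.+1 b g -> Ii a b g.
Proof.
case=> [w [c [Hw Hc ->]]]; apply: Ii_aut; first exact: brwS Hw.
have [Eb|Nb] := eqVneq c a.+1.
  by exists [::], a; split => //; [lia|rewrite Eb !dl_nil].
exists (upb a (c.-1 - a)), c.-1; split; [apply: brw_upb; lia|lia|].
have : forall d, (a <= d < c)%N -> dl a.+1 d.+1 = aut (upb a (c.-1 - a)) (dl a d).
  elim=> [|d IH] Hd; first by rewrite !dl_nil ?aut1 //; lia.
  have [Ed|Nd] := eqVneq a d.+1; first by rewrite Ed !dl_nil ?aut1 //; lia.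
  by rewrite dlSr ?IH ?[in RHS]dlSr ?autM ?aut_upb //; lia.
by move/(_ c.-1); rewrite prednK; [apply; lia|lia].
Qed.

Lemma C_base p q : p != base -> q != base -> okp p -> okp q -> C base p q = Lt p q.
Proof.
move=> Np Nq Hp Hq; have H r : r != base -> okp r -> Lt base r && ~~ Lt r base.
  move=> N Hr; have := Lt_anti ok_base Hr; rewrite eq_sym => /(_ N) ->; rewrite negbK andbb.
  have N' : base != r by rewrite eq_sym.
  rewrite (LtE N'); have E1 : hd base = 1%N by []; suff H1 : (1 < hd r)%N by rewrite E1 (ltn_eqF H1) H1.
  by case: r {Hr N'} N => [[|x u] [i|]] // _; rewrite /hd /= ?lc_gt0 // addnS ltnS addn_gt0 orbT.
rewrite CE; case/andP: (H p Np Hp) => -> _; case/andP: (H q Nq Hq) => _ /negbTE->.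
by rewrite /cyc3; case: (Lt p q).
Qed.

Lemma base_eq g : (act g base == base) = (g == 1).
Proof. by rewrite -{2}(act1g base) ; apply/eqP/eqP => [/act_base_inj|->]. Qed.
Lemma act_base_eq g h : (act g base == act h base) = (g == h).
Proof. by apply/eqP/eqP => [/act_base_inj|->]. Qed.

Lemma winv_fix w : reduced w -> winv w = w -> w = [::].
Proof.
have [n] := ubnP (size w); elim: n w => // n IH [|x w] //; case/lastP: w => [|w y] Hn Hw.
  by rewrite /winv /= => -[/eqP]; rewrite linv_neq.
rewrite winv_cons -cats1 winv_cat /= => -[E] /eqP; rewrite !cats1 eqseq_rcons => /andP[/eqP Ew /eqP Ey].
have Hw' : reduced w by move: (reduced_behead Hw); rewrite -cats1 => /reduced_catl.
have E0 : w = [::] by apply: IH => //; move: Hn; rewrite /= size_rcons; lia.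
by move: Hw; rewrite E0 -Ey /= eqxx.
Qed.

Lemma inv_fix (g : fg) : g^-1 = g -> g = 1.
Proof.
move=> E; apply/eqP; rewrite -fw_eq1; apply/eqP/winv_fix; first exact: fgP.
by rewrite -fwV E.
Qed.

(** In the block, the codes of [X a] and of the puncture a are the smallest ones after [base], so
    the chord from [base] to this puncture separates exactly the two sides of the edge to [X a]. A
    traversal of the edge therefore crosses the chord unless the translated arc ends at [base], that
    is, unless the letter is the first or the last one. *)
Lemma arc_shape a b z : okp z -> inP a b z ->
  (forall g, inF a b g -> unl base (punc a) (act g base) (act g z)) ->
  exists (e : bool) v (f : bool),
    [/\ z.1 = nseq e (a, false) ++ v ++ nseq f (a, true),
        all (fun x : letter nat => (a.+1 <= x.1 < b)%N) v & f -> z.2 = None].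
Proof.
move=> Hz Hin HU; have [Hu Ht] := andP Hin.
have key n : (n < size z.1)%N -> (nth (0, false)%N z.1 n).1 = a ->
    n = 0%N /\ (nth (0, false)%N z.1 n).2 = false \/
    [/\ n.+1 = size z.1, (nth (0, false)%N z.1 n).2 = true & z.2 = None].
  move=> Hn Hj; have Ez : (z.1, z.2) = z by case: (z).
  have okz' : okw z.1 z.2 by [].
  have := tn_br okz' Hn Hj; rewrite Ez => -[B1 B2 B3].
  have := inF_tn Hin n => Fh; have := HU _ Fh; have := tn_z okz' n; rewrite Ez => Etz.
  set h := tn z.1 n in B1 B2 B3 Fh Etz *.
  have Np : act h base != punc a by rewrite act_base; apply/eqP => -[].
  have in1 : inP a b (act h base) by apply: inP_act.
  have in2 : inP a b (act h z) by apply: inP_act.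
  have ok2 : okp (act h z) by apply: ok_act.
  have ok1 : okp (act h base) by apply: ok_act.
  have F y : inP a b y -> okp y -> y != punc a -> y != base -> C base (punc a) y = ~~ br a y.
    move=> Hy Hoy N1 N2; rewrite C_base //; have N1' : punc a != y by rewrite eq_sym.
    rewrite (LtE N1') /br.
    have N3 : hd y != (3 * a + 3)%N by apply: contra N1 => /eqP/hd_punc->.
    have E : hd (punc a) = (3 * a + 3)%N by [].
    rewrite E [_ == hd y]eq_sym (negbTE N3).
    suff H : (3 * a + 2 <= hd y)%N.
      have <- : (3 * a + 3 < hd y)%N = ~~ (hd y == (3 * a + 2)%N) by move: (hd y) H N3; clear=> k; lia.
      by [].
    case: y Hy N2 {Hoy N1 N1' N3} => [[|[k c] w] [m|]] //; rewrite /inP /= /hd /=; first by clear; lia.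
      by move=> /andP[/andP[H _] _] _; move: H; clear; rewrite /lc /=; case: c; lia.
    by rewrite andbT => /andP[H _] _; move: H; clear; rewrite /lc /=; case: c; lia.
  rewrite /unl; case: (boolP (uniq _)) => [|Nu _].
    rewrite /= !inE !negb_or => /and4P[/and3P[_ N1 N2] /andP[N3 N4] _ _] /=.
    by rewrite !F // 1?eq_sym // B1 B2; case: (_.2).
  move: Nu; rewrite /= !inE !negb_or; case: (base =P act h base) => [E|N1].
    have Ee : (nth (0, false)%N z.1 n).2 = false by rewrite -B1 -E br_base.
    left; split=> //; rewrite /h /tn Ee in E; move: E; move=> /esym /eqP; rewrite base_eq => /eqP E.
    have E' : mkF (take n z.1) = 1 by rewrite -[LHS]invgK E invg1.
    have Hr : reduced (take n z.1).
      by have := okw_reduced okz'; rewrite -{1}(cat_take_drop n z.1) => /reduced_catl.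
    have : fw (mkF (take n z.1)) = [::] by rewrite E'.
    rewrite [fw _]/= red_id // => E2; have := size_takel (ltnW Hn); rewrite E2 => <- //.
  case: (base =P act h z) => [E|N2].
    have Ee : (nth (0, false)%N z.1 n).2 = true.
      by move: B2; rewrite -E br_base; case: (_.2).
    right; move: Etz; rewrite Ee -E => -[E1 E2]; split=> //.
    by move: (size_drop n.+1 z.1) Hn; rewrite -E1 /=; clear; lia.
  have N3 : act h base != act h z by apply/eqP => E; move: B2; rewrite -E B1; case: (_.2).
  by rewrite (eq_sym (punc a) (act h base)) Np (eq_sym (punc a)) B3 N3.
have in_v x : x \in z.1 -> x.1 != a -> (a.+1 <= x.1 < b)%N.
  by move=> Hx N; have /andP[H1 H2] := allP Hu _ Hx; rewrite H2 andbT ltn_neqAle eq_sym N H1.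
have nz (w : word nat) : all (fun x : letter nat => x.1 != a) w -> {subset w <= z.1} ->
    all (fun x : letter nat => (a.+1 <= x.1 < b)%N) w.
  by move=> /allP H S; apply/allP => x Hx; apply: in_v; [apply: S|apply: H].
have mid n : (0 < n)%N -> (n.+1 < size z.1)%N -> (nth (0, false)%N z.1 n).1 != a.
  move=> H1 H2; apply/eqP => /(key _ (ltnW H2)) [[E _]|[E _ _]]; [by rewrite E in H1|by rewrite E ltnn in H2].
have first : (0 < size z.1)%N -> (nth (0, false)%N z.1 0).1 = a ->
   nth (0, false)%N z.1 0 = (a, false) \/ [/\ 1%N = size z.1, nth (0, false)%N z.1 0 = (a, true) & z.2 = None].
  move=> H0 Ea; case: (key 0 H0 Ea) => [[_ E]|[E1 E2 E3]]; [left|right]; rewrite [nth _ _ _]surjective_pairing Ea ?E ?E2 //.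
have last n : n.+1%N = size z.1 -> (0 < n)%N -> (nth (0, false)%N z.1 n).1 = a ->
   nth (0, false)%N z.1 n = (a, true) /\ z.2 = None.
  move=> Hn H0 Ea; have Hn' : (n < size z.1)%N by rewrite -Hn.
  case: (key n Hn' Ea) => [[E _]|[_ E2 E3]]; first by rewrite E in H0.
  by split=> //; rewrite [nth _ _ _]surjective_pairing Ea E2.
case Ez : z.1 first last mid nz => [|x w] first last mid nz; first by exists false, [::], false.
have [Ex|Nx] := eqVneq x.1 a; last first.
- case/lastP: w Ez first last mid nz => [|w y] Ez first last mid nz.
    by exists false, [:: x], false; split=> //; apply: nz; rewrite //= Nx.
  have mw : all (fun x : letter nat => x.1 != a) (x :: w).
    rewrite /= Nx; apply/allP => x' /(nthP (0, false)%N) [n Hn <-].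
    by have := mid n.+1; rewrite /= nth_rcons Hn; apply; rewrite ?size_rcons ?ltnS.
  have [Ey|Ny] := eqVneq y.1 a.
    have [|||Ey' E2] := last (size w).+1; rewrite /= ?size_rcons ?nth_rcons ?ltnn ?eqxx //.
    move: Ey'; rewrite /= nth_rcons ltnn eqxx => Ey'.
    exists false, (x :: w), true; split=> //; first by rewrite Ey' cats1.
    by apply: nz => // x'; rewrite !inE mem_rcons inE => /orP[->|->]; rewrite ?orbT.
  exists false, (x :: rcons w y), false; split=> //; first by rewrite cats0.
  by apply: nz => //; rewrite -rcons_cons all_rcons Ny.
have := first isT Ex; rewrite /= => -[E1|[E0 E1 E2]]; last first.
  by exists false, [::], true; rewrite E1; case: (w) E0.
case/lastP: w Ez first last mid nz => [|w y] Ez first last mid nz.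
  by exists true, [::], false; rewrite E1.
have mw : all (fun x : letter nat => x.1 != a) w.
  apply/allP => x' /(nthP (0, false)%N) [n Hn <-].
  by have := mid n.+1; rewrite /= nth_rcons Hn; apply; rewrite ?size_rcons ?ltnS.
have [Ey|Ny] := eqVneq y.1 a.
  have [|||Ey' E2] := last (size w).+1; rewrite /= ?size_rcons ?nth_rcons ?ltnn ?eqxx //.
  move: Ey'; rewrite /= nth_rcons ltnn eqxx => Ey'.
  exists true, w, true; split=> //; first by rewrite E1 Ey' /= cats1.
  by apply: nz => // x' Hx; rewrite !inE mem_rcons inE Hx !orbT.
exists true, (rcons w y), false; split=> //; first by rewrite E1 cats0.
apply: nz; first by rewrite all_rcons Ny.
by move=> x' Hx; rewrite inE Hx orbT.
Qed.

Lemma move_punc a b i : (a <= i < b)%N -> exists w, [/\ brw a b w, autp w (punc a) = punc i & aut w (X a) = X i].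
Proof.
elim: i => [|i IH] Hi; first by exists [::]; split=> //; have -> : a = 0%N by lia.
have [<-|N] := eqVneq a i.+1; first by exists [::].
have Hi' : (a <= i < b)%N by move/eqP: N => N; lia.
have [w [Hw E1 E2]] := IH Hi'.
exists (w ++ [:: (i, true)]); rewrite brw_cat Hw autp_cat aut_cat E1 E2 /= sgp_punc sgX /sgf /sgt /= eqxx.
by split=> //; rewrite andbT; lia.
Qed.

Definition sgi (x : nat * bool) (j : nat) : nat := if j == x.1 then x.1.+1 else if j == x.1.+1 then x.1 else j.
Lemma sgi_inj x : injective (sgi x).
Proof. by move=> i j; rewrite /sgi; do 4?[case: eqP => ?]; lia. Qed.
Lemma act_end g p : (act g p).2 = p.2.
Proof.
rewrite /act; elim: (fw g) => //= x w IH; rewrite -IH /act1; case: (actw w p) => [[|y u] t] /=; case: ifP => //=.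
Qed.
Lemma sgp_end x p : (sgp x p).2 = omap (sgi x) p.2.
Proof.
rewrite /sgp act_end; case: p.2 => //= j; rewrite /sgi.
by case: x.2 => /=; do 2?[case: ifP => //].
Qed.
Lemma autp_end w p q : ((autp w p).2 == (autp w q).2) = (p.2 == q.2).
Proof.
elim: w p q => //= x w IH p q; rewrite IH !sgp_end.
by case: p.2 q.2 => [i|] [j|] //=; rewrite !(inj_eq (@Some_inj _)) (inj_eq (@sgi_inj x)).
Qed.

Lemma SimS a b a' b' z : (a' <= a)%N -> (b <= b')%N -> Sim a' b' z -> Sim a b z.
Proof. by move=> Ha Hb H g Hg; apply: H; apply: inFS Hg. Qed.

Lemma act_word u t : okw u t -> act (mkF u) ([::], t) = (u, t).
Proof. by move=> Hu; rewrite /act [fw _]/= red_id ?(okw_reduced Hu) // act_reduced cats0. Qed.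

(** Induction on the size of the block, then on the length of the arc. [Sim_reduct] provides a
    shorter arc to another puncture that [z] does not cross. A braid makes this arc straight, and
    [arc_shape] then confines [z] to the letters above a, up to an initial [X a]. *)
Lemma Sim_punc_orbit a b z i : okp z -> inP a b z -> z.2 = Some i -> Sim a b z ->
  exists w, brw a b w /\ z = autp w (punc a).
Proof.
have [n] := ubnP (b - a)%N; elim: n a b z i => // n IHn a b z i Hn.
have [m] := ubnP (size z.1); elim: m z i => // m IHm z i Hm Hz Hin Ei HS.
have Hi : (a <= i < b)%N by move: Hin; rewrite /inP Ei => /andP[].
have [Ez|[u [x Ez]]] : z.1 = [::] \/ exists u x, z.1 = rcons u x.
  by case: (lastP z.1) => [|u x]; [left|right; exists u, x].
  have [w [Hw E _]] := move_punc Hi; exists w; split=> //.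
  by rewrite E; rewrite [z]surjective_pairing Ez Ei.
have Hx : x \in z.1 by rewrite Ez mem_rcons mem_head.
have [t [[Ht1 Ht2 Ht3 Ht4 Ht5] HU]] := Sim_reduct Hz Hin HS Hx.
have [w [Hw Et]] := IHm t x.1 (leq_trans Ht3 Hm) Ht1 Ht2 Ht4 Ht5.
have Nx : x.1 != i.
  have : okw z.1 z.2 by []. rewrite Ez Ei -cats1 => /okw_catr /=.
  by rewrite andbT; apply: contra => /eqP->.
set y := autp (binv w) z.
have Hy : okp y by apply: ok_autp.
have Hw' : brw a b (binv w) by rewrite brw_binv.
have Hyin : inP a b y by apply: inP_autp.
have HyS : Sim a b y by apply: Sim_autp.
have HyU g : inF a b g -> unl base (punc a) (act g base) (act g y).
  move=> Hg; have := HU (aut w g); rewrite inF_aut // => /(_ Hg).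
  rewrite -(unl_autp (binv w)) ?ok_act // autp_base !autp_act // autK Et autpK //.
  by rewrite autp_base.
have Zy : z = autp w y by rewrite autpVK.
have Ny : y.2 != Some a.
  by rewrite -[Some a]/((punc a).2) -(autp_end w) -Zy -Et Ht4 Ei; apply: contra Nx => /eqP[->].
suff [w2 [Hw2 E2]] : exists w2, brw a b w2 /\ y = autp w2 (punc a).
  by exists (w2 ++ w); rewrite brw_cat Hw2 autp_cat -E2.
have [i' Ei'] : exists i', y.2 = Some i'.
  have : (y.2 == (base : pt).2) = false by rewrite -(autp_end w) -Zy autp_base Ei.
  by case: (y.2) => // k _; exists k.
have {Ny} Ni : i' != a by apply: contra Ny; rewrite Ei' => /eqP->.
have Hi' : (a <= i' < b)%N by move: Hyin; rewrite /inP Ei' => /andP[].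
have {Ni} Ni : i' <> a by apply/eqP.
have [e [v [f [Ev Hv Hf]]]] := arc_shape Hy Hyin HyU.
have f0 : f = false by case: f Hf {Ev} => // /(_ isT); rewrite Ei'.
rewrite f0 cats0 in Ev; clear Hf f0 f.
have E' : y = (nseq e (a, false) ++ v, Some i') by rewrite [y]surjective_pairing Ev Ei'.
clearbody y; clear HyU Zy Ei'; subst y; case: e {Ev} Hy Hyin HyS => /= Hy Hyin HyS.
- have Fv : inF a.+1 b (mkF v) by apply: inF_mkF.
  have b0 : (0 < b)%N by nlia.
  have [F1 F2] := aut_dnb_pred Fv b0.
  have Hd : brw a b (dnb a (b.-1 - a)) by apply: brw_dnb; nlia.
  (* The braid [dnb] conjugates the lowered word by [X a], and the factor [X a] in the image of the
     puncture cancels the final inverse; what remains is the arc that starts with [X a]. *)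
  set q := act (hom_pred (mkF v)) (punc i'.-1).
  have Eq : autp (dnb a (b.-1 - a)) q = ((a, false) :: v, Some i').
    rewrite autp_act // F2 autp_dnb ?prednK //; try nlia.
    by rewrite -actM // mulgVK -mkF_cons act_word.
  have Hq : okp q by apply: ok_act.
  have [|||||w2 [Hw2 E2]] := IHn a b.-1 q i'.-1; rewrite ?Hq //.
  + nlia.
  + by apply: inP_act => //; rewrite /inP /=; nlia.
  + exact: act_end.
  + apply: (@SimS a b.-1 a b) => //; first nlia.
    rewrite -(autpK (dnb a (b.-1 - a)) Hq) Eq; apply: Sim_autp => //.
    by rewrite brw_binv.
  exists (w2 ++ dnb a (b.-1 - a)); rewrite brw_cat Hd autp_cat -E2 Eq andbT; split=> //.
  by apply: brwS Hw2; nlia.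
have [|||||w2 [Hw2 E2]] := IHn a.+1 b (v, Some i') i'; rewrite ?Hq //.
+ nlia.
+ by rewrite /inP /= Hv; nlia.
+ exact: SimS HyS.
have [|w3 [Hw3 E3 _]] := @move_punc a b a.+1; first nlia.
exists (w3 ++ w2); rewrite brw_cat Hw3 autp_cat E3 -E2; split=> //.
by apply: brwS Hw2.
Qed.

Lemma Ori_C g : g != 1 -> Ori g = C base (act g base) (act g^-1 base).
Proof. by move=> N; rewrite C_base ?ok_act // base_eq // invg_eq1. Qed.

Lemma Ori_aut w g : g != 1 -> Ori (aut w g) = Ori g.
Proof.
move=> N; have N' : aut w g != 1 by apply: contra N => /eqP E; rewrite -(autK w g) E aut1.
rewrite !Ori_C //; have := @C_autp w base (act g base) (act g^-1 base).
rewrite !autp_act // !autp_base autV; apply; rewrite ?ok_act //.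
- by rewrite eq_sym base_eq.
- by rewrite act_base_eq; apply: contra N => /eqP E; apply/eqP/inv_fix.
by rewrite base_eq invg_eq1.
Qed.

(** No code of a letter above a lies between that of [base] and that of the inverse of [X a], so
    ending at a vertex and leaving it through that edge compare alike. *)
Lemma ltp_tail a b c u v : (b = 0 \/ 3 * a + 5 <= b)%N -> u != v ->
  all (fun x : letter nat => (a.+1 <= x.1 < c)%N) u -> all (fun x : letter nat => (a.+1 <= x.1 < c)%N) v ->
  ltp b u None (rcons v (a, true)) None = ltp b u None v None.
Proof.
have L x : (a.+1 <= x.1 < c)%N -> (3 * a + 5 <= lc x)%N by case: x => k [] /=; rewrite /lc /=; lia.
elim: u v b => [|x u IH] [|y v] b Hb // N.
  move=> /= /andP[Hx _] _.
  have -> : (x == (a, true)) = false by apply/eqP => E; rewrite E /= ltnn in Hx.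
  by move: (lc x) (L x Hx) Hb; clear; rewrite /cw /lc /= => k Hx; case=> Hb; lia.
move=> /= /andP[Hx Hu] /andP[Hy Hv]; case: ifP => // /eqP E; rewrite IH //.
  by right; move: (L x Hx); clear; case: x => k []; rewrite /lc /=; lia.
by apply: contra N => /eqP->; rewrite E.
Qed.

Lemma fw_rcons a b g : inF a.+1 b g -> fw (g * (X a)^-1) = rcons (fw g) (a, true).
Proof.
move=> Hg; rewrite fwM XL LV [fw (L _)]/= cats1 red_id //.
have := fgP g; move: Hg; rewrite /inF; case/lastP: (fw g) => [|u x] //.
rewrite all_rcons -[rcons (rcons _ _) _]cats1 cat_rcons reduced_cat1 /= => /andP[/andP[H _] _] ->.
by rewrite !andbT /=; case: x H => k c /= H; apply/eqP => -[E]; rewrite -E ltnn in H.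
Qed.

(* Removing an initial X a, which leaves the chord from (X a)^-1 to v. *)
Lemma Sim_behead a b v : inF a.+1 b v -> v != 1 -> (a < b)%N -> Sim a b (act (X a * v) base) ->
  Sim a.+1 b (act v base) /\ Ori v.
Proof.
move=> Hv N Hab HS.
have Xa : inF a b (X a) by rewrite inFX; lia.
have FS g : inF a.+1 b g -> inF a b g by apply: inFS.
have NX g : inF a.+1 b g -> (g == (X a)^-1) = false.
  move=> Hg; apply/negbTE; apply: contraTneq Hg => ->; rewrite inFVE inFX; lia.
have NXM g h : inF a.+1 b g -> inF a.+1 b h -> (h == g * (X a)^-1) = false.
  move=> Hg Hh; apply/negbTE; apply: contraTneq Hh => ->.
  by rewrite inFMl // inFVE inFX ltnn.
have NX' g : inF a.+1 b g -> ((X a)^-1 == g) = false by move=> Hg; rewrite eq_sym NX.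
have D2 g : g != 1 -> ((X a)^-1 == g * (X a)^-1) = false.
  by move=> Ng; rewrite -[X in X == _]mul1g (inj_eq (mulIg _)) eq_sym (negbTE Ng).
have hdX : hd (act (X a)^-1 base) = (3 * a + 4)%N by rewrite act_base fwV.
have hdF g : inF a.+1 b g -> g != 1 -> (3 * a + 4 < hd (act g base))%N.
  rewrite act_base -fw_eq1 /inF; case: (fw g) => // x w /= /andP[H _] _.
  by move: H; case: x => k []; rewrite /hd /= /lc /=; clear; lia.
have hdFX g : inF a.+1 b g -> g != 1 -> (3 * a + 4 < hd (act (g * (X a)^-1)%g base))%N.
  move=> Hg Ng; rewrite act_base (fw_rcons Hg); move: Ng Hg; rewrite -fw_eq1 /inF; case: (fw g) => // x w _ /= /andP[H _].
  by move: H; case: x => k []; rewrite /hd /= /lc /=; clear; lia.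
have LtX p : (3 * a + 4 < hd p)%N -> Lt (act (X a)^-1 base) p && ~~ Lt p (act (X a)^-1 base).
  move=> H; have N1 : act (X a)^-1 base != p by apply/eqP => E; rewrite -E hdX ltnn in H.
  have N2 : p != act (X a)^-1 base by rewrite eq_sym.
  by rewrite (LtE N1) (LtE N2) hdX (ltn_eqF H) (gtn_eqF H) H /= -leqNgt ltnW.
have CX p q : (3 * a + 4 < hd p)%N -> (3 * a + 4 < hd q)%N -> C (act (X a)^-1 base) p q = Lt p q.
  move=> /LtX/andP[H1 _] /LtX/andP[_ /negbTE H2]; rewrite CE H1 H2 /cyc3.
  by case: (Lt p q).
have tail g : inF a.+1 b g -> v != g -> Lt (act v base) (act (g * (X a)^-1) base) = Lt (act v base) (act g base).
  move=> Hg Nvg; rewrite !act_base (fw_rcons Hg) /Lt /=.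
  by apply: (@ltp_tail a 0 b) => //; left.
have key g : inF a.+1 b g -> unl (act (X a)^-1 base) (act v base) (act (g * (X a)^-1) base) (act (g * v) base).
  move=> Hg; have := HS (X a * g * (X a)^-1).
  rewrite -(unl_act (X a)^-1) ?ok_act // -!actM ?ok_act //.
  have E1 : (X a)^-1 * (X a * g * (X a)^-1) = g * (X a)^-1 by rewrite !mulgA mulVg mul1g.
  have E3 : g * (X a)^-1 * (X a * v) = g * v by rewrite mulgA mulgVK.
  rewrite mulKg E1 E3; apply.
  by apply: inFM; [apply: inFM => //; apply: FS|rewrite inFVE].
split.
  move=> g Hg; rewrite -actM // /unl; apply/implyP; rewrite /= !inE !negb_or.
  rewrite ![base == _]eq_sym !base_eq !act_base_eq => /and4P[/and3P[_ N1 N2] /andP[N3 N4] N5 _].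
  have Fgv : inF a.+1 b (g * v) by apply: inFM.
  rewrite !C_base ?base_eq ?ok_act //.
  have := key g Hg; rewrite /unl /= !inE !act_base_eq !negb_or.
  rewrite (NX' _ Hv) (D2 _ N1) (NX' _ Fgv) (NXM _ _ Hg Hv) [_ * _ == g * v]eq_sym (NXM _ _ Hg Fgv) (negbTE N4) /=.
  rewrite (CX _ _ (hdF v Hv N) (hdFX g Hg N1)) (CX _ _ (hdF v Hv N) (hdF _ Fgv N2)) => /eqP <-.
  by rewrite tail.
have N' : v^-1 != 1 by rewrite invg_eq1.
have Nv : v != v^-1 by apply: contra N => /eqP E; apply/eqP/inv_fix.
have := key v^-1 (inFV Hv); rewrite mulVg /unl /= !inE !act_base_eq !negb_or.
rewrite (NX' _ Hv) (D2 _ N') (NX' _ (inF1 _ _)) (NXM _ _ (inFV Hv) Hv) (negbTE N).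
rewrite [_ * _ == 1]eq_sym (NXM _ _ (inFV Hv) (inF1 _ _)) /= (CX _ _ (hdF v Hv N) (hdFX _ (inFV Hv) N')).
rewrite tail ?inFVE // -/(Ori v) => /eqP ->.
rewrite act1g CE; have /LtX/andP[-> _] := hdF v Hv N.
have B p : (1 < hd p)%N -> Lt base p.
  move=> H; have Np : base != p by apply/eqP => E; rewrite -E in H.
  by rewrite (LtE Np) [hd base](_ : _ = 1%N) // (ltn_eqF H) H.
have -> : Lt base (act (X a)^-1 base) by apply: B; rewrite hdX; clear; lia.
by rewrite /cyc3 /=; case: (Lt _ base).
Qed.

(** The braid word [upb a n] is reused as a word in the generators: both are lists of signed
    indices. *)
Lemma fw_dlV a n : fw (dl a (a + n))^-1 = upb a n.
Proof.
elim: n => [|n IH]; first by rewrite addn0 dl_nil // invg1.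
rewrite addnS dlSr ?leq_addr // invgM XL LV fwM IH upbS [LHS]/= red_id -?IH ?fgP // IH.
case: n {IH} => // n; rewrite upbS /= addnS.
by case: eqP => // -[]; clear; lia.
Qed.

Lemma inP_behead a b x u t : inP a b (x :: u, t) -> inP a b (u, t).
Proof. by case/andP=> /andP[_ H1] H2; apply/andP. Qed.

Lemma hdw_range a b u t : inP a b (u, t) -> (u, t) != base -> (3 * a + 2 <= hdw u t)%N.
Proof.
case: u t => [|[k c] u] [m|] //=; rewrite /inP /=; first by clear; lia.
  by move=> /andP[/andP[/andP[H _] _] _] _; move: H; clear; rewrite /lc /=; case: c; lia.
by rewrite andbT => /andP[/andP[H _] _] _; move: H; clear; rewrite /lc /=; case: c; lia.
Qed.

Lemma ltp_upb a b n u t : okw u t -> inP a b (u, t) -> (u, t) != (upb a n, None) ->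
  hdw u t != (3 * (a + n) + 2)%N -> ltp (3 * (a + n) + 2)%N u t (upb a n) None.
Proof.
elim: n u => [|n IH] u Hu Hp N H.
  have := hdw_range Hp N; have -> : ltp (3 * (a + 0) + 2)%N u t (upb a 0) None = cw (3 * (a + 0) + 2)%N (hdw u t) 1.
    by case: (u).
  by move: H; rewrite /cw; clear; lia.
rewrite upbS in N *; case: u Hu Hp N H => [|x u] Hu Hp N.
  rewrite /hdw /ltp => H; have := lc_tc (a + n, true)%N t; move: H.
  by rewrite /lc /cw /=; clear; move: (tc t) => k; lia.
rewrite ltpE /=; case: (x =P _) => [E|/eqP]; last first.
  by rewrite -lc_eq /cw /lc /=; clear; case: x => i [] /=; lia.
rewrite E [lc (linv _)]/= => _; apply: IH.
- exact: okw_behead Hu.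
- exact: inP_behead Hp.
- by apply: contra N => /eqP [-> ->]; rewrite E.
- by have := ok_hdw Hu; rewrite E.
Qed.

(* The turns made by the path [dl a c] are as sharp as possible. *)
Lemma Lt_dlV a b c p : okp p -> inP a b p -> (a <= c)%N -> p != base -> p != act (dl a c)^-1 base ->
  Lt p (act (dl a c)^-1 base) = (hd p < 3 * c + 2)%N.
Proof.
move=> Hp Hin Hc; rewrite act_base -(subnKC Hc) fw_dlV; move: (c - a)%N => n N0 N.
case: p Hp Hin N0 N => u t Hp Hin N0 N; rewrite /Lt /hd /=.
case: n N => [|n] N.
  have := hdw_range Hin N0; have -> : ltp 0 u t (upb a 0) None = cw 0 (hdw u t) 1 by case: (u).
  by rewrite /cw; clear; move: (hdw u t) => k; lia.
rewrite upbS in N *; case: u Hp Hin N0 N => [|x u] Hp Hin N0 N.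
  by have := tc_gt0 t; have := lc_tc (a + n, true)%N t; rewrite /= /lc /cw /=; clear; move: (tc t) => k; lia.
rewrite ltpE /=; case: (x =P _) => [E|/eqP]; last first.
  by rewrite -lc_eq /cw /lc /=; clear; case: x => i [] /=; lia.
rewrite E [lc (linv _)]/= (@ltp_upb a b) //.
- by rewrite /lc /=; clear; lia.
- exact: okw_behead Hp.
- exact: inP_behead Hin.
- by apply: contra N => /eqP [-> ->]; rewrite E.
- by have := ok_hdw Hp; rewrite E.
Qed.

Lemma dl_eq1 a c : (dl a c == 1) = (c <= a)%N.
Proof.
have [H|H] := leqP c a; first by rewrite dl_nil ?eqxx.
rewrite -invg_eq1 -fw_eq1 -(subnKC (ltnW H)) fw_dlV.
by rewrite -size_eq0 size_rev size_map size_iota; lia.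
Qed.

Lemma hd_dl a c : (a < c)%N -> hd (act (dl a c) base) = (3 * a + 2)%N.
Proof.
move=> H; have := fwV (dl a c)^-1; rewrite invgK -(subnKC (ltnW H)) fw_dlV.
rewrite act_base subnKC ?(ltnW H) // => ->; move: H; rewrite -subn_gt0.
rewrite /upb /winv map_rev revK; case: (c - a)%N => //.
Qed.

Lemma Ori_dl a c : (a < c)%N -> Ori (dl a c).
Proof.
move=> H; rewrite /Ori (@Lt_dlV a c) ?ok_act //.
- by rewrite hd_dl //; lia.
- by apply: inP_act; rewrite ?inF_dl.
- exact: ltnW.
- by rewrite base_eq dl_eq1 -ltnNge.
- by rewrite act_base_eq; apply/eqP => /esym/inv_fix/eqP; rewrite dl_eq1 leqNgt H.
Qed.

Lemma Ii_Ori a b g : Ii a b g -> g != 1 -> Ori g.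
Proof.
case=> w [c [Hw Hc ->]] N; have N' : dl a c != 1 by apply: contra N => /eqP->; rewrite aut1.
by rewrite Ori_aut // Ori_dl // ltnNge -dl_eq1.
Qed.

Lemma fw_catM g h : reduced (fw g ++ fw h) -> fw (g * h) = fw g ++ fw h.
Proof. by move=> H; rewrite fwM red_id. Qed.

Lemma hd_mul_out a c g d : inF a c d -> inF a c g = false ->
  hd (act (g * d) base) = hd (act g base).
Proof.
move=> Hd; elim/inF_ind: d / Hd g => [|x d Hx Hd IH] g Hg; first by rewrite mulg1.
have Hx' : inF a c (L x) by rewrite inFL.
have Hgx : inF a c (g * L x) = false by rewrite inFMr.
rewrite mulgA IH //; case: (hd_step g x) => // E; first by rewrite E inF1 in Hg.
by rewrite E inF1 in Hgx.
Qed.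

Lemma hd_in a c g : inF a c g -> (hd (act g base) < 3 * c + 2)%N.
Proof.
rewrite act_base /inF; case: (fw g) => [|[i e] w] /=; first by rewrite /hd /=; clear; lia.
by case/andP=> /andP[_ H] _; move: H; rewrite /hd /= /lc /=; clear; case: e; lia.
Qed.

Lemma Sim_dl a b c : (a <= c <= b)%N -> Sim a b (act (dl a c) base).
Proof.
move=> /andP[Hac Hcb] g Hg; rewrite -actM // /unl; set d := dl a c.
have Fd : inF a b d by rewrite inF_dl.
apply/implyP; rewrite /= !inE !negb_or [base == _]eq_sym !base_eq.
rewrite ![base == _]eq_sym !base_eq !act_base_eq => /and4P[/and3P[N1 N2 N3] /andP[N4 N5] N6 _].
have K p : inF a b p -> p != 1 -> p != d ->
    C base (act d base) (act p base) = (hd (act (d^-1 * p)%g base) < 3 * c + 2)%N.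
  move=> Fp P1 P2; rewrite -(@C_act d^-1) ?ok_act // ?base_eq //.
  + rewrite -!actM ?ok_act // mulVg act1g C_rot C_base ?ok_act //.
    * rewrite (@Lt_dlV a b) ?ok_act //.
      - by apply: inP_act; rewrite ?inFM ?inFVE.
      - by rewrite base_eq -[1](mulVg d) (inj_eq (mulgI _)).
      by rewrite act_base_eq -[X in _ == X]mulg1 (inj_eq (mulgI _)).
    * by rewrite base_eq -[1](mulVg d) (inj_eq (mulgI _)).
    by rewrite base_eq invg_eq1.
  + by rewrite eq_sym base_eq.
  by rewrite act_base_eq eq_sym.
rewrite !K // 1?eq_sym // ?inFM //; apply/eqP; rewrite mulgA.
case Fk: (inF a c (d^-1 * g)); last by rewrite (@hd_mul_out a c) ?inF_dl.
by rewrite !(@hd_in a c) // inFM ?inF_dl.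
Qed.

Lemma Ii_Sim a b g : Ii a b g -> Sim a b (act g base).
Proof.
case=> w [c [Hw Hc ->]]; rewrite -(autp_base w) -autp_act //.
by apply: Sim_autp; rewrite ?ok_act //; apply: Sim_dl.
Qed.

Lemma Ii_inF a b g : Ii a b g -> inF a b g.
Proof. by case=> w [c [Hw /andP[Ha Hb] ->]]; rewrite inF_aut // inF_dl. Qed.

Lemma Sim_inv a b g : inF a b g -> Sim a b (act g base) -> Sim a b (act g^-1 base).
Proof.
move=> Fg H h Hh; rewrite -(unl_act g) ?ok_act // -!actM ?ok_act // mulgV act1g.
rewrite unl_swapl ?ok_act // unl_swapr.
have := H (g * h * g^-1); rewrite -!actM ?ok_act // mulgVK; apply.
by rewrite !inFM ?inFVE.
Qed.

Lemma Ori_inv g : g != 1 -> Ori g^-1 = ~~ Ori g.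
Proof.
move=> N; rewrite /Ori invgK; apply: Lt_anti; rewrite ?ok_act // act_base_eq.
by apply: contra N => /eqP/esym/inv_fix->.
Qed.

Lemma Ii_cons a b v : (a < b)%N -> Ii a.+1 b v -> Ii a b (X a * v).
Proof.
move=> Hab [w [c [Hw Hc ->]]]; exists w, c; split; [exact: brwS Hw|lia|].
rewrite (dlS (_ : a < c)%N); last lia.
by rewrite autM (autX_id Hw) // ltnn.
Qed.

(** As for arcs: after a braid, the loop is a word [v] above a, possibly preceded by [X a] and
    followed by its inverse. If both occur, [aut_dnb_pred] applies; an initial [X a] alone is
    removed by [Sim_behead]; a final inverse alone contradicts the orientation. *)
Lemma Sim_Ii a b g : (a <= b)%N -> inF a b g -> Sim a b (act g base) ->
  (g == 1) || Ori g -> Ii a b g.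
Proof.
have [n] := ubnP (b - a)%N; elim: n a b g => // n IHn a b g Hn Hab Fg HS.
have [->|N1] /= := eqVneq g 1.
  by exists [::], a; rewrite leqnn Hab dl_nil.
move=> HO; have [x Hx] : exists x, x \in (act g base).1.
  rewrite act_base; move: N1; rewrite -fw_eq1; case: (fw g) => // x u _.
  by exists x; rewrite mem_head.
have okg : okp (act g base) by rewrite ok_act.
have ing : inP a b (act g base) by apply: inP_act.
have [t [[Ht1 Ht2 _ Ht4 Ht5] HU]] := Sim_reduct okg ing HS Hx.
have [w [Hw Et]] := Sim_punc_orbit Ht1 Ht2 Ht4 Ht5.
suff : Ii a b (aut (binv w) g) by move=> /(Ii_aut Hw); rewrite autVK.
have Hw' : brw a b (binv w) by rewrite brw_binv.
have {}HU h : inF a b h -> unl base (punc a) (act h base) (act h (act (aut (binv w) g) base)).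
  move=> Hh; have := HU (aut w h); rewrite inF_aut // => /(_ Hh).
  rewrite -(unl_autp (binv w)) ?ok_act // autp_base !autp_act // autK Et autpK //.
  by rewrite autp_base.
have {}HS : Sim a b (act (aut (binv w) g) base).
  by rewrite -(autp_base (binv w)) -autp_act //; apply: Sim_autp.
have {}Fg : inF a b (aut (binv w) g) by rewrite inF_aut.
have {}HO : Ori (aut (binv w) g) by rewrite Ori_aut.
have {}N1 : aut (binv w) g != 1 by apply: contra N1 => /eqP E; rewrite -(autVK w g) E aut1.
move: (aut _ g) N1 HO Fg HS HU => {okg ing t Ht1 Ht2 Ht4 Ht5 Et Hw Hw' w Hx x}g N1 HO Fg HS HU.
have ab : (a < b)%N.
  move: N1 Fg; rewrite -fw_eq1 /inF; case: (fw g) => // x u _ /= /andP[/andP[H1 H2] _].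
  exact: leq_ltn_trans H1 H2.
have [] := arc_shape _ _ HU; rewrite ?ok_act ?inP_act // => e [v [f [E Hv _]]].
have Fv : inF a.+1 b (mkF v) by apply: inF_mkF.
have {E} E : g = (if e then X a else 1) * mkF v * (if f then (X a)^-1 else 1).
  rewrite -(mkF_fw g); move: E; rewrite act_base /= => ->; rewrite !mkF_cat mulgA XL LV.
  by congr (_ * _ * _); [case: (e)|case: (f)].
move: (mkF v) Fv E => {Hv}v Fv E; have Fv' : inF a b v by apply: inFS Fv.
have n1 : (b - a.+1 < n)%N by move: Hn ab; clear; lia.
have IH1 : Sim a.+1 b (act v base) -> (v == 1) || Ori v -> Ii a.+1 b v by apply: IHn.
case: e f E => [] [] E.
- have b0 : (0 < b)%N by apply: leq_ltn_trans ab.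
  have [F1 F2] := aut_dnb_pred Fv b0; rewrite E -F2.
  have Hd : brw a b (dnb a (b.-1 - a)) by apply: brw_dnb; move: ab; clear; lia.
  have Eg : g = aut (dnb a (b.-1 - a)) (hom_pred v) by rewrite F2.
  apply: Ii_aut => //; have [w [c [H1 H2 ->]]] : Ii a b.-1 (hom_pred v).
    apply: IHn => //.
    + by move: Hn ab; clear; lia.
    + by move: ab; clear; lia.
    + apply: (@SimS a b.-1 a b); rewrite ?leq_pred //.
      rewrite -(autK (dnb a (b.-1 - a)) (hom_pred v)) -Eg -(autp_base (binv (dnb a (b.-1 - a)))) -autp_act //.
      by apply: Sim_autp; rewrite ?ok_act ?brw_binv.
    by move: HO; rewrite Eg Ori_aut ?orbT //; [move=> ->; rewrite orbT|apply: contra N1 => /eqP H; rewrite Eg H aut1].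
  exists w, c; split=> //; first by apply: brwS H1; rewrite ?leq_pred.
  by move: H2; clear; lia.
- rewrite mulg1 in E; rewrite E; apply: Ii_cons => //.
  have [Ev|Nv] := eqVneq v 1.
    by exists [::], a.+1; rewrite leqnn ab dl_nil.
  have [H1 H2] := Sim_behead Fv Nv ab (eq_rect _ (fun g => Sim a b (act g base)) HS _ E).
  by apply: IH1; rewrite ?H2 ?orbT.
- have Eg : g^-1 = X a * v^-1 by rewrite E mul1g invgM invgK.
  suff H : Ii a b g^-1 by move: (Ii_Ori H); rewrite invg_eq1 N1 Ori_inv // HO => /(_ isT).
  rewrite Eg; apply: Ii_cons => //.
  have [Ev|Nv] := eqVneq v^-1 1.
    by exists [::], a.+1; rewrite Ev leqnn ab dl_nil.
  have Fv1 : inF a.+1 b v^-1 by rewrite inFVE.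
  have HS' := Sim_inv Fg HS; rewrite Eg in HS'.
  have [H1 H2] := Sim_behead Fv1 Nv ab HS'.
  by apply: IHn; rewrite ?H2 ?orbT.
rewrite mul1g mulg1 in E; rewrite E; apply: Ii_shift; apply: IH1; rewrite -E ?HO ?orbT //.
exact: SimS HS.
Qed.

Lemma Ii_P a b g : (a <= b)%N -> Ii a b g <-> [/\ inF a b g, Sim a b (act g base) & (g == 1) || Ori g].
Proof.
move=> Hab; split=> [H|[]]; last exact: Sim_Ii.
split; [exact: Ii_inF H|exact: Ii_Sim|case: eqVneq => //= N; exact: Ii_Ori H N].
Qed.

(** The braid in the definition may leave the subinterval, but the conditions of [Ii_P] do not
    mention braids and restrict to it. *)
Lemma Ii_sub a b a' b' g : (a <= a' <= b')%N -> (b' <= b)%N -> inF a' b' g -> Ii a b g -> Ii a' b' g.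
Proof.
move=> /andP[Ha Hab] Hb Fg H; have ab : (a <= b)%N by apply: leq_trans Hb; apply: leq_trans Hab.
have [_ HS HO] := (Ii_P g ab).1 H; apply/Ii_P => //; split=> //.
exact: SimS HS.
Qed.

(** * Subwords of simple loops *)

(** The codes from [3 * p + 2] to [3 * q + 1] are those of the letters and punctures of the block
    [[p, q)]. *)
Definition outr p q (P : pt) := (hd P < 3 * p + 2)%N || (3 * q + 1 < hd P)%N.

Lemma outr_base p q : outr p q base.
Proof. by rewrite /outr /hd /= addn2. Qed.

Lemma hd_inr p q g : inF p q g -> g != 1 -> ~~ outr p q (act g base).
Proof.
rewrite act_base -fw_eq1 /inF /outr; case: (fw g) => // -[i e] w /= /andP[/andP[H1 H2] _] _.
by rewrite /hd /= /lc /=; case: e; lia.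
Qed.

Lemma hd_cone p q g P : inF p q g -> g != 1 -> okp P -> outr p q P ->
  hd (act g P) = hd (act g base).
Proof.
move=> Fg N okP HP; have [//|[i [Ep _ Ha]]|E] := hd_act okP N.
  move: HP Fg N; rewrite Ep /outr /hd /= /inF -fw_eq1; move: Ha; case: (fw g) => // x w /= /andP[/eqP <- _].
  by move=> H /andP[/andP[H1 H2] _] _; exfalso; move: H H1 H2; clear; lia.
have := @hd_inr p q g^-1; rewrite inFVE invg_eq1 => /(_ Fg N).
by move: HP; rewrite /outr E => ->.
Qed.

Lemma C_hd p q r : hd p != hd q -> hd q != hd r -> hd r != hd p ->
  C p q r = cycn (hd p) (hd q) (hd r).
Proof.
move=> H1 H2 H3; have N1 : p != q by apply: contra H1 => /eqP->.
have N2 : q != r by apply: contra H2 => /eqP->.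
have N3 : r != p by apply: contra H3 => /eqP->.
by rewrite CE !LtE // (negbTE H1) (negbTE H2) (negbTE H3).
Qed.

(* Seen from the subtree of F_[p,q), a point behind the vertex g is the base
   point of g. *)
Lemma C_cone p q g h k P Q R : inF p q g -> inF p q h -> inF p q k ->
  g != h -> h != k -> k != g -> okp P -> okp Q -> okp R ->
  outr p q P -> outr p q Q -> outr p q R ->
  C (act g P) (act h Q) (act k R) = C (act g base) (act h base) (act k base).
Proof.
move=> Fg Fh Fk N1 N2 N3 oP oQ oR HP HQ HR.
pose D := fun x : letter nat => (p <= x.1 < q)%N.
have Dg x : inF p q x -> all D (act x base).1 by rewrite act_base.
have [||||||||||f Ff [H1 H2 H3]] := @hd_separate D (act g base) (act h base) (act k base);
  rewrite ?ok_act ?Dg ?act_base_eq //.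
have out_base := outr_base p q.
have K x Z : inF p q x -> okp Z -> outr p q Z ->
    (hd (act (f * x) Z) = hd (act (f * x) base) /\ ~~ outr p q (act (f * x) base)) \/
    (outr p q (act (f * x) Z) /\ hd (act (f * x) base) = 1%N).
  move=> Fx oZ HZ; have [E|N] := eqVneq (f * x) 1; first by right; rewrite E !act1g.
  by left; rewrite (@hd_cone p q) ?hd_inr ?inFM.
have Ka := K g P Fg oP HP; have Kb := K h Q Fh oQ HQ; have Kc := K k R Fk oR HR.
move: H1 H2 H3; rewrite -!actM // => H1 H2 H3.
have N1' : act g P != act h Q.
  rewrite -(act_eq f) ?ok_act // -!actM //; apply: contra H1 => /eqP E; apply/eqP.
  move: Ka Kb; rewrite E /outr; clear; move: (hd _) (hd _) (hd _) => x y z; lia.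
have N2' : act h Q != act k R.
  rewrite -(act_eq f) ?ok_act // -!actM //; apply: contra H2 => /eqP E; apply/eqP.
  move: Kb Kc; rewrite E /outr; clear; move: (hd _) (hd _) (hd _) => x y z; lia.
have N3' : act k R != act g P.
  rewrite -(act_eq f) ?ok_act // -!actM //; apply: contra H3 => /eqP E; apply/eqP.
  move: Kc Ka; rewrite E /outr; clear; move: (hd _) (hd _) (hd _) => x y z; lia.
rewrite -(@C_act f (act g P)) ?ok_act // -(@C_act f (act g base)) ?ok_act ?act_base_eq // -!actM //.
move: Ka Kb Kc H1 H2 H3; rewrite /outr; clear => Ka Kb Kc H1 H2 H3.
rewrite !C_hd //; move: (hd _) (hd _) (hd _) (hd _) (hd _) (hd _) Ka Kb Kc H1 H2 H3 => ? ? ? ? ? ?;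
  rewrite /cycn; lia.
Qed.

(** By [C_cone], the parts of the loop before and after the syllable may be contracted to its end
    vertices, so a crossing of the syllable with a translate would be a crossing of the whole
    loop. *)
Lemma syllable_Sim a b p q u g v : (a <= p)%N -> (q <= b)%N -> inF a b u -> inF p q g ->
  outr p q (act u^-1 base) -> outr p q (act v base) ->
  Sim a b (act (u * g * v) base) -> Sim p q (act g base).
Proof.
move=> Hp Hq Fu Fg Hu Hv HS k Fk; rewrite -actM // /unl; apply/implyP.
rewrite /= !inE !negb_or ![base == _]eq_sym !base_eq !act_base_eq => /and4P[/and3P[N1 N2 N3] /andP[N4 N5] N6 _].
have S x : inF p q x -> inF a b x by apply: inFS.
have := HS (u * k * u^-1); rewrite -(unl_act u^-1) ?ok_act // -!actM ?ok_act //.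
have -> : u^-1 * (u * g * v) = g * v by rewrite !mulgA mulVg mul1g.
have -> : u^-1 * (u * k * u^-1) = k * u^-1 by rewrite !mulgA mulVg mul1g.
have -> : k * u^-1 * (u * g * v) = k * g * v by rewrite !mulgA mulgVK.
have Fk' := S k Fk; have -> : inF a b (u * k * u^-1) by rewrite !inFM ?inFVE.
move/(_ isT); rewrite !actM ?ok_act // -{1}[act u^-1 base]act1g -!(actM k g) ?ok_act // /unl.
have K x y P Q : inF p q x -> inF p q y -> okp P -> okp Q -> outr p q P -> outr p q Q -> x != y ->
   act x P != act y Q.
  move=> Fx Fy oP oQ HP HQ N; apply/negP => /eqP E.
  have := actVK y oQ; move: E => /(congr1 (act y^-1)); rewrite actK // -actM // => E _.
  have N' : y^-1 * x != 1 by apply: contra N => /eqP E'; rewrite -(mulVKg y x) E' mulg1.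
  have F' : inF p q (y^-1 * x) by rewrite inFM ?inFVE.
  move: HQ (hd_inr F' N'); rewrite -E /outr (hd_cone F' N') // /outr; by move=> ->.
rewrite [uniq _](_ : _ = true); last first.
  by rewrite /= !inE !negb_or !K ?inFM ?ok_act // eq_sym.
have out_base := outr_base p q.
rewrite !(@C_cone p q) ?inFM ?ok_act //; by rewrite eq_sym.
Qed.

Section Syllables.
Variables a m b : nat.
Hypothesis Hm : (a <= m <= b)%N.

Definition sd (c : bool) (g : fg) := if c then inF a m g else inF m b g.

Fixpoint alts (T : fg -> Prop) (c : bool) (s : seq fg) : Prop :=
  if s is x :: s' then [/\ sd c x, T x & alts T (~~ c) s'] else True.

Definition nt (g : fg) : Prop := g != 1.

Lemma sd1 c : sd c 1. Proof. by case: c; exact: inF1. Qed.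
Lemma sdM c g h : sd c g -> sd c h -> sd c (g * h).
Proof. by case: c; apply: inFM. Qed.
Lemma sdV c g : sd c g^-1 = sd c g.
Proof. by case: c; apply: inFVE. Qed.
Lemma sd_inF c g : sd c g -> inF a b g.
Proof. by case/andP: Hm => H1 H2; case: c; apply: inFS. Qed.

Lemma alts_cat T c s t : alts T c (s ++ t) <-> alts T c s /\ alts T (c (+) odd (size s)) t.
Proof.
elim: s c => [|x s IH] c /=; first by rewrite addbF; split=> [|[]].
by rewrite addbN -addNb; split=> [[H1 H2 /IH[H3 H4]]|[[H1 H2 H3] H4]]; do ?split=> //; apply/IH.
Qed.

Lemma alts_rev (T : fg -> Prop) c s : (forall x, T x -> T x^-1) -> alts T c s ->
  alts T (c (+) ~~ odd (size s)) (rev [seq x^-1 | x <- s]).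
Proof.
move=> HT; elim: s c => [|x s IH] c //= [H1 H2 H3].
rewrite rev_cons -cats1; apply/alts_cat; split.
  by have := IH _ H3; rewrite /=; case: (c); case: (odd _).
have -> : c (+) ~~ odd (size (x :: s)) (+) odd (size (rev [seq x0^-1 | x0 <- s])) = c.
  by rewrite size_rev size_map /=; case: (c); case: (odd _).
by rewrite /= sdV; split=> //; apply: HT.
Qed.

Lemma pr_rev (s : seq fg) : pr (rev [seq x^-1 | x <- s]) = (pr s)^-1.
Proof.
elim: s => [|x s IH] /=; first by rewrite invg1.
by rewrite rev_cons -cats1 pr_cat IH /= mulg1 invgM.
Qed.

Lemma alts_inF T c s : alts T c s -> inF a b (pr s).
Proof. by elim: s c => [|x s IH] c //= [H1 _ /IH H2]; rewrite inFM // (sd_inF H1). Qed.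

Lemma alts_imp (T T' : fg -> Prop) c s : (forall x, x \in s -> T x -> T' x) -> alts T c s -> alts T' c s.
Proof.
elim: s c => //= x s IH c H [H1 H2 H3]; split=> //; first by apply: H; rewrite ?mem_head.
by apply: IH => // y Hy; apply: H; rewrite inE Hy orbT.
Qed.

Lemma alts_in T c s x : alts T c s -> x \in s -> T x /\ exists c', sd c' x.
Proof.
elim: s c => //= y s IH c [H1 H2 H3]; rewrite inE => /orP[/eqP->|/(IH _ H3)] //.
by split=> //; exists c.
Qed.

Definition lside (c : bool) (x : letter nat) := if c then (a <= x.1 < m)%N else (m <= x.1 < b)%N.
Lemma sd_all c g : sd c g = all (lside c) (fw g).
Proof. by case: c. Qed.
Lemma lside_neg c x : lside c x -> lside (~~ c) x = false.
Proof. by rewrite /lside; case: c => /=; lia. Qed.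

Lemma reduced_cat_sides c u v : reduced u -> reduced v -> all (lside c) u ->
  (if v is y :: _ then lside (~~ c) y else true) -> reduced (u ++ v).
Proof.
elim: u => // x u IH Hu Hv /= /andP[Hx Ha] Hy; rewrite IH ?(reduced_behead Hu) // andbT.
case: u Hu {IH Ha} => [_|z u /andP[]] //=; case: v Hy {Hv} => // y v Hy.
apply/negP => /eqP E; have := lside_neg Hx; move: Hy; rewrite E.
by rewrite /lside /=; case: (c) => /= -> .
Qed.

Lemma alts_fw c s : alts nt c s -> fw (pr s) = flatten [seq fw x | x <- s].
Proof.
elim: s c => //= x s IH c [H1 H2 H3]; rewrite -(IH _ H3) fw_catM //.
apply: (@reduced_cat_sides c); rewrite ?fgP -?sd_all //.
case: s IH H3 => // y s IH H3; rewrite (IH _ H3) /=; case: H3 => /= Hy Ny _.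
by move: Hy Ny; rewrite sd_all /nt -fw_eq1; case: (fw y) => //= z w /andP[].
Qed.

Definition out c (P : pt) := if c then outr a m P else outr m b P.
Lemma out_base c : out c base. Proof. by case: c; exact: outr_base. Qed.

Lemma hd_side c x s : alts nt c (x :: s) -> hd (act (pr (x :: s)) base) = hd (act x base).
Proof.
move=> H; rewrite !act_base (alts_fw H); case: H => _ N _; move: N.
by rewrite /nt -fw_eq1 /=; case: (fw x).
Qed.

Lemma hd_sd c g : sd c g -> nt g -> (if c then hd (act g base) < 3 * m + 2 else 3 * m + 2 <= hd (act g base))%N.
Proof.
case: c => [/hd_in//|]; rewrite /sd /inF /nt act_base -fw_eq1.
by case: (fw g) => // -[i e] w /= /andP[/andP[H1 H2] _] _; rewrite /hd /= /lc /=; case: e; lia.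
Qed.

Lemma out_alts c s : alts nt (~~ c) s -> out c (act (pr s) base).
Proof.
case: s => [_|x s H]; first exact: out_base.
have E := hd_side H; case: H => H N _; have := hd_sd H N; rewrite -E.
by case: (c); rewrite /= /outr; move: (hd _) => h; clear; lia.
Qed.

(** Simplicity passes to a syllable, but its orientation is not determined; hence the
    alternative. *)
Lemma syllable_I c s1 g s2 : alts nt c (s1 ++ g :: s2) -> Ii a b (pr (s1 ++ g :: s2)) ->
  let c' := c (+) odd (size s1) in
  sd c' g /\ (Ii (if c' then a else m) (if c' then m else b) g \/
              Ii (if c' then a else m) (if c' then m else b) g^-1).
Proof.
move=> /alts_cat[H1 [H2 H3 H4]] HI c'; split=> //; case/andP: Hm => Ham Hmb.
set p := if c' then a else m; set q := if c' then m else b.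
have Hpq : (a <= p <= q)%N /\ (q <= b)%N by rewrite /p /q; case: (c'); lia.
have [/andP[Hp Hpq'] Hq] := Hpq.
have Fg : inF p q g by move: H2; rewrite /sd /p /q -/c'; case: (c').
have HS : Sim p q (act g base).
  apply: (@syllable_Sim a b p q (pr s1) g (pr s2)) => //.
  - exact: alts_inF H1.
  - rewrite -pr_rev; suff : out c' (act (pr (rev [seq x^-1 | x <- s1])) base) by rewrite /out /p /q; case: (c').
    apply: out_alts; rewrite /c' -addbN; apply: alts_rev => // x; by rewrite /nt invg_eq1.
  - suff : out c' (act (pr s2) base) by rewrite /out /p /q; case: (c').
    exact: out_alts.
  by rewrite -mulgA -[g * _]/(pr (g :: s2)) -pr_cat; apply: Ii_Sim.
have [O|NO] := boolP (Ori g); [left|right]; apply: Sim_Ii; rewrite ?inFVE // ?O ?orbT //.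
  exact: Sim_inv.
by rewrite Ori_inv ?NO ?orbT.
Qed.

(** The translate of the loop by [g^-1] runs from [g^-1] to [pr s], which starts in the right block
    and so comes after the loop's first direction. As the two chords do not cross, [g^-1] also comes
    after it. *)
Lemma first_Ori g s : alts nt true (g :: s) -> s != [::] -> Ii a b (pr (g :: s)) -> Ori g.
Proof.
move=> H Ns HI; have Eh := hd_side H; have F := alts_inF H.
case: (H) => Hg Ng Hs; have Fs := alts_inF Hs; have Nal : pr (g :: s) != 1.
  rewrite -base_eq; apply: contra Ng => /eqP E; rewrite -base_eq.
  move: Eh; rewrite E act_base; move: (fw g) => [|x w] // E'.
  by have := lc_gt0 x; rewrite -[lc x]E'.
have Hs1 : (3 * m + 2 <= hd (act (pr s) base))%N.
  case: s Hs Ns {H HI Eh F Fs Nal} => // y s Hs _; rewrite (hd_side Hs).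
  by case: Hs => H1 H2 _; exact: (hd_sd H1 H2).
have N2 : pr s != g^-1.
  apply: contraTneq Hs1 => ->; rewrite -ltnNge; apply: (@hd_in a); by rewrite inFVE.
have Ns1 : pr s != 1 by apply: contraTneq Hs1 => ->; rewrite act1g /hd /=; lia.
have := Ii_Sim HI; move/(_ g^-1); rewrite inFVE (sd_inF Hg) => /(_ isT).
rewrite /= -actM // mulKg /unl /= !inE !negb_or ![base == _]eq_sym !base_eq !act_base_eq.
have -> : (g * pr s == g^-1) = false.
  by rewrite -(inj_eq (mulgI g^-1)) mulKg; apply/negbTE; apply: contraTneq Hs1 => ->; rewrite -ltnNge; apply: (@hd_in a); rewrite inFM ?inFVE.
have -> : (g * pr s == pr s) = false.
  by rewrite -[X in _ == X]mul1g (inj_eq (mulIg _)) (negbTE Ng).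
rewrite /= in Nal; rewrite Nal Ns1 invg_eq1 Ng eq_sym N2 /=.
rewrite !C_base ?ok_act ?base_eq ?invg_eq1 //.
have Hg1 := hd_sd Hg Ng.
have Nd : act (g * pr s) base != act (pr s) base.
  by rewrite act_base_eq -[X in _ == X]mul1g (inj_eq (mulIg _)).
rewrite [X in _ == X](_ : _ = true); last first.
  rewrite LtE //= -[hd (act (g * _) _)]/(hd (act (pr (g :: s)) base)) Eh.
  by rewrite ltn_eqF; rewrite (leq_trans Hg1).
move=> /eqP HL; rewrite Ori_C //.
have <- : C base (act (g * pr s) base) (act g^-1 base) = C base (act g base) (act g^-1 base); last first.
  by rewrite C_base ?ok_act ?base_eq ?invg_eq1.
rewrite actM //.
have := @C_cone a m 1 g g^-1 base (act (pr s) base) base.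
rewrite !act1g; apply; rewrite ?inFVE ?ok_act //; try exact: outr_base.
- by rewrite eq_sym.
- by apply/eqP => E; case/eqP: Ng; apply: inv_fix.
- by rewrite invg_eq1.
by rewrite /outr; move: Hs1; clear; lia.
Qed.

(** By its orientation the loop does not return before the direction in which it leaves, and the
    directions of the right block are the last ones. *)
Lemma start_end g : Ii a b g -> (3 * m + 2 <= hd (act g base))%N -> (3 * m + 2 <= hd (act g^-1 base))%N.
Proof.
move=> HI H; have N : g != 1 by apply: contraTneq H => ->; rewrite act1g /hd /=; lia.
have := Ii_Ori HI N; rewrite /Ori LtE; last first.
  by rewrite act_base_eq; apply/eqP => /esym/inv_fix/eqP; rewrite (negbTE N).
by case: eqP => [<-|_] // /ltnW; apply: leq_trans.
Qed.

(* If the first syllable is [dl a c], no later passage joins the two sides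
   [a, c) and [c, m) at a vertex. *)
Lemma no_switch c v W1 x y W2 : (a < c <= m)%N -> inF a b v -> (3 * m + 2 <= hd (act v base))%N ->
  Ii a b (dl a c * v) -> fw (dl a c * v) = W1 ++ x :: y :: W2 ->
  (x.1 < m)%N -> (y.1 < m)%N -> (x.1 < c)%N = (y.1 < c)%N.
Proof.
move=> /andP[Hac Hcm] Fv Hv HI Ew Hx Hy; set d := dl a c in HI Ew *; set al := d * v in HI Ew.
have Fal := Ii_inF HI; have Hr := fgP al; rewrite Ew in Hr.
have E1 : W1 ++ x :: y :: W2 = rcons W1 x ++ y :: W2 by rewrite -cats1 -catA.
rewrite E1 in Hr; have R1 := reduced_catl Hr.
have R2 : reduced (y :: W2) by move: Hr; rewrite reduced_cat1 => /andP[].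
set u := mkF (rcons W1 x); set w := mkF (y :: W2).
have Eal : al = u * w by rewrite -mkF_cat -E1 -Ew mkF_fw.
have Fu' : fw u = rcons W1 x by rewrite /= red_id.
have Fw' : fw w = y :: W2 by have := red_id R2.
have : all (fun z : letter nat => (a <= z.1 < b)%N) (rcons W1 x ++ y :: W2) by rewrite -E1 -Ew.
rewrite all_cat => /andP[A1 A2].
have Fu : inF a b u by rewrite /inF Fu'.
have Fw : inF a b w by rewrite /inF Fw'.
have Hu : hd (act u^-1 base) = lc (linv x).
  by rewrite act_base fwV Fu' -cats1 winv_cat.
have Hw : hd (act w base) = lc y by rewrite act_base Fw'.
have Bx : (a <= x.1 < b)%N by move: A1; rewrite all_rcons => /andP[].
have By : (a <= y.1 < b)%N by move: A2 => /andP[].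
have Hcb : (c <= b)%N by apply: leq_trans Hcm _; case/andP: Hm.
have Fd : inF a b d by rewrite inF_dl.
have He : hd (act d^-1 base) = (3 * c + 1)%N.
  rewrite act_base /d -(subnKC (ltnW Hac)) fw_dlV; move: Hac; rewrite -subn_gt0.
  by case: (c - a)%N => // n _; rewrite upbS /hd /= /lc /=; clear; lia.
have Ltd p : okp p -> inP a b p -> p != base -> p != act d^-1 base -> (hd p < 3 * c + 2)%N -> Lt p (act d^-1 base).
  by move=> *; rewrite (@Lt_dlV a b) // ltnW.
have Lth p q : (hd p < hd q)%N -> Lt p q /\ Lt q p = false.
  move=> H; have N : p != q by apply: contraTneq H => ->; rewrite ltnn.
  have N' : q != p by rewrite eq_sym.
  by rewrite (LtE N) (LtE N') (ltn_eqF H) (gtn_eqF H) H [(hd q < _)%N]ltnNge (ltnW H).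
(* With the vertex between [x] and [y] as root, the loop runs from [u^-1] to [w], and the translate
   whose first syllable ends there runs from [d^-1] to [v]. If exactly one of [x], [y] has index
   below [c], these chords cross. *)
have := Ii_Sim HI; move/(_ (u * d^-1)); rewrite -(unl_act u^-1) ?ok_act // -!actM ?ok_act //.
have -> : inF a b (u * d^-1) by rewrite inFM ?inFVE.
have -> : u^-1 * al = w by rewrite Eal mulKg.
have -> : u^-1 * (u * d^-1) = d^-1 by rewrite mulKg.
have -> : d^-1 * al = v by rewrite mulKg.
move/(_ isT).
have Ltdu p : Lt p (act d^-1 base) -> p != act d^-1 base -> Lt (act d^-1 base) p = false.
  by move=> H N; apply/negbTE/negP => /(Lt_trans H); rewrite Lt_irr.
have Nu : u^-1 != 1 by rewrite invg_eq1 -fw_eq1 Fu' -size_eq0 size_rcons.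
have Nw : w != 1 by rewrite -fw_eq1 Fw'.
have Iu : inP a b (act u^-1 base) by apply: inP_act; rewrite ?inFVE.
have Iw : inP a b (act w base) by apply: inP_act.
have cx : (3 * x.1 + 2 <= lc (linv x) <= 3 * x.1 + 4)%N by clear; case: x => i []; rewrite /lc /=; lia.
have cy : (3 * y.1 + 2 <= lc y <= 3 * y.1 + 4)%N by clear; case: y => i []; rewrite /lc /=; lia.
have Nvd : v != d^-1 by apply: contraTneq Hv => ->; rewrite He; move: Hcm; clear; lia.
have Huv : (hd (act u^-1 base) < hd (act v base))%N by rewrite Hu; move: cx Hx Hv; clear; lia.
have Hwv : (hd (act w base) < hd (act v base))%N by rewrite Hw; move: cy Hy Hv; clear; lia.
have Hev : (hd (act d^-1 base) < hd (act v base))%N by rewrite He; move: Hcm Hv; clear; lia.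
have Nuv : u^-1 != v by apply: contraTneq Huv => ->; rewrite ltnn.
have Nwv : w != v by apply: contraTneq Hwv => ->; rewrite ltnn.
have [Lev Lve] := Lth _ _ Hev; have [Luv Lvu] := Lth _ _ Huv; have [Lwv Lvw] := Lth _ _ Hwv.
rewrite /unl /= !inE !negb_or !act_base_eq Nuv Nwv [d^-1 == _]eq_sym Nvd /=.
have [Px|Px] := ltnP x.1 c; have [Py|Py] := ltnP y.1 c => //.
- have Huw : (hd (act u^-1 base) < hd (act w base))%N by rewrite Hu Hw; move: Px Py cx cy; clear; lia.
  have Hew : (hd (act d^-1 base) < hd (act w base))%N by rewrite Hw He; move: Py cy; clear; lia.
  have [Luw Lwu] := Lth _ _ Huw; have [Lew Lwe] := Lth _ _ Hew.
  have -> : u^-1 != w by apply: contraTneq Huw => ->; rewrite ltnn.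
  have -> : w != d^-1 by apply: contraTneq Hew => ->; rewrite ltnn.
  have [E|N] := eqVneq u^-1 d^-1.
    case/eqP: Nwv; apply: (mulgI u); rewrite -Eal /al; congr (_ * _).
    by rewrite -[RHS]invgK E invgK.
  have Lue := Ltd _ (ok_act _ ok_base) Iu; rewrite base_eq act_base_eq Nu N in Lue.
  have {}Lue : Lt (act u^-1 base) (act d^-1 base).
    by apply: Lue => //; rewrite Hu; move: Px cx; clear; lia.
  have Leu : Lt (act d^-1 base) (act u^-1 base) = false by apply: Ltdu; rewrite ?act_base_eq.
  by rewrite /C /= ?Luw ?Lwu ?Lue ?Leu ?Lew ?Lwe ?Lwv ?Lvw ?Lvu ?Luv.
have Hwu : (hd (act w base) < hd (act u^-1 base))%N by rewrite Hu Hw; move: Px Py cx cy; clear; lia.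
have Heu : (hd (act d^-1 base) < hd (act u^-1 base))%N by rewrite Hu He; move: Px cx; clear; lia.
have [Lwu Luw] := Lth _ _ Hwu; have [Leu Lue] := Lth _ _ Heu.
have -> : u^-1 != w by apply: contraTneq Hwu => ->; rewrite ltnn.
have -> : u^-1 != d^-1 by apply: contraTneq Heu => ->; rewrite ltnn.
have [E|N] := eqVneq w d^-1.
  (* Here the chords share an end, and the orientation of the loop is contradicted instead. *)
  have Nal : al != 1 by rewrite -[1](mulgV d) /al (inj_eq (mulgI _)).
  have := Ii_Ori HI Nal; rewrite Ori_C // -(@C_act d^-1) ?ok_act //.
  - rewrite -!actM ?ok_act // /al mulKg -/al.
    have -> : d^-1 * al^-1 = u^-1 by rewrite Eal E invgM invgK mulKg.
    by rewrite /C ?Lev ?Lve ?Leu ?Lue ?Luv ?Lvu.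
  - by rewrite eq_sym base_eq.
  - by rewrite act_base_eq; apply/eqP => /esym/inv_fix/eqP; rewrite (negbTE Nal).
  - by rewrite base_eq invg_eq1.
have Lwe := Ltd _ (ok_act _ ok_base) Iw; rewrite base_eq act_base_eq Nw N in Lwe.
have {}Lwe : Lt (act w base) (act d^-1 base).
  by apply: Lwe => //; rewrite Hw; move: Py cy; clear; lia.
have Lew : Lt (act d^-1 base) (act w base) = false by apply: Ltdu; rewrite ?act_base_eq.
by rewrite /C /= ?Luw ?Lwu ?Lue ?Leu ?Lew ?Lwe ?Lwv ?Lvw ?Lvu ?Luv.
Qed.
End Syllables.

Lemma choice_fun (A B : Type) (R : A -> B -> Prop) :
  (forall x, exists y, R x y) -> exists f, forall x, R x (f x).
Proof.
move=> H; pose c x := ClassicalEpsilon.constructive_indefinite_description _ (H x).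
by exists (fun x => proj1_sig (c x)) => x; exact: proj2_sig (c x).
Qed.

(** * Braids that fix a product of generators *)

Definition rfl (a b : nat) (t : fg) : Prop :=
  exists u i, [/\ inF a b u, (a <= i < b)%N & t = u * X i * u^-1].

Lemma rflX a b i : (a <= i < b)%N -> rfl a b (X i).
Proof. by move=> Hi; exists 1, i; rewrite mul1g invg1 mulg1 inF1. Qed.
Lemma rfl_conj a b t g : inF a b g -> rfl a b t -> rfl a b (g * t * g^-1).
Proof. by move=> Fg [u [i [Fu Hi ->]]]; exists (g * u), i; rewrite inFM // invgM !mulgA. Qed.
Lemma rflS a b a' b' t : (a' <= a)%N -> (b <= b')%N -> rfl a b t -> rfl a' b' t.
Proof. by move=> Ha Hb [u [i [Fu Hi ->]]]; exists u, i; split=> //; [exact: inFS Fu|lia]. Qed.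
Lemma rfl_sg a b x t : (a <= x.1)%N -> (x.1.+1 < b)%N -> rfl a b t -> rfl a b (sg x t).
Proof.
move=> H1 H2 [u [i [Fu Hi ->]]]; rewrite !sgM sgV; apply: rfl_conj; first exact: inF_sg.
rewrite sgX /sgf; case: x H1 H2 => k [] /= H1 H2; case: (i =P k) => [Ei|_];
  [|case: (i =P k.+1) => [Ej|_]| |case: (i =P k.+1) => [Ej|_]]; try (by apply: rflX; lia).
- exists (X k.+1)^-1, k; rewrite invgK inFVE inFX; split=> //; lia.
- exists (X k), k.+1; rewrite inFX; split=> //; lia.
Qed.
Lemma rfl_aut a b w t : brw a b w -> rfl a b t -> rfl a b (aut w t).
Proof. by elim: w t => //= x w IH t /andP[/andP[H1 H2] Hw] Ht; apply: IH => //; apply: rfl_sg. Qed.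

Lemma size_red w : (size (red w) <= size w)%N.
Proof.
elim: w => //= x w IH; rewrite -/(red w); case: (red w) IH => [|y v] //= IH.
by case: ifP => _ /=; lia.
Qed.

Lemma rfl_word a b t : rfl a b t -> exists w j,
  [/\ fw t = w ++ (j, false) :: winv w, mkF w * X j * (mkF w)^-1 = t & (a <= j < b)%N].
Proof.
case=> u [i [Fu Hi ->]]; rewrite -(mkF_fw u); have := fgP u; move: (fw u) => {Fu}w.
elim/last_ind: w => [|w x IH] Hw; first by exists [::], i; split=> //; rewrite invg1 mulg1 mul1g.
have rw : reduced w by move: Hw; rewrite -cats1 => /reduced_catl.
have [E|N] := eqVneq x.1 i.
  have [w' [j [H1 H2 H3]]] := IH rw; exists w', j; split=> //.
    rewrite -H1; congr fw; rewrite -cats1 mkF_cat invgM !mulgA; congr (_ * _).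
    by rewrite -[mkF [:: x]]/(L x) [x]surjective_pairing E LX; case: x.2; rewrite ?mulgVK ?mulgK.
  rewrite H2 -cats1 mkF_cat invgM !mulgA; congr (_ * _).
  by rewrite -[mkF [:: x]]/(L x) [x]surjective_pairing E LX; case: x.2; rewrite ?mulgVK ?mulgK.
exists (rcons w x), i; split=> //.
have R : reduced (rcons w x ++ (i, false) :: winv (rcons w x)).
  have := reduced_winv Hw; rewrite reduced_cat1 -[rcons (rcons w x) _]cats1 cat_rcons reduced_cat1 Hw.
  rewrite -cats1 winv_cat /= => ->; rewrite !andbT (inj_eq (@linv_inj _)).
  by apply/andP; split; apply: contra N => /eqP E; [rewrite -[x]linvK -E|rewrite E].
by rewrite -mkF_winv XL -!mkF_cat -catA [fw _]/= red_id.
Qed.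

Lemma lcp (w v : word nat) : exists p w' v', [/\ w = p ++ w', v = p ++ v' &
  match w', v' with x :: _, y :: _ => x != y | _, _ => true end].
Proof.
elim: w v => [|x w IH] [|y v]; first by exists [::], [::], [::].
- by exists [::], [::], (y :: v).
- by exists [::], (x :: w), [::].
have [->|N] := eqVneq x y; last by exists [::], (x :: w), (y :: v).
by have [p [w' [v' [-> -> H]]]] := IH v; exists (y :: p), w', v'.
Qed.

Lemma reduced_join u v : reduced u -> reduced v ->
  (forall u' x y v', u = rcons u' x -> v = y :: v' -> y != linv x) -> reduced (u ++ v).
Proof.
case/lastP: u => // u x Hu; case: v => [|y v] Hv H; first by rewrite cats0.
rewrite reduced_cat1 Hv andbT -[rcons (rcons u x) _]cats1 cat_rcons reduced_cat1 Hu /= andbT.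
exact: H.
Qed.

Section Chain.
Variables (q : nat) (t : nat -> fg) (w : nat -> word nat) (j : nat -> nat).
Let x i : letter nat := (j i, false).
Let len (g : fg) := size (fw g).
Hypothesis ht : forall i, (i < q)%N -> fw (t i) = w i ++ x i :: winv (w i).

Let tE i : (i < q)%N -> t i = mkF (w i) * L (x i) * (mkF (w i))^-1.
Proof. by move=> Hi; rewrite -(mkF_fw (t i)) ht // mkF_cat mkF_cons mkF_winv mulgA. Qed.

Let len_conj v k : (len (mkF v * L (x k) * (mkF v)^-1)%g <= (size v).*2.+1)%N.
Proof.
rewrite -mkF_winv -!mkF_cat; apply: leq_trans (size_red _) _.
by rewrite !size_cat /winv size_rev size_map /=; lia.
Qed.
Let len_t i : (i < q)%N -> len (t i) = (size (w i)).*2.+1.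
Proof. by move=> Hi; rewrite /len ht // size_cat /= /winv size_rev size_map; lia. Qed.

(** When no Hurwitz move shortens a factor, neighbouring conjugators cancel without reaching the
    middle letters [x i], which all survive in the product. If its length is exactly the number of
    factors, every conjugator is therefore empty. *)
Lemma chain p : (p <= q)%N ->
  (forall i, (p <= i)%N -> (i.+1 < q)%N ->
     (len (t i.+1) <= len (t i * t i.+1 * (t i)^-1)%g)%N /\
     (len (t i) <= len ((t i.+1)^-1 * t i * t i.+1)%g)%N) ->
  let P := pr [seq t k | k <- iota p (q - p)] in
  ((p < q)%N -> exists r, fw P = w p ++ x p :: r) /\
  (q - p <= len P)%N /\ (len P = q - p -> forall k, (p <= k < q)%N -> w k = [::])%N.
Proof.
move Ed: (q - p)%N => d; elim: d p Ed => [|d IH] p Ed Hpq Hmin P.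
  by split; [lia|split=> // _ k; lia].
have Hp : (p < q)%N by lia.
have [|||] := IH p.+1; rewrite -/P; try lia; first by move=> i Hi; apply: Hmin; lia.
set P' := pr _ => HP [HL HW]; have EP : P = t p * P' by [].
have [Eq|Nq] := eqVneq p.+1 q.
  have d0 : d = 0%N by lia.
  rewrite EP /P' d0 mulg1; split=> [_|]; first by exists (winv (w p)); rewrite ht.
  split; first by rewrite len_t.
  rewrite len_t // => H k Hk; have -> : k = p by lia.
  by apply: size0nil; lia.
have Hp1 : (p.+1 < q)%N by lia.
have [r Er] := HP Hp1; have [M1 M2] := Hmin p (leqnn _) Hp1.
have [e [w' [v' [Ew Ev Hd]]]] := lcp (w p) (w p.+1).
set W := (w p ++ x p :: winv w') ++ (v' ++ x p.+1 :: r).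
have EW : P = mkF W.
  have A1 : t p = mkF (w p ++ x p :: winv w') * (mkF e)^-1.
    by rewrite -(mkF_fw (t p)) ht // -mkF_winv -mkF_cat -catA {2}Ew winv_cat.
  have A2 : P' = mkF e * mkF (v' ++ x p.+1 :: r).
    by rewrite -(mkF_fw P') Er Ev -mkF_cat -catA.
  by rewrite EP A1 A2 mulgA mulgVK -mkF_cat.
have rW : reduced W.
  apply: reduced_join.
  - have := fgP (t p); rewrite ht // {2}Ew winv_cat -cat_cons catA; exact: reduced_catl.
  - have := fgP P'; rewrite Er Ev -catA; elim: (e) => //= z s IHs H; apply: IHs; exact: reduced_behead H.
  move=> u' z y s Eu Es; apply/eqP => Ey.
  case: w' Ew Hd Eu {W EW} => [|z1 w'] Ew Hd Eu; case: v' Ev Hd Es => [|z2 v'] Ev Hd Es.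
  - move: Eu Es; rewrite cats1 => /rcons_inj[_ Ez] [E _].
    by move: Ey; rewrite -E -Ez /x /linv /= => -[].
  - move: Eu Es; rewrite cats1 => /rcons_inj[_ Ez] [E _].
    move: M1; rewrite len_t // (tE Hp) (tE Hp1) Ev Ew cats0 E Ey -Ez mkF_cat mkF_cons -LV.
    set A := mkF e; set B := mkF v'.
    have -> : A * L (x p) * A^-1 * (A * ((L (x p))^-1 * B) * L (x p.+1) * (A * ((L (x p))^-1 * B))^-1) *
       (A * L (x p) * A^-1)^-1 = mkF (e ++ v') * L (x p.+1) * (mkF (e ++ v'))^-1.
      by rewrite mkF_cat -/A -/B !invgM !invgK !mulgA !(mulgVK, mulgK).
    by have := len_conj (e ++ v') p.+1; rewrite !size_cat /=; lia.
  - move: Eu Es; rewrite winv_cons -cat_cons catA cats1 => /rcons_inj[_ Ez'] [E _].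
    move: Ey; rewrite -E -Ez' linvK => Ez.
    move: M2; rewrite len_t // (tE Hp) (tE Hp1) Ev Ew cats0 -Ez mkF_cat mkF_cons.
    set A := mkF e; set B := mkF w'.
    have -> : (A * L (x p.+1) * A^-1)^-1 * (A * (L (x p.+1) * B) * L (x p) * (A * (L (x p.+1) * B))^-1) *
       (A * L (x p.+1) * A^-1) = mkF (e ++ w') * L (x p) * (mkF (e ++ w'))^-1.
      by rewrite mkF_cat -/A -/B !invgM !invgK !mulgA !(mulgVK, mulgK).
    by have := len_conj (e ++ w') p; rewrite !size_cat /=; lia.
  move: Eu Es; rewrite winv_cons -cat_cons catA cats1 => /rcons_inj[_ E] [E' _].
  by case/eqP: Hd; rewrite E' Ey -E linvK.
have FP : fw P = W by rewrite EW /= red_id.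
have L1 : len P = (size (w p) + (size w').+1 + (len P' - size e))%N.
  by rewrite /len FP Er Ev !size_cat /= /winv size_rev size_map; lia.
have L2 : size (w p) = (size e + size w')%N by rewrite Ew size_cat.
have L3 : (size e <= len P')%N by rewrite /len Er Ev -catA size_cat leq_addr.
split=> [_|]; first by exists (winv w' ++ v' ++ x p.+1 :: r); rewrite FP /W -catA.
split; first by rewrite L1 L2; lia.
move=> E k Hk; have w0 : size w' = 0%N by lia.
have HW' := HW ltac:(lia).
have [->|Nk] := eqVneq k p; last by apply: HW'; lia.
have E1 := HW' p.+1 ltac:(lia); move: Ev Ew; rewrite E1 (size0nil w0) cats0.
by case: (e) => // _ ->.
Qed.

End Chain.

Lemma sum_step (f : nat -> nat) (f' : nat -> nat) p q i : (p <= i)%N -> (i.+1 < q)%N ->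
  (forall k, k != i -> k != i.+1 -> f' k = f k) ->
  (\sum_(p <= k < q) f' k + f i + f i.+1 = \sum_(p <= k < q) f k + f' i + f' i.+1)%N.
Proof.
move=> H1 H2 H; rewrite !(@big_cat_nat _ _ _ i p q) //=; try lia.
rewrite !(@big_ltn _ _ _ i q) 1?ltnW // !(@big_ltn _ _ _ i.+1 q) //.
have -> : (\sum_(p <= k < i) f' k = \sum_(p <= k < i) f k)%N.
  by apply: eq_big_nat => k Hk; apply: H; lia.
have -> : (\sum_(i.+2 <= k < q) f' k = \sum_(i.+2 <= k < q) f k)%N.
  by apply: eq_big_nat => k Hk; apply: H; lia.
by lia.
Qed.

Lemma fw_prX (s : seq nat) : fw (pr [seq X i | i <- s]) = [seq (i, false) | i <- s].
Proof.
have R : reduced [seq (i, false) | i <- s].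
  by elim: s => // i [|k s] //= ->; rewrite andbT; apply/eqP => -[].
by elim: s R => //= i s IH R; rewrite fw_catM IH ?(reduced_behead R).
Qed.

Lemma sgf0 i : sgf (i, false) i = X i * X i.+1 * (X i)^-1.
Proof. by rewrite /sgf /= eqxx. Qed.
Lemma sgf1 i : sgf (i, false) i.+1 = X i.
Proof. by rewrite /sgf /= eqxx (_ : (i.+1 == i) = false) //; lia. Qed.
Lemma sgf0V i : sgf (i, true) i = X i.+1.
Proof. by rewrite /sgf /= eqxx. Qed.
Lemma sgf1V i : sgf (i, true) i.+1 = (X i.+1)^-1 * X i * X i.+1.
Proof. by rewrite /sgf /= eqxx (_ : (i.+1 == i) = false) //; lia. Qed.

(* Artin's argument: a shortest factorization in the Hurwitz orbit has no
   cancellation between consecutive factors. *)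
Lemma aut_split a b w p q : brw a b w -> (a <= p)%N -> (q <= b)%N -> (p <= q)%N -> aut w (dl p q) = dl p q ->
  exists v, brw p q v /\ forall g, inF p q g -> aut w g = aut v g.
Proof.
move=> Hw Ha Hb Hpq Hd.
suff [v [Hv Ev]] : exists v, brw p q v /\ forall i, (p <= i < q)%N -> aut w (aut v (X i)) = X i.
  exists (binv v); rewrite brw_binv; split=> // g Fg.
  have E h : inF p q h -> aut w (aut v h) = h.
    elim/inF_ind: h / => [|x h Hx _ IH]; first by rewrite !aut1.
    by rewrite !autM IH; congr (_ * _); case: x Hx => i [] /= Hi; rewrite LX ?autV Ev.
  by rewrite -{1}(autVK v g) E // inF_aut // brw_binv.
pose M v := (\sum_(p <= i < q) size (fw (aut w (aut v (X i)))))%N.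
suff H n : forall v, brw p q v -> (M v < n)%N -> exists v', brw p q v' /\
    forall i, (p <= i < q)%N -> aut w (aut v' (X i)) = X i.
  exact: (H (M [::]).+1 [::]).
elim: n => // n IH v Hv Hn; pose t i := aut w (aut v (X i)).
have St e i : (p <= i)%N -> (i.+1 < q)%N -> brw p q ((i, e) :: v).
  by move=> H1 H2; rewrite /brw /= H1 H2.
have Mo e i : (p <= i)%N -> (i.+1 < q)%N -> let t' k := aut w (aut ((i, e) :: v) (X k)) in
    (M ((i, e) :: v) + size (fw (t i)) + size (fw (t i.+1)) = M v + size (fw (t' i)) + size (fw (t' i.+1)))%N.
  move=> H1 H2 t'; apply: (@sum_step (fun k => size (fw (t k))) (fun k => size (fw (t' k)))) => // k K1 K2.
  by rewrite /t' /= sgX sgf_id.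
have [[i [H1 H2 H3]]|Nmin] := Classical_Prop.classic (exists i, [/\ (p <= i)%N, (i.+1 < q)%N &
   (size (fw (t i * t i.+1 * (t i)^-1)%g) < size (fw (t i.+1)))%N \/
   (size (fw ((t i.+1)^-1 * t i * t i.+1)%g) < size (fw (t i)))%N]).
  case: H3 => H3.
    apply: (IH ((i, false) :: v)); first exact: St.
    have := Mo false i H1 H2; rewrite /= !sgX sgf0 sgf1 !autM !autV -/(t i) -/(t i.+1).
    by move: (size _) (size _) (size _) H3 => *; lia.
  apply: (IH ((i, true) :: v)); first exact: St.
  have := Mo true i H1 H2; rewrite /= !sgX sgf0V sgf1V !autM !autV -/(t i) -/(t i.+1).
  by move: (size _) (size _) (size _) H3 => *; lia.
exists v; split=> //; have rt i : (p <= i < q)%N -> rfl a b (t i).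
  move=> Hi; apply: rfl_aut Hw _; apply: (@rflS p q) => //; apply: rfl_aut Hv _; exact: rflX.
pose t0 i := if (p <= i < q)%N then t i else X i.
have [w' Hw'] : exists w' : nat -> word nat * nat, forall i,
    fw (t0 i) = (w' i).1 ++ ((w' i).2, false) :: winv (w' i).1.
  apply: (@choice_fun _ _ (fun i z => fw (t0 i) = z.1 ++ (z.2, false) :: winv z.1)) => i.
  rewrite /t0; case: ifP => [/rt/rfl_word[u [k [E _ _]]]|_]; first by exists (u, k).
  by exists ([::], i).
have := @chain q t0 (fun i => (w' i).1) (fun i => (w' i).2) (fun i _ => Hw' i) p Hpq.
have E0 i : (p <= i < q)%N -> t0 i = t i by rewrite /t0 => ->.
case=> [i H1 H2|_ [_ H]].
  rewrite !E0; try lia; split; rewrite leqNgt; apply/negP => H; apply: Nmin; exists i; split=> //; by [left|right].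
have EP : pr [seq t0 k | k <- iota p (q - p)] = dl p q.
  have -> : [seq t0 k | k <- iota p (q - p)] = [seq aut w (aut v x) | x <- xs p q].
    rewrite /xs -map_comp; apply/eq_in_map => i; rewrite mem_iota subnKC // => Hi /=.
    by rewrite E0.
  by rewrite map_comp -!aut_pr -/(dl p q) aut_dl.
have fd : fw (dl p q) = [seq (i, false) | i <- iota p (q - p)] by exact: fw_prX.
have {}H : forall k, (p <= k < q)%N -> (w' k).1 = [::].
  by apply: H; rewrite EP fd size_map size_iota.
have Et i : (p <= i < q)%N -> t0 i = X (w' i).2.
  by move=> Hi; apply: fg_inj; rewrite Hw' H.
have : [seq t0 k | k <- iota p (q - p)] = [seq X (w' k).2 | k <- iota p (q - p)].
  by apply/eq_in_map => i; rewrite mem_iota subnKC //; apply: Et.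
move/(congr1 (fun s => fw (pr s))); rewrite EP fd.
rewrite (map_comp X (fun k => (w' k).2)) fw_prX -map_comp.
move=> /eq_in_map Ei i Hi; rewrite -/(t i) -E0 // Et //; congr X.
have Hi' : i \in iota p (q - p) by rewrite mem_iota subnKC.
by have /= [<-] := Ei i Hi'.
Qed.

(** * Congruences and normal forms in free products *)

Definition rel := fg -> fg -> Prop.
Definition cong (E : rel) : Prop :=
  [/\ forall g, E g g, forall g h, E g h -> E h g, forall g h k, E g h -> E h k -> E g k
    & forall g g' h h', E g g' -> E h h' -> E (g * h) (g' * h')].

Section Cong.
Variables (E : rel) (EC : cong E).
Lemma c_refl g : E g g. Proof. by case: EC. Qed.
Lemma c_sym g h : E g h -> E h g. Proof. by case: EC => _ + _ _; apply. Qed.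
Lemma c_trans g h k : E g h -> E h k -> E g k. Proof. by case: EC => _ _ + _; apply. Qed.
Lemma c_mul g g' h h' : E g g' -> E h h' -> E (g * h) (g' * h'). Proof. by case: EC => _ _ _; apply. Qed.
Lemma c_inv g h : E g h -> E g^-1 h^-1.
Proof.
move=> H; have := c_mul (c_mul (c_refl g^-1) (c_sym H)) (c_refl h^-1).
by rewrite -mulgA mulgV mulg1 mulVg mul1g; apply.
Qed.
Lemma c_eq g h : g = h -> E g h. Proof. by move=> ->; apply: c_refl. Qed.
Lemma c_mulI g h k : E (g * h) (g * k) -> E h k.
Proof. by move/(c_mul (c_refl g^-1)); rewrite !mulKg. Qed.
Lemma c_Imul g h k : E (h * g) (k * g) -> E h k.
Proof. by move=> H; have := c_mul H (c_refl g^-1); rewrite !mulgK. Qed.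
Lemma c_div g h : E g h <-> E (g^-1 * h) 1.
Proof.
split=> [H|H]; first by have := c_mul (c_inv H) (c_refl h); rewrite mulVg; apply.
by apply/c_sym; have := c_mul (c_refl g) H; rewrite mulVKg mulg1.
Qed.
Lemma c_hom f f' g : (forall x, x \in fw g -> E (f x.1) (f' x.1)) -> E (hom f g) (hom f' g).
Proof.
rewrite hom.unlock; elim: (fw g) => [|x w IH] H /=; first exact: c_refl.
apply: c_mul; last by apply: IH => y Hy; apply: H; rewrite inE Hy orbT.
have := H x (mem_head _ _); rewrite /evl; case: x.2 => //; exact: c_inv.
Qed.
Lemma c_aut a b w w' : (forall i, (a <= i < b)%N -> E (aut w (X i)) (aut w' (X i))) ->
  forall g, inF a b g -> E (aut w g) (aut w' g).
Proof.
move=> H g Fg; rewrite !aut_hom; apply: c_hom => x Hx; apply: H.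
exact: (allP Fg).
Qed.
End Cong.

Definition nz (E : rel) (g : fg) : Prop := ~ E g 1.

(* E restricts to the free product of its restrictions to the two blocks. *)
Definition FP (E : rel) a m b : Prop :=
  forall c s, alts a m b (nz E) c s -> E (pr s) 1 -> s = [::].

Fixpoint eqs (E : rel) (s t : seq fg) : Prop :=
  match s, t with
  | x :: s', y :: t' => E x y /\ eqs E s' t'
  | [::], [::] => True
  | _, _ => False
  end.

Lemma eqs_size E s t : eqs E s t -> size s = size t.
Proof. by elim: s t => [|x s IH] [|y t] //= [_ /IH->]. Qed.

Lemma nz_inv E g : cong E -> nz E g -> nz E g^-1.
Proof. by move=> EC H H'; apply: H; have := c_inv EC H'; rewrite invgK invg1. Qed.

(** At the first disagreement, the reversed inverse of one normal form followed by the other, with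
    at most one pair of syllables merged, would be a non-empty alternating product equal to 1. *)
Lemma nf_uniq E a m b c s c' t : (a <= m <= b)%N -> cong E -> FP E a m b ->
  alts a m b (nz E) c s -> alts a m b (nz E) c' t -> E (pr s) (pr t) ->
  eqs E s t /\ (s != [::] -> c = c').
Proof.
move=> Hm EC HF; elim: s c c' t => [|x s IH] c c' t Hs Ht HE.
  by have -> := HF c' t Ht (c_sym EC HE).
case: t Ht HE => [|y t] Ht HE; first by have := HF c (x :: s) Hs HE.
have HE' : E ((pr (x :: s))^-1 * pr (y :: t)) 1 by apply: (c_div EC _ _).1.
have [Ec|Nc] := eqVneq c c'; last first.
  have /(HF _ _) : alts a m b (nz E) (c (+) ~~ odd (size (x :: s))) (rev [seq z^-1 | z <- x :: s] ++ (y :: t)).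
    apply/alts_cat; split; first by apply: alts_rev => // z; apply: nz_inv.
    rewrite size_rev size_map; have -> : c (+) ~~ odd (size (x :: s)) (+) odd (size (x :: s)) = c'.
      by move: Nc; case: (c) (c') => [] [] //=; case: (odd _).
    exact: Ht.
  rewrite pr_cat pr_rev => /(_ HE') /(congr1 size); rewrite size_cat /=; lia.
subst c'; case: (Hs) (Ht) => Hx Nx Hs' [Hy Ny Ht'].
have [Exy|Nxy] := Classical_Prop.classic (E x y).
  have [|H _] := IH (~~ c) (~~ c) t Hs' Ht'; last by split=> //; split.
  apply: (c_mulI EC (g := x)); apply: (c_trans EC HE).
  by apply: c_mul => //; [apply: c_sym|apply: c_refl].
have /(HF _ _) : alts a m b (nz E) (~~ c (+) ~~ odd (size s)) (rev [seq z^-1 | z <- s] ++ (x^-1 * y) :: t).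
  apply/alts_cat; split; first by apply: alts_rev => // z; apply: nz_inv.
  rewrite size_rev size_map; have -> : ~~ c (+) ~~ odd (size s) (+) odd (size s) = c.
    by case: (c); case: (odd _).
  split=> //; first by apply: sdM; rewrite ?sdV.
  by move/((c_div EC _ _).2).
rewrite pr_cat pr_rev /= !mulgA -invgM -mulgA => /(_ HE') /(congr1 size); rewrite size_cat /=; lia.
Qed.

Lemma FP_sub E a m b a' b' : (a <= a' <= m)%N -> (m <= b' <= b)%N -> FP E a m b -> FP E a' m b'.
Proof.
move=> Ha Hb HF c s Hs; apply: (HF c); elim: s c Hs => //= x s IH c [H1 H2 H3]; split=> //; last exact: IH.
by case: (c) H1; apply: inFS; lia.
Qed.

Definition syl a m b r g : Prop :=
  exists s, [/\ (size s <= r)%N, all (fun x => inF a m x || inF m b x) s & g = pr s].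

Lemma syl_alts a m b r g : syl a m b r g -> exists c s, [/\ alts a m b nt c s, (size s <= r)%N & g = pr s].
Proof.
case=> s [Hs Ha ->]; suff [c [t [H1 H2 H3]]] : exists c t, [/\ alts a m b nt c t, (size t <= size s)%N & pr s = pr t].
  by exists c, t; rewrite (leq_trans H2 Hs).
elim: s {Hs} Ha => [_|x s IH /= /andP[Hx /IH[c [t [Ht Hst ->]]]]]; first by exists true, [::].
have [->|Nx] := eqVneq x 1; first by exists c, t; rewrite mul1g leqW.
have [c' Hc] : exists c', sd a m b c' x by case/orP: Hx => H; [exists true|exists false].
have [E|N] := eqVneq c' c; last first.
  by exists c', (x :: t); split=> //; split=> //; move: N Ht; case: (c) (c') => [] [].
subst c'; case: t Ht Hst => [|y t] Ht Hst; first by exists c, [:: x].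
case: Ht => Hy Ny Ht; have [E|N] := eqVneq (x * y) 1.
  by exists (~~ c), t; rewrite /= mulgA E mul1g; split=> //; move: Hst => /=; lia.
by exists c, ((x * y) :: t); rewrite /= mulgA; split=> //; [split=> //; apply: sdM|exact: leqW].
Qed.

Lemma syl_all a m b g : (a <= m <= b)%N -> inF a b g -> exists r, syl a m b r g.
Proof.
move=> Hm; elim/inF_ind: g / => [|x g Hx _ [r [s [H1 H2 ->]]]]; first by exists 0%N, [::].
exists r.+1, (L x :: s); split=> //=; rewrite H2 andbT !inFL; lia.
Qed.

(** * Reflection length and pan-transitivity *)

(** Required of [dl a b] only; for partial products and their braid images, the length follows by
    completing a factorization to one of [dl a b]. *)
Definition Len (E : rel) a b : Prop :=
  forall s, (forall x, x \in s -> rfl a b x) -> E (dl a b) (pr s) -> (b - a <= size s)%N.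
Definition Inv (E : rel) a b : Prop := forall i, (a <= i < b)%N -> E (X i * X i) 1.
Definition base_rel E a b : Prop := [/\ cong E, Inv E a b & Len E a b].
(** Pan-transitivity for those factorizations that are braid images of consecutive generators. *)
Definition PT (E : rel) a b : Prop := forall p q w1 w2, (a <= p <= q)%N -> (q <= b)%N ->
  brw a b w1 -> brw a b w2 -> E (aut w1 (dl p q)) (aut w2 (dl p q)) ->
  exists v, brw p q v /\ forall i, (p <= i < q)%N -> E (aut w1 (aut v (X i))) (aut w2 (X i)).
(** The form of transitivity that suits the induction on syllables: it speaks of loops instead of
    tuples of factors. *)
Definition Star (E : rel) a b : Prop := forall g h, Ii a b g -> Ii a b h -> E g h ->
  exists w, [/\ brw a b w, forall k, inF a b k -> E (aut w k) k & aut w g = h].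

Lemma xs_rfl a b p q x : (a <= p)%N -> (q <= b)%N -> x \in xs p q -> rfl a b x.
Proof.
move=> Ha Hb; rewrite /xs => /mapP[i]; rewrite mem_iota => Hi ->; apply: rflX; lia.
Qed.
Lemma size_xs p q : size (xs p q) = (q - p)%N.
Proof. by rewrite size_map size_iota. Qed.

Lemma aut_xs_rfl a b w p q x : brw a b w -> (a <= p)%N -> (q <= b)%N ->
  x \in [seq aut w y | y <- xs p q] -> rfl a b x.
Proof. by move=> Hw Ha Hb /mapP[y /(xs_rfl Ha Hb) Hy ->]; apply: rfl_aut. Qed.

Lemma Len_sub E a b a' b' : (a <= a' <= b')%N -> (b' <= b)%N -> cong E -> Len E a b -> Len E a' b'.
Proof.
move=> Ha Hb EC HL s Hs HE.
suff : (b - a <= size (xs a a' ++ s ++ xs b' b))%N by rewrite !size_cat !size_xs; set k := size s; lia.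
apply: HL.
- move=> x; rewrite !mem_cat => /or3P[|/Hs|]; [apply: xs_rfl; lia|apply: rflS; lia|apply: xs_rfl; lia].
- rewrite !pr_cat -!/(dl _ _) (@dl_cat a a' b) ?(@dl_cat a' b' b); try lia.
  by apply: c_mul => //; [apply: c_refl|apply: c_mul => //; apply: c_refl].
Qed.

Lemma base_sub E a b a' b' : (a <= a' <= b')%N -> (b' <= b)%N -> base_rel E a b -> base_rel E a' b'.
Proof.
move=> Ha Hb [EC HI HL]; split=> //; last exact: Len_sub HL.
by move=> i Hi; apply: HI; lia.
Qed.
Lemma PT_sub E a b a' b' : (a <= a')%N -> (b' <= b)%N -> PT E a b -> PT E a' b'.
Proof.
by move=> Ha Hb H p q w1 w2 Hp Hq H1 H2 HE; apply: H => //; [lia|lia|apply: brwS H1|apply: brwS H2].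
Qed.

Lemma Len_pair E a b w w' c c' : base_rel E a b -> brw a b w -> brw a b w' -> (a <= c <= b)%N ->
  (a <= c' <= b)%N -> E (aut w (dl a c)) (aut w' (dl a c')) -> (c' <= c)%N.
Proof.
move=> [EC _ HL] Hw Hw' Hc Hc' HE.
suff : (b - a <= size ([seq aut w y | y <- xs a c] ++ [seq aut w' y | y <- xs c' b]))%N.
  by rewrite size_cat !size_map !size_iota; lia.
apply: HL.
- by move=> x; rewrite mem_cat => /orP[]; apply: aut_xs_rfl => //; lia.
- rewrite pr_cat -!aut_pr -!/(dl _ _) -{1}(aut_dl Hw') (@dl_cat a c' b) // autM.
  by apply: c_mul => //; [apply: c_sym|apply: c_refl].
Qed.

Lemma Ii_nz E a b g : base_rel E a b -> Ii a b g -> g != 1 -> nz E g.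
Proof.
move=> HB [w [c [Hw Hc ->]]] N HE.
have : (c <= a)%N; last by rewrite -dl_eq1 => /eqP H; rewrite H aut1 eqxx in N.
apply: (Len_pair (w := [::]) (w' := w) HB) => //; first by rewrite leqnn (leq_trans _ (proj2 (andP Hc))) ?(proj1 (andP Hc)).
by rewrite dl_nil // aut1; apply: c_sym HE; case: HB.
Qed.

(** [PT] is applied to the image of [dl a c] and to that of its complement [dl c b]; the two braids
    act on disjoint intervals and combine into one. *)
Lemma PT_Star E a b : base_rel E a b -> PT E a b -> Star E a b.
Proof.
move=> HB HP g h [w1 [c [H1 Hc ->]]] [w2 [c' [H2 Hc' ->]]] HE.
have EC : cong E by case: HB.
have Ec : c' = c by apply/eqP; rewrite eqn_leq (Len_pair HB H1 H2 Hc Hc' HE) (Len_pair HB H2 H1 Hc' Hc (c_sym EC HE)).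
move: HE; rewrite Ec => HE; case/andP: (Hc) => Hac Hcb.
have HE2 : E (aut w1 (dl c b)) (aut w2 (dl c b)).
  apply: (c_mulI EC (g := aut w1 (dl a c))); rewrite -autM -dl_cat // aut_dl //.
  apply: (c_trans EC (h := aut w2 (dl a c) * aut w2 (dl c b))).
    by rewrite -autM -dl_cat // aut_dl //; apply: c_refl.
  by apply: c_mul => //; [apply: c_sym|apply: c_refl].
have [|v1 [Hv1 K1]] := HP a c w1 w2 _ Hcb H1 H2 HE; first by rewrite leqnn.
have [|v2 [Hv2 K2]] := HP c b w1 w2 _ (leqnn b) H1 H2 HE2; first by rewrite Hac.
have Bv1 : brw a b v1 by apply: brwS Hv1.
have Bv2 : brw a b v2 by apply: brwS Hv2.
have K x : inF a b x -> E (aut (v1 ++ v2 ++ w1) x) (aut w2 x).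
  apply: c_aut => // i Hi; rewrite !aut_cat; have [Hic|Hci] := ltnP i c.
    rewrite (@aut_id a c c b v2) //; first by apply: K1; lia.
    + by rewrite inF_aut // inFX; lia.
    by rewrite leqnn orbT.
  rewrite (@autX_id a c v1) //; last lia.
  by apply: K2; lia.
have Hv : brw a b (binv (v1 ++ v2 ++ w1) ++ w2) by rewrite brw_cat brw_binv !brw_cat Bv1 Bv2 H1.
exists (binv (v1 ++ v2 ++ w1) ++ w2); split=> //.
  move=> k Fk; rewrite aut_cat; apply: (c_sym EC); rewrite -{1}(autVK (v1 ++ v2 ++ w1) k); apply: K.
  by rewrite inF_aut // brw_binv !brw_cat Bv1 Bv2.
rewrite aut_cat; congr aut; apply: (aut_inj (w := v1 ++ v2 ++ w1)); rewrite autVK.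
by rewrite !aut_cat (aut_dl Hv1) (@aut_id a c c b v2) ?inF_dl // leqnn orbT.
Qed.

Lemma move_seg a b p q : (a <= p <= q)%N -> (q <= b)%N ->
  exists w, brw a b w /\ forall i, (a <= i < a + (q - p))%N -> aut w (X i) = X (i + (p - a)).
Proof.
move=> /andP[Ha Hpq] Hb; move Ed: (p - a)%N => d; elim: d p q Ed Ha Hpq Hb => [|d IH] p q Ed Ha Hpq Hb.
  by exists [::]; split=> // i _; rewrite addn0.
have [||||w [Hw E]] := IH p.-1 q.-1; try lia.
exists (w ++ upb p.-1 (q - p)); split.
  by rewrite brw_cat Hw brw_upb; lia.
move=> i Hi; rewrite aut_cat E; last lia.
by rewrite aut_upb; [congr X|]; lia.
Qed.

Lemma aut_dl_seg w p q d : (forall i, (p <= i < q)%N -> aut w (X i) = X (i + d)) ->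
  aut w (dl p q) = dl (p + d) (q + d).
Proof.
move=> H; rewrite /dl aut_pr /xs -map_comp; congr pr; rewrite subnDr (addnC p d) iotaDl -map_comp.
by apply/eq_in_map => i; rewrite mem_iota => Hi /=; rewrite H ?(addnC d) //; lia.
Qed.

Lemma Ii_seg a b p q w : (a <= p <= q)%N -> (q <= b)%N -> brw a b w -> Ii a b (aut w (dl p q)).
Proof.
move=> Hp Hq Hw; apply: Ii_aut => //; have [v [Hv E]] := move_seg Hp Hq.
exists v, (a + (q - p))%N; split=> //; first lia.
by rewrite (aut_dl_seg E); congr dl; lia.
Qed.

Lemma Ii_compl a b g : Ii a b g -> Ii a b (g^-1 * dl a b).
Proof.
case=> [w [c [Hw Hc ->]]]; rewrite -(aut_dl Hw) -autV -autM (dl_cat Hc) mulKg.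
by apply: Ii_seg => //; lia.
Qed.

(** The braid [w1 ++ k ++ binv w2] fixes [dl p q] in the free group itself, so by [aut_split] it
    acts on that interval as a braid of the interval. *)
Lemma Star_PT E a b : cong E -> Star E a b -> PT E a b.
Proof.
move=> EC HS p q w1 w2 Hp Hq H1 H2 HE.
have [k [Hk K1 K2]] := HS _ _ (Ii_seg Hp Hq H1) (Ii_seg Hp Hq H2) HE.
have Hw : brw a b (w1 ++ k ++ binv w2) by rewrite !brw_cat brw_binv H1 Hk.
have [||||v [Hv Ev]] := @aut_split a b _ p q Hw; try lia.
  by rewrite !aut_cat K2 autK.
exists (binv v); rewrite brw_binv; split=> // i Hi.
have Fi : inF p q (aut (binv v) (X i)) by rewrite inF_aut ?brw_binv // inFX.
have Fi' : inF a b (aut w1 (aut (binv v) (X i))) by rewrite inF_aut //; apply: inFS Fi; lia.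
apply: (c_trans EC (c_sym EC (K1 _ Fi'))); apply: c_eq => //.
have := Ev _ Fi; rewrite autVK !aut_cat => /(congr1 (aut w2)); rewrite autVK //.
Qed.

(** * Free products of congruences *)

(** Equality in the free product of the quotients of the two blocks by [E]. *)
Inductive Gen (E : rel) (a m b : nat) : rel :=
| Gen_base c g h : sd a m b c g -> sd a m b c h -> E g h -> Gen E a m b g h
| Gen_refl g : Gen E a m b g g
| Gen_sym g h : Gen E a m b g h -> Gen E a m b h g
| Gen_trans g h k : Gen E a m b g h -> Gen E a m b h k -> Gen E a m b g k
| Gen_mul g g' h h' : Gen E a m b g g' -> Gen E a m b h h' -> Gen E a m b (g * h) (g' * h').

Lemma Gen_cong E a m b : cong (Gen E a m b).
Proof. by split=> [g|g h|g h k|g g' h h']; [exact: Gen_refl|exact: Gen_sym|exact: Gen_trans|exact: Gen_mul]. Qed.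

Lemma Gen_le E a m b g h : cong E -> Gen E a m b g h -> E g h.
Proof.
move=> EC; elim=> [c x y _ _ //|x|x y _|x y z _ + _|x x' y y' _ + _].
- exact: c_refl.
- exact: c_sym.
- exact: c_trans.
exact: c_mul.
Qed.

(* Van der Waerden's action on normal forms: a state lists the syllables,
   tagged by their block and replaced by class representatives. *)
Section NormalForms.
Variables (E : rel) (a m b : nat).
Hypotheses (Hm : (a <= m <= b)%N) (EC : cong E).
Notation sd := (sd a m b).

Definition state := seq (bool * fg).
Definition rep (c : bool) (g : fg) : fg :=
  ClassicalEpsilon.epsilon (inhabits 1) (fun h => sd c h /\ E g h).
Definition triv (g : fg) : bool :=
  if ClassicalEpsilon.excluded_middle_informative (E g 1) then true else false.

Lemma trivP g : reflect (E g 1) (triv g).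
Proof. by rewrite /triv; case: ClassicalEpsilon.excluded_middle_informative => H; constructor. Qed.

Lemma triv_eq g h : E g h -> triv g = triv h.
Proof.
move=> H; apply/trivP/trivP => H'; apply: c_trans H' => //; by apply: c_sym.
Qed.

Lemma repP c g : sd c g -> sd c (rep c g) /\ E g (rep c g).
Proof.
move=> Hg; apply: (ClassicalEpsilon.epsilon_spec (inhabits 1) (fun h => sd c h /\ E g h)).
by exists g; split=> //; apply: c_refl.
Qed.
(** Extensionality makes the chosen representative depend only on the class, so that states can be
    compared by plain equality. *)
Lemma rep_eq c g h : E g h -> rep c g = rep c h.
Proof.
move=> H; rewrite /rep; congr ClassicalEpsilon.epsilon.
apply: FunctionalExtensionality.functional_extensionality => k.
apply: PropExtensionality.propositional_extensionality.
by split=> -[H1 H2]; split=> //; apply: (c_trans EC) H2 => //; apply: c_sym.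
Qed.

Definition hdt (s : state) : option bool := if s is (c, _) :: _ then Some c else None.
Definition spl (c : bool) (s : state) : fg * state :=
  if s is (c', x) :: s' then (if c' == c then (x, s') else (1, s)) else (1, s).
Definition cns (c : bool) (g : fg) (s : state) : state :=
  if triv g then s else (c, rep c g) :: s.
Definition op (c : bool) (g : fg) (s : state) : state :=
  cns c (g * (spl c s).1) (spl c s).2.

Fixpoint valid (s : state) : Prop :=
  if s is (c, x) :: s' then [/\ sd c x, ~~ triv x, rep c x = x, hdt s' != Some c & valid s'] else True.

Lemma spl_valid c s : valid s ->
  [/\ sd c (spl c s).1, hdt (spl c s).2 != Some c, valid (spl c s).2 & cns c (spl c s).1 (spl c s).2 = s].
Proof.
have T1 : triv 1 by apply/trivP; apply: c_refl.
case: s => [|[c' x] s] /=; first by rewrite /cns T1 sd1.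
case=> H1 H2 H3 H4 H5; have [<-|N] := eqVneq c' c; rewrite /cns /=.
  by rewrite (negbTE H2) H3.
rewrite T1; split=> //; first exact: sd1.
Qed.

Lemma cns_valid c g s : sd c g -> hdt s != Some c -> valid s -> valid (cns c g s).
Proof.
move=> Hg Hs Vs; rewrite /cns; case: ifP => //= T; have [H1 H2] := repP Hg.
by split=> //; [rewrite -(triv_eq H2) T|rewrite -(rep_eq c H2)].
Qed.

Lemma op_valid c g s : sd c g -> valid s -> valid (op c g s).
Proof.
by move=> Hg Vs; have [H1 H2 H3 _] := spl_valid c Vs; apply: cns_valid => //; apply: sdM.
Qed.

Lemma op_cns c g h s : sd c h -> hdt s != Some c -> op c g (cns c h s) = cns c (g * h) s.
Proof.
move=> Hh Hs; rewrite /op /cns; case: (trivP h) => [T|_].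
  have -> : spl c s = (1, s) by case: s Hs => [|[c' x] s] //= N; rewrite ifN //; apply: contra N => /eqP->.
  have H : E (g * 1) (g * h) by apply: c_mul => //; [apply: c_refl|apply: c_sym].
  by rewrite /= (triv_eq H) (rep_eq c H).
have [H1 H2] := repP Hh; rewrite /= eqxx /=.
have H : E (g * rep c h) (g * h) by apply: c_mul => //; [apply: c_refl|apply: c_sym].
by rewrite (triv_eq H) (rep_eq c H).
Qed.

Lemma opM c g h s : sd c h -> valid s -> op c (g * h) s = op c g (op c h s).
Proof.
move=> Hh Vs; have [H1 H2 _ _] := spl_valid c Vs.
by rewrite {3}/op op_cns ?mulgA //; apply: sdM.
Qed.
Lemma op1 c s : valid s -> op c 1 s = s.
Proof. by move=> Vs; have [_ _ _ H] := spl_valid c Vs; rewrite /op mul1g. Qed.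

Definition opl (x : letter nat) (s : state) : state :=
  if (a <= x.1 < b)%N then op (x.1 < m)%N (L x) s else s.
Definition opw (w : word nat) (s : state) : state := foldr opl s w.

Lemma sdL (x : letter nat) : (a <= x.1 < b)%N -> sd (x.1 < m)%N (L x).
Proof. by move=> H; rewrite /sd; case: ltnP => H1; rewrite inFL; lia. Qed.

Lemma opl_valid x s : valid s -> valid (opl x s).
Proof. by move=> Vs; rewrite /opl; case: ifP => // H; apply: op_valid => //; apply: sdL. Qed.
Lemma opw_valid w s : valid s -> valid (opw w s).
Proof. by move=> Vs; elim: w => //= x w; apply: opl_valid. Qed.
Lemma oplK x s : valid s -> opl x (opl (linv x) s) = s.
Proof.
move=> Vs; rewrite /opl -[(linv x).1]/(x.1); case: ifP => H; last by rewrite H.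
have Hx : sd (x.1 < m)%N (L (linv x)) by apply: (@sdL (linv x)).
by rewrite H -opM // -LV mulgV op1.
Qed.
Lemma opw_push x w s : valid s -> opw (push x w) s = opl x (opw w s).
Proof.
move=> Vs; case: w => //= y w; case: eqP => //= ->.
by rewrite oplK //; apply: opw_valid.
Qed.
Lemma opw_red w s : valid s -> opw (red w) s = opw w s.
Proof. by move=> Vs; elim: w => //= x w IH; rewrite opw_push // IH. Qed.

Definition opg (g : fg) (s : state) : state := opw (fw g) s.
Lemma opgM g h s : valid s -> opg (g * h) s = opg g (opg h s).
Proof. by move=> Vs; rewrite /opg fwM opw_red // /opw foldr_cat. Qed.
Lemma opg_sd c g s : sd c g -> valid s -> opg g s = op c g s.
Proof.
move=> Hg Vs; rewrite /opg; have := Hg; rewrite sd_all -{3}(mkF_fw g).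
elim: (fw g) => [_|x w IH /= /andP[Hx Hw]] /=; first by rewrite op1.
have Ex : (x.1 < m)%N = c by move: Hx; rewrite /lside; case: (c); lia.
have Hw' : sd c (mkF w) by rewrite sd_all; apply: all_red.
have Hab : (a <= x.1 < b)%N by move: Hx Hm; rewrite /lside; case: (c); lia.
by rewrite IH // /opl Hab Ex mkF_cons opM.
Qed.

Lemma Gen_opg g h s : Gen E a m b g h -> valid s -> opg g s = opg h s.
Proof.
move=> H; elim: H s => {g h} [c g h Hg Hh H|g|g h _ IH|g h k _ IH1 _ IH2|g g' h h' _ IH1 _ IH2] s Vs //.
- rewrite (opg_sd Hg) // (opg_sd Hh) // /op /cns.
  have H' : E (g * (spl c s).1) (h * (spl c s).1) by apply: c_mul => //; apply: c_refl.
  by rewrite (triv_eq H') (rep_eq c H').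
- by rewrite IH.
- by rewrite IH1 // IH2.
by rewrite !opgM // IH2 // IH1 //; apply: opw_valid.
Qed.

(** Acting on the empty state, a non-empty alternating product leaves a state headed by the block of
    its first syllable. *)
Lemma FP_Gen : FP (Gen E a m b) a m b.
Proof.
move=> c s Hs H; have := Gen_opg H (s := [::]) I; rewrite /(opg 1) /=.
suff : hdt (opg (pr s) [::]) = if s is [::] then None else Some c by case: s {Hs H} => // x s; move=> + E1; rewrite E1.
elim: s c Hs {H} => // x s IH c [Hx Nx Hs].
have V : valid (opg (pr s) [::]) by apply: opw_valid.
rewrite /= opgM // (opg_sd Hx) // /op.
have -> : spl c (opg (pr s) [::]) = (1, opg (pr s) [::]).
  have := IH _ Hs; case: (opg _ _) => // -[c' y] s0 /=.
  by case: (s) => // _ _ [->]; case: (c).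
rewrite /= mulg1 /cns; case: (trivP x) => // T; case: Nx.
by apply: (Gen_base (c := c)); rewrite ?sd1.
Qed.
End NormalForms.

(** * Equivalent simple loops *)

Definition linked (E : rel) a b g h : Prop :=
  exists w, [/\ brw a b w, forall k, inF a b k -> E (aut w k) k & aut w g = h].

Definition pmI a b g : Prop := Ii a b g \/ Ii a b g^-1.

Lemma pmI_nz E a b g : base_rel E a b -> pmI a b g -> g != 1 -> nz E g.
Proof.
move=> HB [HI|HI] N; first exact: Ii_nz HI N.
have := Ii_nz HB HI; rewrite invg_eq1 => /(_ N) Hn HE; apply: Hn.
by case: HB => EC _ _; have := c_inv EC HE; rewrite invg1.
Qed.

Lemma pmI_sub a b a' b' g : (a <= a' <= b')%N -> (b' <= b)%N -> inF a' b' g -> pmI a b g -> pmI a' b' g.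
Proof.
by move=> Ha Hb Fg [HI|HI]; [left|right]; apply: Ii_sub HI => //; rewrite inFVE.
Qed.

(** [t] completes the loop to [dl a b] on the right, and its conjugate [t'] on the left; [nomix]
    needs both. *)
Lemma Ii_factor a b w c : brw a b w -> (a <= c <= b)%N ->
  exists s t t', [/\ aut w (dl a c) = pr s, size s = (c - a)%N,
    dl a b = pr s * pr t /\ dl a b = pr t' * pr s, size t = (b - c)%N /\ size t' = (b - c)%N &
    forall x, [|| x \in s, x \in t | x \in t'] -> rfl a b x].
Proof.
move=> Hw Hc; pose s := [seq aut w y | y <- xs a c]; pose t := [seq aut w y | y <- xs c b].
have Es : aut w (dl a c) = pr s by rewrite -aut_pr.
have Et : aut w (dl c b) = pr t by rewrite -aut_pr.
have Ed : dl a b = pr s * pr t by rewrite -Es -Et -autM -dl_cat // aut_dl.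
have Fs : inF a b (pr s) by rewrite -Es inF_aut // inF_dl // (proj2 (andP Hc)).
exists s, t, [seq pr s * x * (pr s)^-1 | x <- t]; split=> //.
- by rewrite size_map size_xs.
- split=> //; suff -> : pr [seq pr s * x * (pr s)^-1 | x <- t] = pr s * pr t * (pr s)^-1 by rewrite mulgVK.
  by elim: (t) => [|x u IH] /=; rewrite ?mulg1 ?mulgV // IH !mulgA mulgVK.
- by rewrite !size_map size_iota.
have Ht x : x \in t -> rfl a b x by apply: aut_xs_rfl; lia.
move=> x /or3P[|/Ht //|/mapP[y /Ht Hy ->]]; last exact: rfl_conj.
by apply: aut_xs_rfl; lia.
Qed.

Lemma rfl_inF a b x : rfl a b x -> inF a b x.
Proof. by case=> u [i [Fu Hi ->]]; rewrite !inFM ?inFVE ?inFX. Qed.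

Lemma rfl_sq E a b x : cong E -> Inv E a b -> rfl a b x -> E (x * x) 1.
Proof.
move=> EC HI [u [i [Fu Hi ->]]]; have -> : u * X i * u^-1 * (u * X i * u^-1) = u * (X i * X i) * u^-1.
  by rewrite !mulgA mulgVK.
rewrite -[1](mulgV u) -[X in E _ (X / _)]mulg1.
by apply: c_mul => //; [apply: c_mul => //; [exact: c_refl|exact: HI]|exact: c_refl].
Qed.

Lemma pr_inF a b s : (forall x, x \in s -> rfl a b x) -> inF a b (pr s).
Proof.
elim: s => //= x s IH H; apply: inFM; first by apply/rfl_inF/H/mem_head.
by apply: IH => y Hy; apply: H; rewrite inE Hy orbT.
Qed.

(** With [x] the first factor and [s] the product of the others, the square is [x * s * x^-1] times
    [x * x * s], and [x * x] is trivial modulo [E]. *)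
Lemma sq_short E a b s : cong E -> Inv E a b -> s != [::] -> (forall x, x \in s -> rfl a b x) ->
  exists t, [/\ size t = ((size s).-1 + (size s).-1)%N, forall x, x \in t -> rfl a b x & E (pr s * pr s) (pr t)].
Proof.
case: s => // x s EC HI _ H; have Hx := H x (mem_head _ _).
have Hs y : y \in s -> rfl a b y by move=> Hy; apply: H; rewrite inE Hy orbT.
exists ([seq x * y * x^-1 | y <- s] ++ s); split.
- by rewrite size_cat size_map.
- by move=> y; rewrite mem_cat => /orP[/mapP[z /Hs Hz ->]|/Hs //]; apply: rfl_conj => //; apply: rfl_inF.
rewrite pr_cat; have -> : pr [seq x * y * x^-1 | y <- s] = x * pr s * x^-1.
  by elim: (s) => [|y u IH] /=; rewrite ?mulg1 ?mulgV // IH !mulgA mulgVK.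
rewrite [pr (x :: s)]/= mulgA; apply: c_mul => //; last exact: c_refl.
apply: c_mul => //; first exact: c_refl.
have := c_mul EC (c_refl EC x^-1) (rfl_sq EC HI Hx); rewrite mulKg mulg1 //.
Qed.

(** The product of two loops of adjacent blocks has the sum of their lengths as its length. If they
    were equal modulo [E], this product would be a square, which [sq_short] makes shorter; if they
    were inverse, it would be trivial. *)
Lemma nomix E a c b x y : base_rel E a b -> (a <= c <= b)%N -> pmI a c x -> x != 1 -> pmI c b y ->
  E x y -> False.
Proof.
move=> HB Hc; have [EC HI HL] := HB; move=> Hx Nx Hy HE.
wlog Hx' : x y Hx Nx Hy HE / Ii a c x.
  move=> H; case: Hx => Hx; first by apply: (H x y) => //; left.
  apply: (H x^-1 y^-1) => //; rewrite ?invg_eq1 //; [by left| |exact: c_inv].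
  by case: Hy => Hy; [right; rewrite invgK|left].
have Ny : y != 1.
  apply/eqP => Ey; apply: (pmI_nz HB _ Nx); last by rewrite -Ey.
  left; case: Hx' => w [e [Hw He ->]]; exists w, e; split=> //; [apply: brwS Hw|]; lia.
case: Hx' HE Nx => w [e [Hw He ->]] HE Nx.
have [Ha|He'] := leqP e a; first by case/eqP: Nx; rewrite dl_nil ?aut1.
have [s [t [t' [Es Ss [D1 D2] [St St'] R]]]] := Ii_factor Hw He.
have Sp : exists y0 e0 w0, [/\ y0 = y \/ y0 = y^-1, brw c b w0, (c <= e0 <= b)%N & y0 = aut w0 (dl c e0)].
  by case: Hy => -[w0 [e0 [H1 H2 H3]]]; [exists y, e0, w0; split=> //; left|exists y^-1, e0, w0; split=> //; right].
have [y0 [e0 [w0 [Ey0 Hw0 He0 E0]]]] := Sp.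
have Ce : (c < e0)%N.
  rewrite ltnNge; apply/negP => H; move: E0; rewrite dl_nil // aut1 => E1.
  by case: Ey0 => H'; move: Ny; rewrite -?(invg_eq1 y) -H' E1 eqxx.
have [s0 [t0 [t0' [Es0 Ss0 [D3 D4] [St0 St0'] R0]]]] := Ii_factor Hw0 He0.
have Rx z : [|| z \in s, z \in t | z \in t'] -> rfl a b z by move/R; apply: rflS; lia.
have Rx0 z : [|| z \in s0, z \in t0 | z \in t0'] -> rfl a b z by move/R0; apply: rflS; lia.
have Rs z : z \in s -> rfl a b z by move=> H; apply: Rx; rewrite H.
have Rs0 z : z \in s0 -> rfl a b z by move=> H; apply: Rx0; rewrite H.
have HLen u : (forall z, z \in u -> rfl a b z) -> E (pr s * pr s0) (pr u) -> ((e - a) + (e0 - c) <= size u)%N.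
  move=> Ru Hu; suff : (b - a <= size (t' ++ u ++ t0))%N.
    by rewrite !size_cat St' St0; set k := size u; lia.
  apply: HL => [z|]; first by rewrite !mem_cat => /or3P[H|/Ru //|H]; [apply: Rx|apply: Rx0]; rewrite H ?orbT.
  rewrite (dl_cat Hc) D2 D3 !pr_cat -!mulgA; apply: c_mul => //; first exact: c_refl.
  by rewrite !mulgA; apply: c_mul => //; exact: c_refl.
rewrite Es in HE; rewrite Es0 in E0.
case: Ey0 => Ey0.
  have HE0 : E (pr s) (pr s0) by rewrite -E0 Ey0.
  have [Hle|Hlt] := leqP (e - a) (e0 - c).
    have [|u [Su Ru Eu]] := @sq_short E a b s EC HI _ Rs; first by rewrite -size_eq0 Ss; lia.
    have : E (pr s * pr s0) (pr u).
      by apply: (c_trans EC) Eu; apply: c_mul => //; [exact: c_refl|exact: c_sym].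
    by move/(HLen u Ru); rewrite Su Ss; lia.
  have [|u [Su Ru Eu]] := @sq_short E a b s0 EC HI _ Rs0; first by rewrite -size_eq0 Ss0; lia.
  have : E (pr s * pr s0) (pr u) by apply: (c_trans EC) Eu; apply: c_mul => //; exact: c_refl.
  by move/(HLen u Ru); rewrite Su Ss0; lia.
have HE0 : E (pr s * pr s0) 1.
  by rewrite -E0 Ey0 -[1](mulgV y); apply: c_mul => //; exact: c_refl.
have N0 (z : fg) : z \in [::] -> rfl a b z by [].
by have /= := HLen [::] N0 HE0; lia.
Qed.

Lemma linked_extl E a m b w : (a <= m <= b)%N -> cong E -> brw a m w ->
  (forall k, inF a m k -> E (aut w k) k) -> forall k, inF a b k -> E (aut w k) k.
Proof.
move=> Hm EC Hw H k Fk; apply: (c_aut EC (w' := [::]) _ Fk) => i Hi /=.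
have [Him|Hmi] := ltnP i m; first by apply: H; rewrite inFX; lia.
by rewrite (autX_id Hw) ?ltnNge ?Hmi ?andbF //; apply: c_refl.
Qed.

(** The congruence pulled back along a braid: it compensates for a braid applied to the loops in
    order to make their first syllable straight. *)
Definition twist (E : rel) w : rel := fun g h => E (aut w g) (aut w h).

Lemma twist_cong E w : cong E -> cong (twist E w).
Proof.
move=> EC; split=> [g|g h|g h k|g g' h h']; rewrite /twist ?autM.
- exact: c_refl.
- exact: c_sym.
- exact: c_trans.
exact: c_mul.
Qed.

Lemma rfl_inv_sq E a b x : base_rel E a b -> rfl a b x -> E (x * x) 1.
Proof. by case=> EC HI _; apply: rfl_sq. Qed.

Lemma twist_base E a b w : brw a b w -> base_rel E a b -> base_rel (twist E w) a b.
Proof.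
move=> Hw HB; have [EC HI HL] := HB; split; first exact: twist_cong.
  move=> i Hi; rewrite /twist autM aut1; apply: rfl_inv_sq HB _.
  exact: rfl_aut Hw (rflX Hi).
move=> s Hs; rewrite /twist aut_dl // aut_pr => /HL; rewrite size_map; apply.
by move=> x /mapP[y /Hs Hy ->]; apply: rfl_aut.
Qed.

Lemma twist_PT E a b w : brw a b w -> PT E a b -> PT (twist E w) a b.
Proof.
move=> Hw HP p q w1 w2 Hp Hq H1 H2; rewrite /twist -!aut_cat => /HP.
case=> //; rewrite ?brw_cat ?H1 ?H2 // => v [Hv Ev]; exists v; split=> // i Hi.
by have := Ev i Hi; rewrite !aut_cat.
Qed.

Lemma twist_PTr E a m b w : (a <= m)%N -> cong E -> brw a m w -> PT E m b -> PT (twist E w) m b.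
Proof.
move=> Ham EC Hw HP p q w1 w2 /andP[Hp Hpq] Hq H1 H2.
have K v g : brw m b v -> inF m b g -> aut w (aut v g) = aut v g.
  by move=> Hv Fg; apply: (aut_id (a := m) (b := b) _ Hw); rewrite ?inF_aut // leqnn.
rewrite /twist !K ?inF_dl // => /HP [|//|//|//|v [Hv Ev]]; first by rewrite Hp.
exists v; split=> // i Hi; have Fi : inF m b (X i) by rewrite inFX; lia.
have Fi' : inF m b (aut v (X i)) by rewrite inF_aut //; apply: brwS Hv.
by rewrite !K //; apply: Ev.
Qed.

Lemma alts_aut a m b (T : fg -> Prop) c s w : (a <= m <= b)%N -> brw a m w \/ brw m b w ->
  (forall x, T x -> T (aut w x)) -> alts a m b T c s -> alts a m b T c [seq aut w x | x <- s].
Proof.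
move=> Hm Hw HT; elim: s c => //= x s IH c [H1 H2 H3]; split; [|exact: HT|exact: IH].
by case: Hw => Hw; case: (c) H1 => H1 /=; first [by rewrite inF_aut | by rewrite (aut_id H1 Hw) // leqnn ?orbT].
Qed.

Lemma nt_aut w x : nt x -> nt (aut w x).
Proof. by apply: contra => /eqP E; rewrite -(autK w x) E aut1. Qed.

Lemma twist_FP E a m b w : (a <= m <= b)%N -> brw a m w -> FP E a m b -> FP (twist E w) a m b.
Proof.
move=> Hm Hw HF c s Hs; rewrite /twist aut1 aut_pr => /HF H.
apply: size0nil; rewrite -(size_map (aut w)) (H c) //.
elim: s c Hs {H} => //= x s IH c [H1 H2 H3]; split; last exact: IH.
  by case: (c) H1 => H1 /=; first [by rewrite inF_aut | by rewrite (aut_id H1 Hw) // leqnn ?orbT].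
by rewrite /nz /twist aut1 in H2.
Qed.

Lemma alts_pmI a m b c s : (a <= m <= b)%N -> alts a m b nt c s -> Ii a b (pr s) ->
  forall x, x \in s -> x != 1 /\ exists c', sd a m b c' x /\
    pmI (if c' then a else m) (if c' then m else b) x.
Proof.
move=> Hm Hs HI x Hx; case/splitPr: Hx Hs HI => s1 s2 Hs HI.
have [H1 H2] := syllable_I Hm Hs HI; split; last by exists (c (+) odd (size s1)).
by case/alts_cat: Hs => _ [].
Qed.

Lemma alts_nz E a m b c s : (a <= m <= b)%N -> base_rel E a b -> alts a m b nt c s -> Ii a b (pr s) ->
  alts a m b (nz E) c s.
Proof.
move=> Hm HB Hs HI; apply: alts_imp (Hs) => x Hx _.
have [N [c' [_ H]]] := alts_pmI Hm Hs HI Hx.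
by apply: pmI_nz N; [apply: base_sub HB|exact: H]; case: (c'); lia.
Qed.

Lemma Ii_first a m b x s : (a <= m <= b)%N -> alts a m b nt true (x :: s) -> s != [::] ->
  Ii a b (pr (x :: s)) -> Ii a m x.
Proof.
move=> Hm Hs Ns HI; have O := first_Ori Hm Hs Ns HI.
have [H1 []] // := syllable_I (s1 := [::]) Hm Hs HI.
by case: Hs => _ Nx _ /Ii_Ori; rewrite invg_eq1 Nx Ori_inv // O => /(_ isT).
Qed.

Lemma in_flatten_split (T : eqType) (x : T) (f : T -> word nat) s : x \in s ->
  exists U V, flatten [seq f y | y <- s] = U ++ f x ++ V.
Proof.
case/splitPr => s1 s2; exists (flatten [seq f y | y <- s1]), (flatten [seq f y | y <- s2]).
by rewrite map_cat flatten_cat.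
Qed.

Lemma same_side a c m (u : word nat) : all (fun x : letter nat => (a <= x.1 < m)%N) u ->
  (forall U x y V, u = U ++ x :: y :: V -> (x.1 < c)%N = (y.1 < c)%N) ->
  all (fun x : letter nat => (a <= x.1 < c)%N) u \/ all (fun x : letter nat => (c <= x.1 < m)%N) u.
Proof.
elim: u => [|x u IH]; first by left.
move=> /= /andP[Hx Hu] H; case: IH => // [U y z V E||]; first by apply: (H (x :: U)); rewrite E.
- case: u Hu H => [|y u] Hu H /= Hy; first by have [H1|H1] := ltnP x.1 c; [left|right]; lia.
  have := H [::] x y u erefl; case/andP: Hy => H1 ->; left; lia.
case: u Hu H => [|y u] Hu H /= Hy; first by have [H1|H1] := ltnP x.1 c; [left|right]; lia.
have := H [::] x y u erefl; case/andP: Hy => H1 ->; right; lia.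
Qed.

Lemma later_syllables a c m b s x : (a < c <= m)%N -> (m <= b)%N -> s != [::] -> alts a m b nt false s ->
  Ii a b (dl a c * pr s) -> x \in s -> inF a m x -> inF a c x \/ inF c m x.
Proof.
move=> Hc Hmb Ns Hs HI Hx Fx; case/andP: (Hc) => Hac Hcm.
have Hm : (a <= m <= b)%N by lia.
have Hs' : alts a m b nt true (dl a c :: s).
  by split=> //; [rewrite /sd inF_dl|rewrite /nt dl_eq1 -ltnNge].
have Hhd : (3 * m + 2 <= hd (act (pr s) base))%N.
  by case: (s) Hs Ns => // y s0 H _; rewrite (hd_side Hm H); case: H => H1 H2 _; exact: (hd_sd Hm H1 H2).
have Fx' := Fx; apply: same_side Fx _ => U y z V E.
have [U' [V' E']] := in_flatten_split fw Hx.
have A1 : all (fun t : letter nat => (a <= t.1 < m)%N) (U ++ y :: z :: V) by rewrite -E.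
have [Hy Hz] : (y.1 < m)%N /\ (z.1 < m)%N.
  by move: A1; rewrite all_cat => /andP[_ /= /and3P[/andP[_ H1] /andP[_ H2] _]].
apply: (@no_switch a m b Hm c (pr s) (fw (dl a c) ++ U' ++ U) y z (V ++ V') Hc (alts_inF Hm Hs) Hhd HI) => //.
by rewrite -[dl a c * _]/(pr (dl a c :: s)) (alts_fw Hm Hs') /= E' E -!catA.
Qed.

(** [nomix] excludes that equal syllables lie on different sides of [c], so each equality of
    syllables already holds inside one of the blocks [[a, c)] and [[c, b)]. *)
Lemma Gen_eqs E a m c b s t : (a <= c <= m)%N -> (m <= b)%N -> base_rel E a m ->
  (forall x, x \in s -> inF a m x -> [/\ x != 1, pmI a m x & inF a c x \/ inF c m x]) ->
  (forall x, x \in t -> inF a m x -> [/\ x != 1, pmI a m x & inF a c x \/ inF c m x]) ->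
  forall d, alts a m b nt d s -> alts a m b nt d t -> eqs E s t -> Gen E a c b (pr s) (pr t).
Proof.
move=> Hc Hmb HB; elim: s t => [|x s IH] [|y t] //=; first by move=> *; apply: Gen_refl.
move=> Hs Ht d [Hx Nx Hs'] [Hy Ny Ht'] [Exy Est]; apply: Gen_mul; last first.
  apply: (IH t _ _ (~~ d)) => // z Hz; first by apply: Hs; rewrite inE Hz orbT.
  by apply: Ht; rewrite inE Hz orbT.
case: d Hx Hy {Hs' Ht'} => /= Hx Hy; last first.
  by apply: (Gen_base (c := false)) => //=; [apply: inFS Hx|apply: inFS Hy]; lia.
have [_ Ix Dx] := Hs x (mem_head _ _) Hx; have [_ Iy Dy] := Ht y (mem_head _ _) Hy.
have EC : cong E by case: HB.
have S1 z : inF a c z -> pmI a m z -> pmI a c z by apply: pmI_sub; lia.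
have S2 z : inF c m z -> pmI a m z -> pmI c m z by apply: pmI_sub; lia.
case: Dx => Dx; case: Dy => Dy.
- by apply: (Gen_base (c := true)).
- by case: (nomix HB Hc (S1 _ Dx Ix) Nx (S2 _ Dy Iy) Exy).
- by case: (nomix HB Hc (S1 _ Dy Iy) Ny (S2 _ Dx Ix) (c_sym EC Exy)).
by apply: (Gen_base (c := false)) => //=; [apply: inFS Dx|apply: inFS Dy]; lia.
Qed.

Lemma Gen_base_rel E a c b : (a <= c <= b)%N -> base_rel E a b -> base_rel (Gen E a c b) a b.
Proof.
move=> Hc [EC HI HL]; split; first exact: Gen_cong.
  move=> i Hi; have [Hic|Hci] := ltnP i c.
    by apply: (Gen_base (c := true)); rewrite /= ?inFM ?inFX ?inF1 //; [lia|lia|exact: HI].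
  by apply: (Gen_base (c := false)); rewrite /= ?inFM ?inFX ?inF1 //; [lia|lia|exact: HI].
by move=> s Hs /(Gen_le EC); apply: HL.
Qed.

Lemma Gen_PT E a c b d : (a <= c <= b)%N -> cong E -> PT E (if d then a else c) (if d then c else b) ->
  PT (Gen E a c b) (if d then a else c) (if d then c else b).
Proof.
move=> Hc EC HP p q w1 w2 Hp Hq H1 H2 HE.
have [v [Hv Ev]] := HP p q w1 w2 Hp Hq H1 H2 (Gen_le EC HE); exists v; split=> // i Hi.
have Fi : inF p q (X i) by rewrite inFX.
have S g : inF p q g -> inF (if d then a else c) (if d then c else b) g.
  by apply: inFS => //; case/andP: Hp.
apply: (Gen_base (c := d)); last exact: Ev.
  by have := S _ (etrans (inF_aut _ Hv) Fi); rewrite -(inF_aut _ H1) /sd; case: (d).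
by have := S _ Fi; rewrite -(inF_aut _ H2) /sd; case: (d).
Qed.

Definition loops_linked n : Prop := forall E a m b, (b - a < n)%N -> (a <= m <= b)%N ->
  base_rel E a b -> PT E a m -> PT E m b -> FP E a m b -> Star E a b.

(** Only the syllables of the first loop are bounded. [E] and [m] are quantified because the
    induction step replaces both. *)
Definition linked_upto n r : Prop := forall E a m b g h, (b - a < n)%N -> (a <= m <= b)%N ->
  base_rel E a b -> PT E a m -> PT E m b -> FP E a m b ->
  Ii a b g -> Ii a b h -> syl a m b r g -> E g h -> linked E a b g h.

Lemma Ii_alts a m b g : (a <= m <= b)%N -> Ii a b g -> exists c s, alts a m b nt c s /\ g = pr s.
Proof.
move=> Hm /Ii_inF/(syl_all Hm)[r /syl_alts[c [s [H1 _ H2]]]]; by exists c, s.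
Qed.

(* If both loops begin with [dl a c], their complements have fewer syllables
   with respect to the splitting at c. *)
Lemma linked_straight n r E a m b c s t : loops_linked n -> linked_upto n.+1 r ->
  (b - a < n.+1)%N -> (a <= m <= b)%N -> (a < c <= m)%N -> base_rel E a b -> PT E a m -> PT E m b -> FP E a m b ->
  Ii a b (dl a c * pr s) -> Ii a b (dl a c * pr t) -> alts a m b nt false s -> alts a m b nt false t ->
  eqs E s t -> s != [::] -> (size s <= r)%N -> linked E a b (dl a c * pr s) (dl a c * pr t).
Proof.
move=> IHn IHr Hn Hm Hc HB HP1 HP2 HF HIs HIt Hs Ht HE Ns Hr.
have [EC HI HL] := HB; case/andP: (Hc) => Hac Hcm; case/andP: (Hm) => Ham Hmb.
have Hc' : (a <= c <= m)%N by rewrite (ltnW Hac).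
have Hcb : (a <= c <= b)%N by rewrite (ltnW Hac) (leq_trans Hcm).
have Nt : t != [::] by rewrite -size_eq0 -(eqs_size HE) size_eq0.
have Later u : u != [::] -> alts a m b nt false u -> Ii a b (dl a c * pr u) ->
    forall x, x \in u -> inF a m x -> [/\ x != 1, pmI a m x & inF a c x \/ inF c m x].
  move=> Nu Hu Iu x Hx Fx; have Hu' : alts a m b nt true (dl a c :: u).
    by split=> //; [rewrite /sd inF_dl|rewrite /nt dl_eq1 -ltnNge].
  have [|N [c' [H1 H2]]] := alts_pmI Hm Hu' Iu (x := x); first by rewrite inE Hx orbT.
  split=> //; last exact: (later_syllables Hc Hmb Nu Hu Iu Hx Fx).
  case: c' H1 H2 => //= H1 _; case/eqP: N; apply: fg_inj.
  move: Fx H1; rewrite /inF; case: (fw x) => // y w /= /andP[/andP[_ A1] _] /andP[/andP[A2 _] _].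
  by move: A1 A2; clear; lia.
have HBm : base_rel E a m by apply: base_sub HB => //; rewrite Ham leqnn.
have HG : Gen E a c b (dl a c * pr s) (dl a c * pr t).
  apply: Gen_mul; first exact: Gen_refl.
  exact: (Gen_eqs Hc' Hmb HBm (Later s Ns Hs HIs) (Later t Nt Ht HIt) Hs Ht HE).
have GC := Gen_cong E a c b.
have HG2 : Gen E a c b ((dl a c * pr s)^-1 * dl a b) ((dl a c * pr t)^-1 * dl a b).
  by apply: (c_mul GC); [exact: (c_inv GC)|exact: c_refl].
(* In the complement the first syllable [dl a c] cancels, and the inverse of the next one, which
   lies in [[m, b)], merges with [dl c b]. *)
have Hsyl : syl a c b r ((dl a c * pr s)^-1 * dl a b).
  case: (s) Ns Hs Hr (Later s Ns Hs HIs) => // x u _ [Hx _ Hu] Hr Lu.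
  exists (rev [seq y^-1 | y <- u] ++ [:: x^-1 * dl c b]); split.
  - by rewrite size_cat size_rev size_map addn1.
  - rewrite all_cat all_rev all_map; apply/andP; split; last first.
      rewrite /= andbT; apply/orP; right; apply: inFM; last exact: inF_dl.
      by rewrite inFVE; apply: inFS Hx.
    apply/allP => y Hy /=; rewrite !inFVE; have [_ [c' Hc2]] := alts_in Hu Hy.
    case: c' Hc2 => /= Fy; last by apply/orP; right; apply: inFS Fy.
    have [|_ _ [->//|F]] := Lu y _ Fy; first by rewrite inE Hy orbT.
    by apply/orP; right; apply: inFS F.
  by rewrite pr_cat pr_rev /= mulg1 (dl_cat Hcb) !invgM -!mulgA mulKg.
(* The interval [[c, b)] is shorter since [a < c], so the outer induction applies to it, still split
   at [m]. *)
have HPc : PT E c b.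
  apply: (Star_PT EC); apply: (IHn E c m b); rewrite ?Hcm //; first by lia.
  - by apply: base_sub HB; lia.
  - by apply: PT_sub HP1; lia.
  - by apply: FP_sub HF; lia.
have HPa : PT E a c by apply: PT_sub HP1.
have [w [Hw W1 W2]] := IHr _ a c b _ _ Hn Hcb (Gen_base_rel Hcb HB) (Gen_PT (d := true) Hcb EC HPa)
  (Gen_PT (d := false) Hcb EC HPc) (FP_Gen Hcb EC) (Ii_compl HIs) (Ii_compl HIt) Hsyl HG2.
exists w; split=> //; first by move=> k /W1/(Gen_le EC).
have K g : g = dl a b * (g^-1 * dl a b)^-1 by rewrite invgM invgK mulVKg.
by rewrite (K (dl a c * pr s)) (K (dl a c * pr t)) autM autV W2 (aut_dl Hw).
Qed.

Lemma linked_trans E a b g g' h : cong E -> linked E a b g g' -> linked E a b g' h -> linked E a b g h.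
Proof.
move=> EC [w [H1 H2 H3]] [w' [H1' H2' H3']]; exists (w ++ w'); rewrite brw_cat H1 aut_cat H3; split=> //.
move=> k Fk; rewrite aut_cat; apply: (c_trans EC) (H2 k Fk); apply: H2'.
by rewrite inF_aut.
Qed.

Lemma linked_twist E a b w g h : brw a b w -> linked (twist E w) a b (aut (binv w) g) (aut (binv w) h) ->
  linked E a b g h.
Proof.
move=> Hw [v [H1 H2 H3]]; exists (binv w ++ v ++ w); split.
- by rewrite !brw_cat brw_binv Hw H1.
- by move=> k Fk; rewrite !aut_cat -{2}(autVK w k); apply: H2; rewrite inF_aut // brw_binv.
by rewrite !aut_cat H3 autVK.
Qed.

(** If there are later syllables, the first syllables are loops of [[a, m)] by [Ii_first]. [PT_Star]
    makes them equal, a pull-back of the congruence makes them straight, and [linked_straight]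
    applies. *)
Lemma linked_start n r E a m b s h : loops_linked n -> linked_upto n.+1 r ->
  (b - a < n.+1)%N -> (a <= m <= b)%N -> base_rel E a b -> PT E a m -> PT E m b -> FP E a m b ->
  Ii a b (pr s) -> Ii a b h -> alts a m b nt true s -> (size s <= r.+1)%N -> E (pr s) h -> s != [::] ->
  linked E a b (pr s) h.
Proof.
move=> IHn IHr Hn Hm HB HP1 HP2 HF HIs HIt Hs Hr HE Ns.
have [EC HI HL] := HB; case/andP: (Hm) => Ham Hmb.
have [c [t [Ht Eh]]] := Ii_alts Hm HIt; rewrite {h}Eh in HIt HE *.
have [Est Ec] := nf_uniq Hm EC HF (alts_nz Hm HB Hs HIs) (alts_nz Hm HB Ht HIt) HE.
rewrite -(Ec Ns) in Ht => {c Ec}.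
have HBm : base_rel E a m by apply: base_sub HB => //; rewrite Ham leqnn.
have St := PT_Star HBm HP1.
case: s Ns Hs HIs Hr HE Est => // x s _ Hs HIs Hr HE.
case: t Ht HIt HE => // y t Ht HIt HE [Exy Est].
have ext w : brw a m w -> (forall k, inF a m k -> E (aut w k) k) -> forall k, inF a b k -> E (aut w k) k.
  by move=> Hw; apply: linked_extl.
have S1 w : brw a m w -> brw a b w by apply: brwS.
case: (Hs) (Ht) => Fx Nx Hs' [Fy Ny Ht'].
have [E0|Ns] := eqVneq s [::].
  have Et0 : t = [::] by apply: size0nil; rewrite -(eqs_size Est) E0.
  rewrite E0 Et0 /= !mulg1 in HIs HIt *.
  have [||w [Hw W1 W2]] := St x y _ _ Exy; try by apply: Ii_sub (_ : Ii a b _) => //; rewrite Ham leqnn.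
  by exists w; split=> //; [exact: S1|exact: ext].
have Nt : t != [::] by rewrite -size_eq0 -(eqs_size Est) size_eq0.
have Ix := Ii_first Hm Hs Ns HIs; have Iy := Ii_first Hm Ht Nt HIt.
have [w [Hw W1 W2]] := St x y Ix Iy Exy.
apply: (linked_trans EC (g' := aut w (pr (x :: s)))).
  by exists w; split=> //; [exact: S1|exact: ext].
case: Iy => v [c [Hv Hc Ey]]; apply: (linked_twist (S1 _ Hv)).
have Hac : (a < c)%N.
  by rewrite ltnNge -dl_eq1; apply: contra Ny => /eqP E1; rewrite Ey E1 aut1.
pose f z := aut (binv v) (aut w z).
have Hv' : brw a m (binv v) by rewrite brw_binv.
have Ef : aut (binv v) (aut w (pr (x :: s))) = dl a c * pr [seq f z | z <- s].
  by rewrite /= !autM W2 Ey autK !aut_pr -map_comp.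
have Eg : aut (binv v) (pr (y :: t)) = dl a c * pr [seq aut (binv v) z | z <- t].
  by rewrite /= autM {1}Ey autK aut_pr.
rewrite Ef Eg; apply: (linked_straight (r := r) (m := m) IHn IHr Hn Hm).
- lia.
- by apply: twist_base => //; apply: S1.
- exact: twist_PT.
- exact: twist_PTr Ham EC Hv HP2.
- exact: twist_FP.
- by rewrite -Ef; do 2?apply: Ii_aut => //; apply: S1.
- by rewrite -Eg; apply: Ii_aut => //; apply: S1.
- rewrite /f map_comp; apply: alts_aut => //; [by left|exact: nt_aut|].
  by apply: alts_aut => //; [by left|exact: nt_aut].
- by apply: alts_aut => //; [by left|exact: nt_aut].
- have Fs : all (inF a b) s.
    by apply/allP => z Hz; have [_ [c' H]] := alts_in Hs' Hz; apply: sd_inF H.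
  elim: s t Est Fs {Hs HIs Hr HE Hs' Ns Ef Ht HIt Ht' Nt Eg} => [|z s IH] [|z' t] //= [H1 H2] /andP[F1 F2].
  split; last exact: IH.
  by rewrite /twist /f !autVK; apply: (c_trans EC) H1; apply: ext.
- by rewrite -size_eq0 size_map size_eq0.
by rewrite size_map.
Qed.

(** * The mirror image *)

(** The anti-automorphism that sends [X i] to [X (a + b - 1 - i)], for indices of the block. It
    fixes [dl a b] and exchanges left and right, so that a loop starting in the right block can be
    replaced by one starting in the left block. *)
HB.lock Definition mir (a b : nat) (g : fg) : fg :=
  (hom (fun i => (X ((a + b).-1 - i))^-1) g)^-1.

Section Mirror.
Variables a b : nat.
Notation bar i := ((a + b).-1 - i)%N.
Notation mir := (mir a b).

Definition mirw (w : seq (nat * bool)) : seq (nat * bool) :=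
  [seq (bar x.1.+1, ~~ x.2) | x <- w].

Lemma mirM g h : mir (g * h) = mir h * mir g.
Proof. by rewrite mir.unlock homM invgM. Qed.
Lemma mir1 : mir 1 = 1. Proof. by rewrite mir.unlock hom1 invg1. Qed.
Lemma mirV g : mir g^-1 = (mir g)^-1.
Proof. by rewrite mir.unlock homV. Qed.
Lemma mirX i : mir (X i) = X (bar i).
Proof. by rewrite mir.unlock homX invgK. Qed.
Lemma mir_pr s : mir (pr s) = pr (rev [seq mir x | x <- s]).
Proof. by elim: s => [|x s IH] /=; rewrite ?mir1 // mirM IH rev_cons -cats1 pr_cat /= mulg1. Qed.

Lemma inF_mir p q g : (a <= p)%N -> (q <= b)%N -> inF p q g -> inF (a + b - q) (a + b - p) (mir g).
Proof.
move=> Ha Hb Fg; rewrite mir.unlock inFVE; apply: inF_hom Fg => i Hi; rewrite inFVE inFX; lia.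
Qed.
Lemma mirK g : inF a b g -> mir (mir g) = g.
Proof.
elim/inF_ind: g / => [|[i c] g /= Hi Fg IH]; first by rewrite !mir1.
rewrite !mirM IH; congr (_ * _).
have E : (bar (bar i) = i)%N by lia.
by rewrite LX; case: c => /=; rewrite ?mirV !mirX E.
Qed.
Lemma inF_mir' g : inF a b g -> inF a b (mir g).
Proof. by move=> Fg; have := inF_mir (leqnn a) (leqnn b) Fg; rewrite addnK addKn. Qed.

Lemma mir_dl p q : (a <= p <= q)%N -> (q <= b)%N -> mir (dl p q) = dl (a + b - q) (a + b - p).
Proof.
move=> Hp; move Ed: (q - p)%N => d; elim: d q Ed Hp => [|d IH] q Ed Hp Hq.
  by rewrite !dl_nil ?mir1 //; lia.
have Eq : q = q.-1.+1 by lia.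
rewrite Eq dlSr ?mirM ?mirX ?(IH q.-1); try lia.
rewrite (dlS (_ : a + b - q.-1.+1 < a + b - p)%N); last lia.
by congr (X _ * dl _ _); lia.
Qed.

Lemma brw_mirw p q w : (a <= p)%N -> (q <= b)%N -> brw p q w -> brw (a + b - q) (a + b - p) (mirw w).
Proof. by move=> Ha Hb /allP H; apply/allP => x /mapP[y /H Hy ->] /=; lia. Qed.
Lemma brw_mirw' w : brw a b w -> brw a b (mirw w).
Proof. by move=> H; have := brw_mirw (leqnn a) (leqnn b) H; rewrite addnK addKn. Qed.
Lemma mirwK w : brw a b w -> mirw (mirw w) = w.
Proof.
elim: w => //= x w IH /andP[Hx Hw]; rewrite IH // negbK; congr (_ :: _).
by case: x Hx => i c /= Hx; congr (_, _); lia.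
Qed.

Lemma mir_sg x g : (a <= x.1)%N -> (x.1.+1 < b)%N -> inF a b g ->
  mir (sg x g) = sg (bar x.1.+1, ~~ x.2) (mir g).
Proof.
move=> H1 H2; elim/inF_ind: g / => [|[i c] g Hi Fg IH]; first by rewrite sg1 mir1 sg1.
rewrite sgM !mirM sgM IH; congr (_ * _).
suff E : mir (sg x (X i)) = sg (bar x.1.+1, ~~ x.2) (mir (X i)).
  by rewrite LX; case: c {Hi} => /=; rewrite ?sgV ?mirV ?sgV E.
rewrite mirX !sgX; case: x {IH} H1 H2 => k e /= H1 H2.
have K : (bar k = (bar k.+1).+1)%N by lia.
have [->|N1] := eqVneq i k.
  rewrite K; case: e; rewrite /= ?sgf0V ?sgf1 ?sgf0 ?sgf1V ?mirM ?mirV !mirX // K ?mulgA //.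
have [->|N2] := eqVneq i k.+1.
  by case: e; rewrite /= ?sgf0V ?sgf1 ?sgf0 ?sgf1V ?mirM ?mirV !mirX // K ?mulgA.
by rewrite !sgf_id ?mirX //=; move: N1 N2 Hi => /=; lia.
Qed.
Lemma mir_aut w g : brw a b w -> inF a b g -> mir (aut w g) = aut (mirw w) (mir g).
Proof.
elim: w g => //= x w IH g /andP[/andP[H1 H2] Hw] Fg.
by rewrite IH ?mir_sg ?inF_sg.
Qed.

Lemma mir_Ii g : Ii a b g -> Ii a b (mir g).
Proof.
case=> w [c [Hw /andP[Hac Hcb] ->]]; rewrite mir_aut ?mir_dl ?leqnn ?inF_dl //.
by apply: Ii_seg; rewrite ?brw_mirw' //; lia.
Qed.
Lemma mir_rfl x : rfl a b x -> rfl a b (mir x).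
Proof.
case=> u [i [Fu Hi ->]]; rewrite !mirM mirV mirX mulgA -{2}[mir u]invgK; apply: rfl_conj.
  by rewrite inFVE inF_mir'.
by apply: rflX; lia.
Qed.

Definition mrel (E : rel) : rel := fun g h => E (mir g) (mir h).

Lemma mrel_cong E : cong E -> cong (mrel E).
Proof.
move=> EC; split=> [g|g h|g h k|g g' h h']; rewrite /mrel ?mirM.
- exact: c_refl.
- exact: c_sym.
- exact: c_trans.
by move=> H1 H2; apply: c_mul.
Qed.

Lemma mrel_base E : (a <= b)%N -> base_rel E a b -> base_rel (mrel E) a b.
Proof.
move=> Hab [EC HI HL]; split; first exact: mrel_cong.
  by move=> i Hi; rewrite /mrel mirM mirX mir1; apply: HI; lia.
move=> s Hs; rewrite /mrel mir_dl ?leqnn // addnK addKn mir_pr => /HL.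
rewrite size_rev size_map; apply=> x; rewrite mem_rev => /mapP[y /Hs Hy ->]; exact: mir_rfl.
Qed.

Lemma mrel_PT E p q : (a <= p)%N -> (q <= b)%N -> PT E (a + b - q) (a + b - p) -> PT (mrel E) p q.
Proof.
move=> Ha Hb HP p' q' w1 w2 Hp Hq H1 H2.
have S w : brw p q w -> brw a b w by apply: brwS.
have Fd : inF a b (dl p' q') by apply: inF_dl; lia.
rewrite /mrel !mir_aut ?S // mir_dl; try lia.
case/HP; rewrite ?brw_mirw //; try lia; move=> v [Hv Ev].
have Hv' : brw a b v by apply: brwS Hv; lia.
exists (mirw v); split.
  have := brw_mirw (_ : a <= a + b - q')%N (_ : a + b - p' <= b)%N Hv.
  have -> : (a + b - (a + b - p') = p')%N by lia.
  have -> : (a + b - (a + b - q') = q')%N by lia.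
  by apply; lia.
move=> i Hi; have Fi : inF a b (X i) by rewrite inFX; lia.
rewrite /mrel (mir_aut (S _ H1)); last by rewrite inF_aut ?brw_mirw'.
rewrite (mir_aut (brw_mirw' Hv') Fi) (mir_aut (S _ H2) Fi) mirwK // !mirX.
by apply: Ev; lia.
Qed.

Lemma sd_mir m c x : (a <= m <= b)%N -> sd a (a + b - m) b c x -> sd a m b (~~ c) (mir x).
Proof.
move=> Hm; case: c => /= Fx.
  have := inF_mir (leqnn a) (_ : a + b - m <= b)%N Fx.
  have -> : (a + b - (a + b - m) = m)%N by lia.
  by rewrite addKn; apply; lia.
have := inF_mir (_ : a <= a + b - m)%N (leqnn b) Fx.
have -> : (a + b - (a + b - m) = m)%N by lia.
by rewrite addnK; apply; lia.
Qed.

Lemma alts_mir (T T' : fg -> Prop) m c s : (a <= m <= b)%N -> (forall x, inF a b x -> T x -> T' (mir x)) ->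
  alts a (a + b - m) b T c s -> alts a m b T' (~~ (c (+) ~~ odd (size s))) (rev [seq mir x | x <- s]).
Proof.
move=> Hm HT; elim: s c => //= x s IH c [H1 H2 H3].
rewrite rev_cons -cats1; apply/alts_cat; split.
  by have := IH _ H3; case: (c); case: (odd _).
have -> : ~~ (c (+) ~~ ~~ odd (size s)) (+) odd (size (rev [seq mir z | z <- s])) = ~~ c.
  by rewrite size_rev size_map; case: (c); case: (odd _).
split=> //; first exact: sd_mir.
by apply: HT => //; apply: (sd_inF _ H1); lia.
Qed.

Lemma mrel_FP E m : (a <= m <= b)%N -> FP E a m b -> FP (mrel E) a (a + b - m) b.
Proof.
move=> Hm HF c s Hs; rewrite /mrel mir1 mir_pr => HE.
have T x : inF a b x -> nz (mrel E) x -> nz E (mir x) by move=> _; rewrite /nz /mrel mir1.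
have /(congr1 size) := HF _ _ (alts_mir Hm T Hs) HE.
by rewrite size_rev size_map => /size0nil.
Qed.

Lemma mir_linked E g h : inF a b g -> inF a b h -> linked (mrel E) a b (mir g) (mir h) -> linked E a b g h.
Proof.
move=> Fg Fh [w [Hw W1 W2]]; exists (mirw w); split; first exact: brw_mirw'.
  move=> k Fk; have := W1 (mir k) (inF_mir' Fk); rewrite /mrel mir_aut ?inF_mir' // mirK //.
by rewrite -{1}(mirK Fg) -mir_aut ?inF_mir' // W2 mirK.
Qed.

End Mirror.

Lemma linked_one E a m b h : (a <= m <= b)%N -> base_rel E a b -> FP E a m b -> Ii a b h -> E 1 h ->
  linked E a b 1 h.
Proof.
move=> Hm HB HF HIh HE; have [EC _ _] := HB; have [c [t [Ht Eh]]] := Ii_alts Hm HIh.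
have Et : t = [::].
  apply: (HF c); last by rewrite -Eh; apply: c_sym.
  by apply: alts_nz HB Ht _ => //; rewrite -Eh.
by exists [::]; split=> //; [move=> k _; exact: c_refl|rewrite Eh Et].
Qed.

Lemma linked_step n r : loops_linked n -> linked_upto n.+1 r -> linked_upto n.+1 r.+1.
Proof.
move=> IHn IHr E a m b g h Hn Hm HB HP1 HP2 HF HIg HIh /syl_alts[c [s [Hs Hr Eg]]] HE.
have [EC HI HL] := HB; rewrite {g}Eg in HIg HE *.
have [Es|Ns] := eqVneq s [::].
  by rewrite Es /= in HE *; exact: linked_one Hm HB HF HIh HE.
case: c Hs => Hs; first exact: (linked_start IHn IHr Hn Hm HB HP1 HP2 HF HIg HIh Hs Hr HE Ns).
have Hab : (a <= b)%N by lia.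
apply: mir_linked; [exact: Ii_inF HIg|exact: Ii_inF HIh|].
have Hm' : (a <= a + b - m <= b)%N by lia.
have Em : (a + b - (a + b - m) = m)%N by lia.
(* By [start_end], a loop that starts in the right block also ends there; its mirror image therefore
   starts in the left block. *)
have Hodd : odd (size s).
  have T x : nt x -> nt x^-1 by rewrite /nt invg_eq1.
  have := alts_rev T Hs; have : (3 * m + 2 <= hd (act (pr s)^-1 base))%N.
    apply: (start_end Hm HIg); case: (s) Ns Hs => // x u _ H; rewrite (hd_side Hm H).
    by case: H => H1 H2 _; apply: (hd_sd Hm H1 H2).
  rewrite -pr_rev; case: (odd _) => //=; case E0 : (rev _) => [|x u].
    by move: (congr1 size E0); rewrite size_rev size_map => /size0nil E1; rewrite E1 in Ns.
  move=> H4 H; rewrite (hd_side Hm H) in H4; case: H => H1 H2 _.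
  by have /= H3 := hd_sd Hm H1 H2; move: (leq_ltn_trans H4 H3); rewrite ltnn.
have Hs2 : alts a (a + b - m) b nt true (rev [seq mir a b x | x <- s]).
  have := @alts_mir a b nt nt (a + b - m) false s Hm'; rewrite Em Hodd; apply=> //.
  by move=> x Fx; rewrite /nt; apply: contra => /eqP E1; rewrite -(mirK Fx) E1 mir1.
rewrite mir_pr; apply: (linked_start IHn IHr Hn Hm').
- exact: mrel_base.
- by apply: mrel_PT => //; [lia|rewrite Em addKn].
- by apply: mrel_PT => //; [lia|rewrite Em addnK].
- exact: mrel_FP.
- by rewrite -mir_pr; apply: mir_Ii.
- exact: mir_Ii.
- exact: Hs2.
- by rewrite size_rev size_map.
- by rewrite /mrel -mir_pr !mirK //; apply: Ii_inF.
by rewrite -size_eq0 size_rev size_map size_eq0.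
Qed.

Theorem free_product_Star n : loops_linked n.
Proof.
elim: n => // n IHn; have H r : linked_upto n.+1 r.
  elim: r => [|r IHr]; last exact: linked_step.
  move=> E a m b g h _ Hm HB _ _ HF _ HIh [[|x s] [//= _ _ ->]]; exact: linked_one Hm HB HF HIh.
move=> E a m b Hn Hm HB HP1 HP2 HF g h HIg HIh HE; have [r Hr] := syl_all Hm (Ii_inF HIg).
exact: (H r) Hr HE.
Qed.

(** * Hurwitz transitivity in free products *)

Definition seg (t : nat -> fg) i j : fg := pr [seq t k | k <- iota i (j - i)].

Lemma seg_nil t i j : (j <= i)%N -> seg t i j = 1.
Proof. by move=> H; rewrite /seg (_ : (j - i = 0)%N) //; lia. Qed.
Lemma seg_cat t i j k : (i <= j <= k)%N -> seg t i k = seg t i j * seg t j k.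
Proof.
move=> H; rewrite /seg -pr_cat -map_cat; congr (pr (map _ _)).
have -> : (k - i = (j - i) + (k - j))%N by lia.
by rewrite iotaD; congr (_ ++ iota _ _); lia.
Qed.
Lemma seg1 t i : seg t i i.+1 = t i.
Proof. by rewrite /seg subSnn /= mulg1. Qed.
Lemma segS t i j : (i < j)%N -> seg t i j = t i * seg t i.+1 j.
Proof. by move=> H; rewrite (@seg_cat t i i.+1 j) ?seg1 //; lia. Qed.
Lemma eq_seg t t' i j : (forall k, (i <= k < j)%N -> t k = t' k) -> seg t i j = seg t' i j.
Proof.
move=> H; have [Hij|Hij] := leqP i j; last by rewrite !seg_nil // ltnW.
by congr pr; apply/eq_in_map => k; rewrite mem_iota subnKC // => Hk; apply: H.
Qed.

(** Hurwitz transitivity for the Coxeter element alone, on factorizations lifted to the free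
    group. *)
Definition Hur (E : rel) a b : Prop := forall t : nat -> fg,
  (forall i, (a <= i < b)%N -> rfl a b (t i)) -> E (seg t a b) (dl a b) ->
  exists w, brw a b w /\ forall i, (a <= i < b)%N -> E (aut w (X i)) (t i).

Section LemmaA.
Variables (E : rel) (a m b : nat).
Hypotheses (Hm : (a <= m <= b)%N) (HB : base_rel E a b) (HF : FP E a m b).
Let EC : cong E. Proof. by case: HB. Qed.
Notation sd := (sd a m b).
Notation alts := (alts a m b).
Let nzV x : nz E x -> nz E x^-1 := fun H => nz_inv EC H.

Definition hits (t : nat -> fg) : Prop :=
  exists w, brw a b w /\ forall i, (a <= i < b)%N -> E (aut w (X i)) (t i).

Lemma hits_eq t t' : (forall i, (a <= i < b)%N -> E (t i) (t' i)) -> hits t -> hits t'.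
Proof.
move=> H [w [Hw W]]; exists w; split=> // i Hi.
exact: (c_trans EC (W i Hi) (H i Hi)).
Qed.

Definition swp (i : nat) (t : nat -> fg) (k : nat) : fg :=
  if k == i then t i * t i.+1 * (t i)^-1 else if k == i.+1 then t i else t k.
Definition swpV (i : nat) (t : nat -> fg) (k : nat) : fg :=
  if k == i then t i.+1 else if k == i.+1 then (t i.+1)^-1 * t i * t i.+1 else t k.

Lemma hits_swp i t : (a <= i)%N -> (i.+1 < b)%N -> hits (swp i t) -> hits t.
Proof.
move=> H1 H2 [w [Hw W]]; exists ((i, true) :: w); split; first by rewrite /brw /= H1 H2.
have Wi := W i; rewrite /swp eqxx in Wi; have {}Wi := Wi ltac:(lia).
have Wj := W i.+1; rewrite /swp eqxx (_ : (i.+1 == i) = false) in Wj; last lia.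
have {}Wj := Wj ltac:(lia).
move=> k Hk; rewrite /= sgX; have [->|N1] := eqVneq k i; first by rewrite sgf0V.
have [->|N2] := eqVneq k i.+1; last first.
  by rewrite sgf_id //; have := W k Hk; rewrite /swp (negbTE N1) (negbTE N2).
rewrite sgf1V !autM autV.
have -> : t i.+1 = (t i)^-1 * (t i * t i.+1 * (t i)^-1) * t i by rewrite !mulgA mulVg mul1g mulgVK.
by apply: c_mul => //; apply: c_mul => //; apply: c_inv.
Qed.

Lemma hits_swpV i t : (a <= i)%N -> (i.+1 < b)%N -> hits (swpV i t) -> hits t.
Proof.
move=> H1 H2 [w [Hw W]]; exists ((i, false) :: w); split; first by rewrite /brw /= H1 H2.
have Wi := W i; rewrite /swpV eqxx in Wi; have {}Wi := Wi ltac:(lia).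
have Wj := W i.+1; rewrite /swpV eqxx (_ : (i.+1 == i) = false) in Wj; last lia.
have {}Wj := Wj ltac:(lia).
move=> k Hk; rewrite /= sgX; have [->|N1] := eqVneq k i; last first.
  have [->|N2] := eqVneq k i.+1; first by rewrite sgf1.
  by rewrite sgf_id //; have := W k Hk; rewrite /swpV (negbTE N1) (negbTE N2).
rewrite sgf0 !autM autV.
have -> : t i = t i.+1 * ((t i.+1)^-1 * t i * t i.+1) * (t i.+1)^-1 by rewrite !mulgA mulgV mul1g mulgK.
by apply: c_mul => //; [apply: c_mul|apply: c_inv].
Qed.

(** A composite of moves [swpV]: the factor i passes the factors i+1 to j and is conjugated by their
    product. *)
Definition mv (i j : nat) (t : nat -> fg) (k : nat) : fg :=
  if (i <= k < j)%N then t k.+1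
  else if k == j then (seg t i.+1 j.+1)^-1 * t i * seg t i.+1 j.+1 else t k.

Lemma hits_mv i j t : (a <= i <= j)%N -> (j < b)%N -> hits (mv i j t) -> hits t.
Proof.
move Ed: (j - i)%N => n; elim: n i t Ed => [|n IH] i t Ed Hi Hj.
  have -> : i = j by lia.
  apply: hits_eq => k Hk; rewrite /mv; have -> : (j <= k < j)%N = false by lia.
  by case: eqP => [->|_]; [rewrite seg_nil // invg1 mul1g mulg1|]; apply: c_refl.
move=> H; apply: (@hits_swpV i); [lia|lia|]; apply: (IH i.+1); [lia|lia|lia|].
apply: hits_eq H => k Hk; apply: c_eq => //; rewrite /mv /swpV.
have -> : seg (fun k => if k == i then t i.+1 else if k == i.+1 then (t i.+1)^-1 * t i * t i.+1 else t k) i.+2 j.+1 = seg t i.+2 j.+1.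
  by apply: eq_seg => k' Hk'; rewrite !ifN //; lia.
have [Ek|Nk] := eqVneq k j.
  rewrite Ek !ltnn !andbF eqxx (_ : (i.+1 == i) = false); last lia.
  by rewrite (@segS t i.+1 j.+1) ?invgM ?mulgA //; lia.
have [Eki|Nki] := eqVneq k i.
  by rewrite Eki leqnn ltnn /= (_ : (i < j)%N) //; lia.
have -> : (i < k < j)%N = (i <= k < j)%N by lia.
case: ifP => Hik; first by rewrite !ifN //; lia.
by rewrite ifN //; lia.
Qed.

Definition brefl (c : bool) (s : fg) : Prop := if c then rfl a m s else rfl m b s.

Lemma brefl_rfl c s : brefl c s -> rfl a b s.
Proof. by case: c; apply: rflS; lia. Qed.
Lemma brefl_sd c s : brefl c s -> sd c s.
Proof. by case: c => /rfl_inF. Qed.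

Lemma rfl_nz x : rfl a b x -> nz E x.
Proof.
case=> u [i [Fu Hi ->]] HE; have [_ _ HL] := HB.
have {}HE : E (X i) 1.
  have := c_mul EC (c_mul EC (c_refl EC u^-1) HE) (c_refl EC u).
  by rewrite mulg1 mulVg !mulgA mulVg mul1g mulgVK.
have := HL (xs a i ++ xs i.+1 b) _ _; rewrite size_cat !size_xs => H.
suff : (b - a <= i - a + (b - i.+1))%N by lia.
apply: H => [y|]; first by rewrite mem_cat => /orP[]; apply: xs_rfl; lia.
rewrite pr_cat -!/(dl _ _) (@dl_cat a i b) ?(@dlS i b); try lia.
apply: c_mul => //; first exact: c_refl.
by have := c_mul EC HE (c_refl EC (dl i.+1 b)); rewrite mul1g.
Qed.
Lemma brefl_nz c s : brefl c s -> nz E s.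
Proof. by move/brefl_rfl/rfl_nz. Qed.
Lemma brefl_conj c x s : sd c x -> brefl c s -> brefl c (x * s * x^-1).
Proof. by case: c => /= Fx; apply: rfl_conj. Qed.

Lemma sd_uniq c x y : sd c x -> sd (~~ c) y -> E x y -> E x 1.
Proof.
move=> Hx Hy HE; apply: Classical_Prop.NNPP => Nx.
have Ny : nz E y by move=> H; apply: Nx; apply: (c_trans EC HE H).
have : alts (nz E) c [:: x; y^-1] by do 2!split=> //=; rewrite ?sdV //; apply: nzV.
by move/HF; rewrite /= mulg1 => /(_ (_ : E _ _)); case/(_ ltac:(by rewrite -[1](mulgV y); apply: c_mul => //; apply: c_refl)).
Qed.

(** A reflection in normal form: the block of the first syllable, the syllables of the conjugator,
    and a reflection of one of the blocks. *)
Definition datum := (bool * seq fg * fg)%type.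
Definition dval (D : datum) : fg := pr D.1.2 * D.2 * (pr D.1.2)^-1.
Definition good (D : datum) : Prop :=
  alts (nz E) D.1.1 (rcons D.1.2 D.2) /\ brefl (D.1.1 (+) odd (size D.1.2)) D.2.

Lemma normalize w c s : all (fun x => inF a m x || inF m b x) w -> brefl c s ->
  exists D, [/\ good D, (size D.1.2 <= size w)%N & E (pr w * s * (pr w)^-1) (dval D)].
Proof.
move=> + Hs; elim: w => [_|x w IH /= /andP[Hx /IH[[[d v] s'] [[/= G1 G2] Hsz HE]]]].
  exists (c, [::], s); split=> //; last exact: c_refl.
  by split; rewrite /= ?addbF //; split=> //; [exact: brefl_sd|exact: brefl_nz Hs].
have {}HE : E (pr (x :: w) * s * (pr (x :: w))^-1) (x * dval (d, v, s') * x^-1).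
  have -> : pr (x :: w) * s * (pr (x :: w))^-1 = x * (pr w * s * (pr w)^-1) * x^-1 by rewrite /= invgM !mulgA.
  by apply: c_mul => //; [apply: c_mul => //|]; apply: c_refl.
have [Ex|Nx] := Classical_Prop.classic (E x 1).
  exists (d, v, s'); split=> //; first exact: leqW.
  apply: (c_trans EC HE); have := c_mul EC (c_mul EC Ex (c_refl EC (dval (d, v, s')))) (c_inv EC Ex).
  by rewrite invg1 mulg1 mul1g.
have [e He] : exists e, sd e x by case/orP: Hx => H; [exists true|exists false].
have [Ee|Ne] := eqVneq e d; last first.
  exists (e, x :: v, s'); split=> //.
  - have Ed : ~~ e = d by move: Ne; case: (e) (d) => [] [].
    by split; rewrite /= ?Ed // addbN -addNb Ed.
  - apply: (c_trans EC HE); apply: c_eq => //; by rewrite /dval /= invgM !mulgA.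
subst e; case: v G1 G2 Hsz HE => [|y v] G1 G2 Hsz HE.
  exists (d, [::], x * s' * x^-1); rewrite /= addbF in G2 *.
  have G3 := brefl_conj He G2.
  split=> //; first by split; rewrite /= ?addbF //; split=> //; [exact: brefl_sd|exact: brefl_nz G3].
  by apply: (c_trans EC HE); apply: c_eq => //; rewrite /dval /= !mul1g !invg1 !mulg1.
case: G1 => Hy Ny G1; have [Exy|Nxy] := Classical_Prop.classic (E (x * y) 1).
  exists (~~ d, v, s'); split.
  - by split=> //; move: G2 => /=; rewrite addbN addNb.
  - by move: Hsz => /=; lia.
  apply: (c_trans EC HE); rewrite /dval /=.
  have -> : x * (y * pr v * s' * (y * pr v)^-1) * x^-1 = (x * y) * (pr v * s' * (pr v)^-1) * (x * y)^-1.
    by rewrite !invgM !mulgA.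
  have := c_mul EC (c_mul EC Exy (c_refl EC (pr v * s' * (pr v)^-1))) (c_inv EC Exy).
  by rewrite invg1 mulg1 mul1g.
exists (d, (x * y) :: v, s'); split=> //.
- by split=> //; split=> //; apply: sdM.
- by apply: leqW.
apply: (c_trans EC HE); apply: c_eq => //; by rewrite /dval /= !invgM !mulgA.
Qed.

Lemma rfl_good t : rfl a b t -> exists D, good D /\ E t (dval D).
Proof.
case=> u [i [Fu Hi ->]]; have [r [w [_ Hw ->]]] := syl_all Hm Fu.
have Hs : brefl (i < m)%N (X i) by rewrite /brefl; case: ltnP => H; apply: rflX; lia.
by have [D [H1 _ H2]] := normalize Hw Hs; exists D.
Qed.

Lemma good_sides D : good D -> all (fun x => inF a m x || inF m b x) D.1.2.
Proof.
case=> /alts_in H _; apply/allP => x Hx; have [|_ [c]] := H x; first by rewrite mem_rcons inE Hx orbT.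
by case: c => /= ->; rewrite ?orbT.
Qed.

Lemma good_rfl D : good D -> rfl a b (dval D).
Proof.
move=> G; apply: rfl_conj; last by case: G => _ /brefl_rfl.
case: G => + _; rewrite -cats1 => /alts_cat[H _]; exact: (alts_inF Hm H).
Qed.

Lemma eqs_pr u v : eqs E u v -> E (pr u) (pr v).
Proof.
by elim: u v => [|x u IH] [|y v] //= => [_|[H1 /IH H2]]; [apply: c_refl|apply: c_mul].
Qed.

Lemma elcp (d d' : bool) (w v : seq fg) : exists p w' p' v', [/\ w = p ++ w', v = p' ++ v', eqs E p p', (p != [::] -> d = d')
  & match w', v' with x :: _, y :: _ => d = d' -> ~ E x y | _, _ => True end].
Proof.
have [Ed|Nd] := eqVneq d d'; last first.
  by exists [::], w, [::], v; split=> //; case: w v => [|x w] [|y v] // E1; rewrite E1 eqxx in Nd.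
subst d'; elim: w v => [|x w IH] [|y v]; try by (exists [::], [::], [::], [::]).
- by exists [::], [::], [::], (y :: v).
- by exists [::], (x :: w), [::], [::].
have [H|H] := Classical_Prop.classic (E x y); last by exists [::], (x :: w), [::], (y :: v).
have [p [w' [p' [v' [-> -> H1 _ H2]]]]] := IH v.
by exists (x :: p), w', (y :: p'), v'.
Qed.

(** * Factorizations that no move improves *)

Section Chain.
Variable D : nat -> datum.
Notation d i := (D i).1.1.
Notation w i := (D i).1.2.
Notation s i := (D i).2.
Notation t := (fun i => dval (D i)).
Hypothesis HD : forall i, (a <= i < b)%N -> good (D i).
Hypothesis HP : E (seg t a b) (dl a b).
(** Otherwise the Hurwitz move at i would merge [y] with the reflection [s i] and bring the longer
    conjugator to the left. *)
Hypothesis V2 : forall i u y v, (a <= i)%N -> (i.+1 < b)%N ->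
  w i.+1 = u ++ y :: v -> eqs E (w i) u -> sd (d i (+) odd (size (w i))) y -> False.
(** Otherwise moving the factor i past the factors i+1 to j would delete [y] from its conjugator. *)
Hypothesis V3 : forall i j u y v, (a <= i < j)%N -> (j < b)%N -> w i = u ++ y :: v ->
  (forall k, (i < k <= j)%N -> size (w k) = size u) ->
  E (seg t i.+1 j.+1) (pr u * y * (pr u)^-1) -> False.

(** A trivial partial product could be left out, which would factor [dl a b] into too few
    reflections. *)
Lemma seg_nz i j : (a <= i < j)%N -> (j <= b)%N -> ~ E (seg t i j) 1.
Proof.
move=> Hi Hj HE; have [_ _ HL] := HB.
have := HL [seq t k | k <- iota a (i - a) ++ iota j (b - j)]; rewrite size_map size_cat !size_iota => H.
suff : (b - a <= i - a + (b - j))%N by lia.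
apply: H => [x /mapP[k]|].
  by rewrite mem_cat !mem_iota => Hk ->; apply/good_rfl/HD; lia.
rewrite map_cat pr_cat -!/(seg t _ _); apply: (c_trans EC (c_sym EC HP)).
rewrite (@seg_cat t a i b) ?(@seg_cat t i j b); try lia.
apply: c_mul => //; first exact: c_refl.
by have := c_mul EC HE (c_refl EC (seg t j b)); rewrite mul1g.
Qed.

(** The product of the factors from i on has a normal form that begins with all of [w i], and the
    factors i to j-1 multiply to the conjugate of its next syllable [x]. The last items read off the
    blocks of the factors when at most two syllables remain. *)
Definition chained i : Prop := exists x r j,
  [/\ alts (nz E) (d i) (w i ++ x :: r), E (seg t i b) (pr (w i ++ x :: r)), (i < j <= b)%N,
    (forall k, (i <= k < j)%N -> size (w k) = size (w i)) /\ E (seg t i j) (pr (w i) * x * (pr (w i))^-1)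
  & ((size (w i ++ x :: r) <= 1)%N -> forall k, (i <= k < b)%N -> w k = [::] /\ d k = d i) /\
    ((size (w i ++ x :: r) <= 2)%N -> (forall k, (i <= k < b)%N -> w k = [::]) /\
       exists j', [/\ (i < j' <= b)%N, forall k, (i <= k < j')%N -> d k = d i
         & forall k, (j' <= k < b)%N -> d k = ~~ d i])].

Lemma alts_fold e p u x : alts (nz E) e (rcons (p ++ u) x) ->
  alts (nz E) e ((p ++ u) ++ x :: rev [seq z^-1 | z <- u]).
Proof.
rewrite -cats1 => /alts_cat[/[dup] H /alts_cat[Hp Hu] [Hx Nx _]]; apply/alts_cat; split=> //; split=> //.
have := alts_rev nzV Hu; rewrite size_cat oddD.
by case: (e); case: (odd (size p)); case: (odd (size u)).
Qed.

Lemma jn_same e L1 x y L2 : alts (nz E) e (rcons L1 x) -> alts (nz E) (e (+) odd (size L1)) (y :: L2) ->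
  nz E (x * y) -> alts (nz E) e (L1 ++ (x * y) :: L2).
Proof.
rewrite -cats1 => /alts_cat[H1 [Hx _ _]] [Hy _ H2] N; apply/alts_cat; split=> //.
by split=> //; apply: sdM.
Qed.

(** The conjugators of the factors i and i+1 are split after their common part. If neither contains
    the other, nothing further cancels. If one properly contains the other, [V2] or [V3] excludes
    the harmful cancellation. If they agree and the blocks agree too, the middle syllables multiply,
    and the result is not trivial by [seg_nz]. *)
Lemma chain_step i : (a <= i < b)%N -> (i.+1 = b \/ chained i.+1) -> chained i.
Proof.
move=> Hi; have [Gi Bi] := HD Hi; have Hal : alts (nz E) (d i) (w i ++ s i :: rev [seq z^-1 | z <- w i]).
  exact: (@alts_fold (d i) [::] (w i) (s i)).
have Ht : t i = pr (w i) * s i * (pr (w i))^-1 by [].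
have fresh r : alts (nz E) (d i) (w i ++ s i :: r) -> E (seg t i b) (pr (w i ++ s i :: r)) ->
    (3 <= size (w i ++ s i :: r))%N -> chained i.
  move=> H1 H2 H3; exists (s i), r, i.+1; split=> //; first by lia.
    split; last by rewrite seg1; apply: c_refl.
    by move=> k Hk; have -> : k = i by lia.
  by split=> H4; exfalso; lia.
case=> [Eb|[x [r [j [A1 A2 A3 [A4 A5] [A6 A7]]]]]].
  exists (s i), (rev [seq z^-1 | z <- w i]), i.+1.
  have E1 : seg t i b = pr (w i ++ s i :: rev [seq z^-1 | z <- w i]).
    by rewrite -Eb seg1 pr_cat /= pr_rev mulgA.
  split=> //; first by apply: c_eq.
  - lia.
  - split; last by rewrite seg1; apply: c_refl.
    by move=> k Hk; have -> : k = i by lia.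
  have sz : size (w i ++ s i :: rev [seq z^-1 | z <- w i]) = (size (w i)).*2.+1.
    by rewrite size_cat /= size_rev size_map; lia.
  rewrite sz; split=> H.
    move=> k Hk; have -> : k = i by lia.
    by split=> //; apply: size0nil; lia.
  split.
    move=> k Hk; have -> : k = i by lia.
    by apply: size0nil; lia.
  by exists b; split=> [|k Hk|k Hk]; [lia| |lia]; have -> : k = i by lia.
have Hi1 : (a <= i.+1 < b)%N by lia.
have [Gj Bj] := HD Hi1.
have [p [w' [p' [v' [Ew Ev Hp Hd Hh]]]]] := elcp (d i) (d i.+1) (w i) (w i.+1).
have Sp := eqs_size Hp.
have EP : E (seg t i b) (pr (w i ++ s i :: rev [seq z^-1 | z <- w']) * pr (v' ++ x :: r)).
  have Hib : (i < b)%N by case/andP: Hi.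
  rewrite (segS t Hib); apply: (c_trans EC (h := t i * (pr p' * pr (v' ++ x :: r)))).
    by apply: c_mul => //; [exact: c_refl|move: A2; rewrite Ev -catA pr_cat].
  rewrite Ht {2}Ew !pr_cat invgM /= pr_rev -!mulgA; do 3!(apply: c_mul => //; first exact: c_refl).
  rewrite mulgA; have := c_mul EC (c_inv EC (eqs_pr Hp)) (c_refl EC (pr p' * (pr v' * (x * pr r)))).
  rewrite mulKg => H; move: (c_mul EC (c_inv EC (eqs_pr Hp)) (c_refl EC (pr p'))); rewrite mulVg => H'.
  by have := c_mul EC H' (c_refl EC (pr v' * (x * pr r))); rewrite mul1g -mulgA.
have Ap : d i (+) odd (size p) = d i.+1 (+) odd (size p') -> d i = d i.+1.
  by rewrite Sp; case: (d i) (d i.+1) (odd _) => [] [] [].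
have Av : alts (nz E) (d i.+1 (+) odd (size p')) (v' ++ x :: r).
  by move: A1; rewrite Ev -catA => /alts_cat[].
have Aw : alts (nz E) (d i) (w i ++ s i :: rev [seq z^-1 | z <- w']).
  by rewrite Ew; apply: alts_fold; rewrite -Ew.
case: w' Ew Hh EP Aw => [|z w'] Ew Hh EP Aw; case: v' Ev Hh EP Av => [|y v'] Ev Hh EP Av.
- rewrite !cats0 in Ew Ev; rewrite cat0s in EP Av.
  have Sw : size (w i.+1) = size (w i) by rewrite Ew Ev Sp.
  have [Ed|Nd] := eqVneq (d i) (d i.+1).
    have Eij : E (seg t i j) (pr (w i) * (s i * x) * (pr (w i))^-1).
      rewrite segS; last lia.
      apply: (c_trans EC (c_mul EC (c_refl EC (t i)) A5)).
      have Hw : E (pr (w i.+1)) (pr (w i)) by rewrite Ew Ev; apply: c_sym => //; apply: eqs_pr.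
      have -> : pr (w i) * (s i * x) * (pr (w i))^-1 = t i * (pr (w i) * x * (pr (w i))^-1).
        by rewrite /dval !mulgA mulgVK.
      apply: c_mul => //; first exact: c_refl.
      by apply: c_mul => //; [apply: c_mul => //; apply: c_refl|apply: c_inv].
    have Nz : nz E (s i * x).
      move=> H; apply: (@seg_nz i j); [lia|lia|]; apply: (c_trans EC Eij).
      have := c_mul EC (c_mul EC (c_refl EC (pr (w i))) H) (c_refl EC (pr (w i))^-1).
      by rewrite mulg1 mulgV.
    exists (s i * x), r, j; split=> //.
    + apply: jn_same => //; by rewrite Ew Sp Ed.
    + by apply: (c_trans EC EP); apply: c_eq => //; rewrite !pr_cat /= mulg1 !mulgA.
    + lia.
    + split=> // k Hk; have [->//|Nk] := eqVneq k i; rewrite A4 //; lia.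
    have sz : size (w i ++ (s i * x) :: r) = size (w i.+1 ++ x :: r) by rewrite !size_cat Sw.
    rewrite sz; split=> H.
      have K := A6 H; move=> k Hk; have [->|Nk] := eqVneq k i; last by rewrite Ed; apply: K; lia.
      by split=> //; apply: size0nil; rewrite -Sw; have [|->] := K i.+1; first lia.
    have [K1 [j' [J1 J2 J3]]] := A7 H; split.
      move=> k Hk; have [->|Nk] := eqVneq k i; last by apply: K1; lia.
      by apply: size0nil; rewrite -Sw K1 //; lia.
    exists j'; split; [lia| |].
      by move=> k Hk; have [->//|Nk] := eqVneq k i; rewrite Ed; apply: J2; lia.
    by move=> k Hk; rewrite Ed; apply: J3.
  have Nd' : d i.+1 = ~~ d i by move: Nd; case: (d i) (d i.+1) => [] [].
  exists (s i), (x :: r), i.+1; split.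
  + move: Gi; rewrite -cats1 => /alts_cat[H1 [H2 H3 _]]; apply/alts_cat; split=> //; split=> //.
    by move: Av; rewrite -Sp Ew Nd'; case: (d i); case: (odd _).
  + by apply: (c_trans EC EP); apply: c_eq => //; rewrite !pr_cat /= mulg1 !mulgA.
  + lia.
  + split; last by rewrite seg1; apply: c_refl.
    by move=> k Hk; have -> : k = i by lia.
  have sz : size (w i ++ s i :: x :: r) = (size (w i.+1 ++ x :: r)).+1 by rewrite !size_cat Sw /=; lia.
  rewrite sz; split=> H; first by rewrite size_cat /= in H; exfalso; lia.
  have K := A6 ltac:(lia); split.
    move=> k Hk; have [->|Nk] := eqVneq k i; last by have [] := K k ltac:(lia).
    by apply: size0nil; rewrite -Sw; have [|->] := K i.+1; first lia.
  exists i.+1; split; [lia|by move=> k Hk; congr (D _).1.1; lia|].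
  by move=> k Hk; rewrite -Nd'; have [] := K k Hk.
- rewrite cats0 in Ew; have [Es|Ns] := eqVneq (d i (+) odd (size (w i))) (d i.+1 (+) odd (size p')).
    case: (V2 (i := i) (u := p') (y := y) (v := v')) => //; [lia|lia|by rewrite Ew|].
    by rewrite Es; case: Av.
  apply: (fresh (y :: v' ++ x :: r)).
  + move: Gi; rewrite -cats1 => /alts_cat[H1 [H2 H3 _]]; apply/alts_cat; split=> //; split=> //.
    by move: Ns Av => /=; case: (d i (+) _); case: (d i.+1 (+) _).
  + by apply: (c_trans EC EP); apply: c_eq => //; rewrite !pr_cat /= mulg1 !mulgA !pr_cat /= !mulgA.
  by rewrite size_cat /= size_cat /=; lia.
- rewrite cats0 in Ev; rewrite cat0s in EP Av.
  have E1 : rev [seq z0^-1 | z0 <- z :: w'] = rcons (rev [seq z0^-1 | z0 <- w']) z^-1 by rewrite /= rev_cons.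
  rewrite E1 in EP Aw; set L := rev _ in EP Aw; rewrite -rcons_cons -rcons_cat in EP Aw.
  have Sz : (0 < size (w i))%N by rewrite Ew size_cat /=; lia.
  have [Ed|Nd] := eqVneq (d i) (d i.+1).
    have SL : d i.+1 (+) odd (size p') = d i (+) odd (size (w i ++ s i :: L)).
      rewrite /L !size_cat /= size_rev size_map -Sp Ed Ew size_cat /= !(oddD, oddS) /=.
      by case: (d i.+1); case: (odd (size p)); case: (odd (size w')).
    have Nz : nz E (z^-1 * x).
      move/((c_div EC _ _).2) => Ezx; apply: (V3 (i := i) (j := j.-1) (u := p) (y := z) (v := w')) => //.
      * lia.
      * lia.
      * by move=> k Hk; rewrite A4 ?Ev ?Sp //; lia.
      rewrite prednK; last lia.
      apply: (c_trans EC A5); rewrite Ev; have H := c_sym EC (eqs_pr Hp).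
      by apply: c_mul => //; [apply: c_mul => //; apply: c_sym|apply: c_inv].
    apply: (fresh (L ++ (z^-1 * x) :: r)).
    + by rewrite -cat_cons catA; apply: jn_same => //; rewrite -SL.
    + by apply: (c_trans EC EP); apply: c_eq => //; rewrite -cats1 !pr_cat /= !pr_cat /= !mulg1 !mulgA.
    by rewrite size_cat /= size_cat /=; lia.
  have Nd' : d i.+1 = ~~ d i by move: Nd; case: (d i) (d i.+1) => [] [].
  apply: (fresh (L ++ z^-1 :: x :: r)).
  + have -> : w i ++ s i :: L ++ z^-1 :: x :: r = rcons (w i ++ s i :: L) z^-1 ++ x :: r by rewrite -cats1 -!catA.
    apply/alts_cat; split=> //; have -> // : d i (+) odd (size (rcons (w i ++ s i :: L) z^-1)) = d i.+1 (+) odd (size p').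
    rewrite size_rcons /L !size_cat /= size_rev size_map -Sp Nd' Ew size_cat /= !(oddD, oddS) /=.
    by case: (d i); case: (odd (size p)); case: (odd (size w')).
  + by apply: (c_trans EC EP); apply: c_eq => //; rewrite -cats1 !pr_cat /= !pr_cat /= !mulg1 !mulgA.
  by rewrite size_cat /= size_cat /=; lia.
have E1 : rev [seq z0^-1 | z0 <- z :: w'] = rcons (rev [seq z0^-1 | z0 <- w']) z^-1 by rewrite /= rev_cons.
rewrite E1 in EP Aw; set L := rev _ in EP Aw; rewrite -rcons_cons -rcons_cat in EP Aw.
have Sz : (0 < size (w i))%N by rewrite Ew size_cat /=; lia.
have [Ed|Nd] := eqVneq (d i) (d i.+1).
  have SL : d i.+1 (+) odd (size p') = d i (+) odd (size (w i ++ s i :: L)).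
    rewrite /L !size_cat /= size_rev size_map -Sp Ed Ew size_cat /= !(oddD, oddS) /=.
    by case: (d i.+1); case: (odd (size p)); case: (odd (size w')).
  have Nz : nz E (z^-1 * y) by move/((c_div EC _ _).2); apply: Hh.
  apply: (fresh (L ++ (z^-1 * y) :: v' ++ x :: r)).
  + by rewrite -cat_cons catA; apply: jn_same => //; rewrite -SL.
  + by apply: (c_trans EC EP); apply: c_eq => //; rewrite -cats1 !pr_cat /= !pr_cat /= !pr_cat /= !mulg1 !mulgA.
  by rewrite size_cat /= size_cat /=; lia.
have Nd' : d i.+1 = ~~ d i by move: Nd; case: (d i) (d i.+1) => [] [].
apply: (fresh (L ++ z^-1 :: y :: v' ++ x :: r)).
+ have -> : w i ++ s i :: L ++ z^-1 :: y :: v' ++ x :: r = rcons (w i ++ s i :: L) z^-1 ++ y :: v' ++ x :: r by rewrite -cats1 -!catA.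
  apply/alts_cat; split=> //; have -> // : d i (+) odd (size (rcons (w i ++ s i :: L) z^-1)) = d i.+1 (+) odd (size p').
  rewrite size_rcons /L !size_cat /= size_rev size_map -Sp Nd' Ew size_cat /= !(oddD, oddS) /=.
  by case: (d i); case: (odd (size p)); case: (odd (size w')).
+ by apply: (c_trans EC EP); apply: c_eq => //; rewrite -cats1 !pr_cat /= !pr_cat /= !pr_cat /= !mulg1 !mulgA.
by rewrite size_cat /= size_cat /=; lia.
Qed.

End Chain.

Lemma chained_all D : (forall i, (a <= i < b)%N -> good (D i)) -> E (seg (fun i => dval (D i)) a b) (dl a b) ->
  (forall i u y v, (a <= i)%N -> (i.+1 < b)%N -> (D i.+1).1.2 = u ++ y :: v -> eqs E (D i).1.2 u ->
    sd ((D i).1.1 (+) odd (size (D i).1.2)) y -> False) ->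
  (forall i j u y v, (a <= i < j)%N -> (j < b)%N -> (D i).1.2 = u ++ y :: v ->
    (forall k, (i < k <= j)%N -> size (D k).1.2 = size u) ->
    E (seg (fun i => dval (D i)) i.+1 j.+1) (pr u * y * (pr u)^-1) -> False) ->
  forall i, (a <= i < b)%N -> chained D i.
Proof.
move=> HD HP V2 V3 i; move En: (b - i)%N => n; elim: n i En => [|n IH] i En Hi; first lia.
apply: chain_step => //; have [E1|N1] := eqVneq i.+1 b; [by left|right].
by apply: IH; lia.
Qed.

(** [dl a b] has the two syllables [dl a m] and [dl m b], so no conjugator is left and the factors
    of the first block precede those of the second. Counting reflections gives [j' = m], and each
    block is treated by its own hypothesis. *)
Lemma block_factors D : (a < m < b)%N -> Hur E a m -> Hur E m b ->
  (forall i, (a <= i < b)%N -> good (D i)) -> E (seg (fun i => dval (D i)) a b) (dl a b) ->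
  chained D a -> hits (fun i => dval (D i)).
Proof.
move=> Hmm H1 H2 HD HP [x [r [j [A1 A2 _ _ [_ A7]]]]]; have [_ _ HL] := HB.
have Bm : base_rel E a m by apply: base_sub HB; lia.
have Bm' : base_rel E m b by apply: base_sub HB; lia.
have N1 : nz E (dl a m).
  apply: (Ii_nz Bm); first by exists [::], m; split=> //; lia.
  by rewrite dl_eq1; lia.
have N2 : nz E (dl m b).
  apply: (Ii_nz Bm'); first by exists [::], b; split=> //; lia.
  by rewrite dl_eq1; lia.
have AD : alts (nz E) true [:: dl a m; dl m b] by split; [exact: inF_dl|exact: N1|split=> //; exact: inF_dl].
have [Es Ed] : eqs E ((D a).1.2 ++ x :: r) [:: dl a m; dl m b] /\ ((D a).1.2 ++ x :: r != [::] -> (D a).1.1 = true).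
  apply: (nf_uniq Hm EC HF A1 AD); rewrite /= mulg1 -dl_cat //.
  by apply: (c_trans EC (c_sym EC A2)).
have {Ed} Ed : (D a).1.1 = true by apply: Ed; case: (D a).1.2.
have [W [j' [J1 J2 J3]]] := A7 ltac:(by rewrite (eqs_size Es)).
have Et k : (a <= k < b)%N -> dval (D k) = (D k).2 by move=> Hk; rewrite /dval W //= mul1g invg1 mulg1.
have R k : (a <= k < b)%N -> brefl (k < j')%N (dval (D k)).
  move=> Hk; have [_] := HD k Hk; rewrite Et // W //= addbF.
  by case: ltnP => Hj; [rewrite J2 ?Ed //|rewrite J3 ?Ed //]; lia.
set t := fun i => dval (D i) in HP *.
have S1 : sd true (seg t a j').
  by apply: (pr_inF (a := a)) => y /mapP[k]; rewrite mem_iota => Hk ->; have := R k ltac:(lia); have -> : (k < j')%N by lia.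
have S2 : sd false (seg t j' b).
  by apply: (pr_inF (a := m)) => y /mapP[k]; rewrite mem_iota => Hk ->; have := R k ltac:(lia); have -> : (k < j')%N = false by lia.
have HP' : E (seg t a j' * seg t j' b) (dl a m * dl m b) by rewrite -seg_cat -?dl_cat //; lia.
have K : E ((dl a m)^-1 * seg t a j') (dl m b * (seg t j' b)^-1).
  have := c_mul EC (c_mul EC (c_refl EC (dl a m)^-1) HP') (c_refl EC (seg t j' b)^-1).
  by rewrite mulKg !mulgA mulgK.
have K1 : E ((dl a m)^-1 * seg t a j') 1.
  apply: (sd_uniq (c := true)) K; first by apply: sdM => //; rewrite sdV /= inF_dl.
  by apply: sdM => //=; [rewrite inF_dl|rewrite inFVE].
have Ea : E (dl a m) (seg t a j') by apply: (c_div EC _ _).2.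
have Eb : E (dl m b) (seg t j' b).
  have := c_mul EC (c_trans EC (c_sym EC K) K1) (c_refl EC (seg t j' b)).
  by rewrite mulgVK mul1g.
have [_ _ HLm] := Bm; have [_ _ HLm'] := Bm'.
have Jm : j' = m.
  have L1 : (m - a <= size [seq t k | k <- iota a (j' - a)])%N.
    by apply: HLm => // y /mapP[k]; rewrite mem_iota => Hk ->; have := R k ltac:(lia); have -> : (k < j')%N by lia.
  have L2 : (b - m <= size [seq t k | k <- iota j' (b - j')])%N.
    by apply: HLm' => // y /mapP[k]; rewrite mem_iota => Hk ->; have := R k ltac:(lia); have -> : (k < j')%N = false by lia.
  by move: L1 L2; rewrite !size_map !size_iota; lia.
rewrite {j'}Jm in J1 J2 J3 R S1 S2 HP' K K1 Ea Eb.
have [|w1 [Hw1 W1]] := H1 t _ (c_sym EC Ea); first by move=> i Hi; have := R i ltac:(lia); have -> : (i < m)%N by lia.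
have [|w2 [Hw2 W2]] := H2 t _ (c_sym EC Eb); first by move=> i Hi; have := R i ltac:(lia); have -> : (i < m)%N = false by lia.
exists (w1 ++ w2); split.
  by rewrite brw_cat; apply/andP; split; [apply: brwS Hw1|apply: brwS Hw2]; lia.
move=> i Hi; rewrite aut_cat; have [Him|Hmi] := ltnP i m; last first.
  by rewrite (autX_id Hw1); [apply: W2|]; lia.
rewrite (@aut_id a m m b) //; first by apply: W1; lia.
  by rewrite inF_aut // inFX; lia.
by rewrite leqnn orbT.
Qed.

Lemma sum_shift (f : nat -> nat) i j : (i <= j)%N ->
  (\sum_(i <= k < j) f k.+1 + f i = \sum_(i <= k < j) f k + f j)%N.
Proof.
move=> H; have E0 : (\sum_(i.+1 <= k < j.+1) f k = \sum_(i <= k < j) f k.+1)%N by rewrite big_add1.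
have E1 : (\sum_(i <= k < j.+1) f k = f i + \sum_(i.+1 <= k < j.+1) f k)%N by rewrite big_ltn.
by move: E1; rewrite big_nat_recr //= E0; lia.
Qed.

(** Lexicographic induction on the total length of the conjugators, then on their total length
    weighted by position. A move at a failure of [V2] does not raise the total and brings the longer
    conjugator to the left; a move at a failure of [V3] lowers the total. *)
Lemma free_product_Hur : Hur E a m -> Hur E m b -> Hur E a b.
Proof.
move=> H1 H2; have [Ea|Na] := eqVneq a m; first by rewrite -Ea in H2.
have [Eb|Nb] := eqVneq m b; first by rewrite Eb in H1.
have Hmm : (a < m < b)%N by lia.
suff H M N D : (forall i, (a <= i < b)%N -> good (D i)) -> E (seg (fun i => dval (D i)) a b) (dl a b) ->
    (\sum_(a <= i < b) size (D i).1.2 < M)%N -> (\sum_(a <= i < b) i * size (D i).1.2 < N)%N ->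
    hits (fun i => dval (D i)).
  move=> t Ht HE; pose P i D := (a <= i < b)%N -> good D /\ E (t i) (dval D).
  have [D HD] : exists D, forall i, P i (D i).
    apply: choice_fun => i; rewrite /P; case Hi: (a <= i < b)%N; last by exists (true, [::], 1).
    by have [D [G1 G2]] := rfl_good (Ht i Hi); exists D.
  apply: (hits_eq (t := fun i => dval (D i))); first by move=> i /HD[_ Hv]; apply: c_sym.
  apply: (H _.+1 _.+1 D _ _ (leqnn _) (leqnn _)); first by move=> i /HD[].
  apply: (c_trans EC) HE; rewrite /seg; have : {subset iota a (b - a) <= [pred i | a <= i < b]%N}.
    by move=> i; rewrite mem_iota inE; lia.
  elim: (iota _ _) => [|i s IH] Hs /=; first exact: c_refl.
  apply: c_mul => //; last by apply: IH => k Hk; apply: Hs; rewrite inE Hk orbT.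
  by have /HD[_ H'] := Hs i (mem_head _ _); apply: c_sym.
elim: M N D => // M IHM N; elim: N => // N IHN D HD HP HM HN.
pose t i := dval (D i).
have [[i [u [y [v [I1 I2 Ew Hu Hy]]]]]|NV2] := Classical_Prop.classic (exists i u y v,
   [/\ (a <= i)%N, (i.+1 < b)%N, (D i.+1).1.2 = u ++ y :: v, eqs E (D i).1.2 u
     & sd ((D i).1.1 (+) odd (size (D i).1.2)) y]).
  have Gi := HD i ltac:(lia); have Gj := HD i.+1 ltac:(lia).
  have All : all (fun x => inF a m x || inF m b x) ((D i).1.2 ++ ((D i).2 * y) :: v).
    rewrite all_cat (good_sides Gi) /=; have := good_sides Gj; rewrite Ew all_cat /= => /and3P[_ _ ->].
    rewrite andbT; have := sdM (brefl_sd Gi.2) Hy; by case: (_ (+) _) => /= ->; rewrite ?orbT.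
  have [D' [G' S' E']] := normalize All Gj.2.
  have {}E' : E (swp i t i) (dval D').
    apply: (c_trans EC) E'; rewrite /swp eqxx /t /dval Ew !pr_cat /=.
    set A := pr (D i).1.2; set s := (D i).2; set B := pr u; set V := pr v; set s' := (D i.+1).2.
    have EAB : E B A by apply: c_sym => //; apply: eqs_pr.
    have -> : A * s * A^-1 * (B * (y * V) * s' * (B * (y * V))^-1) * (A * s * A^-1)^-1 =
        (A * s * (A^-1 * B)) * (y * V * s' * (y * V)^-1) * (A * s * (A^-1 * B))^-1 by rewrite !invgM !invgK !mulgA.
    have -> : A * (s * y * V) * s' * (A * (s * y * V))^-1 = (A * s) * (y * V * s' * (y * V)^-1) * (A * s)^-1.
      by rewrite !invgM !mulgA.
    have K : E (A * s * (A^-1 * B)) (A * s).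
      have := c_mul EC (c_refl EC (A * s)) (c_mul EC (c_refl EC A^-1) EAB).
      by rewrite mulVg mulg1.
    by apply: c_mul => //; [apply: c_mul => //; apply: c_refl|apply: c_inv].
  pose D1 k := if k == i then D' else if k == i.+1 then D i else D k.
  have Et k : (a <= k < b)%N -> E (dval (D1 k)) (swp i t k).
    rewrite /D1 /swp => _; have [Ek|Nk] := eqVneq k i; first by apply: c_sym => //; move: E'; rewrite /swp eqxx.
    by case: ifP => _; apply: c_refl.
  have D1i : D1 i = D' by rewrite /D1 eqxx.
  have D1j : D1 i.+1 = D i by rewrite /D1 eqxx (_ : (i.+1 == i) = false) //; lia.
  have D1k k : k != i -> k != i.+1 -> D1 k = D k by move=> K1 K2; rewrite /D1 (negbTE K1) (negbTE K2).
  apply: (hits_swp I1 I2); apply: (hits_eq Et); apply: IHN.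
  - by move=> k Hk; rewrite /D1; do 2?[case: ifP => _] => //; apply: HD.
  - apply: (c_trans EC) HP; have -> : seg (fun k => dval (D k)) a b = seg (swp i t) a b.
      rewrite !(@seg_cat _ a i b) ?(@seg_cat _ i i.+2 b); try lia.
      congr (_ * (_ * _)).
      + by apply: eq_seg => k Hk; rewrite /swp !ifN //; lia.
      + rewrite !(@segS _ i i.+2) ?seg1 // /swp !eqxx (_ : (i.+1 == i) = false); last lia.
        by rewrite mulgVK.
      by apply: eq_seg => k Hk; rewrite /swp !ifN //; lia.
    rewrite /seg; have : {subset iota a (b - a) <= [pred i | a <= i < b]%N}.
      by move=> k; rewrite mem_iota inE; lia.
    elim: (iota _ _) => [|k s IH] Hs /=; first exact: c_refl.
    apply: c_mul => //; first by apply: Et; apply: Hs (mem_head _ _).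
    by apply: IH => k' Hk'; apply: Hs; rewrite inE Hk' orbT.
  - have := @sum_step (fun k => size (D k).1.2) (fun k => size (D1 k).1.2) a b i I1 I2 (fun k K1 K2 => congr1 (fun D0 : datum => size D0.1.2) (D1k k K1 K2)).
    rewrite D1i D1j; move: S'; rewrite size_cat Ew size_cat /= (eqs_size Hu); move: HM; clear.
    move: (\sum_(_ <= _ < _) _)%N (\sum_(_ <= _ < _) _)%N (size _) (size _) (size _) => *; lia.
  have := @sum_step (fun k => k * size (D k).1.2)%N (fun k => k * size (D1 k).1.2)%N a b i I1 I2 (fun k K1 K2 => congr1 (fun D0 : datum => k * size D0.1.2)%N (D1k k K1 K2)).
  rewrite D1i D1j; move: S'; rewrite size_cat Ew size_cat /= (eqs_size Hu); move: HN; clear.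
  move: (\sum_(_ <= _ < _) _)%N (\sum_(_ <= _ < _) _)%N (size _) (size _) (size _) => *; nia.
have [[i [j [u [y [v [I1 I2 Ew Hs Hy]]]]]]|NV3] := Classical_Prop.classic (exists i j u y v,
   [/\ (a <= i < j)%N, (j < b)%N, (D i).1.2 = u ++ y :: v, forall k, (i < k <= j)%N -> size (D k).1.2 = size u
     & E (seg t i.+1 j.+1) (pr u * y * (pr u)^-1)]).
  have Gi := HD i ltac:(lia).
  have All : all (fun x => inF a m x || inF m b x) (u ++ v).
    by have := good_sides Gi; rewrite Ew !all_cat /= => /and3P[-> _ ->].
  have [D' [G' S' E']] := normalize All Gi.2.
  have {}E' : E (mv i j t j) (dval D').
    apply: (c_trans EC) E'; rewrite /mv ltnn andbF eqxx {2}/t /dval Ew !pr_cat /=.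
    set B := pr u; set V := pr v; set s := (D i).2; set Z := seg t _ _ in Hy *.
    have -> : B * V * s * (B * V)^-1 = (B * y * B^-1)^-1 * (B * (y * V) * s * (B * (y * V))^-1) * (B * y * B^-1).
      by rewrite !invgM !invgK !mulgA !(mulgVK, mulgK).
    by apply: c_mul => //; apply: c_mul => //; [apply: c_inv|apply: c_refl].
  pose D1 k := if (i <= k < j)%N then D k.+1 else if k == j then D' else D k.
  have Et k : (a <= k < b)%N -> E (dval (D1 k)) (mv i j t k).
    move=> _; have [->|Nk] := eqVneq k j.
      by rewrite /D1 ltnn andbF eqxx; apply: c_sym.
    by rewrite /D1 /mv (negbTE Nk); case: ifP => _; apply: c_refl.
  have I3 : (a <= i <= j)%N by lia.
  apply: (hits_mv I3 I2); apply: (hits_eq Et); apply: (IHM _.+1) (leqnn _) => //.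
  - by move=> k Hk; rewrite /D1; case: ifP => K1; [apply: HD; lia|case: ifP => // _; apply: HD].
  - apply: (c_trans EC) HP; have -> : seg (fun k => dval (D k)) a b = seg (mv i j t) a b.
      rewrite !(@seg_cat _ a i b) ?(@seg_cat _ i j.+1 b); try lia.
      congr (_ * (_ * _)).
      + by apply: eq_seg => k Hk; rewrite /mv !ifN //; lia.
      + rewrite (@segS _ i j.+1) ?(@seg_cat (mv i j t) i j j.+1) ?seg1; try lia.
        have -> : seg (mv i j t) i j = seg t i.+1 j.+1.
          rewrite /seg subSS -addn1 addnC iotaDl -map_comp; congr pr; apply/eq_in_map => k.
          by rewrite mem_iota => Hk; rewrite /mv /= (_ : (i <= k < j)%N) ?add1n //; lia.
        by rewrite /mv ltnn andbF eqxx !mulgA mulgV mul1g.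
      by apply: eq_seg => k Hk; rewrite /mv !ifN //; lia.
    rewrite /seg; have : {subset iota a (b - a) <= [pred i | a <= i < b]%N}.
      by move=> k; rewrite mem_iota inE; lia.
    elim: (iota _ _) => [|k s IH] Hs' /=; first exact: c_refl.
    apply: c_mul => //; first by apply: Et; apply: Hs' (mem_head _ _).
    by apply: IH => k' Hk'; apply: Hs'; rewrite inE Hk' orbT.
  pose f k := size (D k).1.2; pose f' k := size (D1 k).1.2.
  have T1 g : (\sum_(a <= k < b) g k = \sum_(a <= k < i) g k + (\sum_(i <= k < j) g k + (g j + \sum_(j.+1 <= k < b) g k)))%N.
    rewrite (@big_cat_nat _ _ _ i) ?(@big_cat_nat _ _ _ j i b) ?(@big_ltn _ _ _ j b) //=; lia.
  rewrite -/(\sum_(a <= k < b) f' k)%N; move: HM; rewrite -/(\sum_(a <= k < b) f k)%N !T1.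
  have -> : (\sum_(a <= k < i) f' k = \sum_(a <= k < i) f k)%N.
    by apply: eq_big_nat => k Hk; rewrite /f' /D1 !ifN //; lia.
  have -> : (\sum_(j.+1 <= k < b) f' k = \sum_(j.+1 <= k < b) f k)%N.
    by apply: eq_big_nat => k Hk; rewrite /f' /D1 !ifN //; lia.
  have -> : (\sum_(i <= k < j) f' k = \sum_(i <= k < j) f k.+1)%N.
    by apply: eq_big_nat => k Hk; rewrite /f' /D1 Hk.
  have := @sum_shift f i j ltac:(lia); have -> : f' j = size D'.1.2 by rewrite /f' /D1 ltnn andbF eqxx.
  have : (size D'.1.2 < f i)%N by rewrite /f Ew !size_cat /= in S' *; move: S'; clear; lia.
  move: (\sum_(a <= k < i) _)%N (\sum_(i <= k < j) f k)%N (\sum_(i <= k < j) f k.+1)%N (\sum_(j.+1 <= k < b) _)%N => *.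
  by lia.
apply: (block_factors Hmm H1 H2 HD HP).
apply: (chained_all HD HP); last by lia.
- by move=> i u y v *; apply: NV2; exists i, u, y, v.
by move=> i j u y v *; apply: NV3; exists i, j, u, y, v.
Qed.

End LemmaA.

(** * Reflection length of Coxeter elements *)

Section PeqBasics.
Variables (A : Type) (R : word A -> word A -> Prop).
Notation E := (peq R).

Lemma peq_catl p u v : E u v -> E (p ++ u) (p ++ v).
Proof.
elim=> [p' x y q H|p' x q|x|x y _ H|x y z _ H1 _ H2].
- by rewrite !catA -!catA catA [in X in E _ X]catA; apply: peq_rel.
- by rewrite !(catA p); apply: peq_free.
- exact: peq_refl.
- exact: peq_sym.
exact: peq_trans H1 H2.
Qed.
Lemma peq_catr q u v : E u v -> E (u ++ q) (v ++ q).
Proof.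
elim=> [p' x y q' H|p' x q'|x|x y _ H|x y z _ H1 _ H2].
- by rewrite -!catA; apply: peq_rel.
- by rewrite -!catA; apply: peq_free.
- exact: peq_refl.
- exact: peq_sym.
exact: peq_trans H1 H2.
Qed.
Lemma peq_cat u u' v v' : E u u' -> E v v' -> E (u ++ v) (u' ++ v').
Proof. by move=> H1 H2; apply: peq_trans (peq_catr v H1) (peq_catl u' H2). Qed.
Lemma peq_rel0 u v : R u v -> E u v.
Proof. by move=> H; have := peq_rel [::] [::] H; rewrite !cats0. Qed.
Lemma peq_winvr u : E (u ++ winv u) [::].
Proof.
elim/last_ind: u => [|u x IH]; first exact: peq_refl.
rewrite -cats1 winv_cat -catA; apply: (peq_trans _ IH).
exact: (peq_free R u x (winv u)).
Qed.
Lemma peq_winvl u : E (winv u ++ u) [::].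
Proof. by have := peq_winvr (winv u); rewrite winvK. Qed.
End PeqBasics.

Section Rep.
Import GRing.Theory.
Local Open Scope ring_scope.
Variables (n : nat) (m : 'I_n -> 'I_n -> nat).
Hypothesis Hm : coxeter_matrix m.

Lemma roots_exist : exists z : nat -> algC, forall k, (1 < k)%N -> z k != 1 /\ z k ^+ k = 1.
Proof.
apply: (choice_fun (R := fun k (x : algC) => (1 < k)%N -> x != 1 /\ x ^+ k = 1)) => -[|[|k]]; [by exists 0|by exists 0|].
have [z Hz] := C_prim_root_exists (ltn0Sn k.+1); exists z => _; split; last exact: prim_expr_order.
by apply/eqP => E; have := prim_order_dvd Hz 1; rewrite E expr1n eqxx dvdn1.
Qed.

Variable z : nat -> algC.
Hypothesis Hz : forall k, (1 < k)%N -> z k != 1 /\ z k ^+ k = 1.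

(* A Cartan matrix with a_ij a_ji = 2 + z + 1/z, where z is a primitive root
   of unity of order m_ij. *)
Definition zt (i j : 'I_n) : algC := if (i < j)%N then z (m i j) else (z (m i j))^-1.
Definition cartan (i j : 'I_n) : algC := if i == j then 2 else - (1 + zt i j).

(* The second half of the coordinates makes the coroots independent. *)
Definition root (i : 'I_n) : 'rV[algC]_(n + n) := row_mx (delta_mx 0 i) 0.
Definition coroot (j : 'I_n) : 'cV[algC]_(n + n) := col_mx (\col_i cartan i j) (delta_mx j 0).
Definition refl (i : 'I_n) : 'M[algC]_(n + n) := 1%:M - coroot i *m root i.

Lemma root_coroot i j : root i *m coroot j = (cartan i j)%:M.
Proof.
rewrite /root /coroot mul_row_col mul0mx addr0 -rowE; apply/rowP => k.
by rewrite !mxE !ord1 eqxx mulr1n.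
Qed.

Lemma mul_refl (v : 'rV_(n + n)) i : v *m refl i = v - (v *m coroot i) 0 0 *: root i.
Proof.
by rewrite /refl mulmxBr mulmx1 mulmxA {1}[v *m coroot i]mx11_scalar mul_scalar_mx.
Qed.
Lemma root_refl i j : root i *m refl j = root i - cartan i j *: root j.
Proof. by rewrite mul_refl root_coroot !mxE eqxx mulr1n. Qed.

Lemma reflK i : refl i *m refl i = 1%:M.
Proof.
have E : root i *m refl i = - root i.
  by rewrite root_refl /cartan eqxx scaler_nat mulr2n opprD addrA subrr add0r.
by rewrite {1}/refl mulmxBl mul1mx -mulmxA E mulmxN opprK /refl subrK.
Qed.

Lemma ztV i j : i != j -> zt j i = (zt i j)^-1.
Proof.
move=> N; rewrite /zt (Hm.1 j i); case: (ltngtP i j) => [_|_|/val_inj E]; rewrite ?invrK //.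
by rewrite E eqxx in N.
Qed.

Lemma zt_root i j : i != j -> m i j != 0%N -> zt i j != 1 /\ zt i j ^+ m i j = 1.
Proof.
move=> N M; have [|H1 H2] := Hz (k := m i j).
  by have := Hm.2.2 i j N; case: (m i j) M => [|[]].
rewrite /zt; case: ifP => _ //; split; last by rewrite exprVn H2 invr1.
by rewrite invr_eq1.
Qed.

Lemma geom_sum_root (x : algC) k : x != 1 -> x ^+ k = 1 -> \sum_(l < k) x ^+ l = 0.
Proof.
move=> N E; have := subrX1 x k; rewrite E subrr => /esym/eqP.
by rewrite mulf_eq0 subr_eq0 (negbTE N) => /eqP.
Qed.

Definition rho (u : word 'I_n) : 'M[algC]_(n + n) := foldr (fun x M => refl x.1 *m M) 1%:M u.

Lemma rho_cat u v : rho (u ++ v) = rho u *m rho v.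
Proof. by elim: u => [|x u IH] /=; rewrite ?mul1mx // IH mulmxA. Qed.

Lemma alt_add (i j : 'I_n) k : alt i j (2 * k.+1)%N = [:: (i, false); (j, false)] ++ alt i j (2 * k)%N.
Proof.
rewrite /alt (_ : 2 * k.+1 = 2 + 2 * k)%N; last lia.
rewrite iotaD map_cat; congr (_ ++ _); rewrite addnC iotaDl -map_comp.
by apply: eq_map => l /=; rewrite negbK.
Qed.

(* The rows root i + root j and root i + z root j are eigenvectors of the
   product of the two reflections, for the eigenvalues 1/z and z. *)
Lemma rho_alt i j : m i j != 0%N -> rho (alt i j (2 * m i j)%N) = 1%:M.
Proof.
move=> M; have [<-|N] := eqVneq i j.
  by rewrite (Hm.2.1 i) /= mulmx1 reflK.
have [Z1 Zm] := zt_root N M; set x := zt i j in Z1 Zm.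
have Z0 : x != 0.
  apply/eqP => E; move: Zm; rewrite E expr0n (negbTE M) => /eqP; by rewrite eq_sym oner_eq0.
set S := refl i *m refl j.
have Ci : root i *m S = - root i - (1 + x) *: root j.
  rewrite /S mulmxA !root_refl mulmxBl -scalemxAl !root_refl /cartan !eqxx (negbTE N) -/x.
  by move: (root i) (root j) => P Q; apply/rowP => k; rewrite !mxE; ring.
have Cj : root j *m S = (1 + x^-1) *: root i + (1 + x + x^-1) *: root j.
  rewrite /S mulmxA !root_refl mulmxBl -scalemxAl !root_refl /cartan !eqxx eq_sym (negbTE N) (ztV N) -/x.
  by move: (root i) (root j) => P Q; apply/rowP => k; rewrite !mxE; field.
have E1 : (root i + x *: root j) *m S = x *: (root i + x *: root j).
  rewrite mulmxDl -scalemxAl Ci Cj.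
  by move: (root i) (root j) => P Q; apply/rowP => k; rewrite !mxE; field.
have E2 : (root i + root j) *m S = x^-1 *: (root i + root j).
  rewrite mulmxDl Ci Cj.
  by move: (root i) (root j) => P Q; apply/rowP => k; rewrite !mxE; field.
have Sp v : exists y y', v *m S = v + y *: (root i + x *: root j) + y' *: (root i + root j).
  have X1 : x - 1 != 0 by rewrite subr_eq0.
  rewrite /S mulmxA !mul_refl; move: (_ 0 0) ((_ *m coroot j) 0 0) => e f.
  exists (- (f - e) / (x - 1)), ((f - e) / (x - 1) - e).
  by move: (root i) (root j) => P Q; apply/rowP => k; rewrite !mxE; field.
have alt_act k : rho (alt i j (2 * k)%N) = iter k (mulmx S) 1%:M.
  by elim: k => [|k IH] //; rewrite alt_add rho_cat IH /= mulmx1.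
rewrite alt_act; set k := m i j in M Zm *.
have It l (v : 'rV_(n + n)) : v *m iter l (mulmx S) 1%:M = iter l (fun u => u *m S) v.
  elim: l v => [|l IH] v; first by rewrite mulmx1.
  by rewrite iterS mulmxA IH -iterSr.
apply/row_matrixP => r; rewrite !rowE mulmx1 It; move: (delta_mx 0 r) => v.
have [y [y' Ev]] := Sp v.
have K l : iter l (fun u => u *m S) v = v + (y * \sum_(e < l) x ^+ e) *: (root i + x *: root j) +
    (y' * \sum_(e < l) x^-1 ^+ e) *: (root i + root j).
  elim: l => [|l IH]; first by rewrite !big_ord0 !mulr0 !scale0r !addr0.
  rewrite iterS IH !mulmxDl -!scalemxAl E1 E2 Ev !scalerA !big_ord_recl.
  have sh (q : algC) : \sum_(e < l) q ^+ (lift ord0 e) = q * \sum_(e < l) q ^+ e.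
    by rewrite mulr_sumr; apply: eq_bigr => e _; rewrite exprS.
  rewrite !sh !expr0; move: (\sum_(e < l) _) (\sum_(e < l) _) => A B.
  by move: (root i) (root j) => P Q; apply/rowP => e; rewrite !mxE; ring.
by rewrite K !geom_sum_root ?mulr0 ?scale0r ?addr0 // ?invr_eq1 // exprVn Zm invr1.
Qed.

Lemma rho_coxeq u v : coxeq m u v -> rho u = rho v.
Proof.
elim=> [p x y q [i [j [M [-> ->]]]]|p [i c] q|//|//|x y w _ -> _ ->//].
  by rewrite !rho_cat rho_alt // /= mul1mx.
by rewrite !rho_cat /= mulmx1 reflK mul1mx.
Qed.

Lemma rank_conj u i w : coxeq m w (u ++ gen i ++ winv u) -> (\rank (rho w - 1%:M)%R <= 1)%N.
Proof.
move=> /rho_coxeq ->; rewrite !rho_cat /= mulmx1.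
have E : rho u *m rho (winv u) = 1%:M by rewrite -rho_cat (rho_coxeq (peq_winvr _ u)).
have -> : rho u *m (refl i *m rho (winv u)) - 1%:M = rho u *m - coroot i *m (root i *m rho (winv u)).
  by rewrite /refl mulmxBl mul1mx mulmxBr E addrAC subrr add0r mulmxN mulNmx !mulmxA.
exact: leq_trans (mxrankM_maxr _ _) (rank_leq_row _).
Qed.

Lemma rank_mul (A B : 'M[algC]_(n + n)) : (\rank (A *m B - 1%:M)%R <= \rank (A - 1%:M)%R + \rank (B - 1%:M)%R)%N.
Proof.
have -> : A *m B - 1%:M = (A - 1%:M) *m B + (B - 1%:M) by rewrite mulmxBl mul1mx addrA subrK.
apply: leq_trans (mxrank_add _ _) _; rewrite leq_add2r; exact: mxrankM_maxl.
Qed.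

Lemma rank_flatten ss : (forall w, w \in ss -> (\rank (rho w - 1%:M)%R <= 1)%N) ->
  (\rank (rho (flatten ss) - 1%:M)%R <= size ss)%N.
Proof.
elim: ss => [|w ss IH] H /=; first by rewrite subrr mxrank0.
rewrite rho_cat; apply: leq_trans (rank_mul _ _) _; rewrite -add1n.
by apply: leq_add; [apply: H; rewrite mem_head|apply: IH => v Hv; apply: H; rewrite inE Hv orbT].
Qed.

Definition coef (y : 'rV[algC]_(n + n)) k := lsubmx y 0 k.

Lemma coef_refl y i k : coef (y *m refl i) k = coef y k - (y *m coroot i) 0 0 * (i == k)%:R.
Proof.
rewrite mul_refl /coef linearB linearZ !mxE; congr (_ - _ * _).
by rewrite (unsplitK (inl k : 'I_n + 'I_n)) mxE eqxx eq_sym.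
Qed.

Lemma coef_rho (s : seq 'I_n) y k : k \notin s -> coef (y *m rho [seq (i, false) | i <- s]) k = coef y k.
Proof.
elim: s y => [|i s IH] y /=; first by rewrite mulmx1.
rewrite inE negb_or => /andP[N Ns]; rewrite mulmxA IH // coef_refl eq_sym (negbTE N).
by rewrite mulr0 subr0.
Qed.

(* A vector fixed by the Coxeter element is killed by every coroot, because
   the roots are independent. *)
Lemma fix_cox (s : seq 'I_n) (v : 'rV[algC]_(n + n)) : uniq s -> v *m rho [seq (i, false) | i <- s] = v ->
  forall i, i \in s -> v *m coroot i = 0.
Proof.
elim: s => // i s IH /= /andP[Ni Us] Ev.
have E0 : (v *m coroot i) 0 0 = 0.
  have := congr1 (coef^~ i) Ev; rewrite mulmxA coef_rho // coef_refl eqxx mulr1 => /eqP.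
  by rewrite -subr_eq0 addrAC subrr add0r oppr_eq0 => /eqP.
have Ev' : v *m refl i = v by rewrite mul_refl E0 scale0r subr0.
move=> j; rewrite inE => /orP[/eqP->|]; first by rewrite [LHS]mx11_scalar E0 raddf0.
by apply: IH => //; rewrite mulmxA Ev' in Ev.
Qed.

(** By [fix_cox], the vectors fixed by the Coxeter element are killed by n independent coroots, so
    they form a space of codimension at least n. *)
Lemma rank_cox : (n <= \rank (rho (cox_elt n) - 1%:M)%R)%N.
Proof.
pose F : 'M[algC]_(n + n, n) := \matrix_(r, j) coroot j r 0.
have FE j : col j F = coroot j by apply/colP => r; rewrite !mxE.
have RF : \rank F = n.
  apply/eqP; rewrite eqn_leq rank_leq_col /= -{1}(mxrank1 algC n).
  have <- : dsubmx F = 1%:M.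
    by apply/matrixP => r j; rewrite !mxE (unsplitK (inr r : 'I_n + 'I_n)) !mxE eqxx andbT.
  have <- : row_mx 0 1%:M *m F = dsubmx F by rewrite -{1}(vsubmxK F) mul_row_col mul0mx add0r mul1mx.
  exact: mxrankM_maxr.
have : (kermx (rho (cox_elt n) - 1%:M) <= kermx F)%MS.
  apply/row_subP => r; apply/sub_kermxP.
  set v := row r _; have : v *m (rho (cox_elt n) - 1%:M) = 0.
    by apply/sub_kermxP; apply: row_sub.
  rewrite mulmxBr mulmx1 => /eqP; rewrite subr_eq0 => /eqP Ev.
  have K := fix_cox (enum_uniq _) Ev; apply/rowP => j; rewrite [RHS]mxE.
  have := K j (mem_enum _ _); rewrite -FE colE mulmxA -colE => /(congr1 (fun M : 'M_1 => M 0 0)).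
  by rewrite mxE [RHS]mxE.
move/mxrankS; rewrite !mxrank_ker RF addnK; move: (rank_leq_row (rho (cox_elt n) - 1%:M)).
by set r := \rank _; lia.
Qed.

(** A product of r reflections differs from the identity by a matrix of rank at most r, while this
    rank is at least n for the Coxeter element. *)
Lemma cox_len_aux ss : coxeq m (cox_elt n) (flatten ss) ->
  (forall w, w \in ss -> is_refl m w) -> (n <= size ss)%N.
Proof.
move=> HE Hs; apply: leq_trans rank_cox _; rewrite (rho_coxeq HE); apply: rank_flatten => w /Hs[u [i H]].
exact: rank_conj H.
Qed.
End Rep.

Lemma cox_len n (m : 'I_n -> 'I_n -> nat) ss : coxeter_matrix m -> coxeq m (cox_elt n) (flatten ss) ->
  (forall w, w \in ss -> is_refl m w) -> n <= size ss.
Proof. by move=> Hm; have [z Hz] := roots_exist; apply: (cox_len_aux Hm Hz). Qed.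

(** * Words and elements of the free group *)

Section Words.
Variable n : nat.

Definition wfg (w : word 'I_n) : fg := mkF [seq (val x.1, x.2) | x <- w].
(** Letters of index at least n are dropped, which makes [fgw] total; nothing is lost on the block
    [[0, n)]. *)
Definition olet (x : letter nat) : option (letter 'I_n) := omap (fun i => (i, x.2)) (insub x.1).
Definition fgw (g : fg) : word 'I_n := pmap olet (fw g).

Lemma wfg_cat u v : wfg (u ++ v) = wfg u * wfg v.
Proof. by rewrite /wfg map_cat mkF_cat. Qed.
Lemma wfg_gen i : wfg (gen i) = X i. Proof. by []. Qed.
Lemma wfg_winv u : wfg (winv u) = (wfg u)^-1.
Proof. by rewrite -mkF_winv /wfg /winv map_rev -!map_comp. Qed.
Lemma inF_wfg u : inF 0 n (wfg u).
Proof. by apply/inF_mkF/allP => x /mapP[y _ ->] /=. Qed.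
Lemma wfg_cox : wfg (cox_elt n) = dl 0 n.
Proof.
have -> : dl 0 n = mkF [seq (i, false) | i <- iota 0 n].
  rewrite /dl /xs subn0; elim: (iota 0 n) => //= i s ->.
  by rewrite mkF_cons.
by rewrite /wfg /cox_elt -map_comp -val_enum_ord -map_comp.
Qed.

Lemma oletK : pcancel (fun x : letter 'I_n => (val x.1, x.2)) olet.
Proof. by case=> i c; rewrite /olet /= valK. Qed.
Lemma olet_inv x : olet (linv x) = omap linv (olet x).
Proof. by case: x => i c; rewrite /olet /=; case: insub. Qed.

Lemma fgwK g : inF 0 n g -> wfg (fgw g) = g.
Proof.
move=> Fg; rewrite -[RHS]mkF_fw; congr mkF; rewrite /fgw; move: Fg; rewrite /inF.
elim: (fw g) => // -[i c] w IH /= /andP[Hx /IH E].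
have E1 : olet (i, c) = Some (Ordinal Hx, c) by rewrite /olet insubT.
by rewrite E1 /= E.
Qed.

Variable R : word 'I_n -> word 'I_n -> Prop.
Notation E := (peq R).

Lemma pmap_red u : E (pmap olet (red u)) (pmap olet u).
Proof.
elim: u => [|x u IH] /=; first exact: peq_refl.
rewrite -/(red u); apply: (@peq_trans _ _ _ (pmap olet (x :: red u))); last first.
  by rewrite /=; case: (olet x) => [y|//]; exact: (peq_catl [:: y] IH).
case: (red u) => [|y v] /=; first exact: peq_refl.
case: eqP => [->|_] /=; last exact: peq_refl.
rewrite olet_inv; case: (olet x) => [z|] /=; last exact: peq_refl.
exact/peq_sym/(peq_free R [::] z).
Qed.

Lemma wfgK u : E (fgw (wfg u)) u.
Proof.
apply: peq_trans (pmap_red _) _; rewrite (map_pK oletK); exact: peq_refl.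
Qed.
Lemma fgwM g h : E (fgw (g * h)) (fgw g ++ fgw h).
Proof. by rewrite /fgw fwM; apply: peq_trans (pmap_red _) _; rewrite pmap_cat; apply: peq_refl. Qed.

(** Equality in the presented group, carried to the free group as a congruence. *)
Definition prel : rel := fun g h => E (fgw g) (fgw h).

Lemma prel_cong : cong prel.
Proof.
split=> [g|g h|g h k|g g' h h'].
- exact: peq_refl.
- exact: peq_sym.
- exact: peq_trans.
move=> H1 H2; apply: peq_trans (fgwM _ _) _; apply: peq_trans (peq_cat H1 H2) _.
exact/peq_sym/fgwM.
Qed.
Lemma prel_wfg u v : prel (wfg u) (wfg v) <-> E u v.
Proof.
split=> H; first by apply: peq_trans (peq_sym (wfgK u)) _; apply: peq_trans H (wfgK v).
by apply: peq_trans (wfgK u) _; apply: peq_trans H (peq_sym (wfgK v)).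
Qed.
Lemma prel_fgw g u : prel g (wfg u) <-> E (fgw g) u.
Proof.
split=> H; first exact: peq_trans H (wfgK u).
exact: peq_trans H (peq_sym (wfgK u)).
Qed.
Lemma prel_fgwK g : prel (wfg (fgw g)) g.
Proof. exact: wfgK. Qed.

Lemma prel_flatten (t : nat -> fg) ss : (forall i, (i < size ss)%N -> prel (wfg (nth [::] ss i)) (t i)) ->
  prel (wfg (flatten ss)) (pr [seq t i | i <- iota 0 (size ss)]).
Proof.
elim: ss t => [|w ss IH] t H; first exact: (c_refl prel_cong).
rewrite [flatten _]/= wfg_cat [iota _ _]/= -[1%N]/(1 + 0)%N iotaDl /= -map_comp.
apply: (c_mul prel_cong); first exact: (H 0%N).
by apply: (IH (t \o S)) => i Hi; apply: (H i.+1).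
Qed.

Definition shb (p : nat) (b : seq (nat * bool)) : seq (nat * bool) := [seq ((x.1 + p)%N, x.2) | x <- b].
Lemma brw_shb p k b : braid_word k b -> brw p (p + k) (shb p b).
Proof. by move=> /allP H; apply/allP => x /mapP[y /H Hy ->] /=; lia. Qed.
Lemma shb_onto p q v : brw p q v -> exists b, braid_word (q - p) b /\ v = shb p b.
Proof.
move=> /allP H; exists [seq ((x.1 - p)%N, x.2) | x <- v]; split.
  by apply/allP => x /mapP[y /H Hy ->] /=; lia.
rewrite /shb -map_comp -[LHS]map_id; apply/eq_in_map => -[i c] /H /= Hi.
by congr (_, _); lia.
Qed.

Lemma size_hurwitz b (s : seq (word 'I_n)) : size (hurwitz b s) = size s.
Proof.
elim: b => //= x b IH; rewrite /hstep; case: ifP => // H.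
case: ifP => _; rewrite !size_set_nth -IH; move: H; rewrite IH; lia.
Qed.

Lemma nth_hstep (x : nat * bool) (t : seq (word 'I_n)) i : (x.1.+1 < size t)%N ->
  nth [::] (hstep x t) i =
    let g := nth [::] t x.1 in let g' := nth [::] t x.1.+1 in
    if i == x.1 then (if ~~ x.2 then g ++ g' ++ winv g else g')
    else if i == x.1.+1 then (if ~~ x.2 then g else winv g' ++ g ++ g') else nth [::] t i.
Proof.
move=> H; rewrite /hstep H; case: ifP => _; rewrite !nth_set_nth /=.
  case: (i =P x.1.+1) => [->|_]; rewrite ?nth_set_nth /= //.
  by rewrite (_ : (x.1.+1 == x.1) = false) //; lia.
case: (i =P x.1.+1) => [->|_]; rewrite ?nth_set_nth /= //.
by rewrite (_ : (x.1.+1 == x.1) = false) //; lia.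
Qed.

(** The head letter of a braid word acts last on the tuple and first on the generator, so the two
    recursions run in parallel. *)
Lemma hurwitz_aut w p b (s : seq (word 'I_n)) : braid_word (size s) b ->
  (forall i, (i < size s)%N -> prel (wfg (nth [::] s i)) (aut w (X (i + p)))) ->
  forall i, (i < size s)%N -> prel (wfg (nth [::] (hurwitz b s) i)) (aut w (aut (shb p b) (X (i + p)))).
Proof.
have PC := prel_cong.
move=> + H; elim: b => //= x b IH /andP[Hx /IH {}IH] i Hi; have Sz := size_hurwitz b s.
have Hx' : (x.1.+1 < size (hurwitz b s))%N by rewrite Sz.
rewrite (nth_hstep _ Hx') sgX; case: x Hx {Hx'} => j c Hx; rewrite ![(_, _).1]/= ![(_, _).2]/= in Hx *.
have Ei := IH j (ltnW Hx); have Ej := IH j.+1 Hx; rewrite addSn in Ej.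
have [Eij|N1] := eqVneq i j.
  rewrite Eij; case: c; first by rewrite sgf0V.
  rewrite sgf0 !wfg_cat wfg_winv !autM !autV mulgA.
  by apply: c_mul => //; [apply: c_mul|apply: c_inv].
have [Eij|N2] := eqVneq i j.+1.
  rewrite Eij addSn; case: c; last by rewrite sgf1.
  rewrite sgf1V !wfg_cat wfg_winv !autM !autV mulgA.
  by apply: c_mul => //; apply: c_mul => //; apply: c_inv.
rewrite sgf_id; [exact: IH| |].
  by apply/eqP; move/eqP: N1; rewrite /=; lia.
by apply/eqP; move/eqP: N2; rewrite /=; lia.
Qed.
End Words.
Arguments fgw {n} g.

(** * Pan-transitivity in terms of braids *)

Section Coxeter.
Variables (n : nat) (m : 'I_n -> 'I_n -> nat).
Hypothesis Hm : coxeter_matrix m.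
Notation E := (prel (cox_rel m)).
Let EC : cong E := prel_cong (cox_rel m).

Lemma gen_sq i : coxeq m (gen i ++ gen i) [::].
Proof.
apply: peq_rel0; exists i, i; have -> : m i i = 1%N by case: Hm => _ [].
by split.
Qed.
Lemma gen_inv i : coxeq m (winv (gen i)) (gen i).
Proof.
apply: peq_trans (peq_sym _) (_ : peq _ (winv (gen i) ++ gen i ++ gen i) _).
  by rewrite -[X in peq _ _ X]cats0; apply/peq_catl/gen_sq.
rewrite catA -[X in peq _ _ X]cat0s; apply: peq_catr; exact: peq_winvl.
Qed.

Lemma refl_winv w : is_refl m (winv w) -> is_refl m w.
Proof.
case=> u [i H]; exists u, i; apply/prel_wfg; have {H} /(c_inv EC) := (prel_wfg _ _ _).2 H.
rewrite wfg_winv invgK => H; apply: (c_trans EC H).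
rewrite -wfg_winv; apply/prel_wfg; rewrite !winv_cat winvK -catA.
apply/peq_catl/peq_catr; exact: gen_inv.
Qed.

Lemma rfl_is_refl t : rfl 0 n t -> is_refl m (fgw t).
Proof.
case=> u [i [Fu Hi ->]]; exists (fgw u), (Ordinal (Hi : (i < n)%N)).
apply/prel_fgw; rewrite !wfg_cat wfg_winv fgwK // mulgA; exact: c_refl.
Qed.
Lemma is_refl_rfl w : is_refl m w -> exists2 t, rfl 0 n t & E (wfg w) t.
Proof.
case=> u [i H]; exists (wfg u * X i * (wfg u)^-1).
  by exists (wfg u), (val i); rewrite inF_wfg ltn_ord.
by have := (prel_wfg _ _ _).2 H; rewrite !wfg_cat wfg_winv mulgA.
Qed.

Lemma fgw_pr s : peq (cox_rel m) (fgw (pr s)) (flatten [seq fgw x | x <- s]).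
Proof.
elim: s => [|x s IH] /=; first exact: peq_refl.
by apply: peq_trans (fgwM _ _ _) _; apply: peq_catl.
Qed.

Lemma cox_base : base_rel E 0 n.
Proof.
split=> //.
  move=> i /= Hi; have /(prel_wfg _ _ _).2 := gen_sq (Ordinal Hi).
  by rewrite wfg_cat.
move=> s Hs HE; rewrite subn0 -(size_map (@fgw n)); apply: (cox_len Hm).
  apply: peq_trans (peq_sym _) (fgw_pr s); apply: peq_trans (peq_sym HE) _.
  by rewrite -wfg_cox; apply: wfgK.
by move=> w /mapP[x /Hs Hx ->]; apply: rfl_is_refl.
Qed.

Definition fact (g : fg) (k : nat) : Prop :=
  exists s, [/\ size s = k, forall x, x \in s -> rfl 0 n x & E g (pr s)].

Lemma fact_tfact a k : fact (wfg a) k -> exists s, size s = k /\ tfact m a s.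
Proof.
case=> s [Ss Rs Es]; exists [seq fgw x | x <- s]; split; first by rewrite size_map.
split.
  move=> i; rewrite size_map => Hi; left; rewrite (nth_map 1) //.
  by apply/rfl_is_refl/Rs/mem_nth.
by apply: peq_trans (peq_sym (wfgK _ a)) _; apply: peq_trans Es (fgw_pr s).
Qed.

Lemma tfact_rfl a s : tfact m a s -> exists t : nat -> fg,
  [/\ forall i, (i < size s)%N -> rfl 0 n (t i), forall i, (i < size s)%N -> E (wfg (nth [::] s i)) (t i)
    & E (wfg a) (seg t 0 (size s))].
Proof.
move=> [Rs Ea]; pose P i t := (i < size s)%N -> rfl 0 n t /\ E (wfg (nth [::] s i)) t.
have [t Ht] : exists t, forall i, P i (t i).
  apply: choice_fun => i; rewrite /P; case: ltnP => H; last by exists 1.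
  have [t H1 H2] : exists2 t, rfl 0 n t & E (wfg (nth [::] s i)) t.
    by apply: is_refl_rfl; case: (Rs i H) => // /refl_winv.
  by exists t.
exists t; split=> [i /Ht[]//|i /Ht[]//|].
apply: (c_trans EC (h := wfg (flatten s))); first exact/prel_wfg.
by rewrite /seg subn0; apply: prel_flatten => i /Ht[].
Qed.

Lemma tfact_fact a s : tfact m a s -> fact (wfg a) (size s).
Proof.
move=> /tfact_rfl[t [H1 _ H3]]; exists [seq t i | i <- iota 0 (size s - 0)]; split=> //.
  by rewrite size_map size_iota subn0.
by move=> x /mapP[i]; rewrite mem_iota subn0 => Hi ->; apply: H1.
Qed.

Lemma fact_min g h ka kb : fact g ka -> fact h kb -> E (g * h) (dl 0 n) -> (n <= ka + kb)%N.
Proof.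
move=> [s [<- Rs Es]] [t [<- Rt Et]] HE; have [_ _ HL] := cox_base.
have := HL (s ++ t); rewrite subn0 size_cat; apply.
  by move=> x; rewrite mem_cat => /orP[/Rs|/Rt].
by apply: (c_trans EC (c_sym EC HE)); rewrite pr_cat; apply: c_mul.
Qed.

(** Two factorizations whose lengths add up to n are both shortest, since the Coxeter element has
    reflection length n. *)
Lemma fact_tlen a b ka kb : fact (wfg a) ka -> fact (wfg b) kb -> E (wfg a * wfg b) (dl 0 n) ->
  (ka + kb = n)%N -> tlen m a ka /\ tlen m b kb.
Proof.
move=> Fa Fb HE Hk; split; split; try exact: fact_tfact.
  by move=> s /tfact_fact Fs; have := fact_min Fs Fb HE; lia.
by move=> s /tfact_fact Fs; have := fact_min Fa Fs HE; lia.
Qed.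

Lemma fact1 : fact 1 0.
Proof. by exists [::]; split=> //; exact: c_refl. Qed.

Lemma tlen_cox : tlen m (cox_elt n) n.
Proof.
have F : fact (wfg (cox_elt n)) n.
  exists (xs 0 n); split; [by rewrite size_xs subn0|by move=> x; apply: xs_rfl|].
  by rewrite wfg_cox; apply: c_refl.
have [|//] := fact_tlen (b := [::]) F fact1 _ (addn0 n).
by rewrite wfg_cox mulg1; apply: c_refl.
Qed.

Lemma tlen_uniq a k k' : tlen m a k -> tlen m a k' -> k = k'.
Proof.
move=> [[s [<- Hs]] M] [[s' [<- Hs']] M']; apply/eqP; rewrite eqn_leq.
by rewrite (M _ Hs') (M' _ Hs).
Qed.

Lemma fact_tle a ka kb : fact (wfg a) ka -> fact (wfg (winv a ++ cox_elt n)) kb -> (ka + kb = n)%N ->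
  tle m a (cox_elt n).
Proof.
move=> Fa Fb Hk; have [|L1 L2] := fact_tlen Fa Fb _ Hk.
  by rewrite -wfg_cat catA wfg_cat wfg_cat wfg_winv mulgV mul1g wfg_cox; apply: c_refl.
by exists ka, kb, n; split=> //; split=> //; split=> //; apply: tlen_cox.
Qed.

Lemma tle_fact a : tle m a (cox_elt n) -> exists ka kb,
  [/\ tlen m a ka, fact (wfg a) ka, fact (wfg (winv a ++ cox_elt n)) kb & (ka + kb = n)%N].
Proof.
case=> ka [kb [kc [La [Lb [Lc Hk]]]]]; exists ka, kb; split=> //; last by rewrite Hk (tlen_uniq Lc tlen_cox).
  by case: La => -[s [<- H]] _; apply: tfact_fact.
by case: Lb => -[s [<- H]] _; apply: tfact_fact.
Qed.

Lemma aut_fact w p q : (p <= q <= n)%N -> brw 0 n w -> fact (aut w (dl p q)) (q - p).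
Proof.
move=> /andP[Hp Hq] Hw; exists [seq aut w x | x <- xs p q]; split.
- by rewrite size_map size_xs.
- by move=> x; apply: aut_xs_rfl.
by rewrite -aut_pr; apply: c_refl.
Qed.

Lemma aut_tred w p q : (p <= q <= n)%N -> brw 0 n w ->
  let a := fgw (aut w (dl p q)) in
  tle m a (cox_elt n) /\ forall s, size s = (q - p)%N ->
    (forall i, (i < q - p)%N -> E (wfg (nth [::] s i)) (aut w (X (i + p)))) -> tred m a s.
Proof.
move=> Hpq Hw a; have /andP[Hp Hq] := Hpq.
have Ea : wfg a = aut w (dl p q) by rewrite fgwK // inF_aut // inF_dl.
have Fa : fact (wfg a) (q - p) by rewrite Ea; apply: aut_fact.
(* The right complement exists because [move_seg] exhibits [dl p q] as a braid image of an initial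
   product. *)
have [g Fg Eg] : exists2 g, fact g (n - (q - p)) & wfg a * g = dl 0 n.
  have [s [t [t' [Es Ss [D1 _] [St _] R]]]] := @Ii_factor 0 n w (q - p) Hw ltac:(lia).
  have [v [Hv Ev]] := @move_seg 0 n p q Hp Hq; rewrite subn0 in Ev.
  have [s' [u [u' [Es' Ss' [D1' _] [Su _] R']]]] := @Ii_factor 0 n (v ++ w) (q - p) ltac:(by rewrite brw_cat Hv) ltac:(lia).
  exists (pr u); last first.
    rewrite Ea D1' -Es' aut_cat; congr (aut w _ * _); rewrite (aut_dl_seg Ev) add0n; congr dl; lia.
  by exists u; split=> //; [move=> x Hx; apply: R'; rewrite Hx orbT|exact: c_refl].
have Eg' : wfg (winv a ++ cox_elt n) = g by rewrite wfg_cat wfg_winv wfg_cox -Eg mulKg.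
have Hk : (q - p + (n - (q - p)) = n)%N by lia.
have Fb : fact (wfg (winv a ++ cox_elt n)) (n - (q - p)) by rewrite Eg'.
have [|La _] := fact_tlen Fa Fb _ Hk; first by rewrite Eg' Eg; apply: c_refl.
split; first exact: fact_tle Hk.
move=> s Ss Hs; split; last by rewrite Ss.
have It i : (i < size s)%N -> is_refl m (nth [::] s i).
  move=> Hi; rewrite Ss in Hi; have Hip : (0 <= i + p < n)%N by lia.
  have [u [j H]] := rfl_is_refl (rfl_aut Hw (rflX Hip)).
  by exists u, j; apply: peq_trans H; apply/peq_sym/(prel_fgw _ _ _).1/(c_sym EC)/Hs.
split; first by move=> i Hi; left; apply: It.
apply/peq_sym/prel_wfg; rewrite Ea; apply: (c_trans EC (prel_flatten _ (t := fun i => aut w (X (i + p))))).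
  by rewrite Ss.
rewrite Ss /dl aut_pr /xs -map_comp; have := iotaDl p 0 (q - p); rewrite addn0 => ->.
rewrite -map_comp; apply: c_eq => //; congr pr.
by apply: eq_map => i /=; rewrite addnC.
Qed.

Lemma pan_PT : pan_transitive m (cox_elt n) -> PT E 0 n.
Proof.
move=> HP p q w1 w2 Hp Hq H1 H2 HE; have Hpq : (p <= q <= n)%N by lia.
pose s w := [seq fgw (aut w (X (i + p))) | i <- iota 0 (q - p)] : seq (word 'I_n).
have Ss w : size (s w) = (q - p)%N by rewrite size_map size_iota.
have Es w i : brw 0 n w -> (i < q - p)%N -> E (wfg (nth [::] (s w) i)) (aut w (X (i + p))).
  move=> Hw Hi; rewrite (nth_map 0%N) ?size_iota // nth_iota // add0n; exact: prel_fgwK.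
have [Ta Hr1] := aut_tred Hpq H1; have [_ Hr2] := aut_tred Hpq H2.
have R1 := Hr1 (s w1) (Ss w1) (fun i => Es w1 i H1).
have R2 := Hr2 (s w2) (Ss w2) (fun i => Es w2 i H2).
have R2' : tred m (fgw (aut w1 (dl p q))) (s w2).
  move: R2 => [[A1 A2] [A3 A4]]; have HE' : coxeq m (fgw (aut w1 (dl p q))) (fgw (aut w2 (dl p q))) := HE.
  have K x : tfact m (fgw (aut w2 (dl p q))) x <-> tfact m (fgw (aut w1 (dl p q))) x.
    split=> -[B1 B2]; split=> //; first exact: peq_trans HE' B2.
    exact: peq_trans (peq_sym HE') B2.
  split; first exact/K; split; last by move=> x /K/A4.
  by case: A3 => x [B1 /K B2]; exists x.
have [b [Hb [Sb Eb]]] := HP _ Ta _ _ R1 R2'.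
rewrite Ss in Hb; exists (shb p b); split.
  by have := brw_shb p Hb; rewrite subnKC // (proj1 (andP Hpq)).
move=> i Hi; have Hi' : (i - p < q - p)%N by lia.
have := @hurwitz_aut n (cox_rel m) w1 p b (s w1); rewrite Ss => /(_ Hb (fun i => Es w1 i H1) (i - p)%N Hi').
rewrite subnK; last by lia.
move/(c_sym EC) => H; apply: (c_trans EC H); have := Eb (i - p)%N; rewrite size_hurwitz Ss => /(_ Hi').
move/(prel_wfg _ _ _).2 => H'; apply: (c_trans EC H').
by have := Es w2 (i - p)%N H2 Hi'; rewrite subnK //; lia.
Qed.

(** Pan-transitivity at the Coxeter element itself, for the tuple of generators and the given
    factorization. *)
Lemma pan_Hur : pan_transitive m (cox_elt n) -> Hur E 0 n.
Proof.
move=> HP t Ht HE.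
pose s w := [seq fgw (aut w (X (i + 0))) | i <- iota 0 (n - 0)] : seq (word 'I_n).
pose s' := [seq fgw (t i) | i <- iota 0 n] : seq (word 'I_n).
have [Ta Hr] := @aut_tred [::] 0 n (leqnn n) erefl.
have Ss w : size (s w) = (n - 0)%N by rewrite size_map size_iota.
have Es i : (i < n - 0)%N -> E (wfg (nth [::] (s [::]) i)) (aut [::] (X (i + 0))).
  move=> Hi; rewrite (nth_map 0%N) ?size_iota // nth_iota // add0n; exact: prel_fgwK.
have R1 := Hr (s [::]) (Ss [::]) Es.
have R2 : tred m (fgw (aut [::] (dl 0 n))) s'.
  split; last by rewrite /s' size_map size_iota; case: R1 => _; rewrite Ss subn0.
  split.
    move=> i; rewrite size_map size_iota => Hi; left; rewrite (nth_map 0%N) ?size_iota // nth_iota //.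
    exact/rfl_is_refl/Ht.
  apply: peq_trans (peq_sym HE) _; apply: peq_trans (fgw_pr _) _.
  by rewrite -map_comp subn0; apply: peq_refl.
have [b [Hb [Sb Eb]]] := HP _ Ta _ _ R1 R2; rewrite Ss in Hb.
exists (shb 0 b); split; first by have := brw_shb 0 Hb; rewrite subn0 add0n.
move=> i Hi; have := @hurwitz_aut n (cox_rel m) [::] 0 b (s [::]); rewrite Ss subn0 in Hb *.
rewrite subn0 in Es => /(_ Hb Es i Hi); rewrite addn0 => /(c_sym EC) H; apply: (c_trans EC H).
have := Eb i; rewrite size_hurwitz Ss subn0 => /(_ Hi)/(prel_wfg _ _ _).2 H'; apply: (c_trans EC H').
by rewrite (nth_map 0%N) ?size_iota // nth_iota //; apply: prel_fgwK.
Qed.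

(* A reduced factorization of a is the beginning of one of the Coxeter
   element, hence of a braid image of the tuple of generators. *)
Lemma tred_aut a s : Hur E 0 n -> tle m a (cox_elt n) -> tred m a s ->
  exists w, [/\ brw 0 n w, (size s <= n)%N &
    forall i, (i < size s)%N -> E (wfg (nth [::] s i)) (aut w (X i))].
Proof.
move=> HH /tle_fact[ka [kb [La _ [u [Su Ru Eu]] Hk]]] [Hs Ls].
have Ek := tlen_uniq La Ls; rewrite {ka La}Ek in Hk.
have [t [T1 T2 T3]] := tfact_rfl Hs.
pose t' i := if (i < size s)%N then t i else nth 1 u (i - size s).
have Hsn : (size s <= n)%N by lia.
have [||w [Hw W]] := HH t'.
- move=> i Hi; rewrite /t'; case: ltnP => Hi'; first exact: T1.
  by apply/Ru/mem_nth; lia.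
- rewrite (@seg_cat t' 0 (size s) n) //.
  have -> : seg t' 0 (size s) = seg t 0 (size s) by apply: eq_seg => i /andP[_ Hi]; rewrite /t' Hi.
  have -> : seg t' (size s) n = pr u.
    rewrite /seg; congr pr; rewrite (_ : n - size s = size u)%N; last lia.
    rewrite -[X in iota X _]addn0 iotaDl -map_comp -[RHS](mkseq_nth 1 u); apply: eq_map => i.
    by rewrite /t' /= ltnNge leq_addr addKn.
  apply: (c_trans EC (h := wfg a * wfg (winv a ++ cox_elt n))); last first.
    by rewrite wfg_cat wfg_winv wfg_cox mulVKg; apply: c_refl.
  by apply: c_mul => //; apply: c_sym.
exists w; split=> // i Hi; apply: (c_trans EC (T2 i Hi)); apply: (c_sym EC).
by have := W i ltac:(lia); rewrite /t' Hi.
Qed.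

(** By [tred_aut], both factorizations are braid images of the same initial generators, so [PT] with
    [p = 0] links them. *)
Lemma PT_pan : Hur E 0 n -> PT E 0 n -> pan_transitive m (cox_elt n).
Proof.
move=> HH HP a Ta s s' Hs Hs'.
have Sz : size s' = size s by apply: (tlen_uniq Hs'.2 Hs.2).
have [w [Hw Hn W]] := tred_aut HH Ta Hs; have [w' [Hw' _ W']] := tred_aut HH Ta Hs'.
have Prod v (x : seq (word 'I_n)) : brw 0 n v -> tred m a x -> (forall i, (i < size x)%N -> E (wfg (nth [::] x i)) (aut v (X i))) ->
    E (wfg a) (aut v (dl 0 (size x))).
  move=> Hv [[_ Ex] _] Wx; apply: (c_trans EC ((prel_wfg _ _ _).2 Ex)).
  by have := prel_flatten Wx; rewrite /dl aut_pr /xs subn0 -map_comp.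
have HE : E (aut w (dl 0 (size s))) (aut w' (dl 0 (size s))).
  rewrite -{2}Sz; apply: (c_trans EC (c_sym EC (Prod w s Hw Hs W))); exact: Prod.
have [v [Hv V]] := HP 0%N (size s) w w' isT Hn Hw Hw' HE.
have [b [Hb Eb]] := shb_onto Hv; rewrite subn0 in Hb.
exists b; split=> //; split; first by rewrite size_hurwitz Sz.
move=> i; rewrite size_hurwitz => Hi; apply/prel_wfg.
have := @hurwitz_aut n (cox_rel m) w 0 b s Hb.
have W0 j : (j < size s)%N -> E (wfg (nth [::] s j)) (aut w (X (j + 0))) by rewrite addn0; apply: W.
move=> /(_ W0 i Hi); rewrite -Eb addn0 => H; apply: (c_trans EC H).
apply: (c_trans EC (V i Hi)); apply/(c_sym EC)/W'; by rewrite Sz.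
Qed.
End Coxeter.

(** * The two factors *)

Definition fmap (A B : Type) (h : letter A -> word B) (u : word A) : word B := flatten [seq h x | x <- u].

Lemma fmap_cat A B (h : letter A -> word B) u v : fmap h (u ++ v) = fmap h u ++ fmap h v.
Proof. by rewrite /fmap map_cat flatten_cat. Qed.

Lemma peq_fmap A B (R : word A -> word A -> Prop) (R' : word B -> word B -> Prop) h u v :
  (forall x, peq R' (h x ++ h (linv x)) [::]) ->
  (forall u v, R u v -> peq R' (fmap h u) (fmap h v)) ->
  peq R u v -> peq R' (fmap h u) (fmap h v).
Proof.
move=> Hh HR; elim=> [p x y q H|p x q|x|x y _ H|x y z _ H1 _ H2].
- by rewrite !fmap_cat; apply/peq_catl/peq_catr/HR.
- rewrite !fmap_cat; apply/peq_catl; rewrite -[X in peq _ _ X]cat0s; apply: peq_catr.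
  by rewrite /fmap /= cats0.
- exact: peq_refl.
- exact: peq_sym.
exact: peq_trans H1 H2.
Qed.

Definition shf (k : nat) (g : fg) : fg := hom (fun i => X (i + k)) g.

Lemma shfM k g h : shf k (g * h) = shf k g * shf k h.
Proof. exact: homM. Qed.
Lemma shfV k g : shf k g^-1 = (shf k g)^-1.
Proof. exact: homV. Qed.
Lemma shf1 k : shf k 1 = 1. Proof. exact: hom1. Qed.
Lemma shfX k i : shf k (X i) = X (i + k). Proof. exact: homX. Qed.
Lemma shf_pr k s : shf k (pr s) = pr [seq shf k x | x <- s].
Proof. by elim: s => [|x s IH] /=; rewrite ?shf1 // shfM IH. Qed.
Lemma shf_dl k p q : shf k (dl p q) = dl (p + k) (q + k).
Proof.
rewrite /dl shf_pr /xs -map_comp subnDr (addnC p k) iotaDl -map_comp; congr pr.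
by apply: eq_map => i /=; rewrite shfX addnC.
Qed.
Lemma shf_sg k x g : shf k (sg x g) = sg ((x.1 + k)%N, x.2) (shf k g).
Proof.
elim/fg_ind': g => [|[i c] g IH]; first by rewrite sg1 !shf1 sg1.
rewrite sgM !shfM sgM IH; congr (_ * _).
suff E : shf k (sg x (X i)) = sg ((x.1 + k)%N, x.2) (shf k (X i)).
  by rewrite LX; case: c => //=; rewrite sgV !shfV sgV E.
rewrite shfX !sgX; case: x {IH} => j e /=; have [->|N1] := eqVneq i j.
  by case: e; rewrite ?sgf0V ?sgf0 ?shfM ?shfV !shfX ?addSn.
have [->|N2] := eqVneq i j.+1.
  by rewrite addSn; case: e; rewrite ?sgf1V ?sgf1 ?shfM ?shfV !shfX ?addSn.
by rewrite !sgf_id ?shfX //= -?addSn eqn_add2r.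
Qed.
Lemma shf_aut k b g : shf k (aut b g) = aut (shb k b) (shf k g).
Proof. by elim: b g => //= x b IH g; rewrite IH shf_sg. Qed.
Lemma shf_onto k l g : inF k (k + l) g -> exists2 g', inF 0 l g' & g = shf k g'.
Proof.
elim/inF_ind: g / => [|[i c] g /= Hi Fg [g' Fg' ->]]; first by exists 1; rewrite ?shf1.
exists (L ((i - k)%N, c) * g'); first by rewrite inFM ?inFL //=; lia.
by rewrite shfM; congr (_ * _); rewrite !LX; case: c; rewrite ?shfV shfX subnK //; lia.
Qed.
Lemma rfl_shf_onto k l x : rfl k (k + l) x -> exists2 y, rfl 0 l y & x = shf k y.
Proof.
case=> u [i [/shf_onto[u' Fu' ->] Hi ->]]; exists (u' * X (i - k) * u'^-1).
  by exists u', (i - k)%N; split=> //; lia.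
by rewrite !shfM shfV shfX subnK //; lia.
Qed.

Definition agree_shift (E E' : rel) k l : Prop :=
  forall g h, inF 0 l g -> inF 0 l h -> E (shf k g) (shf k h) <-> E' g h.

Lemma PT_shift E E' k l : agree_shift E E' k l -> PT E' 0 l -> PT E k (k + l).
Proof.
move=> HE HP p q w1 w2 Hp Hq H1 H2.
have [b1 [B1 ->]] := shb_onto H1; have [b2 [B2 ->]] := shb_onto H2; rewrite addKn in B1 B2.
have Hb b : braid_word l b -> brw 0 l b by move=> H; have := brw_shb 0 H; rewrite add0n /shb; congr brw; rewrite -[RHS]map_id; apply: eq_map => -[i c]; rewrite addn0.
have {}B1 := Hb _ B1; have {}B2 := Hb _ B2.
have Ed : dl p q = shf k (dl (p - k) (q - k)) by rewrite shf_dl; congr dl; lia.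
have Fd : inF 0 l (dl (p - k) (q - k)) by apply: inF_dl; lia.
rewrite Ed -!shf_aut => /HE; rewrite !inF_aut // => /(_ Fd Fd) HE'.
have [||||v [Hv Ev]] := HP (p - k)%N (q - k)%N b1 b2 _ _ _ _ HE' => //; try lia.
exists (shb k v); split.
  by apply/allP => x /mapP[y Hy ->] /=; have := allP Hv y Hy; lia.
move=> i Hi; have -> : X i = shf k (X (i - k)) by rewrite shfX subnK //; lia.
rewrite -!shf_aut; have Fi : inF 0 l (X (i - k)) by rewrite inFX; lia.
apply/HE; rewrite ?inF_aut //; first by apply: brwS Hv; lia.
by apply: Ev; lia.
Qed.

Lemma Hur_shift E E' k l : agree_shift E E' k l -> Hur E' 0 l -> Hur E k (k + l).
Proof.
move=> HE HH t Ht Et; pose P i x := (i < l)%N -> rfl 0 l x /\ t (i + k)%N = shf k x.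
have [u Hu] : exists u, forall i, P i (u i).
  apply: choice_fun => i; rewrite /P; case: ltnP => Hi; last by exists 1.
  have [|x H1 H2] := @rfl_shf_onto k l (t (i + k)%N); first by apply: Ht; lia.
  by exists x.
have Es : seg t k (k + l) = shf k (seg u 0 l).
  rewrite /seg shf_pr addKn subn0 -map_comp -{1}[k]addn0 iotaDl -map_comp; congr pr.
  by apply/eq_in_map => i; rewrite mem_iota => Hi /=; rewrite addnC; have [] := Hu i Hi.
have Ed : dl k (k + l) = shf k (dl 0 l) by rewrite shf_dl add0n addnC.
rewrite Es Ed in Et; have [|w [Hw W]] := HH u (fun i Hi => (Hu i (proj2 (andP Hi))).1).
  apply: (HE _ _ _ _).1 Et; rewrite ?inF_dl //.
  apply: (pr_inF (a := 0)) => x /mapP[i]; rewrite mem_iota subn0 => Hi ->.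
  by have [] := Hu i Hi.
exists (shb k w); split.
  by apply/allP => x /mapP[y Hy ->] /=; have := allP Hw y Hy; lia.
move=> i Hi; have Hi' : (i - k < l)%N by lia.
have [R1 R2] := Hu _ Hi'; rewrite subnK in R2; last lia.
have -> : X i = shf k (X (i - k)) by rewrite shfX subnK //; lia.
rewrite -shf_aut R2; apply: (HE _ _ _ _).2; last exact: W.
  by rewrite inF_aut // inFX.
exact: rfl_inF R1.
Qed.

Lemma shf0 g : shf 0 g = g.
Proof.
rewrite -[RHS]hom_id; apply: hom_ext => x _; by rewrite addn0.
Qed.

Section Blocks.
Variables (k l : nat) (m1 : 'I_k -> 'I_k -> nat) (m2 : 'I_l -> 'I_l -> nat).
Notation m := (fpmat m1 m2).

Lemma split_l (i : 'I_k) : split (lshift l i) = inl i.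
Proof. exact: (unsplitK (inl i : 'I_k + 'I_l)). Qed.
Lemma split_r (i : 'I_l) : split (rshift k i) = inr i.
Proof. exact: (unsplitK (inr i : 'I_k + 'I_l)). Qed.

Lemma fpmat_coxeter : coxeter_matrix m1 -> coxeter_matrix m2 -> coxeter_matrix m.
Proof.
move=> [S1 [D1 O1]] [S2 [D2 O2]]; split; [|split].
- by move=> i j; rewrite /fpmat; case: (split i) => a; case: (split j) => b.
- by move=> i; rewrite /fpmat; case: (split i) => a.
move=> i j N; rewrite /fpmat; rewrite -(splitK i) -(splitK j) in N.
case: (split i) (split j) N => a [] b //= N; [apply: O1|apply: O2]; by apply: contra N => /eqP->.
Qed.

Definition lft1 (x : letter 'I_k) : word 'I_(k + l) := [:: (lshift l x.1, x.2)].
Definition lft2 (x : letter 'I_l) : word 'I_(k + l) := [:: (rshift k x.1, x.2)].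
(** The retraction of the free product onto its first factor; it shows that equality in the product
    restricts to equality in the factor. *)
Definition ret1 (x : letter 'I_(k + l)) : word 'I_k := if split x.1 is inl i then [:: (i, x.2)] else [::].
Definition ret2 (x : letter 'I_(k + l)) : word 'I_l := if split x.1 is inr i then [:: (i, x.2)] else [::].

Lemma fmap_alt A B (h : letter A -> word B) (f : A -> B) (i j : A) n :
  h (i, false) = gen (f i) -> h (j, false) = gen (f j) -> fmap h (alt i j n) = alt (f i) (f j) n.
Proof.
move=> Hi Hj; rewrite /fmap /alt -map_comp; elim: (iota 0 n) => //= x s ->.
by case: (odd x); rewrite ?Hi ?Hj.
Qed.
Lemma fmap_alt0 A B (h : letter A -> word B) (i j : A) n :
  h (i, false) = [::] -> h (j, false) = [::] -> fmap h (alt i j n) = [::].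
Proof.
move=> Hi Hj; rewrite /fmap /alt -map_comp; elim: (iota 0 n) => //= x s ->.
by case: (odd x); rewrite ?Hi ?Hj.
Qed.

Lemma lft1_cox u v : coxeq m1 u v -> coxeq m (fmap lft1 u) (fmap lft1 v).
Proof.
apply: peq_fmap => [x|_ _ [i [j [M [-> ->]]]]]; first exact: (peq_free _ [::]).
apply: peq_rel0; exists (lshift l i), (lshift l j); rewrite /fpmat !split_l; split=> //; split=> //.
exact: (@fmap_alt _ _ lft1 (lshift l)).
Qed.
Lemma lft2_cox u v : coxeq m2 u v -> coxeq m (fmap lft2 u) (fmap lft2 v).
Proof.
apply: peq_fmap => [x|_ _ [i [j [M [-> ->]]]]]; first exact: (peq_free _ [::]).
apply: peq_rel0; exists (rshift k i), (rshift k j); rewrite /fpmat !split_r; split=> //; split=> //.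
exact: (@fmap_alt _ _ lft2 (rshift k (n:=l))).
Qed.
Lemma lft1_art u v : arteq m1 u v -> arteq m (fmap lft1 u) (fmap lft1 v).
Proof.
apply: peq_fmap => [x|_ _ [i [j [M [-> ->]]]]]; first exact: (peq_free _ [::]).
apply: peq_rel0; exists (lshift l i), (lshift l j); rewrite /fpmat !split_l; split=> //.
by split; apply: (@fmap_alt _ _ lft1 (lshift l)).
Qed.
Lemma lft2_art u v : arteq m2 u v -> arteq m (fmap lft2 u) (fmap lft2 v).
Proof.
apply: peq_fmap => [x|_ _ [i [j [M [-> ->]]]]]; first exact: (peq_free _ [::]).
apply: peq_rel0; exists (rshift k i), (rshift k j); rewrite /fpmat !split_r; split=> //.
by split; apply: (@fmap_alt _ _ lft2 (rshift k (n:=l))).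
Qed.
Lemma ret1_cox u v : coxeq m u v -> coxeq m1 (fmap ret1 u) (fmap ret1 v).
Proof.
apply: peq_fmap => [x|_ _ [i [j [+ [-> ->]]]]].
  by rewrite /ret1 /=; case: (split _) => a; [exact: (peq_free _ [::])|exact: peq_refl].
rewrite /fpmat; case Ei: (split i) => [a|a]; case Ej: (split j) => [b|b] // M.
  apply: peq_rel0; exists a, b; split=> //; split=> //.
  have := @fmap_alt _ _ ret1 (fun x => if split x is inl c then c else a) i j (2 * m1 a b).
  by rewrite /ret1 /= Ei Ej; apply.
by rewrite fmap_alt0 /ret1 /= ?Ei ?Ej //; apply: peq_refl.
Qed.
Lemma ret2_cox u v : coxeq m u v -> coxeq m2 (fmap ret2 u) (fmap ret2 v).
Proof.
apply: peq_fmap => [x|_ _ [i [j [+ [-> ->]]]]].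
  by rewrite /ret2 /=; case: (split _) => a; [exact: peq_refl|exact: (peq_free _ [::])].
rewrite /fpmat; case Ei: (split i) => [a|a]; case Ej: (split j) => [b|b] // M.
  by rewrite fmap_alt0 /ret2 /= ?Ei ?Ej //; apply: peq_refl.
apply: peq_rel0; exists a, b; split=> //; split=> //.
have := @fmap_alt _ _ ret2 (fun x => if split x is inr c then c else a) i j (2 * m2 a b).
by rewrite /ret2 /= Ei Ej; apply.
Qed.
Lemma ret1K u : fmap ret1 (fmap lft1 u) = u.
Proof. by elim: u => //= -[i c] u IH; rewrite -[RHS]cat1s -{2}IH /fmap /= /ret1 /= split_l. Qed.
Lemma ret2K u : fmap ret2 (fmap lft2 u) = u.
Proof. by elim: u => //= -[i c] u IH; rewrite -[RHS]cat1s -{2}IH /fmap /= /ret2 /= split_r. Qed.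

Lemma wfg_lft1 u : wfg (fmap lft1 u) = wfg u.
Proof. by congr mkF; elim: u => //= -[i c] u IH; rewrite -IH. Qed.
Lemma wfg_lft2 u : wfg (fmap lft2 u) = shf k (wfg u).
Proof.
elim: u => [|[i c] u IH]; first by rewrite shf1.
rewrite -cat1s fmap_cat !wfg_cat IH shfM; congr (_ * _).
have W p (x : letter 'I_p) : wfg [:: x] = L (val x.1, x.2) := erefl.
by rewrite mulg1 /lft2 !W !LX; case: c; rewrite /= ?shfV shfX addnC.
Qed.

Lemma agree1 : agree_shift (prel (cox_rel m)) (prel (cox_rel m1)) 0 k.
Proof.
move=> g h Fg Fh; rewrite !shf0 -(fgwK Fg) -(fgwK Fh) -[X in prel (cox_rel m) X]wfg_lft1 -[X in prel (cox_rel m) _ X]wfg_lft1.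
split=> /prel_wfg H; apply/prel_wfg; last exact: lft1_cox.
by have := ret1_cox H; rewrite !ret1K.
Qed.
Lemma agree2 : agree_shift (prel (cox_rel m)) (prel (cox_rel m2)) k l.
Proof.
move=> g h Fg Fh; rewrite -(fgwK Fg) -(fgwK Fh) -!wfg_lft2.
split=> /prel_wfg H; apply/prel_wfg; last exact: lft2_cox.
by have := ret2_cox H; rewrite !ret2K.
Qed.
Lemma art1 g h : inF 0 k g -> inF 0 k h -> prel (art_rel m1) g h -> prel (art_rel m) g h.
Proof.
move=> Fg Fh; rewrite -(fgwK Fg) -(fgwK Fh) => /prel_wfg H.
by rewrite -wfg_lft1 -[X in prel _ _ X]wfg_lft1; apply/prel_wfg/lft1_art.
Qed.
Lemma art2 g h : inF 0 l g -> inF 0 l h -> prel (art_rel m2) g h -> prel (art_rel m) (shf k g) (shf k h).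
Proof.
move=> Fg Fh; rewrite -(fgwK Fg) -(fgwK Fh) => /prel_wfg H.
by rewrite -!wfg_lft2; apply/prel_wfg/lft2_art.
Qed.

(** Every defining relation of the product involves letters of a single block, so its equality is
    generated by equalities inside the blocks, and [FP_Gen] applies. *)
Lemma fpmat_FP : FP (prel (cox_rel m)) 0 k (k + l).
Proof.
set E := prel _; have EC : cong E := prel_cong _; have GC := Gen_cong E 0 k (k + l).
have sub u v : coxeq m u v -> Gen E 0 k (k + l) (wfg u) (wfg v).
  elim=> [p x y q [i [j [M [Ex ->]]]]|p x q|x|x y _ H|x y z _ H1 _ H2].
  - rewrite wfg_cat (wfg_cat x) (wfg_cat p) /= -[X in Gen _ _ _ _ _ (_ * X)]mul1g.
    apply: (c_mul GC); first exact: (c_refl GC).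
    apply: (c_mul GC); last exact: (c_refl GC).
    have Ex1 : E (wfg x) 1.
      have Rx : cox_rel m x [::] by exists i, j; split.
      exact: (prel_wfg _ x [::]).2 (peq_rel0 Rx).
    have K c : (forall e : bool, lside 0 k (k + l) c (val (if e then j else i), false)) -> sd 0 k (k + l) c (wfg x).
      move=> H; rewrite sd_all; apply: all_red; rewrite Ex /alt -map_comp all_map.
      by apply/allP => n _; apply: H.
    move: M; rewrite /fpmat; case Ei: (split i) => [a|a]; case Ej: (split j) => [b|b] // _.
      apply: (Gen_base (c := true)) Ex1; last exact: sd1.
      have Vi : val i = a by rewrite -[i]splitK Ei.
      have Vj : val j = b by rewrite -[j]splitK Ej.
      by apply: K => -[]; rewrite /lside [_.1]/= ?Vi ?Vj ltn_ord.
    apply: (Gen_base (c := false)) Ex1; last exact: sd1.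
    have Vi : val i = (k + a)%N by rewrite -[i]splitK Ei.
    have Vj : val j = (k + b)%N by rewrite -[j]splitK Ej.
    by apply: K => -[]; rewrite /lside [_.1]/= ?Vi ?Vj leq_addr ltn_add2l ltn_ord.
  - rewrite !wfg_cat; apply: (c_mul GC); first exact: (c_refl GC).
    rewrite -[X in Gen _ _ _ _ _ X]mul1g; apply: (c_mul GC); last exact: (c_refl GC).
    rewrite -[[:: x; linv x]]/([:: x] ++ winv [:: x]) wfg_cat wfg_winv mulgV; exact: (c_refl GC).
  - exact: (c_refl GC).
  - exact: (c_sym GC).
  exact: (c_trans GC H1 H2).
have Hk : (0 <= k <= k + l)%N by rewrite leq_addr.
move=> c s Hs HE; apply: (FP_Gen Hk EC (c := c)).
  apply: alts_imp (Hs) => x _ Nx H; apply: Nx; exact: Gen_le H.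
have Fs := alts_inF Hk Hs; have := sub _ _ HE.
by rewrite fgwK // fgwK.
Qed.
End Blocks.

(** * Well-stabilized products *)

Lemma teq_gens n (R : word 'I_n -> word 'I_n -> Prop) b : braid_word n b ->
  teq (peq R) (hurwitz b (gens n)) (gens n) <-> forall i, (i < n)%N -> prel R (aut b (X i)) (X i).
Proof.
move=> Hb; have Sg : size (gens n) = n by rewrite size_map size_enum_ord.
have Eg i : (i < n)%N -> wfg (nth [::] (gens n) i) = X i.
  move=> Hi; have i0 := Ordinal Hi; rewrite (nth_map (Ordinal Hi)) ?size_enum_ord // wfg_gen.
  by rewrite nth_enum_ord.
have PC := prel_cong R.
have H i : (i < n)%N -> prel R (wfg (nth [::] (hurwitz b (gens n)) i)) (aut b (X i)).
  move=> Hi; have := @hurwitz_aut n R [::] 0 b (gens n); rewrite Sg => /(_ Hb _ i Hi).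
  have -> : shb 0 b = b by rewrite /shb -[RHS]map_id; apply: eq_map => -[a c]; rewrite addn0.
  by rewrite addn0; apply => j Hj; rewrite Eg // addn0; apply: c_refl.
split=> [[_ T] i Hi|T].
  apply: (c_trans PC (c_sym PC (H i Hi))); rewrite -(Eg i Hi); apply/prel_wfg/T.
  by rewrite size_hurwitz Sg.
split=> [|i]; first by rewrite size_hurwitz.
rewrite size_hurwitz Sg => Hi; apply/prel_wfg; apply: (c_trans PC (H i Hi)).
by rewrite Eg //; apply: T.
Qed.

(** In the Coxeter group the generators are involutions, so the inverse of an alternating word is
    its reversal, and the two sides of a braid relation join into the Coxeter relator. *)
Lemma art_cox n (m : 'I_n -> 'I_n -> nat) u v : coxeter_matrix m -> arteq m u v -> coxeq m u v.
Proof.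
move=> Hm; elim=> [p x y q [i [j [M [-> ->]]]]|p x q|x|x y _|x y z _ + _]; last first.
- exact: peq_trans.
- exact: peq_sym.
- exact: peq_refl.
- exact: peq_free.
apply/peq_catl/peq_catr; set N := m i j.
have W : forall w : word 'I_n, all (fun x => ~~ x.2) w -> coxeq m (winv w) (rev w).
  elim=> [|[a []] w IH] //= H; first exact: peq_refl.
  by rewrite winv_cons rev_cons -cats1; apply: peq_cat; [exact: IH|exact: gen_inv].
have E : alt i j N ++ rev (alt j i N) = alt i j (2 * N).
  have S2 a b K : size (@alt 'I_n a b K) = K by rewrite size_map size_iota.
  apply: (@eq_from_nth _ (i, false)); first by rewrite size_cat size_rev !S2; lia.
  move=> t; rewrite size_cat size_rev !S2 => Ht; rewrite nth_cat S2.
  rewrite (nth_map 0%N _ _ (_ : t < size (iota 0 (2 * N)))%N) ?size_iota ?nth_iota; try lia.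
  case: ltnP => HtN; first by rewrite (nth_map 0%N) ?size_iota // nth_iota.
  rewrite nth_rev ?S2; last lia.
  rewrite (nth_map 0%N) ?size_iota ?nth_iota; try lia.
  have -> : odd (0 + (N - (t - N).+1))%N = ~~ odd (0 + t).
    have : (N - (t - N).+1 + t).+1 = (2 * N)%N by lia.
    move/(congr1 odd); rewrite oddM /= oddD !add0n; by case: (odd (N - _)); case: (odd t).
  by rewrite if_neg.
have H : coxeq m (alt i j N ++ winv (alt j i N)) [::].
  apply: peq_trans (peq_catl _ (W _ _)) _; first by apply/allP => w /mapP[t _ ->].
  by rewrite E; apply: peq_rel0; exists i, j; split.
apply: peq_trans (_ : peq _ _ (alt i j N ++ winv (alt j i N) ++ alt j i N)) _.
  rewrite -{1}[alt i j N]cats0; apply/peq_catl/peq_sym/peq_winvl.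
by rewrite catA; apply: (peq_catr (alt j i N) H).
Qed.

(* A braid fixing the generators modulo [E] fixes [dl a m], as its image has a
   single syllable, and hence is a product of braids of the two factors. *)
Lemma stab_split E a m b w : (a <= m <= b)%N -> base_rel E a b -> FP E a m b -> brw a b w ->
  (forall i, (a <= i < b)%N -> E (aut w (X i)) (X i)) -> aut w (dl a m) = dl a m.
Proof.
move=> Hm HB HF Hw HE; have EC : cong E by case: HB.
have [Eam|Nam] := eqVneq a m; first by rewrite Eam dl_nil // aut1.
have /andP[Ham Hmb] := Hm; have Hab : (a <= b)%N by lia.
have Ed : E (aut w (dl a m)) (dl a m).
  have := @c_aut E EC a b w [::] HE; apply; apply: inF_dl; lia.
have HI : Ii a b (aut w (dl a m)) by exists w, m.
have [c [s [Hs Es]]] := Ii_alts Hm HI; have HIs := HI; rewrite Es in HIs Ed.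
have Nz := alts_nz Hm HB Hs HIs.
have Hd : alts a m b (nz E) true [:: dl a m].
  split=> //; first by rewrite /sd /= inF_dl //; lia.
  apply: (Ii_nz HB); first by exists [::], m.
  by rewrite dl_eq1; lia.
have [Es1 Ec] := nf_uniq Hm EC HF Nz Hd ltac:(by rewrite /= mulg1).
case: s Es Hs HIs Ed Nz Es1 Ec => [|x [|y s]] /=; [by []| |by move=> ? ? ? ? ? []].
move=> Es [Hx _ _] _ Ed _ _ /(_ isT) Ec; rewrite Ec in Hx.
rewrite mulg1 in Es Ed; have Fx : inF a m (aut w (dl a m)) by rewrite Es.
have [||w' [c' [Hw' Hc' E']]] := Ii_sub _ _ Fx HI; [by rewrite leqnn|by []|].
have Hw'' : brw a b w' by apply: brwS Hw'.
have Ec' : c' = m.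
  rewrite -Es E' in Ed; apply/eqP; rewrite eqn_leq.
  have L1 := @Len_pair E a b w' [::] c' m HB Hw'' erefl.
  have L2 := @Len_pair E a b [::] w' m c' HB erefl Hw''.
  by rewrite L2 ?L1 //=; try lia; apply: (c_sym EC).
by rewrite E' Ec' aut_dl.
Qed.

Section Product.
Variables (k l : nat) (m1 : 'I_k -> 'I_k -> nat) (m2 : 'I_l -> 'I_l -> nat).
Hypotheses (C1 : coxeter_matrix m1) (C2 : coxeter_matrix m2).
Notation m := (fpmat m1 m2).
Notation E := (prel (cox_rel m)).
Let C : coxeter_matrix m := fpmat_coxeter C1 C2.
Let HB : base_rel E 0 (k + l) := cox_base C.
Let Hk : (0 <= k <= k + l)%N. Proof. by rewrite leq_addr. Qed.

Lemma fpmat_well_stabilized : well_stabilized m1 -> well_stabilized m2 -> well_stabilized m.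
Proof.
move=> W1 W2 b Hb; rewrite !teq_gens //; split=> HE i Hi; last first.
  exact: art_cox (HE i Hi).
have Hb' : brw 0 (k + l) b := Hb.
have Ed := stab_split Hk HB (@fpmat_FP k l m1 m2) Hb HE.
(* The complement of the fixed loop is fixed as well, since every braid fixes the full product. *)
have Ed2 : aut b (dl k (k + l)) = dl k (k + l).
  apply: (mulgI (dl 0 k)); rewrite -{1}Ed -autM -dl_cat // aut_dl //.
have [|||v1 [Hv1 V1]] := aut_split Hb' _ _ _ Ed; rewrite ?leq_addr //.
have [|||v2 [Hv2 V2]] := aut_split Hb' _ _ _ Ed2; rewrite ?leq_addr //.
have [Hik|Hik] := ltnP i k.
  have H1 j : (j < k)%N -> prel (cox_rel m1) (aut v1 (X j)) (X j).
    move=> Hj; have Fj : inF 0 k (X j) by rewrite inFX.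
    apply: (agree1 m1 m2 _ _).1; rewrite ?inF_aut // !shf0 -V1 //; apply: HE; lia.
  have /(teq_gens _ Hv1).1 := (W1 v1 Hv1).1 ((teq_gens _ Hv1).2 H1).
  move=> /(_ i Hik); rewrite V1 ?inFX // => H; apply: art1 H; rewrite ?inF_aut ?inFX //.
have [v [Hv Ev]] := shb_onto Hv2; rewrite addKn in Hv.
have Hv' : brw 0 l v := Hv.
have H2 j : (j < l)%N -> prel (cox_rel m2) (aut v (X j)) (X j).
  move=> Hj; have Fj : inF 0 l (X j) by rewrite inFX.
  apply: (agree2 m1 m2 _ _).1; rewrite ?inF_aut // shf_aut -Ev shfX -V2; last by rewrite inFX; lia.
  by apply: HE; lia.
have /(teq_gens _ Hv).1 := (W2 v Hv).1 ((teq_gens _ Hv).2 H2).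
have Hil : (i - k < l)%N by lia.
have Fi : inF 0 l (X (i - k)) by rewrite inFX.
move=> /(_ _ Hil) H; have := art2 m1 _ Fi H; rewrite inF_aut // shf_aut -Ev shfX subnK // V2; first exact.
by rewrite inFX; lia.
Qed.

Hypotheses (P1 : pan_transitive m1 (cox_elt k)) (P2 : pan_transitive m2 (cox_elt l)).

Lemma fpmat_Hur : Hur E 0 (k + l).
Proof.
apply: (free_product_Hur Hk HB (@fpmat_FP k l m1 m2)).
  exact: Hur_shift (agree1 m1 m2) (pan_Hur C1 P1).
exact: Hur_shift (agree2 m1 m2) (pan_Hur C2 P2).
Qed.

Lemma fpmat_Star : Star E 0 (k + l).
Proof.
have H1 : PT E 0 k := PT_shift (agree1 m1 m2) (pan_PT C1 P1).
have H2 : PT E k (k + l) := PT_shift (agree2 m1 m2) (pan_PT C2 P2).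
by apply: (free_product_Star _ Hk HB H1 H2 (@fpmat_FP k l m1 m2)).
Qed.

Lemma fpmat_pan : pan_transitive m (cox_elt (k + l)).
Proof. exact: PT_pan fpmat_Hur (Star_PT (prel_cong _) fpmat_Star). Qed.
End Product.

(** * The dual presentation *)

Lemma peq_inv_unique (A : Type) (R : word A -> word A -> Prop) u v : peq R (u ++ v) [::] -> peq R v (winv u).
Proof.
move=> H; apply: peq_trans (_ : peq R (winv u ++ u ++ v) _).
  by rewrite catA -{1}[v]cat0s; apply/peq_catr/peq_sym/peq_winvl.
by rewrite -[X in peq _ _ X]cats0; apply: peq_catl.
Qed.

Lemma peq_winv (A : Type) (R : word A -> word A -> Prop) u v : peq R u v -> peq R (winv u) (winv v).
Proof.
by move=> H; apply: peq_inv_unique; apply: peq_trans (peq_catr _ (peq_sym H)) _; apply: peq_winvr.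
Qed.

Lemma fmap_winv (A B : Type) (h : letter A -> word B) u : (forall x, h (linv x) = winv (h x)) ->
  fmap h (winv u) = winv (fmap h u).
Proof.
move=> H; elim: u => // x u IH.
by rewrite -cat1s winv_cat !fmap_cat winv_cat IH /fmap /= !cats0 H.
Qed.

Definition altg (x y : fg) (k : nat) : fg := pr [seq if odd j then y else x | j <- iota 0 k].

Lemma altgS x y k : altg x y k.+1 = x * altg y x k.
Proof.
rewrite /altg /= -[1%N]/(1 + 0)%N iotaDl -map_comp; congr (_ * pr _).
by apply: eq_map => j /=; case: (odd j).
Qed.

Lemma aut_altg w x y k : aut w (altg x y k) = altg (aut w x) (aut w y) k.
Proof. by elim: k x y => [|k IH] x y; rewrite ?aut1 // !altgS autM IH. Qed.

Lemma altg_conj x y k : altg (x * y * x^-1) x k * x = altg x y k.+1.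
Proof.
elim/ltn_ind: k => -[|[|k]] IH; first by rewrite mul1g altgS mulg1.
  by rewrite !altgS !mulg1 mulgVK.
have {IH} := IH k (leqnSn _); rewrite (altgS x y k.+2) (altgS y x k.+1) (altgS _ x k.+1) (altgS x (x * y * x^-1)).
by move: (altg (_ * _) x k) (altg x y k.+1) => p q <-; rewrite !mulgA mulgVK.
Qed.

(* The alternating products are the partial products of the orbit of the pair
   [X i, X i.+1] under powers of sigma. *)
Lemma aut_nseq_altg i k : aut (nseq k.+1 (i, false)) (X i.+1) * altg (X i) (X i.+1) k = altg (X i) (X i.+1) k.+1.
Proof.
elim: k => [|k IH]; first by rewrite /= sgX sgf1 altgS.
have -> : nseq k.+2 (i, false) = nseq k.+1 (i, false) ++ [:: (i, false)] by rewrite -[k.+2]addn1 nseqD.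
rewrite aut_cat -(mulgK (altg (X i) (X i.+1) k) (aut (nseq _ _) _)) IH autM autV !aut_altg /= !sgX sgf0 sgf1.
by rewrite -!(altg_conj (X i) (X i.+1)) mulgA mulgVK.
Qed.

Section ArtDual.
Variables (n : nat) (m : 'I_n -> 'I_n -> nat).
Hypothesis Hm : coxeter_matrix m.
Notation E := (prel (cox_rel m)).
Notation c := (cox_elt n).
Notation D := (dgen m c).
Let EC : cong E := prel_cong (cox_rel m).
Let HB : base_rel E 0 n := cox_base Hm.

Lemma sym_exists b i : brw 0 n b -> (i < n)%N -> exists x : D, sval x = fgw (aut b (X i)).
Proof.
move=> Hb Hi; have [|T _] := @aut_tred n m Hm b i i.+1 _ Hb; first lia.
rewrite dl1 in T.
have R : is_refl m (fgw (aut b (X i))) by apply/rfl_is_refl/(rfl_aut Hb)/rflX.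
by exists (exist (fun w => is_refl m w /\ tle m w c) _ (conj R T)).
Qed.

Lemma gen_neq1 i : (i < n)%N -> ~ E (X i) 1.
Proof.
move=> Hi; apply: (Ii_nz HB); last by rewrite -dl1 dl_eq1; lia.
by rewrite -dl1 -[dl _ _]/(aut [::] _); apply: Ii_seg => //; lia.
Qed.

Lemma tred_sym w w' : is_refl m w -> is_refl m w' -> coxeq m w w' -> tred m w [:: w'].
Proof.
move=> R R' H; split; first by split=> [[|i] //= _|]; [left|rewrite /= cats0].
split; first by exists [:: w']; split=> //; split=> [[|i] //= _|]; [left|rewrite /= cats0].
move=> [|//] [_ H0]; have [t [u [i [_ Hi ->]]] Et] := is_refl_rfl R.
case: (gen_neq1 Hi); have E1 : E (u * X i * u^-1) 1.
  by apply: (c_trans EC (c_sym EC Et)); apply: ((prel_wfg _ w [::]).2 H0).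
have := c_mul EC (c_mul EC (c_refl EC u^-1) E1) (c_refl EC u).
by rewrite !mulgA mulgVK mulVg mul1g mulg1 mulVg.
Qed.

Notation Dq := (dualeq m c).

Lemma dualeq_sym (x y : D) : E (wfg (sval x)) (wfg (sval y)) -> Dq [:: (x, false)] [:: (y, false)].
Proof.
move=> /prel_wfg H; have [Rx Tx] := svalP x; have [Ry _] := svalP y.
apply: peq_rel0; exists (sval x); split=> //; split=> //; split=> //.
split; [exact (tred_sym Rx Rx (peq_refl _ _))|exact (tred_sym Rx Ry H)].
Qed.

Variable ds : 'I_n -> D.
Hypothesis Hds : forall i, E (wfg (sval (ds i))) (X i).
Definition toD (x : letter 'I_n) : word D := [:: (ds x.1, x.2)].

Lemma toD_free R u v : peq (fun _ _ => False) u v -> peq R (fmap toD u) (fmap toD v).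
Proof. by apply: peq_fmap => // x; apply: (peq_free _ [::]). Qed.

(** The canonical map, so far on the free group only; the braid relations are checked in
    [dual_art]. *)
Definition FD (g : fg) : word D := fmap toD (fgw g).
Lemma FD_M g h : Dq (FD (g * h)) (FD g ++ FD h).
Proof. by rewrite /FD -fmap_cat; apply/toD_free/fgwM. Qed.
Lemma FD_wfg u : Dq (FD (wfg u)) (fmap toD u).
Proof. exact/toD_free/wfgK. Qed.
Lemma FD_M3 g h k : Dq (FD (g * h * k)) (FD g ++ FD h ++ FD k).
Proof. by rewrite catA; apply: peq_trans (FD_M _ _) _; apply/peq_catr/FD_M. Qed.
Lemma FD_V g : Dq (FD g^-1) (winv (FD g)).
Proof.
apply: peq_inv_unique; apply: peq_trans (peq_sym (FD_M _ _)) _.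
by rewrite mulgV; apply: (FD_wfg [::]).
Qed.

Lemma dual_pair b b' j (x y z t : D) : brw 0 n b -> brw 0 n b' -> (j.+1 < n)%N ->
  aut b (dl j j.+2) = aut b' (dl j j.+2) ->
  E (wfg (sval x)) (aut b (X j)) -> E (wfg (sval y)) (aut b (X j.+1)) ->
  E (wfg (sval z)) (aut b' (X j)) -> E (wfg (sval t)) (aut b' (X j.+1)) ->
  Dq [:: (x, false); (y, false)] [:: (z, false); (t, false)].
Proof.
move=> Hb Hb' Hj Ed Ex Ey Ez Et; have Hj2 : (j <= j.+2 <= n)%N by lia.
have S2 : (j.+2 - j = 2)%N by lia.
have [T H] := aut_tred Hm Hj2 Hb; have [T' H'] := aut_tred Hm Hj2 Hb'.
apply: peq_rel0; exists (fgw (aut b (dl j j.+2))); split=> //; split=> //; split=> //.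
by split; [apply: H|rewrite Ed; apply: H'] => //; rewrite S2 => -[|[|i]] //= _; rewrite ?add1n.
Qed.

(** Induction on the braid. A Hurwitz move turns the pair [y], [z] into another reduced
    factorization of the same element of length two; the dual relation between the two pairs
    expresses the new symbol as the required conjugate. *)
Lemma FD_sym b i x : brw 0 n b -> (i < n)%N -> E (wfg (sval x)) (aut b (X i)) ->
  Dq (FD (aut b (X i))) [:: (x, false)].
Proof.
elim: b i x => [|[j e] b IH] i x.
  move=> _ Hi Ex; apply: peq_trans (FD_wfg (gen (Ordinal Hi))) _.
  apply: dualeq_sym; apply: (c_trans EC (Hds _)); exact: (c_sym EC Ex).
move=> Hx; have Hj : (j.+1 < n)%N by case/andP: Hx.
have Hb : brw 0 n b by case/andP: Hx.
have Hj' : (j < n)%N by lia.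
move=> Hi; have [y Ey] := sym_exists Hb Hj'; have [z Ez] := sym_exists Hb Hj.
have {}Ey : E (wfg (sval y)) (aut b (X j)) by rewrite Ey; apply: prel_fgwK.
have {}Ez : E (wfg (sval z)) (aut b (X j.+1)) by rewrite Ez; apply: prel_fgwK.
have Fy := IH _ _ Hb Hj' Ey; have Fz := IH _ _ Hb Hj Ez.
have Ed : aut b (dl j j.+2) = aut ((j, e) :: b) (dl j j.+2).
  rewrite [RHS]/= sg_dl //=; lia.
have Dp := dual_pair Hb Hx Hj Ed Ey Ez.
have E0 : aut ((j, e) :: b) (X i) = aut b (sgf (j, e) i) by rewrite /= sgX.
rewrite E0; have [Eij|Nij] := eqVneq i j; last have [Eij|Nij'] := eqVneq i j.+1; last first.
- by rewrite sgf_id //; apply: IH.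
- rewrite Eij in E0 *; case: e Hx Ed Dp E0 => Hx Ed Dp E0; last first.
    by rewrite sgf1 => Ex; apply: IH.
  rewrite sgf1V => Ex; rewrite sgf1V in E0.
  have {Dp} H : Dq [:: (y, false); (z, false)] [:: (z, false); (x, false)].
    by apply: Dp; [rewrite /= sgX sgf0V|rewrite E0].
  rewrite !autM autV; apply: peq_trans (FD_M3 _ _ _) _.
  apply: peq_trans (peq_cat (peq_trans (FD_V _) (peq_winv Fz)) (peq_cat Fy Fz)) _.
  apply: peq_trans (peq_catl _ H) _; exact: (peq_catr [:: (x, false)] (peq_winvl _ [:: (z, false)])).
rewrite Eij in E0 *; case: e Hx Ed Dp E0 => Hx Ed Dp E0.
  by rewrite sgf0V => Ex; apply: IH.
rewrite sgf0 => Ex; rewrite sgf0 in E0.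
have {Dp} H : Dq [:: (y, false); (z, false)] [:: (x, false); (y, false)].
  by apply: Dp; [rewrite E0|rewrite /= sgX sgf1].
rewrite !autM autV; apply: peq_trans (FD_M3 _ _ _) _.
apply: peq_trans (peq_cat Fy (peq_cat Fz (peq_trans (FD_V _) (peq_winv Fy)))) _.
rewrite catA; apply: peq_trans (peq_catr _ H) _.
exact: (peq_catl [:: (x, false)] (peq_winvr _ [:: (y, false)])).
Qed.

Lemma altS (A : Type) (a b : A) k : alt a b k.+1 = (a, false) :: alt b a k.
Proof.
rewrite /alt /= -[1%N]/(1 + 0)%N iotaDl -map_comp; congr (_ :: _).
by apply: eq_map => j /=; case: (odd j).
Qed.
Lemma wfg_alt (i j : 'I_n) k : wfg (alt i j k) = altg (X i) (X j) k.
Proof. by elim: k i j => [|k IH] i j //; rewrite altS altgS -cat1s wfg_cat IH. Qed.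

(** A power of the generator exchanging two adjacent punctures gives a loop whose product with an
    alternating word is the next longer one. The Coxeter relation makes this loop equal to the
    generator j in W, so [FD_sym] identifies it with the symbol of j, and the braid relation
    follows. *)
Lemma dual_art_lt (i j : 'I_n) : (i < j)%N -> m i j != 0%N ->
  Dq (fmap toD (alt i j (m i j))) (fmap toD (alt j i (m i j))).
Proof.
move=> Hij M0; have Hj := ltn_ord j.
(* [d] relates the puncture next to i with j and leaves [X i] alone, which reduces to adjacent
   indices. *)
have [||d [Hd Ed]] := @move_seg i.+1 j.+1 j j.+1; try lia.
have {}Ed : aut d (X i.+1) = X j by rewrite Ed ?subnKC //; lia.
have Ei : aut d (X i) = X i by apply: (aut_id (a := i) (b := i.+1)) Hd _; rewrite ?inFX //; lia.
case EM : (m i j) M0 => [//|k] _; pose w := nseq k.+1 (val i, false) ++ d.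
have Hw : brw 0 n w.
  by rewrite brw_cat (brwS _ _ Hd) // andbT; apply/allP => x /nseqP[-> _] /=; lia.
have Eg : aut w (X i.+1) * altg (X i) (X j) k = altg (X i) (X j) k.+1.
  by rewrite -Ei -Ed -!aut_altg /w aut_cat -autM aut_nseq_altg.
have Ew : E (aut w (X i.+1)) (X j).
  apply: (c_Imul EC (g := altg (X i) (X j) k)); rewrite Eg -altgS -!wfg_alt -EM; apply/prel_wfg.
  by apply: art_cox Hm _; apply: peq_rel0; exists i, j; rewrite EM.
have Hi1 : (i.+1 < n)%N by lia.
have F : Dq (FD (aut w (X i.+1))) [:: (ds j, false)].
  by apply: FD_sym => //; apply: (c_trans EC (Hds j)); apply: c_sym.
apply: peq_trans (peq_sym (FD_wfg _)) _; rewrite wfg_alt -Eg -wfg_alt.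
apply: peq_trans (FD_M _ _) _; apply: peq_trans (peq_cat F (FD_wfg _)) _.
by rewrite altS; apply: peq_refl.
Qed.

Lemma dual_art (u v : word 'I_n) : arteq m u v -> Dq (fmap toD u) (fmap toD v).
Proof.
apply: peq_fmap => [x|_ _ [i [j [M [-> ->]]]]]; first exact: (peq_free _ [::]).
have [Hij|Hij|Hij] := ltngtP i j; first exact: dual_art_lt.
  have Em : m i j = m j i by case: Hm.
  by rewrite Em in M *; apply/peq_sym/dual_art_lt.
by rewrite (val_inj Hij); apply: peq_refl.
Qed.

Hypotheses (HH : Hur E 0 n) (HS : Star E 0 n) (HW : well_stabilized m).
Notation A := (prel (art_rel m)).
Let AC : cong A := prel_cong (art_rel m).

(* E-equal loops differ by a braid that fixes the generators modulo [E], hence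
   in the Artin group, by well-stabilization. *)
Lemma loop_art g h : Ii 0 n g -> Ii 0 n h -> E g h -> A g h.
Proof.
move=> Hg Hh /(HS Hg Hh)[w [Hw Ew <-]]; apply: (c_sym AC).
have /(teq_gens _ Hw).1 HA : teq (arteq m) (hurwitz w (gens n)) (gens n).
  by apply/(HW Hw).1/(teq_gens _ Hw).2 => i Hi; apply: Ew; rewrite inFX.
by apply: (@c_aut A AC 0 n w [::] HA); apply: Ii_inF.
Qed.

Variable lam : D -> fg.
Hypothesis Hlam : forall x, exists w, [/\ brw 0 n w, (0 < n)%N, lam x = aut w (X 0) & E (wfg (sval x)) (lam x)].

(** By [loop_art], the lift of a symbol does not depend, in the Artin group, on the braid chosen for
    it. *)
Lemma lam_art b i x : brw 0 n b -> (i < n)%N -> E (wfg (sval x)) (aut b (X i)) -> A (lam x) (aut b (X i)).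
Proof.
move=> Hb Hi Ex; have [w [Hw H0 -> H1]] := Hlam x; apply: loop_art.
- by rewrite -dl1; apply: Ii_seg.
- by rewrite -dl1; apply: Ii_seg => //; lia.
exact: (c_trans EC (c_sym EC H1)).
Qed.

Definition toA (x : letter D) : word 'I_n := if x.2 then winv (fgw (lam x.1)) else fgw (lam x.1).

(** A reduced factorization is a braid image of the first generators, so its lift is a single loop,
    the image of [dl 0 (size u)]; [loop_art] can then compare two such lifts. *)
Lemma toA_red a (u : word D) : tle m a c -> all (fun x => ~~ x.2) u -> tred m a [seq sval x.1 | x <- u] ->
  exists w, [/\ brw 0 n w, (size u <= n)%N, E (wfg a) (aut w (dl 0 (size u)))
    & arteq m (fmap toA u) (fgw (aut w (dl 0 (size u))))].
Proof.
move=> Ta Hu Hr; have [w [Hw]] := tred_aut Hm HH Ta Hr; rewrite size_map => Hn W.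
have Ed v : aut v (dl 0 (size u)) = pr [seq aut v (X i) | i <- iota 0 (size u)].
  by rewrite /dl aut_pr /xs subn0 -map_comp.
exists w; split=> //; rewrite Ed.
  case: Hr => -[_ /prel_wfg Ea] _; apply: (c_trans EC Ea).
  by have := @prel_flatten n (cox_rel m) (fun i => aut w (X i)) [seq sval x.1 | x <- u]; rewrite size_map; apply.
apply/peq_sym/(prel_fgw _ _ _).1/(c_sym AC).
have -> : fmap toA u = flatten [seq fgw (lam x.1) | x <- u].
  by rewrite /fmap; elim: (u) Hu => //= x v IH /andP[/negbTE Hx /IH->]; rewrite /toA Hx.
have := @prel_flatten n (art_rel m) (fun i => aut w (X i)) [seq fgw (lam x.1) | x <- u]; rewrite size_map; apply.
move=> i Hi; have [|x0 _] := @sym_exists [::] 0 erefl; first exact: leq_ltn_trans (leq0n i) (leq_trans Hi Hn).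
rewrite (nth_map (x0, false)) //; apply: (c_trans AC (prel_fgwK _ _)); apply: lam_art => //; first exact: leq_trans Hi Hn.
by have := W i Hi; rewrite (nth_map (x0, false)).
Qed.

Lemma dual_rel_art (u v : word D) : dual_rel m c u v -> arteq m (fmap toA u) (fmap toA v).
Proof.
case=> a [Ta [Hu [Hv [Ru Rv]]]].
have [w [Hw Sw Ew Aw]] := toA_red Ta Hu Ru; have [w' [Hw' Sw' Ew' Aw']] := toA_red Ta Hv Rv.
have Es : size v = size u by have := tlen_uniq Ru.2 Rv.2; rewrite !size_map.
apply: peq_trans Aw _; apply: peq_trans (peq_sym Aw'); rewrite Es in Sw' Ew' *.
apply: loop_art; [by exists w, (size u)|by exists w', (size u)|].
exact: (c_trans EC (c_sym EC Ew)).
Qed.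

Lemma art_dual_iso : pres_iso (arteq m) (dualeq m c).
Proof.
have toDV x : toD (linv x) = winv (toD x) by [].
have toAV x : toA (linv x) = winv (toA x).
  by case: x => x []; rewrite /toA /= ?winvK.
have lamX i : arteq m (fgw (lam (ds i))) (gen i).
  by apply/prel_fgw; rewrite wfg_gen; apply: (@lam_art [::]).
have FDlam x : Dq (fmap toD (fgw (lam x))) [:: (x, false)].
  by have [w [Hw H0 El Ex]] := Hlam x; rewrite El in Ex *; apply: FD_sym Ex.
exists (fmap toD), (fmap toA); split; [|split; [|split; [|split]]].
- exact: dual_art.
- move=> u v; apply: peq_fmap => [x|]; first by rewrite toAV; apply: peq_winvr.
  exact: dual_rel_art.
- by move=> u v; rewrite fmap_cat; apply: peq_refl.
- elim=> [|[i e] u IH]; first exact: peq_refl.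
  rewrite -cat1s !fmap_cat; apply: peq_cat => //; rewrite /fmap /= !cats0.
  case: e; last exact: lamX.
  exact: (peq_winv (lamX i)).
elim=> [|[x e] v IH]; first exact: peq_refl.
rewrite -cat1s !fmap_cat; apply: peq_cat => //; rewrite {2}/fmap /= !cats0 /toA /=.
by case: e; [rewrite fmap_winv //; apply: (peq_winv (FDlam x))|apply: FDlam].
Qed.
End ArtDual.

Lemma art_iso_dual n (m : 'I_n -> 'I_n -> nat) : coxeter_matrix m ->
  Hur (prel (cox_rel m)) 0 n -> Star (prel (cox_rel m)) 0 n -> well_stabilized m ->
  pres_iso (arteq m) (dualeq m (cox_elt n)).
Proof.
move=> Hm HH HS HW.
have [ds Hds] : exists ds : 'I_n -> dgen m (cox_elt n), forall i, prel (cox_rel m) (wfg (sval (ds i))) (X i).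
  apply: (choice_fun (R := fun i x => prel (cox_rel m) (wfg (sval x)) (X (val i)))) => i.
  by have [x Ex] := @sym_exists n m Hm [::] i erefl (ltn_ord i); exists x; rewrite Ex; apply: prel_fgwK.
have [lam Hlam] : exists lam : dgen m (cox_elt n) -> fg, forall x, exists w,
    [/\ brw 0 n w, (0 < n)%N, lam x = aut w (X 0) & prel (cox_rel m) (wfg (sval x)) (lam x)].
  apply: (choice_fun (R := fun x g => exists w, [/\ brw 0 n w, (0 < n)%N, g = aut w (X 0) & prel (cox_rel m) (wfg (sval x)) g])) => x.
  have [Rx Tx] := svalP x; have Hr := tred_sym Hm Rx Rx (peq_refl _ _).
  have [w [Hw Hn W]] := tred_aut Hm HH Tx Hr.
  by exists (aut w (X 0)), w; split=> //; apply: (W 0%N).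
exact: art_dual_iso Hds HH HS HW lam Hlam.
Qed.

Close Scope group_scope.

Theorem theorem5p12 (k l : nat) (m1 : 'I_k -> 'I_k -> nat) (m2 : 'I_l -> 'I_l -> nat) :
  coxeter_matrix m1 -> coxeter_matrix m2 ->
  well_stabilized m1 -> well_stabilized m2 ->
  pan_transitive m1 (cox_elt k) -> pan_transitive m2 (cox_elt l) ->
  well_stabilized (fpmat m1 m2) /\
  pan_transitive (fpmat m1 m2) (cox_elt (k + l)) /\
  pres_iso (arteq (fpmat m1 m2)) (@dualeq (k + l) (fpmat m1 m2) (cox_elt (k + l))).
Proof.
move=> C1 C2 W1 W2 P1 P2; have W := fpmat_well_stabilized C1 C2 W1 W2.
split=> //; split; first exact: fpmat_pan.
apply: (art_iso_dual (fpmat_coxeter C1 C2) _ _ W); first exact: fpmat_Hur.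
exact: fpmat_Star.
Qed.
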